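(* Let $p\in(2,6)$ and $\mu>0$. For $\ell>0$ let $\mathcal G_\ell$ be the metric graph consisting of three halflines and one bounded terminal edge of length $\ell$, all emanating from a common vertex. Then there exists a critical length $\ell^*>0$ such that $\mathcal G_\ell$ has a ground state of mass $\mu$ if and only if $\ell\ge\ell^*$.
   Context: $H^1_\mu(\mathcal G)$: continuous functions on $\mathcal G$, $H^1$ on each edge, with $\int_{\mathcal G}|u|^2=\mu$. $E(u,\mathcal G)=\frac12\int_{\mathcal G}|u'|^2-\frac1p\int_{\mathcal G}|u|^p$; a ground state of mass $\mu$ is a minimizer of $E(\cdot,\mathcal G)$ on $H^1_\mu(\mathcal G)$. *)

(* Defs.v *)
From HB Require Import structures.
From mathcomp Require Import all_boot all_order all_algebra.
From mathcomp Require Import all_classical all_reals all_analysis.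
From mathcomp Require Import Rstruct Rstruct_topology.
Set Implicit Arguments. Unset Strict Implicit. Unset Printing Implicit Defensive.
Import Order.TTheory GRing.Theory Num.Theory.
Local Open Scope classical_set_scope.
Local Open Scope ring_scope.

Notation RR := Rdefinitions.R.
Notation leb := (@lebesgue_measure RR).
Notation MR := (measurableTypeR RR).

(* Edges are parametrized by arclength with 0 at the common vertex. *)
Definition halfline : set MR := [set x : RR | 0 <= x].
Definition seg (l : RR) : set MR := [set x : RR | 0 <= x <= l].

(* u is in H^1(I) (I an interval starting at 0) with weak derivative g:
   u, g in L^2(I), g measurable, and u is the (absolutely continuous)
   primitive u x = u 0 + \int_0^x g. *)
Definition H1_with_deriv (I : set MR) (u g : RR -> RR) : Prop :=
  leb.-integrable I (fun x => ((u x) ^+ 2)%:E) /\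
  measurable_fun I (g : MR -> MR) /\
  leb.-integrable I (fun x => ((g x) ^+ 2)%:E) /\
  forall x, I x ->
    leb.-integrable ([set y : RR | 0 <= y <= x] : set MR) (fun y => (g y)%:E) /\
    u x = u 0 + Rintegral leb ([set y : RR | 0 <= y <= x] : set MR) g.

(* A function on the star graph G_l: three halflines (u1,u2,u3) and one
   terminal edge of length l (v), together with their weak derivatives. *)
Record graphfun := GF {
  u1 : RR -> RR; u2 : RR -> RR; u3 : RR -> RR; v : RR -> RR;
  du1 : RR -> RR; du2 : RR -> RR; du3 : RR -> RR; dv : RR -> RR }.

Definition in_H1 (l : RR) (f : graphfun) : Prop :=
  H1_with_deriv halfline (u1 f) (du1 f) /\
  H1_with_deriv halfline (u2 f) (du2 f) /\
  H1_with_deriv halfline (u3 f) (du3 f) /\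
  H1_with_deriv (seg l) (v f) (dv f) /\
  u1 f 0 = v f 0 /\ u2 f 0 = v f 0 /\ u3 f 0 = v f 0.

Definition edge_int (I : set MR) (h : RR -> RR) : RR := Rintegral leb I h.

Definition mass (l : RR) (f : graphfun) : RR :=
  edge_int halfline (fun x => u1 f x ^+ 2) + edge_int halfline (fun x => u2 f x ^+ 2)
  + edge_int halfline (fun x => u3 f x ^+ 2) + edge_int (seg l) (fun x => v f x ^+ 2).

Definition in_H1_mass (l mu : RR) (f : graphfun) : Prop :=
  in_H1 l f /\ mass l f = mu.

Definition energy (p l : RR) (f : graphfun) : RR :=
  2^-1 * (edge_int halfline (fun x => du1 f x ^+ 2) + edge_int halfline (fun x => du2 f x ^+ 2)
        + edge_int halfline (fun x => du3 f x ^+ 2) + edge_int (seg l) (fun x => dv f x ^+ 2))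
  - p^-1 * (edge_int halfline (fun x => powR `|u1 f x| p) + edge_int halfline (fun x => powR `|u2 f x| p)
        + edge_int halfline (fun x => powR `|u3 f x| p) + edge_int (seg l) (fun x => powR `|v f x| p)).

Definition ground_state (p l mu : RR) (f : graphfun) : Prop :=
  in_H1_mass l mu f /\ forall g, in_H1_mass l mu g -> energy p l f <= energy p l g.

Definition has_ground_state (p l mu : RR) : Prop := exists f, ground_state p l mu f.

(* Main.v *)
Require Import Defs.
From HB Require Import structures.
From mathcomp Require Import all_boot all_order all_algebra.
From mathcomp Require Import Rstruct Rstruct_topology.
From mathcomp Require Import all_classical all_reals all_analysis.
From mathcomp Require Import measurable_realfun.
From mathcomp Require Import ring lra.
Set Implicit Arguments. Unset Strict Implicit. Unset Printing Implicit Defensive.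
Import Order.TTheory GRing.Theory Num.Theory.
Import numFieldNormedType.Exports.
Local Open Scope classical_set_scope.
Local Open Scope ring_scope.

(** Let [e] be the energy of the soliton of mass [mu] on the line and
    [Phi_k(M) = k c M^(p/2+1) - M^(p-2) mu / p].  Calibrating the functional by the
    first integral of the soliton of height [M = sup |u|] gives [E(u) >= Phi_2(M) >= e]
    when the supremum is approached on a halfline, and [E(u) >= Phi_1(M)] always;
    truncated solitons escaping along a halfline show [inf E <= e] for every length.

    Call [l] good if some [u] of mass [mu] has [E(u) < e].  A good [l] has a ground state:
    along a minimizing sequence the maximum sits on the tip, cutting and rescaling exclude a
    loss of mass along the halflines, and the energy of midpoints makes the derivatives
    Cauchy in [L^2].  A long tip is good (put a half soliton on it); a short one is not,
    since then [u] is nearly constant on it and [E(u)] is close to [Phi_3(M)].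

    If [l] has a ground state then every [l' > l] is good.  By the Euler-Lagrange equation
    [u'^2 / 2 = F(u)] on the halflines, so the three slopes at the vertex agree up to sign.
    If they are not equal, or if they vanish, Kirchhoff's law gives [u'^2 / 2 = F(u)] on
    the tip too, and [E(u) >= Phi_3(M) > e], which is absurd.  If they are equal, [u] is the
    same on the three halflines: cut a piece of length [a] from each of them, superpose the
    three pieces and stretch the result by [3] into an interval of length [3 a] inserted
    between the vertex and the tip.  Mass and [L^p] norm are unchanged and the kinetic energy
    drops.

    Hence the good lengths have an infimum [lstar > 0] and contain every [l > lstar].  At
    [lstar] itself, if not good, functions of energy below [e] on slightly longer graphs
    restrict to a minimizing sequence to which the compactness argument applies. *)

(** Calibration takes the place of rearrangements and of the Gagliardo-Nirenberg inequality. Adding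
    [p^-1 M^(p-2)] times the mass to the energy makes the density nonnegative where [|u| <= M], and
    by Young's inequality it dominates the derivative of a function of [|u|]. Lower bounds then come
    from counting how often the edges must carry [|u|] between [0], the vertex value and [M]. The
    exponents satisfy [p - 2 < p/2 + 1] because [p < 6], which gives [Phi_k] a minimum.

    Compactness has to cover the critical length, where the infimum may equal [e]. What forbids an
    escape of mass there is the [L^p] mass that stays on the tip: rescaling an inner piece of mass
    [nu < mu] up to [mu] gains a fixed multiple of [(mu/nu)^(p/2-1) - 1].

    Derivatives are part of the data and matter only up to null sets. Limits are therefore built
    from the derivatives by integration, and a minimizer has its derivative replaced by a continuous
    one before slopes at the vertex make sense. *)

Notation itg := (Rintegral lebesgue_measure).

(** * Integrals over segments and halflines *)

Section integrals.
Context {R : realType}.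
Local Notation MR := (measurableTypeR R).
Local Notation leb := (@lebesgue_measure R).

Definition igr (I : set MR) (f : R -> R) : Prop :=
  leb.-integrable I (fun x => (f x)%:E).
Definition sgm (a b : R) : set MR := [set x : R | a <= x <= b].
Definition ray (a : R) : set MR := [set x : R | a <= x].

Lemma sgmE a b : sgm a b = `[a, b]%classic.
Proof. by apply/seteqP; split => x /=; rewrite in_itv. Qed.

Lemma rayE a : ray a = `[a, +oo[%classic.
Proof. by apply/seteqP; split => x /=; rewrite in_itv /= andbT. Qed.

Lemma msgm a b : measurable (sgm a b).
Proof. by rewrite sgmE. Qed.

Lemma mray a : measurable (ray a).
Proof. by rewrite rayE. Qed.
#[local] Hint Resolve msgm mray : core.

Lemma igrS (I J : set MR) f : measurable I -> measurable J -> J `<=` I ->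
  igr I f -> igr J f.
Proof. exact: integrableS. Qed.

Lemma igr_meas (I : set MR) (f : R -> R) : igr I f -> measurable_fun I (f : MR -> MR).
Proof. by move=> /integrableP[/measurable_EFinP]. Qed.

Lemma igrD (I : set MR) (f g : R -> R) : measurable I -> igr I f -> igr I g -> igr I (fun x => f x + g x).
Proof. by move=> mI fi gi; apply: eq_integrable (integrableD mI fi gi). Qed.

Lemma igrZ (I : set MR) (f : R -> R) (k : R) : measurable I -> igr I f -> igr I (fun x => k * f x).
Proof. by move=> mI fi; apply: eq_integrable (integrableZl mI k fi). Qed.

Lemma igrB (I : set MR) (f g : R -> R) : measurable I -> igr I f -> igr I g -> igr I (fun x => f x - g x).
Proof. by move=> mI fi gi; apply: eq_integrable (integrableB mI fi gi). Qed.

Lemma igr_norm (I : set MR) (f : R -> R) : measurable I -> igr I f -> igr I (fun x => `|f x|).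
Proof. by move=> mI fi; exact: integrable_norm. Qed.

Lemma igr_eq (I : set MR) (f g : R -> R) : measurable I -> (forall x, I x -> f x = g x) -> igr I f -> igr I g.
Proof.
by move=> mI fg; apply: eq_integrable => // x; rewrite inE => Ix; rewrite fg.
Qed.

Lemma igr_le (I : set MR) (f g : R -> R) : measurable I -> measurable_fun I (f : MR -> MR) -> igr I g ->
  (forall x, I x -> `|f x| <= g x) -> igr I f.
Proof.
move=> mI mf gi fg; apply: (le_integrable mI _ _ gi).
  exact/measurable_EFinP.
by move=> x Ix /=; rewrite lee_fin (le_trans (fg _ Ix))// ler_norm.
Qed.

Lemma intD (I : set MR) (f g : R -> R) : measurable I -> igr I f -> igr I g ->
  itg I (fun x => f x + g x) = itg I f + itg I g.
Proof. by move=> *; exact: RintegralD. Qed.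

Lemma intB (I : set MR) (f g : R -> R) : measurable I -> igr I f -> igr I g ->
  itg I (fun x => f x - g x) = itg I f - itg I g.
Proof. by move=> *; exact: RintegralB. Qed.

Lemma intZ (I : set MR) (f : R -> R) (k : R) : measurable I -> igr I f -> itg I (fun x => k * f x) = k * itg I f.
Proof. by move=> *; exact: RintegralZl. Qed.

Lemma int_eq (I : set MR) (f g : R -> R) : (forall x, I x -> f x = g x) -> itg I f = itg I g.
Proof. by move=> fg; apply: eq_Rintegral => x; rewrite inE; exact: fg. Qed.

Lemma int_le (I : set MR) (f g : R -> R) : measurable I -> igr I f -> igr I g ->
  (forall x, I x -> f x <= g x) -> itg I f <= itg I g.
Proof. by move=> *; exact: le_Rintegral. Qed.

Lemma int_ge0 (I : set MR) (f : R -> R) : (forall x, I x -> 0 <= f x) -> 0 <= itg I f.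
Proof. exact: Rintegral_ge0. Qed.

Lemma int_abs (I : set MR) (f : R -> R) : measurable I -> igr I f -> `|itg I f| <= itg I (fun x => `|f x|).
Proof. by move=> *; exact: le_normr_Rintegral. Qed.

Lemma leb_sgm (a b : R) : a <= b -> leb (sgm a b) = (b - a)%:E.
Proof.
by move=> ab; rewrite sgmE lebesgue_measure_itv /= lte_fin lt_neqAle ab andbT;
  case: eqP => [->|//] /=; rewrite subrr.
Qed.

Lemma int_cst (a b k : R) : a <= b -> itg (sgm a b) (fun _ => k) = k * (b - a).
Proof. by move=> ab; rewrite Rintegral_cst// [X in fine X](leb_sgm ab). Qed.

Lemma int_pt a f : itg (sgm a a) f = 0.
Proof. by rewrite sgmE set_itv1 Rintegral_set1. Qed.

Lemma igr_cst a b k : igr (sgm a b) (fun _ => k).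
Proof.
apply: measurable_bounded_integrable => //.
- case: (leP a b) => ab; first by rewrite [X in (X < _)%E](leb_sgm ab) ltry.
  by rewrite sgmE set_itv_ge ?measure0 ?ltry// bnd_simp -ltNge.
- exists `|k|; split; first exact: num_real.
  by move=> y ky x _ /=; rewrite ltW.
Qed.

Lemma sgm_sub (a b c d : R) : c <= a -> b <= d -> sgm a b `<=` sgm c d.
Proof.
move=> ca bd x /andP[ax xb]; apply/andP; split.
- exact: le_trans ca ax.
- exact: le_trans xb bd.
Qed.

Lemma int_split (a b c : R) f : a <= b -> b <= c -> igr (sgm a c) f ->
  itg (sgm a c) f = itg (sgm a b) f + itg (sgm b c) f.
Proof.
move=> ab bc fi.
have := @Rintegral_itvB _ f (BLeft a) (BRight c) b.
rewrite !bnd_simp => /(_ _ ab bc); rewrite -sgmE => /(_ fi) H.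
have fi' : leb.-integrable `]b, c] (EFin \o f).
  apply: integrableS fi => //; rewrite sgmE; apply: subset_itvr; by rewrite bnd_simp.
by rewrite -[LHS](subrK (itg (sgm a b) f)) addrC [in sgm a b]sgmE H
  Rintegral_itv_obnd_cbnd// -sgmE.
Qed.

Lemma int_split_ray (a b : R) f : a <= b -> igr (ray a) f ->
  itg (ray a) f = itg (sgm a b) f + itg (ray b) f.
Proof.
move=> ab fi.
have := @Rintegral_itvB _ f (BLeft a) (BInfty _ false) b.
rewrite !bnd_simp => /(_ _ ab isT); rewrite -rayE => /(_ fi) H.
have fi' : leb.-integrable `]b, +oo[ (EFin \o f).
  apply: integrableS fi => //; rewrite rayE; apply: subset_itvr; by rewrite bnd_simp.
by rewrite -[LHS](subrK (itg (sgm a b) f)) addrC [in sgm a b]sgmE H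
  Rintegral_itv_obnd_cbnd// -rayE.
Qed.

(** * Square integrable functions *)

Definition sq (I : set MR) (f : R -> R) : Prop :=
  measurable_fun I (f : MR -> MR) /\ igr I (fun x => f x ^+ 2).

Lemma sq_mul (I : set MR) (f g : R -> R) : measurable I -> sq I f -> sq I g -> igr I (fun x => f x * g x).
Proof.
move=> mI [mf fi] [mg gi].
apply: (@igr_le _ _ (fun x => f x ^+ 2 + g x ^+ 2)) => //.
- exact: measurable_funM.
- exact: igrD.
- move=> x _; rewrite normrM -[f x ^+ 2]real_normK ?num_real// -[g x ^+ 2]real_normK ?num_real//.
  by have := sqr_ge0 (`|f x| - `|g x|); have := sqr_ge0 (`|f x|);
    have := sqr_ge0 (`|g x|); nra.
Qed.

Lemma sqZ (I : set MR) (f : R -> R) (k : R) : measurable I -> sq I f -> sq I (fun x => k * f x).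
Proof.
move=> mI [mf fi]; split; first exact: measurable_funM.
by apply: igr_eq (igrZ (k ^+ 2) mI fi) => // x _; rewrite exprMn.
Qed.

Lemma sqD (I : set MR) (f g : R -> R) : measurable I -> sq I f -> sq I g -> sq I (fun x => f x + g x).
Proof.
move=> mI sf sg; split; first by apply: measurable_funD; [case: sf|case: sg].
have h := igrZ 2 mI (sq_mul mI sf sg); case: sf => _ sf; case: sg => _ sg.
apply: igr_eq (igrD mI (igrD mI sf sg) h) => // x _; ring.
Qed.

Lemma sqB (I : set MR) (f g : R -> R) : measurable I -> sq I f -> sq I g -> sq I (fun x => f x - g x).
Proof.
move=> mI sf sg; have := sqD mI sf (sqZ (-1) mI sg).
by congr sq; apply/funext => x; rewrite mulN1r.
Qed.

Lemma sqS (I J : set MR) f : measurable I -> measurable J -> J `<=` I -> sq I f -> sq J f.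
Proof.
by move=> mI mJ JI [mf fi]; split; [exact: measurable_funS mf|exact: igrS fi].
Qed.

Lemma sq_cst a b k : sq (sgm a b) (fun _ => k).
Proof. by split => //; exact: igr_cst. Qed.

Lemma sq_igr a b f : sq (sgm a b) f -> igr (sgm a b) f.
Proof.
move=> sf; have := sq_mul (msgm a b) sf (sq_cst a b 1).
by apply: igr_eq => // x _; rewrite mulr1.
Qed.

Lemma cauchy_schwarz (I : set MR) (f g : R -> R) : measurable I -> sq I f -> sq I g ->
  itg I (fun x => f x * g x) ^+ 2 <=
  itg I (fun x => f x ^+ 2) * itg I (fun x => g x ^+ 2).
Proof.
move=> mI sf sg; have fgi := sq_mul mI sf sg.
set F := itg I (fun x => f x ^+ 2); set G := itg I (fun x => g x ^+ 2).
set P := itg I (fun x => f x * g x).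
have key s t : 0 <= s ^+ 2 * F + t ^+ 2 * G - 2 * s * t * P.
  have [_ h] := sqB mI (sqZ s mI sf) (sqZ t mI sg).
  have -> : s ^+ 2 * F + t ^+ 2 * G - 2 * s * t * P =
      itg I (fun x => (s * f x - t * g x) ^+ 2).
    case: sf => _ sf; case: sg => _ sg.
    rewrite /F /G /P -!intZ// -intD//; [|exact: igrZ..].
    rewrite -intB//; [|by apply: igrD => //; exact: igrZ|exact: igrZ].
    by apply: int_eq => x _; ring.
  by apply: int_ge0 => x _; exact: sqr_ge0.
have F0 : 0 <= F by apply: int_ge0 => x _; exact: sqr_ge0.
have G0 : 0 <= G by apply: int_ge0 => x _; exact: sqr_ge0.
(* If [F = 0], the form at [s = (G + 1) / P], [t = 1] equals [G - 2 (G + 1) < 0], so [P] vanishes.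
   Otherwise [s = P], [t = F] gives [F (F G - P^2) >= 0]. *)
have [F00|FN0] := eqVneq F 0.
  have [P0|PN0] := eqVneq P 0; first by rewrite P0 F00; nra.
  have := key ((G + 1) / P) 1; rewrite F00 mulr0 add0r expr1n mul1r mulr1.
  rewrite -mulrA [_ / P * P]mulfVK//; nra.
have := key P F; have : 0 < F by rewrite lt_neqAle eq_sym FN0.
move=> Fp; rewrite expr2 => h.
have : 0 <= F * (F * G - P ^+ 2) by nra.
by rewrite pmulr_rge0// subr_ge0.
Qed.

End integrals.
#[global] Hint Resolve msgm mray : core.

Section calculus.
Context {R : realType}.
Local Notation MR := (measurableTypeR R).
Local Notation leb := (@lebesgue_measure R).

(** * Calculus for absolutely continuous functions *)

(** An epsilon-delta form, since continuity is obtained from Hölder bounds with an explicit [d] and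
    is consumed by local estimates of the same shape. *)
Definition cont_on (I : set MR) (u : R -> R) : Prop :=
  forall x : R, I x -> forall e : R, 0 < e ->
  exists2 d : R, 0 < d & forall y : R, I y -> `|y - x| < d -> `|u y - u x| < e.

Lemma cont_onP (I : set MR) (u : R -> R) :
  cont_on I u <-> {within (I : set R), continuous u}.
Proof.
rewrite subspace_continuousP; split => h x Ix.
- apply/(@cvgrPdist_lt _ R) => e e0; have [d d0 hd] := h x Ix e e0.
  rewrite /within /= nearE; apply/nbhs_ballP; exists d => //= y.
  by rewrite /ball /= => xy Iy; rewrite distrC; apply: hd => //; rewrite distrC.
- move=> e e0; have /cvgrPdist_lt/(_ e e0) := h x Ix.
  rewrite /within /= nearE => /nbhs_ballP[d /= d0 hd]; exists d => // y Iy yx.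
  by rewrite distrC; apply: hd => //; rewrite /ball /= distrC.
Qed.

Lemma cont_onS (I J : set MR) u : J `<=` I -> cont_on I u -> cont_on J u.
Proof.
move=> JI h x Jx e e0; have [d d0 hd] := h x (JI _ Jx) e e0.
by exists d => // y Jy; apply: hd; exact: JI.
Qed.

Lemma cont_on_meas (I : set MR) u : measurable I -> cont_on I u ->
  measurable_fun I (u : MR -> MR).
Proof. by move=> mI /cont_onP; exact: subspace_continuous_measurable_fun. Qed.

Lemma cont_on_igr (a b : R) u : cont_on (sgm a b) u -> igr (sgm a b) u.
Proof.
move=> /cont_onP cu; apply: continuous_compact_integrable => //.
by rewrite sgmE; exact: segment_compact.
Qed.

Lemma cont_on_max (a b : R) u : a <= b -> cont_on (sgm a b) u ->
  exists2 c : R, a <= c <= b & forall x : R, a <= x <= b -> u x <= u c.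
Proof.
move=> ab /cont_onP; rewrite sgmE => /(EVT_max ab)[c]; rewrite in_itv /= => cab h.
by exists c => // x xab; apply: h; rewrite in_itv.
Qed.

Lemma cont_on_comp (I : set MR) u G : cont_on I u -> continuous (G : R -> R) ->
  cont_on I (G \o u).
Proof.
move=> cu cG x Ix e e0.
have /cvgrPdist_lt/(_ e e0) := cG (u x); rewrite nearE => /nbhs_ballP[d /= d0 hd].
have [d' d'0 hd'] := cu x Ix d d0; exists d' => // y Iy yx.
by rewrite distrC; apply: hd; rewrite /ball /= distrC; exact: hd'.
Qed.

Lemma cont_on_norm (I : set MR) u : cont_on I u -> cont_on I (fun x => `|u x|).
Proof. by move=> cu; apply: (cont_on_comp cu); exact: norm_continuous. Qed.

Lemma cont_on_bound (a b : R) u : a <= b -> cont_on (sgm a b) u ->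
  exists M : R, forall x : R, a <= x <= b -> `|u x| <= M.
Proof.
move=> ab /cont_on_norm cu; have [c _ hc] := cont_on_max ab cu.
by exists `|u c|.
Qed.

Lemma igrM_bound (I : set MR) (f g : R -> R) (M : R) : measurable I ->
  measurable_fun I (f : MR -> MR) -> (forall x, I x -> `|f x| <= M) -> igr I g ->
  igr I (fun x => f x * g x).
Proof.
move=> mI mf fM gi; apply: (@igr_le _ _ _ (fun x => M * `|g x|)) => //.
- by apply: measurable_funM => //; exact: igr_meas.
- by apply: igrZ => //; exact: igr_norm.
- by move=> x Ix; rewrite normrM ler_wpM2r// fM.
Qed.

Lemma cont_on_igrM (a b : R) f g : a <= b -> cont_on (sgm a b) f ->
  igr (sgm a b) g -> igr (sgm a b) (fun x => f x * g x).
Proof.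
move=> ab cf gi; have [M hM] := cont_on_bound ab cf.
by apply: (@igrM_bound _ _ _ M) => //; exact: cont_on_meas.
Qed.

(* With [K x] the integral of [|g|] over [[a, x]] this yields the chain rule for absolutely
   continuous functions, without Lebesgue's differentiation theorem. *)
Lemma small_oscillation (a b : R) (D K : R -> R) : a <= b ->
  (forall x y : R, a <= x -> x <= y -> y <= b -> K x <= K y) ->
  (forall x : R, a <= x <= b -> forall e : R, 0 < e -> exists2 d : R, 0 < d &
    forall y : R, a <= y <= b -> `|y - x| < d -> `|D y - D x| <= e * `|K y - K x|) ->
  D b = D a.
Proof.
move=> ab Kmon loc.
suff key e : 0 < e -> `|D b - D a| <= e * (K b - K a).
  apply/eqP; rewrite -subr_eq0 -normr_le0; apply/ler_addgt0Pl => e e0; rewrite addr0.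
  have K0 : 0 <= K b - K a by rewrite subr_ge0 Kmon.
  have := key (e / (K b - K a + 1)); rewrite divr_gt0// ?ltr_wpDl// => /(_ isT) h.
  apply: le_trans h _; rewrite mulrAC ler_pdivrMr; nra.
(* Continuous induction: [S] collects the points that the bound reaches from [a]. Applied to the
   left, [loc] puts the supremum [s] in [S]; applied to the right, it goes past [s] unless
   [s = b]. *)
move=> e0; pose S := [set t : R | a <= t <= b /\ `|D t - D a| <= e * (K t - K a)].
have Sa : S a by split; [rewrite lexx ab|rewrite !subrr mulr0 normr0].
have Sb : ubound S b by move=> t [/andP[]].
have hS : has_sup S by split; [exists a|exists b].
set s := sup S.
have as_ : a <= s by apply: ub_le_sup => //; exists b.
have sb : s <= b by apply: ge_sup => //; exists a.
have sab : a <= s <= b by rewrite as_.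
have [d d0 hd] := loc s sab e e0.
have Ss : S s.
  have [t [tab tS] st] := sup_adherent d0 hS; rewrite -/s in st.
  have ts : t <= s by apply: ub_le_sup => //; exists b.
  have tds : `|t - s| < d by rewrite distrC ger0_norm ?subr_ge0//; lra.
  have h := hd t tab tds; split => //.
  have Kts : K t <= K s by apply: Kmon => //; case/andP: tab.
  rewrite -(subrK (D t) (D s)) -addrA (le_trans (ler_normD _ _))//.
  move: h; rewrite distrC [`|K t - K s|]distrC [`|K s - K t|]ger0_norm ?subr_ge0//.
  by move: tS; lra.
case: (ltP s b) => [sltb|bs]; last first.
  have -> : b = s by apply/eqP; rewrite eq_le bs sb.
  by case: Ss.
pose y := Num.min b (s + d / 2).
have sy : s < y by rewrite lt_min sltb ltrDl divr_gt0.
have yb : y <= b by rewrite ge_min lexx.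
have yab : a <= y <= b by rewrite yb (le_trans as_ (ltW sy)).
have : S y.
  split => //; have ysd : y <= s + d / 2 by rewrite ge_min lexx orbT.
  have h : `|y - s| < d by rewrite ger0_norm ?subr_ge0 ?ltW//; lra.
  have {}h := hd y yab h; case: Ss => _ Ss.
  have Ksy : K s <= K y by apply: Kmon => //; exact: ltW.
  rewrite -(subrK (D s) (D y)) -addrA (le_trans (ler_normD _ _))//.
  by move: h; rewrite [`|K y - K s|]ger0_norm ?subr_ge0//; lra.
by move=> /(ub_le_sup (ex_intro _ b Sb)); rewrite -/s leNgt sy.
Qed.

(** Absolute continuity with the derivative as an argument: [g] matters only up to null sets, and
    the rules of calculus become statements about such pairs. *)
Definition acf (a b : R) (u g : R -> R) : Prop :=
  igr (sgm a b) g /\ forall x : R, a <= x <= b -> u x = u a + itg (sgm a x) g.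

Lemma acf_igr a b u g : acf a b u g -> igr (sgm a b) g.
Proof. by case. Qed.

Lemma acf_diff (a b : R) u g (x y : R) : acf a b u g -> a <= x -> x <= y -> y <= b ->
  u y - u x = itg (sgm x y) g.
Proof.
move=> [gi h] ax xy yb; rewrite (h y) ?yb ?(le_trans ax xy)//.
rewrite (h x) ?ax ?(le_trans xy yb)// (@int_split _ a x y)//; first ring.
by apply: igrS gi => //; exact: sgm_sub.
Qed.

Lemma acf_sub (a b c d : R) u g : acf a b u g -> a <= c -> c <= d -> d <= b -> acf c d u g.
Proof.
move=> ac ca cd db; split; first by apply: igrS (acf_igr ac) => //; exact: sgm_sub.
move=> x /andP[cx xd]; rewrite -(acf_diff ac ca cx); first ring.
exact: le_trans xd db.
Qed.

Lemma acf_cont (a b : R) u g : a <= b -> acf a b u g -> cont_on (sgm a b) u.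
Proof.
move=> ab [gi h]; have := @parameterized_integral_continuous _ a b g ab.
rewrite -sgmE => /(_ gi) /cont_onP c x xab e e0.
have [d d0 hd] := c x xab e e0; exists d => // y yab yx.
have := hd y yab yx; rewrite /parameterized_integral -!sgmE.
by rewrite (h y yab) (h x xab) => yx'; rewrite [X in `|X|](_ : _ = itg (sgm a y) g - itg (sgm a x) g)//; ring.
Qed.

(** By the mean value theorem an increment of [G o u] is [G' xi] times the integral of [g], and
    [G' xi] is close to [G' (u t)] on a short interval. Hence the difference [D] of the two sides
    oscillates less than any fraction of the variation [K], and is constant. *)
Lemma acf_chain (a b : R) u g (G G' : R -> R) : a <= b -> acf a b u g ->
  (forall t : R, is_derive t 1 G (G' t)) -> continuous G' ->
  acf a b (G \o u) (fun x => G' (u x) * g x).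
Proof.
move=> ab ac dG cG'; have cu := acf_cont ab ac; have gi := acf_igr ac.
have cGu : cont_on (sgm a b) (G' \o u) by exact: cont_on_comp.
have hi : igr (sgm a b) (fun x => G' (u x) * g x) by exact: (cont_on_igrM ab cGu).
split => // c /andP[ac' cb].
have gis (x y : R) : a <= x -> y <= b -> igr (sgm x y) g.
  by move=> ax yb; apply: igrS gi => //; exact: sgm_sub.
have his (x y : R) : a <= x -> y <= b -> igr (sgm x y) (fun x => G' (u x) * g x).
  by move=> ax yb; apply: igrS hi => //; exact: sgm_sub.
pose D x := G (u x) - itg (sgm a x) (fun x => G' (u x) * g x).
pose K x := itg (sgm a x) (fun x => `|g x|).
have Kd (x y : R) : a <= x -> x <= y -> y <= b -> K y - K x = itg (sgm x y) (fun x => `|g x|).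
  move=> ax xy yb; rewrite /K (@int_split _ a x y)//; first ring.
  by apply: igr_norm => //; exact: gis.
have : D c = D a.
  apply: (@small_oscillation a c D K ac').
    move=> x y ax xy yc; rewrite -subr_ge0 Kd// ?(le_trans yc)//.
    by apply: int_ge0.
  move=> x /andP[ax xc] e e0; have xb := le_trans xc cb.
  have e20 : 0 < e / 2 by rewrite divr_gt0.
  have /cvgrPdist_lt/(_ _ e20) := cG' (u x); rewrite nearE => /nbhs_ballP[d1 /= d10 hd1].
  have xab : sgm a b x by rewrite /sgm /= ax xb.
  have [d d0 hd] := cu x xab d1 d10.
  exists d => // y /andP[ay yc] yx; have yb := le_trans yc cb.
  have near t : `|t - u x| < d1 -> `|G' t - G' (u x)| < e / 2.
    by move=> h; rewrite distrC; apply: hd1; rewrite /ball /= distrC.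
  have main (lo up : R) : a <= lo -> lo <= up -> up <= b ->
      (forall t : R, lo <= t <= up -> `|u t - u x| < d1) ->
      `|D up - D lo| <= e * `|K up - K lo|.
    move=> alo lohi hib close.
    have [xi xi1 xi2] : exists2 xi, `|xi - u x| < d1 & G (u up) - G (u lo) = G' xi * (u up - u lo).
      have hlo : `|u lo - u x| < d1 by apply: close; rewrite lexx.
      have hhi : `|u up - u x| < d1 by apply: close; rewrite lexx lohi.
      have cG (p q : R) : {within `[p, q], continuous G}.
        apply: continuous_subspaceT => t; apply: differentiable_continuous.
        by apply/derivable1_diffP; case: (dG t).
      case: (leP (u lo) (u up)) => luh.
        have [xi] := MVT_segment luh (fun t _ => dG t) (cG _ _).
        rewrite in_itv /= => /andP[l1 l2] e1; exists xi => //.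
        by move: hlo hhi; rewrite !ltr_norml => /andP[? ?] /andP[? ?]; lra.
      have [xi] := MVT_segment (ltW luh) (fun t _ => dG t) (cG _ _).
      rewrite in_itv /= => /andP[l1 l2] e1; exists xi; last by lra.
      by move: hlo hhi; rewrite !ltr_norml => /andP[? ?] /andP[? ?]; lra.
    have -> : D up - D lo = itg (sgm lo up) (fun t => (G' xi - G' (u t)) * g t).
      have -> : D up - D lo = G' xi * itg (sgm lo up) g
          - itg (sgm lo up) (fun x => G' (u x) * g x).
        rewrite -(acf_diff ac alo lohi hib) -xi2 /D (@int_split _ a lo up)//; first ring.
        exact: his.
      rewrite -intZ//; last exact: gis.
      rewrite -intB//; [|by apply: igrZ => //; exact: gis|exact: his].
      by apply: int_eq => t _; ring.
    rewrite Kd// [X in _ * X]ger0_norm; last exact: int_ge0.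
    have gn : igr (sgm lo up) (fun x => `|g x|) by apply: igr_norm => //; exact: gis.
    rewrite -intZ//; apply: le_trans (int_abs _ _) _ => //.
      apply: igr_eq (igrB _ (igrZ (G' xi) _ (gis lo up alo hib)) (his lo up alo hib)) => // t _.
      by ring.
    apply: int_le => //; last first.
      move=> t tlh; rewrite normrM ler_wpM2r//.
      have h1 := near _ xi1; have h2 := near _ (close t tlh).
      by rewrite ler_norml; move: h1 h2; rewrite !ltr_norml => /andP[? ?] /andP[? ?]; lra.
    - exact: igrZ.
    - apply: igr_norm => //.
      apply: igr_eq (igrB _ (igrZ (G' xi) _ (gis lo up alo hib)) (his lo up alo hib)) => // t _.
      by ring.
  case: (leP x y) => xy.
    apply: main => // t /andP[xt ty]; apply: hd.
      by rewrite /sgm /= (le_trans ax xt) (le_trans ty yb).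
    by move: yx; rewrite !ger0_norm ?subr_ge0//; lra.
  rewrite distrC [`|K y - _|]distrC; apply: main => //; first exact: ltW.
  move=> t /andP[yt tx]; apply: hd.
    by rewrite /sgm /= (le_trans ay yt) (le_trans tx xb).
  by move: yx; rewrite distrC [`|t - x|]distrC !ger0_norm ?subr_ge0//; [lra|exact: ltW].
rewrite /D /= int_pt subr0 => <-; ring.
Qed.

Lemma acf_lin (a b : R) u g w h (s t : R) : acf a b u g -> acf a b w h ->
  acf a b (fun x => s * u x + t * w x) (fun x => s * g x + t * h x).
Proof.
move=> [gi gu] [hi hw]; split; first by apply: igrD => //; exact: igrZ.
move=> x /andP[ax xb].
have gix : igr (sgm a x) g by apply: igrS gi => //; exact: sgm_sub.
have hix : igr (sgm a x) h by apply: igrS hi => //; exact: sgm_sub.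
rewrite intD//; [|exact: igrZ|exact: igrZ]; rewrite !intZ//.
by rewrite gu ?ax// hw ?ax//; ring.
Qed.

Lemma acf_eq (a b : R) u g u' g' : acf a b u g -> a <= b ->
  (forall x : R, a <= x <= b -> u x = u' x) ->
  (forall x : R, a <= x <= b -> g x = g' x) -> acf a b u' g'.
Proof.
move=> [gi gu] ab uu gg; split; first exact: igr_eq gi.
move=> x xab; rewrite -uu// gu// uu ?lexx//; congr (_ + _).
by apply: int_eq => t /andP[? ?]; apply: gg; move: xab => /andP[? ?]; lra.
Qed.

Lemma is_derive_sqr (t : R) : is_derive t 1 (fun x : R => x ^+ 2) (2 * t).
Proof.
have h := is_deriveX 2 (is_derive_id t (1 : R)).
have -> : (fun x : R => x ^+ 2) = (@id R) ^+ 2 by apply/funext => x; rewrite exprfctE.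
by apply: (is_derive_eq h); rewrite /GRing.scale /= expr1 mulr1.
Qed.

Lemma continuous_dbl : continuous (fun t : R => 2 * t).
Proof. by move=> t; exact: mulrl_continuous. Qed.

(** Polarization, [u w = ((u + w)^2 - u^2 - w^2) / 2], reduces the product to the chain rule for the
    square. *)
Lemma acf_mul (a b : R) u g w h : a <= b -> acf a b u g -> acf a b w h ->
  acf a b (fun x => u x * w x) (fun x => g x * w x + u x * h x).
Proof.
move=> ab acu acw.
have s1 := acf_chain ab (acf_lin 1 1 acu acw) is_derive_sqr continuous_dbl.
have s2 := acf_chain ab acu is_derive_sqr continuous_dbl.
have s3 := acf_chain ab acw is_derive_sqr continuous_dbl.
apply: acf_eq (acf_lin 2^-1 (- 2^-1) s1 (acf_lin 1 1 s2 s3)) ab _ _ => x _ /=; by field.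
Qed.

Lemma acf_C1 (a b : R) (F f : R -> R) : a <= b -> cont_on (sgm a b) f ->
  cont_on (sgm a b) F -> (forall x : R, a < x < b -> is_derive x 1 F (f x)) ->
  acf a b F f.
Proof.
move=> ab cf cF dF; split; first exact: cont_on_igr.
move=> x /andP[ax xb]; move: ax; rewrite le_eqVlt => /orP[/eqP<-|ax].
  by rewrite int_pt addr0.
have sub : sgm a x `<=` sgm a b by exact: sgm_sub.
have /cont_onP cfx := cont_onS sub cf; have /cont_onP cFx := cont_onS sub cF.
rewrite sgmE in cfx; rewrite sgmE in cFx.
have /(continuous_within_itvP _ ax)[_ cFa cFb] := cFx.
rewrite /Rintegral sgmE (@continuous_FTC2 _ f F a x ax cfx) /=; first ring.
- split=> // y; rewrite in_itv /= => /andP[ay yx].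
  by have [] : is_derive y 1 F (f y) by apply: dF; rewrite ay (lt_le_trans yx xb).
- move=> y; rewrite in_itv /= => /andP[ay yx]; rewrite derive1E.
  by have [] : is_derive y 1 F (f y) by apply: dF; rewrite ay (lt_le_trans yx xb).
Qed.

End calculus.

Section edges.
Context {R : realType}.
Local Notation MR := (measurableTypeR R).
Local Notation leb := (@lebesgue_measure R).

(** * Sobolev functions on an edge *)

Lemma itg_sub (I J : set MR) (f : R -> R) : measurable I -> measurable J ->
  J `<=` I -> igr I f -> (forall x, I x -> 0 <= f x) -> itg J f <= itg I f.
Proof.
move=> mI mJ JI fi f0; apply: fine_le.
- exact: (integrable_fin_num mJ (igrS mI mJ JI fi)).
- exact: integrable_fin_num.
- apply: ge0_subset_integral => //; first exact: (measurable_int leb fi).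
Qed.

Lemma sqr_lt_norm (t e : R) : 0 <= e -> t ^+ 2 < e ^+ 2 -> `|t| < e.
Proof. by move=> e0 h; rewrite ltr_norml; apply/andP; split; nra. Qed.

Lemma sqr_le_norm (t e : R) : 0 <= e -> t ^+ 2 <= e ^+ 2 -> `|t| <= e.
Proof. by move=> e0 h; rewrite ler_norml; apply/andP; split; nra. Qed.

Lemma itg_lt_exists (a b C : R) f : a <= b -> igr (sgm a b) f ->
  itg (sgm a b) f < C * (b - a) -> exists2 x : R, a <= x <= b & f x < C.
Proof.
move=> ab fi h; apply: contrapT => hn.
have : C * (b - a) <= itg (sgm a b) f.
  rewrite -int_cst//; apply: int_le => //; first exact: igr_cst.
  move=> x xab; rewrite leNgt; apply/negP => fx; apply: hn; by exists x.
by rewrite leNgt h.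
Qed.

Lemma sgm_head (a b : R) : a <= b -> sgm a b = [set a] `|` (`]a, b]%classic : set R).
Proof. by move=> ab; rewrite sgmE setU1itv. Qed.

(* A derivative may be changed at the left endpoint; this is what happens at
   the junction of a piecewise definition. *)
Lemma igr_eq_oc (a b : R) f g : a <= b -> igr (sgm a b) f ->
  (forall x : R, a < x <= b -> f x = g x) -> igr (sgm a b) g.
Proof.
move=> ab fi fg.
have fi' : igr `]a, b] f.
  by apply: igrS fi => //; rewrite sgmE; apply: subset_itvr; rewrite bnd_simp.
have gi' : igr `]a, b] g.
  by apply: igr_eq fi' => // x; rewrite /= in_itv /= => xab; rewrite fg.
have mg : measurable_fun (sgm a b) (g : MR -> MR).
  rewrite sgm_head//; apply/measurable_funU => //; split.
    exact: measurable_fun_set1.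
  exact: igr_meas gi'.
apply: (@igr_le _ _ g (fun x => `|f x| + `|g a| * \1_([set a] : set R) x)) => //.
  apply: igrD => //; first exact: igr_norm.
  apply: igrZ => //; apply: (igrS measurableT) => //.
  rewrite -set_itv1; exact: integrable_indic_itv.
move=> x xab; have [->|xa] := eqVneq x a.
  by rewrite indicE mem_set//= mulr1 lerDr.
rewrite fg; last by move: xab => /andP[ax ->]; rewrite lt_neqAle eq_sym xa ax.
by rewrite lerDl mulr_ge0// indicE.
Qed.

Lemma itg_eq_oc (a b : R) f g : a <= b -> igr (sgm a b) f ->
  (forall x : R, a < x <= b -> f x = g x) -> itg (sgm a b) f = itg (sgm a b) g.
Proof.
move=> ab fi fg; have gi := igr_eq_oc ab fi fg.
have sub : (`]a, b]%classic : set R) `<=` sgm a b.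
  by rewrite sgmE; apply: subset_itvr; rewrite bnd_simp.
have {}fi : igr `]a, b] f by apply: igrS fi.
have {}gi : igr `]a, b] g by apply: igrS gi.
rewrite sgmE -!Rintegral_itv_obnd_cbnd//.
by apply: eq_Rintegral => x; rewrite inE /= in_itv /= => xab; rewrite fg.
Qed.

Lemma acf_eq_oc (a b : R) u g u' g' : acf a b u g -> a <= b ->
  (forall x : R, a <= x <= b -> u x = u' x) ->
  (forall x : R, a < x <= b -> g x = g' x) -> acf a b u' g'.
Proof.
move=> [gi gu] ab uu gg; split; first exact: igr_eq_oc gi gg.
move=> x /andP[ax xb]; rewrite -!uu ?ax ?lexx//= gu ?ax//; congr (_ + _).
apply: itg_eq_oc => //; first by apply: igrS gi => //; exact: sgm_sub.
by move=> t /andP[? ?]; apply: gg; lra.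
Qed.

Lemma igr_join (a b c : R) f : a <= b -> b <= c -> igr (sgm a b) f -> igr (sgm b c) f ->
  igr (sgm a c) f.
Proof.
move=> ab bc f1 f2.
have sE : sgm a c = sgm a b `|` sgm b c.
  apply/seteqP; split => x /=; rewrite /sgm /=.
    by move=> /andP[ax xc]; case: (leP x b) => xb; [left|right]; rewrite ?ax ?xc ?andbT// ltW.
  by move=> [|] /andP[? ?]; lra.
have mf : measurable_fun (sgm a c) (f : MR -> MR).
  by rewrite sE; apply/measurable_funU => //; split; exact: igr_meas.
have zi (d e : R) : sgm d e `<=` sgm a c -> igr (sgm d e) f ->
    igr (sgm a c) (fun x => `|f x| * \1_(sgm d e) x).
  move=> sub fi; have := (igrS (msgm d e) _ _ (igr_norm (msgm d e) fi)).
  have := @integrable_restrict _ _ _ leb (sgm d e) (msgm d e) (sgm a c) (msgm a c)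
     (EFin \o (fun x => `|f x|)).
  rewrite setIidr// => -[h _] _; apply: eq_integrable (h (igr_norm (msgm d e) fi)) => //.
  move=> x _; rewrite /= patchE indicE; case: ifPn => xin /=; first by rewrite mulr1.
  by rewrite mulr0.
apply: (@igr_le _ _ f (fun x => `|f x| * \1_(sgm a b) x + `|f x| * \1_(sgm b c) x)) => //.
  by apply: igrD => //; apply: zi => //; rewrite sE; [left|right].
rewrite sE => x -[xs|xs]; rewrite !indicE.
  by rewrite (mem_set xs) mulr1 lerDl mulr_ge0.
by rewrite (mem_set xs) mulr1 lerDr mulr_ge0.
Qed.

Lemma acf_join (a b c : R) u g : a <= b -> b <= c -> acf a b u g -> acf b c u g ->
  acf a c u g.
Proof.
move=> ab bc [g1 u1] [g2 u2]; have gi := igr_join ab bc g1 g2; split => //.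
move=> x /andP[ax xc]; case: (leP x b) => xb; first by rewrite u1 ?ax.
rewrite u2 ?xc ?ltW// u1 ?ab ?lexx// (@int_split _ a b x _ ab (ltW xb)); first ring.
by apply: igrS gi => //; exact: sgm_sub.
Qed.

(** What the proofs use of an edge, so that the halflines and the tip share the same lemmas. *)
Definition is_edge (I : set MR) : Prop :=
  [/\ measurable I, forall x : R, I x -> 0 <= x, I 0 &
      forall x y : R, I y -> 0 <= x -> x <= y -> I x].

Lemma edge_ray : is_edge (ray 0).
Proof. by split => //; rewrite /ray /=. Qed.

Lemma edge_sgm (l : R) : 0 <= l -> is_edge (sgm 0 l).
Proof.
move=> l0; split => //; rewrite /sgm /=.
- by move=> x /andP[].
- by rewrite lexx l0.
- by move=> x y /andP[_ yl] -> xy; rewrite (le_trans xy yl).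
Qed.

(** The clauses of [H1_with_deriv] over an arbitrary [realType]; for [RR] both unfold to the same
    proposition, and [funs_in_H1] relies on this. *)
Definition H1 (I : set MR) (u g : R -> R) : Prop :=
  igr I (fun x => u x ^+ 2) /\ measurable_fun I (g : MR -> MR) /\
  igr I (fun x => g x ^+ 2) /\
  forall x : R, I x -> igr (sgm 0 x) g /\ u x = u 0 + itg (sgm 0 x) g.

Lemma edge_sub I (a b : R) : is_edge I -> I b -> 0 <= a -> sgm a b `<=` I.
Proof.
by move=> [_ _ _ h] Ib a0 x /andP[ax xb]; apply: h Ib _ xb; exact: le_trans ax.
Qed.

Lemma H1_acf I u g (a b : R) : is_edge I -> H1 I u g -> 0 <= a -> a <= b -> I b ->
  acf a b u g.
Proof.
move=> eI [_ [_ [_ h]]] a0 ab Ib; have [gi _] := h b Ib.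
have b0 : 0 <= b by exact: le_trans ab.
have : acf 0 b u g.
  split => // x /andP[x0 xb]; case: eI => _ _ _ hI.
  by have [] := h x (hI _ _ Ib x0 xb).
by move=> /acf_sub; apply.
Qed.

Lemma H1_dsq I u g : H1 I u g -> sq I g.
Proof. by move=> [_ [? [? _]]]. Qed.

Lemma acf_holder (a b : R) u g : a <= b -> acf a b u g -> sq (sgm a b) g ->
  (u b - u a) ^+ 2 <= (b - a) * itg (sgm a b) (fun x => g x ^+ 2).
Proof.
move=> ab ac sg; rewrite (acf_diff ac)//.
have := cauchy_schwarz (msgm a b) (sq_cst a b 1) sg.
rewrite (int_eq (g := g)) => [|x _]; last by rewrite mul1r.
by rewrite (int_eq (f := fun=> 1 ^+ 2) (g := fun=> 1)) ?int_cst ?mul1r// => x _; rewrite expr1n.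
Qed.

Lemma H1_holder I u g (x y : R) : is_edge I -> H1 I u g -> I x -> I y ->
  (u y - u x) ^+ 2 <= `|y - x| * itg I (fun x => g x ^+ 2).
Proof.
move=> eI h; wlog xy : x y / x <= y.
  move=> H Ix Iy; case: (leP x y) => xy; first exact: H.
  by have := H _ _ (ltW xy) Iy Ix; rewrite distrC -(opprB (u x)) sqrrN.
move=> Ix Iy; have x0 : 0 <= x by case: eI => _ + _ _; apply.
have sub := edge_sub eI Iy x0; have mI : measurable I by case: eI.
have sg := sqS mI (msgm x y) sub (H1_dsq h).
apply: le_trans (acf_holder xy (H1_acf eI h x0 xy Iy) sg) _.
rewrite [`|y - x|]ger0_norm ?subr_ge0// ler_wpM2l ?subr_ge0//.
by apply: itg_sub => //; [case: h => _ [_ []]|move=> t _; exact: sqr_ge0].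
Qed.

Lemma H1_cont I u g : is_edge I -> H1 I u g -> cont_on I u.
Proof.
move=> eI h x Ix e e0; set A := itg I (fun x => g x ^+ 2).
have A0 : 0 <= A by apply: int_ge0 => ? _; exact: sqr_ge0.
exists (e ^+ 2 / (A + 1)); first by rewrite divr_gt0 ?exprn_gt0// ltr_wpDl.
move=> y Iy; rewrite ltr_pdivlMr ?ltr_wpDl// => yx.
have := H1_holder eI h Ix Iy; rewrite -/A => hh.
apply: sqr_lt_norm; first exact: ltW.
by have := normr_ge0 (y - x); nra.
Qed.

Lemma H1_sq I u g : is_edge I -> H1 I u g -> sq I u.
Proof.
move=> eI h; split; last by case: h.
by apply: cont_on_meas (H1_cont eI h); case: eI.
Qed.

Lemma H1_bounded I u g : is_edge I -> H1 I u g ->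
  exists2 M : R, 0 <= M & forall x, I x -> `|u x| <= M.
Proof.
move=> eI h; have mI : measurable I by case: eI.
have [_ ui] := H1_sq eI h; have [_ gi] := H1_dsq h.
set X := itg I (fun x => u x ^+ 2); set A := itg I (fun x => g x ^+ 2).
have X0 : 0 <= X by apply: int_ge0 => ? _; exact: sqr_ge0.
have A0 : 0 <= A by apply: int_ge0 => ? _; exact: sqr_ge0.
have S0 : 0 <= u 0 ^+ 2 + X + A by rewrite !addr_ge0// sqr_ge0.
(* From [(u^2)' = 2 u g <= u^2 + g^2], the square of [u] is at most [S = u 0 ^+ 2 + X + A], and
   [S <= (S + 1)^2] avoids a square root. *)
exists (u 0 ^+ 2 + X + A + 1); first by rewrite addr_ge0.
move=> x Ix; have x0 : 0 <= x by case: eI => _ + _ _; apply.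
have ac := H1_acf eI h (lexx 0) x0 Ix; have sub := edge_sub eI Ix (lexx 0).
have := acf_diff (acf_chain x0 ac is_derive_sqr continuous_dbl) (lexx 0) x0 (lexx x).
move=> /= hd.
have : u x ^+ 2 - u 0 ^+ 2 <= X + A.
  rewrite hd /X /A -intD//; apply: le_trans (itg_sub mI (msgm 0 x) sub _ _) => //.
  - apply: int_le => //.
    + by have := acf_igr (acf_chain x0 ac is_derive_sqr continuous_dbl).
    + by apply: igrS (igrD mI ui gi).
    + by move=> t _; have := sqr_ge0 (u t - g t); nra.
  - exact: igrD.
  - by move=> t _; rewrite addr_ge0 ?sqr_ge0.
by move=> hx; apply: sqr_le_norm; [rewrite addr_ge0|nra].
Qed.

Lemma H1_lin I u g w h (s t : R) : is_edge I -> H1 I u g -> H1 I w h ->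
  H1 I (fun x => s * u x + t * w x) (fun x => s * g x + t * h x).
Proof.
move=> eI hu hw; have mI : measurable I by case: eI.
have [mu iu] := sqD mI (sqZ s mI (H1_sq eI hu)) (sqZ t mI (H1_sq eI hw)).
have [mg ig] := sqD mI (sqZ s mI (H1_dsq hu)) (sqZ t mI (H1_dsq hw)).
split => //; split => //; split => // x Ix.
have x0 : 0 <= x by case: eI => _ + _ _; apply.
have [ai ae] := acf_lin s t (H1_acf eI hu (lexx 0) x0 Ix) (H1_acf eI hw (lexx 0) x0 Ix).
by split => //; apply: ae; rewrite x0 lexx.
Qed.

Lemma H1_Z I u g (k : R) : is_edge I -> H1 I u g ->
  H1 I (fun x => k * u x) (fun x => k * g x).
Proof.
move=> eI h; have := H1_lin k 0 eI h h.
by congr H1; apply/funext => x; rewrite mul0r addr0.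
Qed.

Lemma H1_restrict (I J : set MR) u g : is_edge I -> is_edge J -> J `<=` I ->
  H1 I u g -> H1 J u g.
Proof.
move=> [mI _ _ _] [mJ _ _ _] JI [h1 [h2 [h3 h4]]]; split; first exact: igrS h1.
split; first exact: measurable_funS h2.
by split; [exact: igrS h3|move=> x Jx; apply: h4; exact: JI].
Qed.

Lemma H1_sgm (l : R) u g : 0 <= l -> acf 0 l u g -> sq (sgm 0 l) g -> H1 (sgm 0 l) u g.
Proof.
move=> l0 ac [mg gi]; split.
  apply: cont_on_igr; apply: (cont_on_comp (G := fun x => x ^+ 2) (acf_cont l0 ac)).
  exact: exprn_continuous.
split => //; split => // x /andP[x0 xl]; case: ac => gi' ua.
by split; [apply: igrS gi' => //; exact: sgm_sub|apply: ua; rewrite x0].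
Qed.

Definition zext (L : R) (f : R -> R) (x : R) : R := if x <= L then f x else 0.

Lemma zext_ray (L : R) (f : R -> R) : 0 <= L -> igr (sgm 0 L) f ->
  igr (ray 0) (zext L f) /\ itg (ray 0) (zext L f) = itg (sgm 0 L) f.
Proof.
move=> L0 fi; have sE : ray 0 `&` sgm 0 L = sgm 0 L.
  by apply/seteqP; split => x /=; rewrite /sgm /ray /=; [case|move=> /andP[? ?]; split=> //; apply/andP].
have pE x : ray 0 x -> (f \_ (sgm 0 L)) x = zext L f x.
  rewrite /ray /= patchE /zext => x0; case: (leP x L) => xL.
    by rewrite mem_set//= /sgm /= x0.
  by rewrite memNset//= /sgm /= x0 => h; rewrite leNgt xL in h.
split.
  have := @integrable_restrict _ _ _ leb (sgm 0 L) (msgm 0 L) (ray 0) (mray 0) (EFin \o f).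
  rewrite sE => -[h _]; apply: eq_integrable (h fi) => // x; rewrite inE => x0.
  by rewrite -pE//= !patchE; case: ifP.
by rewrite -[in RHS]sE Rintegral_mkcondr; apply: int_eq => x x0; rewrite pE.
Qed.

Lemma zext_comp (L : R) (f Phi : R -> R) : Phi 0 = 0 ->
  (fun x => Phi (zext L f x)) = zext L (fun x => Phi (f x)).
Proof. by move=> P0; apply/funext => x; rewrite /zext; case: ifP. Qed.

Lemma H1_zext (L : R) u g : 0 <= L -> acf 0 L u g -> sq (sgm 0 L) g -> u L = 0 ->
  H1 (ray 0) (zext L u) (zext L g).
Proof.
move=> L0 ac sg uL; have [ui [_ [gi h]]] := H1_sgm L0 ac sg.
have sq0 : (0 : R) ^+ 2 = 0 by rewrite expr0n.
have mz : measurable_fun (ray 0) (zext L g : MR -> MR).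
  by apply: igr_meas; have [] := zext_ray L0 (sq_igr sg).
split; first by rewrite (@zext_comp _ _ (fun x => x ^+ 2))//; have [] := zext_ray L0 ui.
split => //; split.
  by rewrite (@zext_comp _ _ (fun x => x ^+ 2))//; have [] := zext_ray L0 gi.
move=> x; rewrite /ray /= => x0.
have z1 : acf 0 L (zext L u) (zext L g).
  by apply: acf_eq ac L0 _ _ => y /andP[_ yL]; rewrite /zext yL.
case: (leP x L) => xL.
  have [gi' he] := acf_sub z1 (lexx 0) x0 xL.
  by split => //; apply: he; rewrite x0 lexx.
have z2 : acf L x (zext L u) (zext L g).
  apply: (@acf_eq_oc L x (fun=> 0) (fun=> 0)) => //; last first.
  - by move=> y /andP[Ly _]; rewrite /zext leNgt Ly.
  - move=> y /andP[Ly _]; rewrite /zext; case: leP => // yL.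
    by rewrite -uL; congr u; apply/eqP; rewrite eq_le Ly.
  - exact: ltW.
  split; first exact: igr_cst.
  by move=> y /andP[Ly _]; rewrite int_cst// mul0r addr0.
have [gi' he] := acf_join L0 (ltW xL) z1 z2.
by split => //; apply: he; rewrite x0 lexx.
Qed.

Lemma powR_le_sqr (p M t : R) : 2 <= p -> `|t| <= M -> `|t| `^ p <= M `^ (p - 2) * t ^+ 2.
Proof.
move=> p2 tM; have -> : t ^+ 2 = `|t| `^ 2 by rewrite powR_mulrn// real_normK// num_real.
have [->|t0] := eqVneq `|t| 0; first by rewrite powR0 ?mulr_ge0 ?powR_ge0//; lra.
have -> : `|t| `^ p = `|t| `^ (p - 2) * `|t| `^ 2.
  by rewrite -powRD ?subrK// t0 implybT.
rewrite ler_wpM2r ?powR_ge0// ge0_ler_powR ?nnegrE ?subr_ge0//.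
exact: le_trans tM.
Qed.

Lemma continuous_powR_norm (p : R) : 0 < p -> continuous (fun t : R => `|t| `^ p).
Proof.
move=> p0 t; have [->|t0] := eqVneq t 0.
  apply/cvgrPdist_lt => e e0; rewrite normr0 powR0 ?gt_eqF// nearE.
  apply/nbhs_ballP; exists (e `^ (p^-1)) => /=; first by rewrite powR_gt0.
  move=> y; rewrite /ball /= !sub0r !normrN => ye; rewrite ger0_norm ?powR_ge0//.
  have : `|y| `^ p < (e `^ p^-1) `^ p by rewrite gt0_ltr_powR ?nnegrE ?powR_ge0.
  by rewrite -powRrM mulVf ?gt_eqF// powRr1// ltW.
apply: (@continuous_comp _ _ _ (fun x : R => `|x|) (fun x => x `^ p)).
  exact: norm_continuous.
apply: differentiable_continuous; apply/derivable1_diffP.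
by have [] : is_derive `|t| 1 (fun x => x `^ p) (p * `|t| `^ (p - 1)) by
  apply: is_derive1_powR; rewrite normr_gt0.
Qed.


End edges.

Section calibration.
Context {R : realType}.
Local Notation MR := (measurableTypeR R).
Local Notation leb := (@lebesgue_measure R).

Lemma mvt_seg (G G' : R -> R) (a b : R) : (forall t : R, is_derive t 1 G (G' t)) ->
  a <= b -> exists2 c : R, a <= c <= b & G b - G a = G' c * (b - a).
Proof.
move=> dG ab; have cG : {within `[a, b], continuous G}.
  apply: continuous_subspaceT => t; apply: differentiable_continuous.
  by apply/derivable1_diffP; case: (dG t).
by have [c] := MVT_segment ab (fun t _ => dG t) cG; rewrite in_itv /= => cab e; exists c.
Qed.

Context (p : R) (p2 : 2 < p).

(** * The calibration *)

(** The speed at level [t] of the soliton of height [1], read off from its first integral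
    [u'^2 / 2 = (u^2 - u^p) / p]. As [Num.sqrt] is [0] on negative numbers, [gk] is extended
    continuously by zero outside [[-1, 1]]. *)
Definition gk (t : R) : R := Num.sqrt (2 / p) * `|t| * Num.sqrt (1 - `|t| `^ (p - 2)).

Let p_gt0 : 0 < p. Proof. by apply: lt_trans p2. Qed.
Let pm2_gt0 : 0 < p - 2. Proof. by rewrite subr_gt0. Qed.

Lemma gk_cont : continuous gk.
Proof.
move=> t; apply: cvgM; [apply: cvgM; first exact: cvg_cst|].
  exact: (@norm_continuous _ R t).
apply: (@continuous_comp _ _ _ (fun t : R => 1 - `|t| `^ (p - 2)) Num.sqrt).
  by apply: cvgB; [exact: cvg_cst|exact: continuous_powR_norm].
exact: sqrt_continuous.
Qed.

Lemma gk_ge0 t : 0 <= gk t.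
Proof. by rewrite !mulr_ge0// sqrtr_ge0. Qed.

Lemma gkN t : gk (- t) = gk t.
Proof. by rewrite /gk normrN. Qed.

Lemma gk_out t : 1 <= `|t| -> gk t = 0.
Proof.
move=> t1; rewrite /gk [X in _ * X](_ : _ = 0) ?mulr0//.
apply/eqP; rewrite sqrtr_eq0 subr_le0.
by have := @ge0_ler_powR R (p - 2) (ltW pm2_gt0) 1 `|t|; rewrite !nnegrE powR1; apply.
Qed.

Lemma gk_sqr t : `|t| <= 1 -> gk t ^+ 2 = 2 / p * t ^+ 2 * (1 - `|t| `^ (p - 2)).
Proof.
move=> t1; rewrite /gk !exprMn real_normK ?num_real// !sqr_sqrtr//.
  rewrite subr_ge0.
  by have := @ge0_ler_powR R (p - 2) (ltW pm2_gt0) `|t| 1; rewrite !nnegrE powR1; apply.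
by rewrite divr_ge0// ltW.
Qed.

Lemma gk_le_norm t : gk t <= `|t|.
Proof.
case: (leP `|t| 1) => t1; last by rewrite gk_out// ltW.
rewrite -ler_sqr ?nnegrE ?gk_ge0// gk_sqr// real_normK ?num_real//.
have h1 : 0 <= 1 - `|t| `^ (p - 2) <= 1.
  rewrite subr_ge0 gerBl powR_ge0 andbT.
  by have := @ge0_ler_powR R (p - 2) (ltW pm2_gt0) `|t| 1; rewrite !nnegrE powR1; apply.
have h2 : 0 <= 2 / p <= 1.
  by apply/andP; split; [rewrite divr_ge0// ltW|rewrite ler_pdivrMr// mul1r ltW].
move: h1 h2 => /andP[a0 a1] /andP[b0 b1]; have := sqr_ge0 t.
have : 2 / p * (1 - `|t| `^ (p - 2)) <= 1 by nra.
nra.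
Qed.

Lemma gk_le1 t : gk t <= 1.
Proof.
case: (leP `|t| 1) => t1; first exact: le_trans (gk_le_norm t) t1.
by rewrite gk_out// ltW.
Qed.

(** The primitive of [gk] vanishing at [0]. The base point [-2] lies to the left of the support of
    [gk], and the integral over the empty segment is [0] for [t < -2], so that one formula is
    differentiable on the whole line. *)
Definition Hk (t : R) : R := itg (sgm (-2) t) gk - itg (sgm (-2) 0) gk.

Lemma gk_igr (a b : R) : igr (sgm a b) gk.
Proof.
apply: cont_on_igr; apply/cont_onP; apply: continuous_subspaceT; exact: gk_cont.
Qed.

Lemma is_derive_Hk (t : R) : is_derive t 1 Hk (gk t).
Proof.
case: (ltP (-2) t) => t2.
  have gi : lebesgue_measure.-integrable `[-2, t + 1] (EFin \o gk).
    by rewrite -sgmE; exact: gk_igr.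
  have t1 : t < t + 1 by rewrite ltrDl.
  have [dv dve] := continuous_FTC1_closed t1 gi t2 (gk_cont (x := t)).
  have -> : Hk = (fun x => itg `[-2, x] gk) + cst (- itg (sgm (-2) 0) gk).
    by apply/funext => x; rewrite /Hk sgmE.
  have hF : is_derive t 1 (fun x => itg `[-2, x] gk) (gk t).
    by rewrite -dve derive1E; exact: (DeriveDef dv (erefl _)).
  by apply: (is_derive_eq (is_deriveD hF (is_derive_cst _ t 1))); rewrite addr0.
rewrite gk_out; last by rewrite ler0_norm; lra.
apply: (@near_eq_is_derive _ _ _ (cst (- itg (sgm (-2) 0) gk))).
  apply/nbhs_ballP; exists 1 => //= y; rewrite /ball /= ltr_norml => /andP[y1 y2].
  rewrite /Hk; suff -> : itg (sgm (-2) y) gk = 0 by rewrite sub0r.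
  case: (leP (-2) y) => y3; last first.
    by rewrite sgmE set_itv_ge ?Rintegral_set0// bnd_simp -ltNge.
  rewrite (int_eq (g := fun=> 0)) ?int_cst ?mul0r// => x /andP[x1 x2].
  by apply: gk_out; rewrite ler0_norm; lra.
Qed.

Lemma Hk0 : Hk 0 = 0.
Proof. by rewrite /Hk subrr. Qed.

Lemma HkN t : Hk (- t) = - Hk t.
Proof.
have h (x : R) : is_derive x 1 (Hk + (Hk \o -%R)) 0.
  have dN : is_derive x (1 : R) (fun y : R => - y) (- 1).
    exact: (is_deriveN (is_derive_id x (1 : R))).
  have := is_derive1_comp (is_derive_Hk (- x)) dN; rewrite gkN mulrN1 => d2.
  by apply: (is_derive_eq (is_deriveD (is_derive_Hk x) d2)); rewrite subrr.
have := is_derive_0_is_cst t 0 h; rewrite /GRing.add /= /comp oppr0 Hk0 addr0.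
by move=> /eqP; rewrite addr_eq0 => /eqP ->; rewrite opprK.
Qed.

Lemma Hk_mono (s t : R) : s <= t -> Hk s <= Hk t.
Proof.
move=> st; rewrite -subr_ge0; have [c _ ->] := mvt_seg is_derive_Hk st.
by rewrite mulr_ge0 ?gk_ge0 ?subr_ge0.
Qed.

Lemma Hk_lip (s t : R) : s <= t -> Hk t - Hk s <= t - s.
Proof.
move=> st; have [c _ ->] := mvt_seg is_derive_Hk st.
by rewrite -[leRHS]mul1r ler_wpM2r ?gk_le1// subr_ge0.
Qed.

Lemma Hk_ge0 t : 0 <= t -> 0 <= Hk t.
Proof. by move=> t0; rewrite -Hk0 Hk_mono. Qed.

Lemma Hk_abs t : `|Hk t| = Hk `|t|.
Proof.
case: (leP 0 t) => t0; first by rewrite !ger0_norm ?Hk_ge0.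
rewrite [`|t|]ler0_norm ?ltW// HkN ler0_norm// -oppr_ge0 -HkN Hk_ge0// oppr_ge0 ltW//.
Qed.

Lemma Hk_le_sqr (t : R) : 0 <= t -> Hk t <= t ^+ 2.
Proof.
move=> t0; have [c /andP[c0 ct] h] := mvt_seg is_derive_Hk t0.
rewrite Hk0 !subr0 in h; rewrite h expr2 ler_wpM2r//.
by apply: le_trans (gk_le_norm c) _; rewrite ger0_norm.
Qed.

Lemma Hk1_gt0 : 0 < Hk 1.
Proof.
have h : (2^-1 : R) <= 3 / 4 by lra.
have gp (c : R) : 2^-1 <= c <= 3 / 4 -> 0 < gk c.
  move=> /andP[c1 c2]; rewrite /gk !mulr_gt0 ?sqrtr_gt0 ?divr_gt0// ?normr_gt0 ?gt_eqF//; try lra.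
  rewrite subr_gt0 ger0_norm; last lra.
  have := @gt0_ltr_powR R (p - 2) pm2_gt0 c 1; rewrite !nnegrE powR1; apply; lra.
have [c cc e] := mvt_seg is_derive_Hk h.
have : 0 < Hk (3 / 4) - Hk 2^-1 by rewrite e mulr_gt0 ?gp//; lra.
have h1 : Hk (3 / 4) <= Hk 1 by apply: Hk_mono; lra.
have h2 : 0 <= Hk 2^-1 by apply: Hk_ge0; lra.
lra.
Qed.

(** Energy density plus a multiple of the mass density; the multiple is the one for which the
    potential part vanishes at level [M], hence is nonnegative below it. *)
Definition Lag (M : R) (u g : R -> R) (x : R) : R :=
  2^-1 * g x ^+ 2 + p^-1 * (M `^ (p - 2) * u x ^+ 2 - `|u x| `^ p).

(** The calibration. Its derivative in [|t|] is the square root of twice the potential part of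
    [Lag], so that [Lag] dominates the derivative of [Kal M (u x)] by Young's inequality, with
    equality along the soliton of height [M]; scaling to height [1] produces [Hk]. *)
Definition Kal (M t : R) : R := M `^ (p / 2) * M * Hk (`|t| / M).

Lemma Lag_ge0 M u g x : `|u x| <= M -> 0 <= Lag M u g x.
Proof.
move=> uM; apply: addr_ge0; first by rewrite mulr_ge0 ?sqr_ge0// invr_ge0.
by rewrite mulr_ge0 ?invr_ge0 ?(ltW p_gt0)// subr_ge0 powR_le_sqr// ltW.
Qed.

Lemma Lag_young (M u z : R) : 0 < M -> `|u| <= M ->
  M `^ (p / 2) * (gk (u / M) * `|z|) <=
  2^-1 * z ^+ 2 + p^-1 * (M `^ (p - 2) * u ^+ 2 - `|u| `^ p).
Proof.
move=> M0 uM; set w := u / M; set s := M `^ (p / 2).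
have w1 : `|w| <= 1.
  by rewrite normrM normfV [`|M|]gtr0_norm// ler_pdivrMr// mul1r.
have s2 : s ^+ 2 = M `^ (p - 2) * M ^+ 2.
  rewrite -powR_mulrn ?powR_ge0// -powRrM -[in RHS]powR_mulrn ?ltW//.
  by rewrite -powRD ?(gt_eqF M0) ?implybT// subrK mulfVK// pnatr_eq0.
have uw : `|u| = M * `|w|.
  by rewrite normrM normfV [`|M|]gtr0_norm// mulrCA divff ?gt_eqF// mulr1.
have up : `|u| `^ p = M `^ (p - 2) * M ^+ 2 * (w ^+ 2 * `|w| `^ (p - 2)).
  have pE (y : R) : 0 <= y -> y `^ p = y `^ (p - 2) * y ^+ 2.
    move=> y0; rewrite -[in y ^+ 2]powR_mulrn// -powRD ?subrK//.
    by rewrite (gt_eqF p_gt0).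
  rewrite uw pE ?mulr_ge0 ?(ltW M0)// powRM ?(ltW M0)// exprMn real_normK ?num_real//.
  ring.
have u2 : u ^+ 2 = M ^+ 2 * w ^+ 2 by rewrite -exprMn /w mulrCA divff ?gt_eqF// mulr1.
have g2 := gk_sqr w1.
have -> : p^-1 * (M `^ (p - 2) * u ^+ 2 - `|u| `^ p) = 2^-1 * (s * gk w) ^+ 2.
  by rewrite up u2 [(s * gk w) ^+ 2]exprMn s2 g2; field; rewrite gt_eqF.
have := sqr_ge0 (`|z| - s * gk w); rewrite -[z ^+ 2]real_normK ?num_real//; nra.
Qed.

Lemma igr_powp (I : set MR) u (M : R) : measurable I -> sq I u -> (forall x, I x -> `|u x| <= M) ->
  igr I (fun x => `|u x| `^ p).
Proof.
move=> mI [mu ui] uM.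
apply: (@igr_le _ _ (fun x => `|u x| `^ p) (fun x => M `^ (p - 2) * u x ^+ 2)) => //.
- apply: (@measurableT_comp _ _ _ _ _ _ (fun t : R => `|t| `^ p)) => //.
  by apply: continuous_measurable_fun; exact: continuous_powR_norm.
- exact: igrZ.
- by move=> x Ix; rewrite ger0_norm ?powR_ge0// powR_le_sqr// ?uM// ltW.
Qed.

Lemma igr_Lag (I : set MR) u g (M : R) : measurable I -> sq I u -> sq I g ->
  (forall x, I x -> `|u x| <= M) -> igr I (Lag M u g).
Proof.
move=> mI su sg uM; have pi := igr_powp mI su uM.
case: su sg => [_ su] [_ sg]; apply: igrD => //; first exact: igrZ.
by apply: igrZ => //; apply: igrB => //; exact: igrZ.
Qed.

Lemma itg_Lag (I : set MR) u g (M : R) : measurable I -> sq I u -> sq I g ->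
  (forall x, I x -> `|u x| <= M) ->
  itg I (Lag M u g) = 2^-1 * itg I (fun x => g x ^+ 2) +
    p^-1 * (M `^ (p - 2) * itg I (fun x => u x ^+ 2) - itg I (fun x => `|u x| `^ p)).
Proof.
move=> mI su sg uM; have pi := igr_powp mI su uM.
case: su sg => [_ su] [_ sg].
rewrite intD//; [|exact: igrZ|by apply: igrZ => //; apply: igrB => //; exact: igrZ].
rewrite !intZ//; last by apply: igrB => //; exact: igrZ.
by rewrite intB// ?intZ//; exact: igrZ.
Qed.

(** The chain rule is applied to [Hk (u / M)], which is differentiable where [|u|] is not; the
    absolute value in [Kal] returns through the oddness of [Hk] and the reverse triangle
    inequality. *)
Lemma calib (a b M : R) u g : a <= b -> acf a b u g -> sq (sgm a b) g -> 0 < M ->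
  (forall x : R, a <= x <= b -> `|u x| <= M) ->
  `|Kal M (u b) - Kal M (u a)| <= itg (sgm a b) (Lag M u g).
Proof.
move=> ab ac sg M0 uM.
have su : sq (sgm a b) u.
  have cu := acf_cont ab ac; split; first exact: cont_on_meas.
  by apply: cont_on_igr; apply: (cont_on_comp (G := fun x => x ^+ 2)) => //; exact: exprn_continuous.
have acw := acf_lin M^-1 0 ac ac.
have {}acw : acf a b (fun x => u x / M) (fun x => g x / M).
  by apply: acf_eq acw ab _ _ => x _; rewrite mul0r addr0 mulrC.
have acH := acf_chain ab acw is_derive_Hk gk_cont.
have hd := acf_diff acH (lexx a) ab (lexx b).
have s0 : 0 <= M `^ (p / 2) by exact: powR_ge0.
have KE t : Kal M t = M `^ (p / 2) * M * `|Hk (t / M)|.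
  by rewrite /Kal Hk_abs normrM normfV [`|M|]gtr0_norm.
rewrite !KE -mulrBr normrM ger0_norm ?mulr_ge0 ?(ltW M0)//.
apply: (@le_trans _ _ (M `^ (p / 2) * M * `|Hk (u b / M) - Hk (u a / M)|)).
  by rewrite ler_wpM2l ?mulr_ge0 ?(ltW M0)// ler_dist_dist.
move: hd => /= ->.
have hi := acf_igr acH.
apply: (@le_trans _ _ (M `^ (p / 2) * M * itg (sgm a b) (fun x => `|gk (u x / M) * (g x / M)|))).
  by rewrite ler_wpM2l ?mulr_ge0 ?(ltW M0)// int_abs.
have hin := igr_norm (msgm a b) hi.
rewrite -intZ//; apply: int_le => //; [exact: igrZ|exact: igr_Lag|].
move=> x xab; have := Lag_young (g x) M0 (uM x xab).
move=> h; apply: le_trans h; rewrite normrM [`|g x / M|]normrM normfV [`|M|]gtr0_norm//.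
rewrite ger0_norm ?gk_ge0// le_eqVlt; apply/orP; left; apply/eqP.
by field; rewrite gt_eqF.
Qed.

Lemma Kal_ge0 M t : 0 <= M -> 0 <= Kal M t.
Proof. by move=> M0; rewrite !mulr_ge0 ?powR_ge0// Hk_ge0// divr_ge0. Qed.

Lemma Kal_le_sqr M t : 0 < M -> Kal M t <= M `^ (p / 2) / M * t ^+ 2.
Proof.
move=> M0; rewrite /Kal.
have h : Hk (`|t| / M) <= (`|t| / M) ^+ 2 by rewrite Hk_le_sqr// divr_ge0// ltW.
apply: (@le_trans _ _ (M `^ (p / 2) * M * (`|t| / M) ^+ 2)).
  by rewrite ler_wpM2l// mulr_ge0 ?powR_ge0// ltW.
rewrite expr_div_n real_normK ?num_real// le_eqVlt; apply/orP; left; apply/eqP.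
by field; rewrite gt_eqF.
Qed.

Lemma Kal_max M : 0 < M -> Kal M M = M `^ (p / 2) * M * Hk 1.
Proof. by move=> M0; rewrite /Kal gtr0_norm// divff// gt_eqF. Qed.

Lemma Kal_lip M s t : 0 < M -> `|s| <= `|t| -> Kal M t - Kal M s <= M `^ (p / 2) * (`|t| - `|s|).
Proof.
move=> M0 st; rewrite /Kal -mulrBr -mulrA ler_wpM2l ?powR_ge0//.
have h : `|s| / M <= `|t| / M by rewrite ler_pM2r// invr_gt0.
have := Hk_lip h; rewrite -mulrBl ler_pdivlMr//; by rewrite mulrC.
Qed.

End calibration.

(** * Calibration along a halfline *)

Section graph.
Context {R : realType}.
Local Notation MR := (measurableTypeR R).
Local Notation leb := (@lebesgue_measure R).

Context (p : R) (p2 : 2 < p).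

Lemma regroup (a b c : R) : 2 * a + b <= b - c + (2 * a - c + 2 * c).
Proof. lra. Qed.

(** Stands in for decay at infinity: one far point with a small value is enough to cut a function or
    to end a calibration. The segment is so long that [u^2 >= e] on all of it would give more than
    the whole mass. *)
Lemma ray_small (u : R -> R) (a e : R) : igr (ray a) (fun x => u x ^+ 2) -> 0 < e ->
  exists2 x : R, a <= x & u x ^+ 2 < e.
Proof.
move=> ui e0; set X := itg (ray a) (fun x => u x ^+ 2).
have X0 : 0 <= X by apply: int_ge0 => ? _; exact: sqr_ge0.
pose b := a + X / e + 1.
have ab : a <= b by rewrite /b -addrA lerDl addr_ge0// divr_ge0// ltW.
have sub : sgm a b `<=` ray a by move=> x /andP[].
have ui' : igr (sgm a b) (fun x => u x ^+ 2) by exact: igrS ui.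
have le := itg_sub (mray a) (msgm a b) sub ui (fun x _ => sqr_ge0 (u x)).
have : itg (sgm a b) (fun x => u x ^+ 2) < e * (b - a).
  apply: le_lt_trans le _; rewrite -/X.
  have -> : e * (b - a) = X + e by rewrite /b; field; rewrite gt_eqF.
  by rewrite ltrDl.
by move=> /(itg_lt_exists ab ui')[x /andP[ax _] h]; exists x.
Qed.

Section ray.
Variables (u g : R -> R) (a M : R).
Hypotheses (a0 : 0 <= a) (hu : H1 (ray 0) u g) (M0 : 0 < M).
Hypothesis uM : forall x : R, a <= x -> `|u x| <= M.

Let ra : ray a `<=` ray 0. Proof. by move=> x; apply: le_trans. Qed.
Let su : sq (ray a) u. Proof. exact: sqS (H1_sq edge_ray hu). Qed.
Let sg : sq (ray a) g. Proof. exact: sqS (H1_dsq hu). Qed.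
Let iL : igr (ray a) (Lag p M u g). Proof. exact: igr_Lag. Qed.
Let ss (x y : R) : a <= x -> sgm x y `<=` ray a.
Proof. by move=> ax t /andP[xt _]; exact: le_trans ax xt. Qed.

Lemma seg_calib (x y : R) : a <= x -> x <= y ->
  `|Kal p M (u y) - Kal p M (u x)| <= itg (sgm x y) (Lag p M u g).
Proof.
move=> ax xy; have x0 : 0 <= x by exact: le_trans ax.
have y0 : 0 <= y by exact: le_trans xy.
apply: calib => //; first exact: (H1_acf edge_ray hu x0 xy y0).
- by apply: sqS sg => //; exact: ss.
- by move=> t /andP[xt _]; apply: uM; exact: le_trans xt.
Qed.

(** The function goes from [u a] to [u x] and then, since it is square integrable, to almost [0]:
    the value [Kal] at [u x] is paid once on each side. *)
Lemma ray_calib2 (x : R) : a <= x ->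
  2 * Kal p M (u x) - Kal p M (u a) <= itg (ray a) (Lag p M u g).
Proof.
move=> ax; apply/ler_addgt0Pl => e e0.
set C := M `^ (p / 2) / M.
have C0 : 0 <= C by rewrite divr_ge0 ?powR_ge0// ltW.
have rx : ray x `<=` ray a by move=> t; exact: le_trans ax.
have ui : igr (ray x) (fun x => u x ^+ 2) by case: su => _; exact: igrS.
have [y xy uy] := ray_small ui (divr_gt0 e0 (ltr_wpDl C0 ltr01)).
have ay : a <= y by exact: le_trans xy.
have k1 := seg_calib (lexx a) ax; have k2 := seg_calib ax xy.
have ky := Kal_le_sqr p2 (u y) M0; rewrite -/C in ky.
have ky' : Kal p M (u y) <= e.
  apply: le_trans ky _; move: uy; rewrite ltr_pdivlMr ?ltr_wpDl//.
  have := sqr_ge0 (u y); nra.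
have iLs (s t : R) : a <= s -> igr (sgm s t) (Lag p M u g).
  by move=> as_; apply: igrS iL => //; exact: ss.
have sp : itg (sgm a y) (Lag p M u g) = itg (sgm a x) (Lag p M u g) + itg (sgm x y) (Lag p M u g).
  by apply: int_split => //; exact: iLs.
have le : itg (sgm a y) (Lag p M u g) <= itg (ray a) (Lag p M u g).
  by apply: itg_sub => //; [exact: ss|move=> t at_; apply: Lag_ge0 => //; exact: uM].
by move: k1 k2; rewrite !ler_norml => /andP[? ?] /andP[? ?]; lra.
Qed.

End ray.

(** * The star graph *)

(* Edges are indexed by ['I_4]; [tip] is the bounded edge, the others are halflines. *)
Definition tip : 'I_4 := ord_max.
Definition dom (l : R) (i : 'I_4) : set MR := if i == tip then sgm 0 l else ray 0.
Definition inH (l : R) (U G : 'I_4 -> R -> R) : Prop :=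
  (forall i, H1 (dom l i) (U i) (G i)) /\ (forall i, U i 0 = U tip 0).
Definition sqn (l : R) (U : 'I_4 -> R -> R) : R :=
  \sum_i itg (dom l i) (fun x => U i x ^+ 2).
Definition pn (l : R) (U : 'I_4 -> R -> R) : R :=
  \sum_i itg (dom l i) (fun x => `|U i x| `^ p).
Definition ener (l : R) (U G : 'I_4 -> R -> R) : R := 2^-1 * sqn l G - p^-1 * pn l U.
Definition bnd (l : R) (U : 'I_4 -> R -> R) (M : R) : Prop :=
  forall i x, dom l i x -> `|U i x| <= M.

Lemma edge_dom (l : R) i : 0 <= l -> is_edge (dom l i).
Proof. by rewrite /dom => l0; case: ifP => _; [exact: edge_sgm|exact: edge_ray]. Qed.

Lemma mdom (l : R) i : measurable (dom l i).
Proof. by rewrite /dom; case: ifP. Qed.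
Hint Resolve mdom : core.

Lemma dom_tip (l : R) : dom l tip = sgm 0 l.
Proof. by rewrite /dom eqxx. Qed.

Lemma dom_ray (l : R) i : i != tip -> dom l i = ray 0.
Proof. by rewrite /dom => /negPf ->. Qed.

Lemma sqn_ge0 l U : 0 <= sqn l U.
Proof. by apply: sumr_ge0 => i _; apply: int_ge0 => x _; exact: sqr_ge0. Qed.

Lemma pn_ge0 l U : 0 <= pn l U.
Proof. by apply: sumr_ge0 => i _; apply: int_ge0 => x _; exact: powR_ge0. Qed.

Section function.
Variables (l : R) (U G : 'I_4 -> R -> R).
Hypotheses (l0 : 0 <= l) (hU : inH l U G).

Let ed i : is_edge (dom l i). Proof. exact: edge_dom. Qed.
Let su i : sq (dom l i) (U i). Proof. exact: H1_sq (ed i) (hU.1 i). Qed.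
Let sg i : sq (dom l i) (G i). Proof. exact: H1_dsq (hU.1 i). Qed.

Lemma inH_bounded : exists2 M : R, 0 < M & bnd l U M.
Proof.
have /choice[m hm] : forall i, exists m : R, 0 <= m /\ forall x, dom l i x -> `|U i x| <= m.
  by move=> i; have [m m0 h] := H1_bounded (ed i) (hU.1 i); exists m.
exists (1 + \sum_i m i); first by rewrite ltr_pwDl// sumr_ge0// => i _; case: (hm i).
move=> i x dx; have [mi0 hi] := hm i; apply: le_trans (hi x dx) _.
rewrite (bigD1 i)//= addrCA lerDl addr_ge0// sumr_ge0// => j _; by case: (hm j).
Qed.

Lemma pn_le (M : R) : bnd l U M -> pn l U <= M `^ (p - 2) * sqn l U.
Proof.
move=> hM; rewrite /pn /sqn mulr_sumr; apply: ler_sum => i _.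
have [_ ui] := su i.
rewrite -intZ//; apply: int_le => //; [|exact: igrZ|].
  by apply: (@igr_powp _ p p2 _ _ M) => // x dx; exact: hM.
by move=> x dx; rewrite powR_le_sqr ?(ltW p2)//; exact: hM.
Qed.

Lemma ener_act (M : R) : bnd l U M ->
  ener l U G + p^-1 * (M `^ (p - 2) * sqn l U) = \sum_i itg (dom l i) (Lag p M (U i) (G i)).
Proof.
move=> hM; transitivity (\sum_i (2^-1 * itg (dom l i) (fun x => G i x ^+ 2) +
    p^-1 * (M `^ (p - 2) * itg (dom l i) (fun x => U i x ^+ 2)
      - itg (dom l i) (fun x => `|U i x| `^ p)))).
  rewrite big_split /= -!mulr_sumr sumrB -mulr_sumr /ener /pn /sqn; ring.
by apply: eq_bigr => i _; rewrite itg_Lag// => x dx; exact: hM.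
Qed.

Lemma sum_tip (F : 'I_4 -> R) : \sum_i F i = F tip + \sum_(i | i != tip) F i.
Proof. by rewrite (bigD1 tip). Qed.

Lemma sum_ray_cst (k : R) : \sum_(i : 'I_4 | i != tip) k = 3 * k.
Proof.
rewrite sumr_const (_ : #|_| = 3%N) ?mulr_natl//.
by rewrite cardC1 card_ord.
Qed.

(** With [k] the value of [Kal] at the vertex, the halfline [i] costs at least [2 Kal (U i x) - k],
    each of the other two at least [k], and the tip at least [Kal (U tip y) - k]; the vertex terms
    cancel. *)
Lemma lower_both (M x y : R) i : 0 < M -> bnd l U M -> i != tip -> 0 <= x -> 0 <= y <= l ->
  2 * Kal p M (U i x) + Kal p M (U tip y) <= ener l U G + p^-1 * (M `^ (p - 2) * sqn l U).
Proof.
move=> M0 hM it x0 /andP[y0 yl]; rewrite ener_act// sum_tip (bigD1 i)//=.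
have hr j : j != tip -> forall z : R, 0 <= z ->
    2 * Kal p M (U j z) - Kal p M (U tip 0) <= itg (dom l j) (Lag p M (U j) (G j)).
  move=> jt z z0; have := hU.1 j; have hMj := hM j; rewrite dom_ray// in hMj *; move=> hj.
  by rewrite -(hU.2 j); exact: (ray_calib2 (lexx 0) hj M0 hMj z0).
have h1 : 2 * Kal p M (U tip 0) <= \sum_(j | (j != tip) && (j != i)) itg (dom l j) (Lag p M (U j) (G j)).
  have := sum_ray_cst (Kal p M (U tip 0)); rewrite (bigD1 i)//= => e1.
  have -> : 2 * Kal p M (U tip 0) = \sum_(j < 4 | (j != tip) && (j != i)) Kal p M (U tip 0).
    by move: e1; lra.
  apply: ler_sum => j /andP[jt _]; have := hr j jt 0 (lexx 0); rewrite (hU.2 j); lra.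
have h2 : Kal p M (U tip y) - Kal p M (U tip 0) <= itg (dom l tip) (Lag p M (U tip) (G tip)).
  have yd : dom l tip y by rewrite dom_tip /sgm /= y0.
  have sub := edge_sub (ed tip) yd (lexx 0).
  have iL : igr (dom l tip) (Lag p M (U tip) (G tip)) by apply: igr_Lag => // z; exact: hM.
  apply: le_trans (itg_sub (mdom l tip) (msgm 0 y) sub iL _); last first.
    by move=> z dz; apply: Lag_ge0 => //; exact: hM.
  apply: le_trans (ler_norm _) _; apply: (calib p2 y0) => //.
  - exact: H1_acf (ed tip) (hU.1 tip) (lexx 0) y0 yd.
  - exact: sqS (sg tip).
  - by move=> z zy; apply: (hM tip); exact: sub.
have h3 := hr i it x x0.
apply: (@le_trans _ _ (Kal p M (U tip y) - Kal p M (U tip 0) +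
  ((2 * Kal p M (U i x) - Kal p M (U tip 0)) + 2 * Kal p M (U tip 0)))).
  exact: regroup.
exact: (lerD h2 (lerD h3 h1)).
Qed.

Lemma lower_tip (M x : R) : 0 < M -> bnd l U M -> 0 <= x <= l ->
  Kal p M (U tip x) + 2 * Kal p M (U tip 0) <= ener l U G + p^-1 * (M `^ (p - 2) * sqn l U).
Proof.
move=> M0 hM xl; have := lower_both M0 hM (isT : ord0 != tip) (lexx 0) xl.
by rewrite (hU.2 ord0) addrC.
Qed.

End function.

End graph.
#[global] Hint Resolve mdom : core.

Section levels.
Context {R : realType}.
Local Notation MR := (measurableTypeR R).
Local Notation leb := (@lebesgue_measure R).

Context (p : R) (p2 : 2 < p) (p6 : p < 6).
Local Notation c := (Hk p 1).

(** * Energy levels *)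

Definition Phi (k mu M : R) : R := k * c * (M `^ (p / 2) * M) - p^-1 * (M `^ (p - 2) * mu).

(* The critical point of [Phi k mu]; for [k = 2] (resp. [k = 1]) it is the height of
   the soliton on the line (resp. halfline) of mass [mu]. *)
Definition Mst (k mu : R) : R :=
  (2 * mu * (p - 2) / (k * c * p * (p + 2))) `^ (2 / (6 - p)).

(** For [k = 2] this is the soliton energy, called [e] in the overview; for [k = 1] it is the energy
    of a half soliton of mass [mu]. *)
Definition lev (k mu : R) : R := Phi k mu (Mst k mu).

Let p_gt0 : 0 < p. Proof. by apply: lt_trans p2. Qed.
Let pm2 : 0 < p - 2. Proof. by rewrite subr_gt0. Qed.
Let sm6 : 0 < 6 - p. Proof. by rewrite subr_gt0. Qed.
Let c0 : 0 < c. Proof. exact: Hk1_gt0. Qed.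

Lemma powR_tangent (y th : R) : 0 <= y -> 0 < th < 1 -> y `^ th <= th * y + (1 - th).
Proof.
move=> y0 /andP[t0 t1].
have := @conjugate_powR R (y `^ th) 1 th^-1 (1 - th)^-1; rewrite powR_ge0 ler01.
rewrite !invr_gt0 t0 subr_gt0 t1 !invrK addrCA subrr addr0 => /(_ isT isT isT isT erefl).
rewrite mulr1 powR1 -powRrM mulfV ?gt_eqF// powRr1// mul1r; lra.
Qed.

Lemma Mst_gt0 (k mu : R) : 0 < k -> 0 < mu -> 0 < Mst k mu.
Proof.
by move=> k0 m0; rewrite powR_gt0// divr_gt0// ?mulr_gt0// addr_gt0.
Qed.

Lemma powRD_pos (M a b : R) : 0 < M -> M `^ (a + b) = M `^ a * M `^ b.
Proof. by move=> M0; rewrite powRD// (gt_eqF M0) implybT. Qed.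

Lemma alphaE (M : R) : 0 < M -> M `^ (p / 2) * M = M `^ (p / 2 + 1).
Proof. by move=> M0; rewrite powRD_pos// powRr1// ltW. Qed.

(** The equation [Phi' = 0] multiplied by [2 p M]. *)
Lemma Mst_crit (k mu : R) : 0 < k -> 0 < mu -> let M := Mst k mu in
  k * c * (M `^ (p / 2) * M) * (p + 2) * p = 2 * (p - 2) * (M `^ (p - 2) * mu).
Proof.
move=> k0 m0 M; have M0 : 0 < M by exact: Mst_gt0.
have h : M `^ ((6 - p) / 2) = 2 * mu * (p - 2) / (k * c * p * (p + 2)).
  rewrite /M /Mst -powRrM (_ : 2 / (6 - p) * _ = 1) ?powRr1//.
    by rewrite ltW// divr_gt0// ?mulr_gt0// addr_gt0.
  by field; rewrite gt_eqF.
have e : M `^ (p / 2 + 1) = M `^ (p - 2) * M `^ ((6 - p) / 2).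
  by rewrite -powRD_pos//; congr (_ `^ _); field.
rewrite alphaE// e h; field.
by rewrite !gt_eqF// addr_gt0.
Qed.

(** In the variable [X = (M / N)^(p/2+1)], with [N] the critical point, the term [(M / N)^(p-2)] is
    [X^th] with [th < 1] since [p < 6]. Concavity puts it below its tangent at [X = 1], and
    criticality of [N] makes the linear terms cancel. *)
Lemma lev_le (k mu M : R) : 0 < k -> 0 < mu -> 0 < M -> lev k mu <= Phi k mu M.
Proof.
move=> k0 m0 M0; rewrite /lev; have := Mst_crit k0 m0; have := Mst_gt0 k0 m0.
set N := Mst k mu => N0 /= crit; rewrite /Phi.
set t := M / N; have t0 : 0 < t by rewrite divr_gt0.
have MN : M = N * t by rewrite /t mulrCA divff ?gt_eqF// mulr1.
have al0 : 0 < p / 2 + 1 by rewrite addr_gt0// divr_gt0.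
set th := (p - 2) / (p / 2 + 1).
have th01 : 0 < th < 1.
  rewrite /th divr_gt0//= ltr_pdivrMr// mul1r; move: p6; lra.
have := powR_tangent (powR_ge0 t (p / 2 + 1)) th01.
rewrite -powRrM (_ : (p / 2 + 1) * th = p - 2); last by rewrite /th mulrCA divff ?gt_eqF// mulr1.
have -> : M `^ (p / 2) * M = (N `^ (p / 2) * N) * t `^ (p / 2 + 1).
  by rewrite !alphaE// MN powRM// ltW.
have -> : M `^ (p - 2) = N `^ (p - 2) * t `^ (p - 2) by rewrite MN powRM// ltW.
set X := t `^ (p / 2 + 1); set Y := t `^ (p - 2) => h.
set a := N `^ (p / 2) * N in crit *; set b := N `^ (p - 2) in crit *.
have a0 : 0 < a by apply: mulr_gt0 => //; exact: powR_gt0.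
have bE : p^-1 * (b * mu) * th = k * c * a.
  apply: (mulIf (x := 2 * (p + 2) * p)); first by rewrite gt_eqF// !mulr_gt0// addr_gt0.
  transitivity (2 * (k * c * a * (p + 2) * p)); last by ring.
  rewrite crit /th; field; rewrite !gt_eqF//; lra.
have b0 : 0 < p^-1 * (b * mu).
  by rewrite mulr_gt0 ?invr_gt0//; apply: mulr_gt0 => //; exact: powR_gt0.
have -> : p^-1 * (b * Y * mu) = p^-1 * (b * mu) * Y by ring.
rewrite -[k * c * (a * X)]/(k * c * (a * X)) [k * c * (a * X)]mulrA -bE.
move: b0; set B := p^-1 * (b * mu) => b0; nra.
Qed.

Lemma cMM_gt0 (M : R) : 0 < M -> 0 < c * (M `^ (p / 2) * M).
Proof. by move=> M0; apply: mulr_gt0 => //; apply: mulr_gt0 => //; exact: powR_gt0. Qed.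

Lemma lev_lt0 (k mu : R) : 0 < k -> 0 < mu -> lev k mu < 0.
Proof.
move=> k0 m0; rewrite /lev /Phi; have := Mst_crit k0 m0; have := Mst_gt0 k0 m0.
set N := Mst k mu => N0 /=; set a := N `^ (p / 2) * N; set b := N `^ (p - 2) * mu => crit.
have a0 : 0 < k * c * a by rewrite -mulrA mulr_gt0// cMM_gt0.
have b0 : 0 < b by apply: mulr_gt0 => //; exact: powR_gt0.
rewrite subr_lt0 [p^-1 * b]mulrC ltr_pdivlMr//.
have : k * c * a * p * (p + 2) = 2 * (p - 2) * b by rewrite -crit; ring.
have pp : 0 < p + 2 by rewrite addr_gt0.
move: a0; set A := k * c * a => a0 e.
have : A * p * (p + 2) < b * (p + 2) by rewrite e; have := mulr_gt0 b0 sm6; lra.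
by rewrite ltr_pM2r.
Qed.

Lemma lev12 (mu : R) : 0 < mu -> lev 1 mu < lev 2 mu.
Proof.
move=> m0; have M0 := Mst_gt0 (k := 2) (ltr0n _ 2) m0.
apply: le_lt_trans (lev_le ltr01 m0 M0) _.
by rewrite /lev /Phi ltrD2r -!mulrA ltr_pM2r ?ltr1n// cMM_gt0.
Qed.

Section function.
Variables (l mu : R) (U G : 'I_4 -> R -> R).
Hypotheses (l0 : 0 <= l) (mu0 : 0 < mu) (hU : inH l U G) (Umu : sqn l U = mu).

(** The supremum of [|U|] over the graph, recorded through approximation: on the halflines this
    spares an argument on decay, and [Kal] is Lipschitz. *)
Definition maxval (M : R) : Prop := [/\ 0 < M, bnd l U M &
  forall e : R, 0 < e -> exists i x, dom l i x /\ M - e < `|U i x|].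

Lemma maxval_ex : exists M, maxval M.
Proof.
have [M1 M10 hM1] := inH_bounded l0 hU.
pose S := [set y : R | exists i x, dom l i x /\ y = `|U i x|].
have d0 i : dom l i 0 by have [] := edge_dom i l0.
have S0 : S `|U tip 0| by exists tip, 0.
have ubS : ubound S M1 by move=> y [i [x [dx ->]]]; exact: hM1.
have hS : has_sup S by split; [by exists `|U tip 0| | by exists M1].
have bS : bnd l U (sup S).
  by move=> i x dx; apply: ub_le_sup; [exists M1|exists i, x].
exists (sup S); split => //.
  rewrite ltNge; apply/negP => s0.
  have z i x : dom l i x -> U i x = 0.
    move=> dx; apply/eqP; rewrite -normr_le0; exact: le_trans (bS i x dx) s0.
  move: mu0; rewrite -Umu /sqn big1 ?ltxx// => i _.
  rewrite (int_eq (g := fun=> 0)); last by move=> x dx; rewrite (z i x dx) expr0n.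
  have -> : (fun=> (0 : R)) = (fun x => 0 * (fun=> 0) x) :> (R -> R) by apply/funext => x; rewrite mul0r.
  by rewrite intZ ?mul0r//; exact: integrable0.
move=> e e0; have [y [i [x [dx ->]]] h] := sup_adherent e0 hS.
by exists i, x.
Qed.

(** The tip is compact: either it carries the supremum, or its own maximum is strictly smaller and
    every value close enough to [M] is taken on a halfline. *)
Lemma maxval_cases M : maxval M ->
  (exists2 x : R, 0 <= x <= l & `|U tip x| = M) \/
  (forall e : R, 0 < e -> exists i x, [/\ i != tip, 0 <= x & M - e < `|U i x|]).
Proof.
move=> [M0 bM hM].
have ct : cont_on (sgm 0 l) (U tip).
  by have := H1_cont (edge_dom tip l0) (hU.1 tip); rewrite dom_tip.
have [x xl hx] := cont_on_max l0 (cont_on_norm ct).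
have : `|U tip x| <= M by apply: bM; rewrite dom_tip.
rewrite le_eqVlt => /orP[/eqP xM|xM]; [by left; exists x|right => e e0].
have e'0 : 0 < Num.min e (M - `|U tip x|) by rewrite lt_min e0 subr_gt0.
have [i [y [dy]]] := hM _ e'0; rewrite ltrBlDr -ltrBlDl lt_min => /andP[h1 h2].
have [it|it] := eqVneq i tip.
  move: dy h2; rewrite it dom_tip => dy; have := hx y dy; lra.
move: dy; rewrite dom_ray// => dy; exists i, y; split => //; lra.
Qed.

Lemma ener_tip M x : maxval M -> 0 <= x <= l -> `|U tip x| = M ->
  c * (M `^ (p / 2) * M) + 2 * Kal p M (U tip 0) - p^-1 * (M `^ (p - 2) * mu) <= ener p l U G.
Proof.
move=> [M0 bM hM] xl xM; have := lower_tip p2 l0 hU M0 bM xl; rewrite Umu.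
have -> : Kal p M (U tip x) = c * (M `^ (p / 2) * M).
  by rewrite /Kal xM divff ?gt_eqF// mulrC.
lra.
Qed.

Lemma ener_ray M : maxval M ->
  (forall e : R, 0 < e -> exists i x, [/\ i != tip, 0 <= x & M - e < `|U i x|]) ->
  Phi 2 mu M <= ener p l U G.
Proof.
move=> [M0 bM hM] hr; apply/ler_addgt0Pl => e e0.
set s := M `^ (p / 2); have s0 : 0 < s by exact: powR_gt0.
(* The deficit [M - |U i x|] counts twice, with the Lipschitz constant [s] of [Kal], whence the
   tolerance [e / (2 s)]. *)
have e10 : 0 < Num.min M (e / (2 * s)) by rewrite lt_min M0 divr_gt0// mulr_gt0.
have [i [x [it x0 h]]] := hr _ e10.
have z0 : 0 <= (0 : R) <= l by rewrite lexx.
have := lower_both p2 l0 hU M0 bM it x0 z0; rewrite Umu => lw.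
have nM : `|M| = M by rewrite gtr0_norm.
have uM : `|U i x| <= `|M| by rewrite nM; apply: bM; rewrite dom_ray.
have := Kal_lip p2 M0 uM; rewrite nM -/s => kl.
have k0 := Kal_ge0 p2 (U tip 0) (ltW M0).
have KM := Kal_max p M0; rewrite -/s in KM.
have : s * (M - `|U i x|) <= e / 2.
  have : M - `|U i x| <= e / (2 * s) by move: h; rewrite ltrBlDr -ltrBlDl lt_min => /andP[_ /ltW].
  rewrite -(ler_pM2l s0) (_ : s * (e / (2 * s)) = e / 2)//; field; by rewrite gt_eqF.
rewrite /Phi -/s; move: KM kl; set K := Kal p M M; set K' := Kal p M (U i x).
rewrite -/K' in lw; set E := ener p l U G in lw *; set F := p^-1 * _ in lw *; move=> KM kl h4.
have -> : 2 * c * (s * M) = 2 * K by rewrite KM; ring.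
lra.
Qed.

Lemma ener_Phi1 M : maxval M -> Phi 1 mu M <= ener p l U G.
Proof.
move=> hM; have M0 : 0 < M by case: hM.
have a0 : 0 <= c * (M `^ (p / 2) * M) by rewrite !mulr_ge0 ?powR_ge0// ltW.
case: (maxval_cases hM) => [[x xl xM]|hr].
  have := ener_tip hM xl xM; have := Kal_ge0 p2 (U tip 0) (ltW M0).
  rewrite /Phi mul1r; lra.
apply: le_trans (ener_ray hM hr); rewrite /Phi mul1r.
by rewrite lerD2r -[2 * c * _]mulrA -[leLHS]mul1r ler_wpM2r// ler1n.
Qed.

Lemma ener_lev2 M : maxval M -> ener p l U G < lev 2 mu ->
  exists2 x : R, 0 <= x <= l & `|U tip x| = M.
Proof.
move=> hM hE; case: (maxval_cases hM) => // hr.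
have M0 : 0 < M by case: hM.
by have := le_trans (lev_le (ltr0n _ 2) mu0 M0) (ener_ray hM hr); rewrite leNgt hE.
Qed.

(* An a priori bound playing the role of the Gagliardo-Nirenberg inequality. *)
Lemma maxval_upper M : maxval M -> ener p l U G < 0 ->
  M <= (mu / (p * c)) `^ (2 / (6 - p)).
Proof.
move=> hM E0; have M0 : 0 < M by case: hM.
have := le_lt_trans (ener_Phi1 hM) E0; rewrite /Phi mul1r subr_lt0 alphaE//.
have -> : M `^ (p / 2 + 1) = M `^ (p - 2) * M `^ ((6 - p) / 2).
  by rewrite -powRD_pos//; congr (_ `^ _); field.
have q0 : 0 < M `^ (p - 2) by exact: powR_gt0.
move=> h; have {}h : M `^ ((6 - p) / 2) <= mu / (p * c).
  rewrite ler_pdivlMr ?mulr_gt0//.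
  move: h; rewrite [_^-1 * _]mulrC ltr_pdivlMr// => h.
  have : M `^ (p - 2) * (M `^ ((6 - p) / 2) * (p * c)) < M `^ (p - 2) * mu.
    by apply: le_lt_trans h; rewrite le_eqVlt; apply/orP; left; apply/eqP; ring.
  by rewrite ltr_pM2l// => /ltW.
have -> : M = (M `^ ((6 - p) / 2)) `^ (2 / (6 - p)).
  rewrite -powRrM (_ : (6 - p) / 2 * _ = 1) ?powRr1 ?ltW//.
  by field; rewrite gt_eqF.
apply: ge0_ler_powR; rewrite ?nnegrE ?powR_ge0//; first by rewrite divr_ge0// ltW.
by rewrite divr_ge0// ltW// mulr_gt0.
Qed.

(** Since the kinetic term is nonnegative, [- p E] is at most the [L^p] term, itself at most
    [M^(p-2) mu]. A definitely negative energy thus prevents a sequence from flattening out. *)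
Lemma maxval_lower M : maxval M -> ener p l U G < 0 ->
  (- ener p l U G * p / mu) `^ ((p - 2)^-1) <= M.
Proof.
move=> [M0 bM _] E0.
have := pn_le p2 l0 hU bM; rewrite Umu => h.
have g0 := sqn_ge0 l G.
have {}h : - ener p l U G * p / mu <= M `^ (p - 2).
  rewrite ler_pdivrMr// /ener opprB mulrBl [p^-1 * _ * p]mulrAC mulVf ?gt_eqF// mul1r.
  by rewrite lerBlDr; apply: le_trans h _; rewrite lerDl !mulr_ge0// ?invr_ge0// ltW.
have -> : M = (M `^ (p - 2)) `^ (p - 2)^-1.
  by rewrite -powRrM mulfV ?gt_eqF// powRr1// ltW.
apply: ge0_ler_powR; rewrite ?nnegrE ?powR_ge0 ?invr_ge0 ?(ltW pm2)//.
by rewrite divr_ge0 ?mulr_ge0 ?oppr_ge0 ?ltW.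
Qed.

Lemma grad_upper M : bnd l U M -> ener p l U G < 0 ->
  sqn l G <= 2 / p * (M `^ (p - 2) * mu).
Proof.
move=> bM E0; have := pn_le p2 l0 hU bM; rewrite Umu => h.
have : 2^-1 * sqn l G <= p^-1 * (M `^ (p - 2) * mu).
  apply: le_trans (_ : p^-1 * pn p l U <= _); first by move: E0; rewrite /ener; lra.
  by rewrite ler_wpM2l// invr_ge0 ltW.
by rewrite [2 / p * _](_ : _ = 2 * (p^-1 * (M `^ (p - 2) * mu))); [lra|ring].
Qed.

End function.

(** Below the soliton level the maximum [M] sits on the tip, at a height between [Mn] and [Mx], and
    the Hölder bound brings the vertex value [m] close to [M]. But [Kal M + 2 Kal m], minus the mass
    term, is less than [Phi 2 mu M], so [Kal M] is less than [2 (Kal M - Kal m)], which is at most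
    [Q (M - |m|)]. *)
Lemma short_tip (mu : R) : 0 < mu -> exists2 l0 : R, 0 < l0 &
  forall (l : R) U G, 0 < l -> l <= l0 -> inH l U G -> sqn l U = mu ->
  lev 2 mu <= ener p l U G.
Proof.
move=> mu0; pose Mx := (mu / (p * c)) `^ (2 / (6 - p)).
pose Mn := (- lev 2 mu * p / mu) `^ ((p - 2)^-1).
have e0 := lev_lt0 (ltr0n _ 2) mu0.
have Mn0 : 0 < Mn by rewrite powR_gt0// divr_gt0// mulr_gt0// oppr_gt0.
have Mx0 : 0 < Mx by rewrite powR_gt0// divr_gt0// mulr_gt0.
pose gap := c * (Mn `^ (p / 2) * Mn).
have gap0 : 0 < gap by exact: cMM_gt0.
pose Q := 2 * Mx `^ (p / 2); have Q0 : 0 < Q by apply: mulr_gt0 => //; exact: powR_gt0.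
pose Am := 2 / p * (Mx `^ (p - 2) * mu).
have Am0 : 0 < Am.
  by apply: mulr_gt0; [rewrite divr_gt0|apply: mulr_gt0 => //; exact: powR_gt0].
(* Chosen so that [M - |m| <= sqrt (l * Am)] contradicts [gap < Q (M - |m|)]. *)
exists (gap ^+ 2 / (Q ^+ 2 * Am)); first by rewrite divr_gt0 ?exprn_gt0// mulr_gt0 ?exprn_gt0.
move=> l U G l0 ll0 hU Umu; rewrite leNgt; apply/negP => hE.
have E0 : ener p l U G < 0 by exact: lt_trans hE e0.
have [M hM] := maxval_ex (ltW l0) mu0 hU Umu.
have [x xl xM] := ener_lev2 (ltW l0) mu0 hU Umu hM hE.
have [M0 bM _] := hM.
have MMx : M <= Mx := maxval_upper (ltW l0) mu0 hU Umu hM E0.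
have MnM : Mn <= M.
  apply: le_trans (maxval_lower (ltW l0) mu0 hU Umu hM E0).
  apply: ge0_ler_powR; rewrite ?nnegrE ?invr_ge0 ?(ltW pm2)//.
  - by rewrite divr_ge0 ?mulr_ge0 ?oppr_ge0 ?ltW.
  - by rewrite divr_ge0 ?mulr_ge0 ?oppr_ge0 ?ltW.
  - by rewrite -!mulrA ler_wpM2r ?divr_ge0 ?(ltW p_gt0) ?(ltW mu0)// lerN2 ltW.
have hg := grad_upper (ltW l0) hU Umu bM E0.
have hg' : sqn l G <= Am.
  apply: le_trans hg _; rewrite ler_wpM2l ?divr_ge0 ?(ltW p_gt0)// ler_wpM2r ?(ltW mu0)//.
  by apply: ge0_ler_powR; rewrite ?nnegrE ?(ltW pm2) ?(ltW M0) ?(ltW Mx0).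
set m := U tip 0.
have mM : `|m| <= M by apply: bM; have [] := edge_dom tip (ltW l0).
have hold : (M - `|m|) ^+ 2 <= l * Am.
  have ed := edge_dom tip (ltW l0).
  have xd : dom l tip x by rewrite dom_tip.
  have d0 : dom l tip 0 by case: ed.
  have h1 := H1_holder ed (hU.1 tip) d0 xd.
  have h2 : (M - `|m|) ^+ 2 <= (U tip x - U tip 0) ^+ 2.
    rewrite -xM -[leRHS]real_normK ?num_real// ler_sqr ?nnegrE ?subr_ge0 ?xM//.
    by rewrite -xM; exact: lerB_dist.
  apply: le_trans h2 (le_trans h1 _).
  have a1 : itg (dom l tip) (fun x => G tip x ^+ 2) <= Am.
    apply: le_trans hg'; rewrite /sqn (bigD1 tip)//= lerDl sumr_ge0// => i _.
    by apply: int_ge0 => y _; exact: sqr_ge0.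
  have a2 : `|x - 0| <= l by move: xl => /andP[x0 xl]; rewrite subr0 ger0_norm.
  apply: ler_pM => //; apply: int_ge0 => y _; exact: sqr_ge0.
have tipE := ener_tip (ltW l0) hU Umu hM xl xM; rewrite -/m in tipE.
have nM : `|M| = M by rewrite gtr0_norm.
have kl : Kal p M M - Kal p M m <= M `^ (p / 2) * (M - `|m|).
  by have := @Kal_lip _ _ p2 M m M M0; rewrite nM; apply.
have KM : Kal p M M = c * (M `^ (p / 2) * M) by rewrite Kal_max// mulrC.
have Phi2 := lev_le (ltr0n _ 2) mu0 M0.
have sMx : M `^ (p / 2) <= Mx `^ (p / 2).
  by apply: ge0_ler_powR; rewrite ?nnegrE ?divr_ge0 ?(ltW p_gt0) ?(ltW M0) ?(ltW Mx0).
have gM : gap <= c * (M `^ (p / 2) * M).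
  rewrite ler_wpM2l ?(ltW c0)// ler_pM ?powR_ge0 ?(ltW Mn0)//.
  by apply: ge0_ler_powR; rewrite ?nnegrE ?divr_ge0 ?(ltW p_gt0) ?(ltW M0) ?(ltW Mn0).
have key : gap < Q * (M - `|m|).
  have d0 : 0 <= M - `|m| by rewrite subr_ge0.
  have : M `^ (p / 2) * (M - `|m|) <= Mx `^ (p / 2) * (M - `|m|) by rewrite ler_wpM2r.
  rewrite /Q; move: Phi2 tipE hE kl gM; rewrite /Phi KM.
  rewrite -[2 * c * _]mulrA -[2 * Mx `^ _ * _]mulrA.
  move: (M `^ (p / 2) * (M - `|m|)) (Mx `^ (p / 2) * (M - `|m|)) => y1 y2.
  move: (c * (M `^ (p / 2) * M)) (p^-1 * _) (ener p l U G) (Kal p M m) (lev 2 mu) => z1 z2 z3 z4 z5; lra.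
have : gap ^+ 2 < (Q * (M - `|m|)) ^+ 2.
  by rewrite ltr_sqr ?nnegrE ?(ltW gap0)// ltW// (lt_trans gap0).
rewrite [(Q * _) ^+ 2]exprMn ltNge => /negP; apply.
apply: (@le_trans _ _ (Q ^+ 2 * (l * Am))); first by rewrite ler_wpM2l ?sqr_ge0.
move: ll0; rewrite ler_pdivlMr; last by rewrite mulr_gt0 ?exprn_gt0.
by congr (_ <= _); ring.
Qed.

End levels.

Section completeness.
Context {R : realType}.
Local Notation MR := (measurableTypeR R).
Local Notation leb := (@lebesgue_measure R).

(** * Completeness of the space of square integrable functions *)

Lemma itg_fatou (I : set MR) (f : nat -> R -> R) (h : R -> R) (C : R) : measurable I ->
  (forall n, igr I (f n)) -> (forall n x, I x -> 0 <= f n x) ->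
  (forall n, itg I (f n) <= C) ->
  (forall x, I x -> (f n x @[n --> \oo] --> h x)) ->
  igr I h /\ itg I h <= C.
Proof.
move=> mI fi f0 fC fh.
have mh : measurable_fun I (h : MR -> MR).
  by apply: (@measurable_fun_cvg _ _ _ _ f) => // n; exact: igr_meas.
have h0 x : I x -> 0 <= h x.
  move=> Ix; rewrite -(cvg_lim _ (fh x Ix))//; apply: limr_ge.
    by apply/cvg_ex; exists (h x); exact: fh.
  by near=> n; exact: f0.
have F := @fatou _ _ _ leb _ mI (fun n x => (f n x)%:E)
  (fun n => measurable_int leb (fi n)) (fun n x Ix => f0 n x Ix).
have e1 : (\int[leb]_(x in I) (h x)%:E = \int[leb]_(x in I) limn_einf (fun n => (f n x)%:E))%E.
  apply: eq_integral => x; rewrite inE => Ix.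
  have /cvg_limn_einf_sup[-> _]// : (f n x)%:E @[n --> \oo] --> (h x)%:E.
  by apply: cvg_EFin; [exact: nearW|exact: fh].
have le : (\int[leb]_(x in I) (h x)%:E <= C%:E)%E.
  rewrite e1; apply: le_trans F _; rewrite limn_einf_lim; apply: lime_le.
    exact: is_cvg_einfs.
  near=> n; apply: (@le_trans _ _ (\int[leb]_(x in I) (f n x)%:E)%E).
    by apply: ereal_inf_lbound; exists n => //=.
  by rewrite -[leLHS]fineK ?lee_fin; [exact: fC|exact: (integrable_fin_num mI (fi n))].
have hi : igr I h.
  apply/integrableP; split; first exact/measurable_EFinP.
  have -> : (\int[leb]_(x in I) `|(h x)%:E| = \int[leb]_(x in I) (h x)%:E)%E.
    by apply: eq_integral => x; rewrite inE => Ix /=; rewrite ger0_norm// h0.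
  exact: le_lt_trans le (ltry _).
split => //; rewrite -lee_fin fineK//; exact: integrable_fin_num.
Unshelve. all: by end_near. Qed.

(** For a sequence that is Cauchy at rate [4^-k], the limit is obtained pointwise almost everywhere
    from an absolutely convergent telescoping series, and the rate passes to the limit by Fatou. *)
Lemma riesz_fischer (I : set MR) (g : nat -> R -> R) : measurable I ->
  (forall k, sq I (g k)) ->
  (forall k m, (k <= m)%N -> itg I (fun x => (g k x - g m x) ^+ 2) <= (4^-1) ^+ k) ->
  exists2 h : R -> R, sq I h & forall k, itg I (fun x => (g k x - h x) ^+ 2) <= (4^-1) ^+ k.
Proof.
move=> mI sg cg.
(* The weight is a compromise: the integrals of [d k] still decay like [2^-k], while
   [|z| <= 2^k z^2 + 2^-k] bounds the increments by summable terms wherever the sum of the [d k] is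
   finite. *)
pose d k x := 2 ^+ k * (g k x - g k.+1 x) ^+ 2.
have d0 k x : 0 <= d k x by rewrite mulr_ge0 ?sqr_ge0 ?exprn_ge0.
have sd k : igr I (fun x => (g k x - g k.+1 x) ^+ 2) by case: (sqB mI (sg k) (sg k.+1)).
have di k : igr I (d k) by exact: igrZ.
have dI k : itg I (d k) <= (2^-1) ^+ k.
  rewrite intZ//; have := cg k k.+1 (leqnSn k) => h.
  apply: (@le_trans _ _ (2 ^+ k * (4^-1) ^+ k)); first by rewrite ler_wpM2l// exprn_ge0.
  by rewrite -exprMn le_eqVlt (_ : 2 * 4^-1 = 2^-1 :> R) ?eqxx//; field.
pose S x := (\sum_(0 <= k <oo) (d k x)%:E)%E.
have mS : measurable_fun I S.
  have -> : S = (fun x => \sum_(k <oo | k \in xpredT) (d k x)%:E)%E.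
    by apply/funext => x; apply: eq_eseriesl => k; rewrite unfold_in.
  apply: (@ge0_emeasurable_sum _ MR R I (fun k x => (d k x)%:E) xpredT) => [k x _ _|k _].
    by rewrite lee_fin.
  exact: (measurable_int leb (di k)).
have S0 x : (0 <= S x)%E by apply: nneseries_ge0 => k _ _; rewrite lee_fin.
have iS : leb.-integrable I S.
  apply/integrableP; split => //.
  have -> : (\int[leb]_(x in I) `|S x| = \int[leb]_(x in I) S x)%E.
    by apply: eq_integral => x _; rewrite gee0_abs.
  rewrite integral_nneseries//; [|by move=> k; exact: (measurable_int leb (di k))|].
    have le2 : (\sum_(0 <= k <oo) \int[leb]_(x in I) (d k x)%:E <=
        \sum_(0 <= k <oo) ((2^-1 : R) ^+ k)%:E)%E.
      apply: lee_nneseries => [k _ _|k _].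
        by apply: integral_ge0 => x _; rewrite lee_fin.
      by rewrite -[leLHS]fineK ?lee_fin; [exact: dI|exact: (integrable_fin_num mI (di k))].
    apply: le_lt_trans le2 _.
    have cgeo : series (geometric (1 : R) 2^-1) @ \oo --> ((1 - 2^-1)^-1 : R).
      have := @cvg_geometric_series R 1 2^-1; rewrite mul1r; apply.
      by rewrite ger0_norm ?invr_ge0// invf_lt1// ltr1n.
    rewrite (_ : limn _ = ((1 - 2^-1)^-1)%:E) ?ltry//.
    apply/cvg_lim => //; apply/fine_cvgP; split.
      by near=> n; rewrite sumEFin.
    apply: cvg_trans cgeo; apply: near_eq_cvg; near=> n => /=.
    by rewrite sumEFin /= /series /=; apply: eq_bigr => k _; rewrite /geometric /= mul1r.
  by move=> k x _; rewrite lee_fin.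
have [N [mN N0 sN]] := integrable_ae mI iS.
have Sfin x : I x -> ~ N x -> S x \is a fin_num.
  by move=> Ix Nx; apply: contrapT => h; apply: Nx; apply: sN => /= H; exact: h (H Ix).
pose D := I `\` N.
have mD : measurable D by exact: measurableD.
have DI : D `<=` I by move=> x [].
have cvx x : D x -> cvgn (fun k => g k x).
  move=> [Ix Nx]; have Sf := Sfin x Ix Nx.
  have cd : cvgn (series (fun k => d k x)).
    have : cvgn (fun n => \sum_(0 <= k < n) (d k x)%:E)%E.
      by apply: is_cvg_nneseries => k _ _; rewrite lee_fin.
    move=> cs; have : (\sum_(0 <= k < n) (d k x)%:E)%E @[n --> \oo] --> (fine (S x))%:E.
      by rewrite fineK.
    move=> /fine_cvgP[_ h]; apply/cvg_ex; exists (fine (S x)).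
    apply: cvg_trans h; apply: near_eq_cvg; near=> n => /=.
    by rewrite sumEFin /series.
  have cgeo : cvgn (series (geometric (1 : R) 2^-1)).
    by apply: is_cvg_geometric_series; rewrite ger0_norm ?invr_ge0// invf_lt1// ltr1n.
  have ct : cvgn (series (telescope (fun k => g k x))).
    apply: normed_cvg.
    have := is_cvg_seriesD cd cgeo; apply: series_le_cvg => k //=.
      by rewrite addr_ge0// /geometric /= mul1r exprn_ge0.
    have -> : (d^~ x + geometric 1 2^-1) k = d k x + (2^-1) ^+ k.
      by rewrite fctE /geometric /= mul1r.
    rewrite /telescope /d /= distrC.
    set z := g k x - g k.+1 x.
    have q0 : 0 < (2 : R) ^+ k by rewrite exprn_gt0.
    have -> : (2^-1 : R) ^+ k = (2 ^+ k)^-1 by rewrite exprVn.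
    set q := (2 : R) ^+ k in q0 *.
    rewrite -(ler_pM2l q0) mulrDr mulfV ?gt_eqF// -[z ^+ 2]real_normK ?num_real//.
    have := sqr_ge0 (q * `|z| - 1); have := normr_ge0 z; nra.
  have e : (fun k => g k x) = (fun k => g 0%N x + series (telescope (fun k => g k x)) k).
    by apply/funext => k; exact: (eq_sum_telescope (fun k => g k x) k).
  by rewrite e; apply: is_cvgD => //; exact: is_cvg_cst.
(* The value [0] on the exceptional null set keeps [h] measurable on all of [I]. *)
pose h (x : R) : R := if x \in D then limn (fun k => g k x) else 0.
have hD x : D x -> g k x @[k --> \oo] --> h x.
  by move=> Dx; rewrite /h mem_set//; exact: cvx.
have mg k : measurable_fun I (g k : MR -> MR) by case: (sg k).
have mhD : measurable_fun D (h : MR -> MR).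
  apply: (@measurable_fun_cvg _ _ _ _ g) => // k; exact: measurable_funS (mg k).
have IE : I = D `|` (I `&` N).
  apply/seteqP; split => x; last by move=> [[]//|[]].
  by move=> Ix; case: (pselect (N x)) => Nx; [right|left].
have mh : measurable_fun I (h : MR -> MR).
  rewrite IE; apply/measurable_funU => //; first exact: measurableI.
  split => //; have m0 : measurable_fun (I `&` N) ((fun=> 0) : MR -> MR) by exact: measurable_cst.
  by apply: eq_measurable_fun m0 => x; rewrite inE => -[_ Nx]; rewrite /h memNset// => -[].
have key k : igr D (fun x => (g k x - h x) ^+ 2) /\
    itg D (fun x => (g k x - h x) ^+ 2) <= (4^-1) ^+ k.
  apply: (@itg_fatou D (fun m x => (g k x - g (m + k)%N x) ^+ 2)) => //.
  - by move=> m; apply: igrS DI _ => //; case: (sqB mI (sg k) (sg (m + k)%N)).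
  - by move=> m x _; exact: sqr_ge0.
  - move=> m; apply: le_trans (cg k (m + k)%N (leq_addl _ _)).
    apply: itg_sub => //; first by case: (sqB mI (sg k) (sg (m + k)%N)).
    by move=> x _; exact: sqr_ge0.
  - move=> x Dx; have hx := hD x Dx.
    rewrite -(cvg_shiftn k) in hx.
    have : (g k x - g (m + k)%N x) @[m --> \oo] --> g k x - h x.
      by apply: cvgB => //; exact: cvg_cst.
    by move=> c2; exact: (cvgM c2 c2).
have mq k : measurable_fun I ((fun x => (g k x - h x) ^+ 2) : MR -> MR).
  have mb : measurable_fun I ((fun x => g k x - h x) : MR -> MR) by exact: (measurable_funB (mg k) mh).
  exact: measurable_funX.
have iq k : igr I (fun x => (g k x - h x) ^+ 2).
  apply/(negligible_integrable mN mI _ N0); last by have [] := key k.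
  by apply/measurable_EFinP; exact: mq.
exists h => [|k].
  have s1 : sq I (fun x => g 0%N x - h x) by split => //; exact: (measurable_funB (mg 0%N) mh).
  have := sqB mI (sg 0%N) s1; congr sq; apply/funext => x; ring.
rewrite /Rintegral (negligible_integral mN mI (iq k) N0).
by have [] := key k.
Unshelve. all: by end_near. Qed.

Lemma sqr_split (a b th : R) : 0 < th ->
  a ^+ 2 <= (1 + th) * b ^+ 2 + (1 + th^-1) * (a - b) ^+ 2.
Proof.
move=> t0; have e : th * th^-1 = 1 by rewrite mulfV// gt_eqF.
have t1 : 0 < th^-1 by rewrite invr_gt0.
have := sqr_ge0 (th * b - (a - b)) => h.
have : 0 <= th^-1 * (th * b - (a - b)) ^+ 2 by rewrite mulr_ge0// ltW.
have -> : th^-1 * (th * b - (a - b)) ^+ 2 =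
   th * th^-1 * (th * b ^+ 2) - 2 * (th * th^-1) * (b * (a - b)) + th^-1 * (a - b) ^+ 2 by ring.
rewrite e; lra.
Qed.

Lemma cont_on_eq (I : set MR) (u w : R -> R) : (forall x, I x -> u x = w x) ->
  cont_on I u -> cont_on I w.
Proof.
move=> uw cu x Ix e e0; have [d d0 hd] := cu x Ix e e0.
by exists d => // y Iy yx; rewrite -!uw// hd.
Qed.

Lemma powR_lip (p M a b : R) : 2 < p -> 0 <= a -> a <= b -> b <= M ->
  b `^ p - a `^ p <= p * M `^ (p - 2) * (b * (b - a)).
Proof.
move=> p2 a0; rewrite le_eqVlt => /orP[/eqP <- _|ab bM].
  by rewrite !subrr !mulr0.
have b0 : 0 < b by exact: le_lt_trans ab.
have p0 : 0 < p by exact: lt_trans p2.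
have dp x : x \in `]a, b[ -> is_derive x 1 (fun y => y `^ p) (p * x `^ (p - 1)).
  by rewrite in_itv /= => /andP[ax _]; apply: is_derive1_powR; exact: le_lt_trans ax.
have cp : {within `[a, b], continuous (fun y => y `^ p)}.
  rewrite -sgmE; apply/cont_onP; apply: (@cont_on_eq _ (fun y => `|y| `^ p)).
    by move=> y /andP[ay _]; rewrite ger0_norm// (le_trans a0).
  by apply/cont_onP; apply: continuous_subspaceT; exact: continuous_powR_norm.
have [x] := MVT ab dp cp; rewrite in_itv /= => /andP[ax xb] ->.
have x0 : 0 < x by exact: le_lt_trans ax.
have e1 : x `^ (p - 1) = x `^ (p - 2) * x.
  rewrite -[X in _ * X]powRr1 ?(ltW x0)// -powRD ?(gt_eqF x0) ?implybT//.
  by congr (_ `^ _); ring.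
rewrite -!mulrA ler_pM2l// mulrA ler_wpM2r ?subr_ge0 ?(ltW ab)// e1.
apply: ler_pM; rewrite ?powR_ge0 ?(ltW x0) ?(ltW xb)//.
apply: ge0_ler_powR; rewrite ?nnegrE ?subr_ge0 ?(ltW p2) ?(ltW x0)//.
  by rewrite (le_trans (ltW b0)).
exact: le_trans (ltW xb) bM.
Qed.

(** Mean value theorem followed by Young's inequality with weight [th]: for functions bounded by
    [M], closeness in [L^2] controls the [L^p] term. *)
Lemma powR_dist (p M a b th : R) : 2 < p -> 0 < th -> `|a| <= M -> `|b| <= M ->
  `|a| `^ p - `|b| `^ p <=
  p * M `^ (p - 2) * (th * (a ^+ 2 + b ^+ 2) + th^-1 * (a - b) ^+ 2).
Proof.
move=> p2 t0 aM bM; have p0 : 0 < p by exact: lt_trans p2.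
set k := p * M `^ (p - 2); have k0 : 0 <= k by rewrite mulr_ge0 ?powR_ge0// ltW.
have ti : 0 < th^-1 by rewrite invr_gt0.
have r0 : 0 <= th * (a ^+ 2 + b ^+ 2) + th^-1 * (a - b) ^+ 2.
  by rewrite addr_ge0// mulr_ge0 ?addr_ge0 ?sqr_ge0 ?(ltW t0) ?(ltW ti).
case: (leP `|a| `|b|) => ab.
  apply: (@le_trans _ _ 0); last by rewrite mulr_ge0.
  by rewrite subr_le0; apply: ge0_ler_powR; rewrite ?nnegrE// ltW.
apply: le_trans (powR_lip p2 (normr_ge0 b) (ltW ab) aM) _; rewrite -/k ler_wpM2l//.
have d : `|a| - `|b| <= `|a - b| by exact: lerB_dist.
apply: (@le_trans _ _ (`|a| * `|a - b|)); first by rewrite ler_wpM2l.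
apply: (@le_trans _ _ (th * a ^+ 2 + th^-1 * (a - b) ^+ 2)); last first.
  by rewrite lerD2r ler_wpM2l ?(ltW t0)// lerDl sqr_ge0.
rewrite -[a ^+ 2]real_normK ?num_real// -[(a - b) ^+ 2]real_normK ?num_real//.
move: (`|a|) (`|a - b|) (normr_ge0 a) (normr_ge0 (a - b)) => A D A0 D0.
have e : th * th^-1 = 1 by rewrite mulfV// gt_eqF.
have : 0 <= th^-1 * (th * A - D) ^+ 2 by rewrite mulr_ge0 ?sqr_ge0// ltW.
have -> : th^-1 * (th * A - D) ^+ 2 =
   th * th^-1 * (th * A ^+ 2) - 2 * (th * th^-1) * (A * D) + th^-1 * D ^+ 2 by ring.
rewrite e; have := mulr_ge0 A0 D0; lra.
Qed.

End completeness.

(** * Compactness of minimizing sequences *)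

Section splitting.
Context {R : realType}.
Local Notation MR := (measurableTypeR R).
Local Notation leb := (@lebesgue_measure R).

Context (p : R) (p2 : 2 < p) (p6 : p < 6).
Let p_gt0 : 0 < p. Proof. by apply: lt_trans p2. Qed.
Let q_gt0 : 0 < p / 2 - 1. Proof. by rewrite subr_gt0 ltr_pdivlMr// mul1r. Qed.

Definition lin (s : R) (U : 'I_4 -> R -> R) (t : R) (V : 'I_4 -> R -> R) (i : 'I_4) (x : R) : R :=
  s * U i x + t * V i x.

Definition sqg (l : R) (U : 'I_4 -> R -> R) : Prop := forall i, sq (dom l i) (U i).

Lemma inH_sqg l U G : 0 <= l -> inH l U G -> sqg l U.
Proof. by move=> l0 hU i; exact: H1_sq (edge_dom i l0) (hU.1 i). Qed.

Lemma inH_sqgd l U G : inH l U G -> sqg l G.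
Proof. by move=> hU i; exact: H1_dsq (hU.1 i). Qed.

Lemma inH_lin (l s t : R) U G V K : 0 <= l -> inH l U G -> inH l V K ->
  inH l (lin s U t V) (lin s G t K).
Proof.
move=> l0 [hU cU] [hV cV]; split => i; first exact: H1_lin (edge_dom i l0) (hU i) (hV i).
by rewrite /lin cU cV.
Qed.

Lemma inH_Z (l k : R) U G : 0 <= l -> inH l U G ->
  inH l (fun i x => k * U i x) (fun i x => k * G i x).
Proof.
move=> l0 [hU cU]; split => i; last by rewrite cU.
exact: H1_Z (edge_dom i l0) (hU i).
Qed.

Lemma sqn_Z (l k : R) U : sqg l U -> sqn l (fun i x => k * U i x) = k ^+ 2 * sqn l U.
Proof.
move=> sU; rewrite /sqn mulr_sumr; apply: eq_bigr => i _; rewrite -intZ//; last by case: (sU i).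
by apply: int_eq => x _; rewrite exprMn.
Qed.

Lemma pn_Z (l k : R) U (M : R) : 0 <= k -> sqg l U -> bnd l U M ->
  pn p l (fun i x => k * U i x) = k `^ p * pn p l U.
Proof.
move=> k0 sU bM; rewrite /pn mulr_sumr; apply: eq_bigr => i _; rewrite -intZ//.
  by apply: int_eq => x _; rewrite normrM powRM// ger0_norm.
by apply: (igr_powp p2 (mdom l i) (sU i)) => x dx; exact: bM.
Qed.

Lemma sqn_par l U V : sqg l U -> sqg l V ->
  sqn l (lin 2^-1 U 2^-1 V) = 2^-1 * sqn l U + 2^-1 * sqn l V - 4^-1 * sqn l (lin 1 U (-1) V).
Proof.
move=> sU sV; rewrite /sqn !mulr_sumr -big_split -sumrB; apply: eq_bigr => i _ /=.
have mD := mdom l i; have [_ iu] := sU i; have [_ iv] := sV i.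
have [_ id] := sqD mD (sqZ 1 mD (sU i)) (sqZ (-1) mD (sV i)).
rewrite -!intZ// -intD; [|done|exact: igrZ|exact: igrZ].
rewrite -intB; [|done|by apply: igrD => //; exact: igrZ|exact: igrZ].
apply: int_eq => x _; rewrite /lin; by field.
Qed.

Lemma sqn_dist (l : R) U V (th : R) : 0 < th -> sqg l U -> sqg l V ->
  sqn l U <= (1 + th) * sqn l V + (1 + th^-1) * sqn l (lin 1 U (-1) V).
Proof.
move=> t0 sU sV; rewrite /sqn !mulr_sumr -big_split; apply: ler_sum => i _ /=.
have mD := mdom l i; have [_ iu] := sU i; have [_ iv] := sV i.
have [_ id] := sqD mD (sqZ 1 mD (sU i)) (sqZ (-1) mD (sV i)).
rewrite -!intZ// -intD; [|done|exact: igrZ|exact: igrZ].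
apply: int_le => //; first by apply: igrD => //; exact: igrZ.
by move=> x _; rewrite /lin mul1r mulN1r; exact: sqr_split.
Qed.

Lemma pn_dist (l : R) U V (M th : R) : 0 < th -> sqg l U -> sqg l V -> bnd l U M -> bnd l V M ->
  pn p l U - pn p l V <=
  p * M `^ (p - 2) * (th * (sqn l U + sqn l V) + th^-1 * sqn l (lin 1 U (-1) V)).
Proof.
move=> t0 sU sV bU bV; rewrite /sqn /pn -sumrB -big_split !mulr_sumr -big_split mulr_sumr.
apply: ler_sum => i _ /=.
have mD := mdom l i; have [_ iu] := sU i; have [_ iv] := sV i.
have [_ id] := sqD mD (sqZ 1 mD (sU i)) (sqZ (-1) mD (sV i)).
have pu : igr (dom l i) (fun x => `|U i x| `^ p).
  by apply: (igr_powp p2 mD (sU i)) => x dx; exact: bU.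
have pv : igr (dom l i) (fun x => `|V i x| `^ p).
  by apply: (igr_powp p2 mD (sV i)) => x dx; exact: bV.
have iuv := igrD mD iu iv.
rewrite -intB// -intD// -!intZ// -intD; [|done|exact: igrZ|exact: igrZ].
have it := igrD mD (igrZ th mD iuv) (igrZ th^-1 mD id).
rewrite -intZ//; apply: int_le => //; [exact: igrB|exact: igrZ|].
by move=> x dx; rewrite /lin mul1r mulN1r; apply: powR_dist => //; [exact: bU|exact: bV].
Qed.

(** Compare with [k U], where [k^2 = mu / nu] and [nu] is the mass of [U]. The kinetic term scales
    like [k^2], the [L^p] term like [k^p = k^2 (mu / nu)^(p/2-1)]; dividing the energy of [k U] by
    [k^2] leaves the excess of the second factor over [1] as a gain. *)
Lemma scaling (l mu I : R) U G : 0 <= l -> 0 < mu ->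
  (forall V K, inH l V K -> sqn l V = mu -> I <= ener p l V K) ->
  inH l U G -> 0 < sqn l U ->
  sqn l U / mu * I + p^-1 * pn p l U * ((mu / sqn l U) `^ (p / 2 - 1) - 1) <= ener p l U G.
Proof.
move=> l0 m0 hI hU n0; set nu := sqn l U in n0 *.
set s := mu / nu; have s0 : 0 < s by rewrite divr_gt0.
have [M M0 bM] := inH_bounded l0 hU.
have sU := inH_sqg l0 hU; have sG := inH_sqgd hU.
set k := Num.sqrt s; have k2 : k ^+ 2 = s by rewrite sqr_sqrtr// ltW.
have kp : k `^ p = s `^ (p / 2 - 1) * s.
  rewrite /k -powR12_sqrt ?(ltW s0)// -powRrM -[in RHS](powRr1 (ltW s0)) -powRrM mul1r.
  by rewrite -powRD_pos// subrK mulrC.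
have hk := inH_Z k l0 hU.
have := hI _ _ hk; rewrite (sqn_Z k sU) k2 -/nu /s mulfVK ?gt_eqF// => /(_ erefl).
have -> : ener p l (fun i x => k * U i x) (fun i x => k * G i x) =
    2^-1 * (k ^+ 2 * sqn l G) - p^-1 * (k `^ p * pn p l U).
  by rewrite /ener (sqn_Z k sG) (pn_Z (sqrtr_ge0 s) sU bM).
rewrite k2 kp /ener.
set A := sqn l G; set B := pn p l U; set y := s `^ _ => h.
have -> : nu / mu = s^-1 by rewrite /s invf_div.
have : s^-1 * I <= s^-1 * (2^-1 * (s * A) - p^-1 * (y * s * B)).
  by rewrite ler_wpM2l// invr_ge0 ltW.
have -> : s^-1 * (2^-1 * (s * A) - p^-1 * (y * s * B)) = 2^-1 * A - p^-1 * B * y.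
  by field; rewrite !gt_eqF.
lra.
Qed.

(** Beyond [x] the function is replaced by an affine piece of length [1] from [u x] down to [0],
    which adds at most [u x ^+ 2] to the mass and to the kinetic integral. *)
Lemma cut_ray (x : R) u g : 0 <= x -> H1 (ray 0) u g -> exists ug : (R -> R) * (R -> R),
  [/\ H1 (ray 0) ug.1 ug.2, ug.1 0 = u 0,
   itg (sgm 0 x) (fun t => u t ^+ 2) <= itg (ray 0) (fun t => ug.1 t ^+ 2)
     <= itg (sgm 0 x) (fun t => u t ^+ 2) + u x ^+ 2,
   itg (ray 0) (fun t => ug.2 t ^+ 2) <= itg (sgm 0 x) (fun t => g t ^+ 2) + u x ^+ 2 &
   itg (sgm 0 x) (fun t => `|u t| `^ p) <= itg (ray 0) (fun t => `|ug.1 t| `^ p)].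
Proof.
move=> x0 hu; set r := u x; pose L := x + 1.
pose w t := if t <= x then u t else r * (1 - (t - x)).
pose k t := if t <= x then g t else - r.
have xL : x <= L by rewrite /L lerDl.
have L0 : 0 <= L by exact: le_trans xL.
have ac1 : acf 0 x w k.
  by apply: acf_eq (H1_acf edge_ray hu (lexx 0) x0 x0) x0 _ _ => t /andP[_ tx]; rewrite /w /k tx.
have ac2 : acf x L w k.
  apply: (@acf_eq_oc _ x L (fun t => r * (1 - (t - x))) (fun=> - r)) => //.
  - split; first exact: igr_cst.
    by move=> t /andP[xt _]; rewrite int_cst//; ring.
  - move=> t /andP[xt _]; rewrite /w; case: leP => // tx.
    have -> : t = x by apply/eqP; rewrite eq_le tx xt.
    by rewrite subrr subr0 mulr1.
  - by move=> t /andP[xt _]; rewrite /k leNgt xt.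
have ac := acf_join x0 xL ac1 ac2.
have kE1 t : sgm 0 x t -> k t = g t by move=> /andP[_ tx]; rewrite /k tx.
have wE1 t : sgm 0 x t -> w t = u t by move=> /andP[_ tx]; rewrite /w tx.
have sgx : sq (sgm 0 x) g by apply: sqS (H1_dsq hu) => // t /andP[].
have k2i1 : igr (sgm 0 x) (fun t => k t ^+ 2).
  by case: sgx => _; apply: igr_eq => // t tx; rewrite kE1.
have kE2 t : x < t <= L -> (- r) ^+ 2 = k t ^+ 2 by move=> /andP[xt _]; rewrite /k leNgt xt.
have k2i2 : igr (sgm x L) (fun t => k t ^+ 2) by exact: igr_eq_oc (igr_cst _ _ ((- r) ^+ 2)) kE2.
have sk : sq (sgm 0 L) k.
  by split; [exact: igr_meas (acf_igr ac)|exact: igr_join k2i2].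
have wL : w L = 0.
  rewrite /w /L; case: leP => [h|_]; first by exfalso; lra.
  by rewrite (_ : x + 1 - x = 1) ?subrr ?mulr0//; ring.
have cw := acf_cont L0 ac.
have w2 : igr (sgm 0 L) (fun t => w t ^+ 2).
  by apply: cont_on_igr; apply: (cont_on_comp (G := fun t => t ^+ 2) cw); exact: exprn_continuous.
have wp : igr (sgm 0 L) (fun t => `|w t| `^ p).
  by apply: cont_on_igr; apply: (cont_on_comp (G := fun t => `|t| `^ p) cw); exact: continuous_powR_norm.
have sq0 : (0 : R) ^+ 2 = 0 by rewrite expr0n.
have pw0 : `|0 : R| `^ p = 0 by rewrite normr0 powR0// gt_eqF.
have wr t : x <= t <= L -> w t ^+ 2 <= r ^+ 2.
  move=> /andP[xt tL]; rewrite /w; case: (leP t x) => tx.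
    by have -> : t = x by apply/eqP; rewrite eq_le tx xt.
  rewrite exprMn -[leRHS]mulr1 ler_wpM2l ?sqr_ge0// expr_le1//; rewrite /L in tL; lra.
have sub2 : sgm x L `<=` sgm 0 L by exact: sgm_sub.
have ew2 : itg (sgm 0 x) (fun t => w t ^+ 2) = itg (sgm 0 x) (fun t => u t ^+ 2).
  by apply: int_eq => t tx; rewrite wE1.
have ek2 : itg (sgm 0 x) (fun t => k t ^+ 2) = itg (sgm 0 x) (fun t => g t ^+ 2).
  by apply: int_eq => t tx; rewrite kE1.
have ewp : itg (sgm 0 x) (fun t => `|w t| `^ p) = itg (sgm 0 x) (fun t => `|u t| `^ p).
  by apply: int_eq => t tx; rewrite wE1.
have k2i := igr_join x0 xL k2i1 k2i2.
have Lx : L - x = 1 by rewrite /L; ring.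
exists (zext L w, zext L k); split => /=.
- exact: H1_zext.
- by rewrite /zext L0 /w x0.
- rewrite (@zext_comp _ _ _ (fun t => t ^+ 2))//; have [_ ->] := zext_ray L0 w2.
  rewrite (int_split x0 xL w2) ew2; apply/andP; split.
    by rewrite lerDl int_ge0// => t _; exact: sqr_ge0.
  rewrite lerD2l; have -> : r ^+ 2 = itg (sgm x L) (fun=> r ^+ 2) by rewrite int_cst// Lx mulr1.
  by apply: int_le => //; [exact: igrS w2|exact: igr_cst].
- rewrite (@zext_comp _ _ _ (fun t => t ^+ 2))//; have [_ ->] := zext_ray L0 k2i.
  rewrite (int_split x0 xL k2i) ek2.
  by rewrite -(itg_eq_oc xL (igr_cst _ _ ((- r) ^+ 2)) kE2) int_cst// Lx mulr1 sqrrN.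
- rewrite (@zext_comp _ _ _ (fun t => `|t| `^ p))//; have [_ ->] := zext_ray L0 wp.
  rewrite (int_split x0 xL wp) ewp.
  by rewrite lerDl int_ge0// => t _; exact: powR_ge0.
Qed.

(** Calibration with the supremum [m] over the outer ray gives [Phi 2 N m], up to the starting value
    [Kal m (u x)], which is of order [u x ^+ 2]. As [N <= mu], [Phi 2 N m] is at least [N / mu]
    times [Phi 2 mu m]. *)
Lemma outer_bound (x M mu : R) u g : 0 <= x -> H1 (ray 0) u g -> 0 < M ->
  (forall t : R, 0 <= t -> `|u t| <= M) -> 0 < mu -> itg (ray x) (fun t => u t ^+ 2) <= mu ->
  itg (ray x) (fun t => u t ^+ 2) / mu * lev p 2 mu - M `^ (p / 2 - 1) * u x ^+ 2 <=
  2^-1 * itg (ray x) (fun t => g t ^+ 2) - p^-1 * itg (ray x) (fun t => `|u t| `^ p).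
Proof.
move=> x0 hu M0 uM m0 numu.
have sub : ray x `<=` ray 0 by move=> t; exact: le_trans.
have su := sqS (mray 0) (mray x) sub (H1_sq edge_ray hu).
have sg := sqS (mray 0) (mray x) sub (H1_dsq hu).
set N := itg (ray x) (fun t => u t ^+ 2) in numu *; set A := itg _ (fun t => g t ^+ 2).
set B := itg _ (fun t => `|u t| `^ p).
have N0 : 0 <= N by apply: int_ge0 => t _; exact: sqr_ge0.
have A0 : 0 <= A by apply: int_ge0 => t _; exact: sqr_ge0.
have e0 := lev_lt0 p2 p6 (ltr0n _ 2) m0.
have y0 : 0 <= M `^ (p / 2 - 1) * u x ^+ 2 by rewrite mulr_ge0 ?powR_ge0 ?sqr_ge0.
pose S := [set y : R | exists2 t : R, x <= t & y = `|u t|].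
have S0 : S `|u x| by exists x.
have ubS : ubound S M by move=> y [t xt ->]; apply: uM; exact: le_trans xt.
have hS : has_sup S by split; [by exists `|u x| | by exists M].
have bS (t : R) : x <= t -> `|u t| <= sup S by move=> xt; apply: ub_le_sup; [exists M|exists t].
have SM : sup S <= M by apply: ge_sup => //; exists `|u x|.
(* The calibration needs a positive height, so a function vanishing on the whole outer ray is
   treated apart. *)
case: (leP (sup S) 0) => s0.
  have uz (t : R) : x <= t -> u t = 0.
    by move=> xt; apply/eqP; rewrite -normr_le0; exact: le_trans (bS t xt) s0.
  have -> : B = 0.
    rewrite /B (int_eq (g := fun t => 0 * u t ^+ 2)).
      by rewrite intZ ?mul0r//; case: su.
    by move=> t xt; rewrite uz// normr0 powR0 ?gt_eqF// mul0r.
  have : N / mu * lev p 2 mu <= 0 by rewrite mulr_ge0_le0 ?divr_ge0 ?(ltW m0) ?(ltW e0).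
  lra.
set m := sup S in s0 bS SM *.
have uLag := itg_Lag p2 (mray x) su sg bS; rewrite -/A -/B -/N in uLag.
have main : Phi p 2 N m - Kal p m (u x) <= 2^-1 * A - p^-1 * B.
  apply/ler_addgt0Pl => e e1.
  set s := m `^ (p / 2); have sp : 0 < s by exact: powR_gt0.
  have e10 : 0 < e / (2 * s) by rewrite divr_gt0// mulr_gt0.
  have [_ [t xt ->] ht] := sup_adherent e10 hS; rewrite -/m in ht.
  have := ray_calib2 p2 x0 hu s0 bS xt; rewrite uLag => lw.
  have nm : `|m| = m by rewrite gtr0_norm.
  have utm : `|u t| <= `|m| by rewrite nm bS.
  have := Kal_lip p2 s0 utm; rewrite nm -/s => kl.
  have KM := Kal_max p s0; rewrite -/s in KM.
  have : s * (m - `|u t|) <= e / 2.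
    have : m - `|u t| <= e / (2 * s) by move: ht; rewrite ltrBlDr -ltrBlDl => /ltW.
    rewrite -(ler_pM2l sp) (_ : s * (e / (2 * s)) = e / 2)//; field; by rewrite gt_eqF.
  rewrite /Phi -/s; move: KM kl lw.
  have -> : 2 * Hk p 1 * (s * m) = 2 * (s * m * Hk p 1) by ring.
  move: (Kal p m m) (Kal p m (u t)) (Kal p m (u x)) (s * m * Hk p 1) (s * (m - `|u t|)) => k1 k2 k3 k4 k5.
  move=> ->; move: (m `^ (p - 2) * N) => k6; lra.
have PN : N / mu * lev p 2 mu <= Phi p 2 N m.
  have le1 : N / mu <= 1 by rewrite ler_pdivrMr// mul1r.
  have nm0 : 0 <= N / mu by rewrite divr_ge0// ltW.
  apply: (@le_trans _ _ (N / mu * Phi p 2 mu m)).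
    by rewrite ler_wpM2l// lev_le.
  rewrite /Phi mulrBr (_ : N / mu * (p^-1 * (m `^ (p - 2) * mu)) = p^-1 * (m `^ (p - 2) * N)).
    rewrite lerD2r -[leRHS]mul1r ler_wpM2r// -mulrA mulr_ge0// ltW// cMM_gt0//.
  by field; rewrite !gt_eqF.
have Kx : Kal p m (u x) <= M `^ (p / 2 - 1) * u x ^+ 2.
  apply: le_trans (Kal_le_sqr p2 _ s0) _; rewrite ler_wpM2r ?sqr_ge0//.
  have -> : m `^ (p / 2) / m = m `^ (p / 2 - 1).
    rewrite -[p / 2 in LHS](subrK 1) powRD_pos// powRr1 ?(ltW s0)// mulfK// gt_eqF//.
  by apply: ge0_ler_powR; rewrite ?nnegrE ?(ltW q_gt0) ?(ltW s0) ?(ltW M0).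
lra.
Qed.

End splitting.

(** * No loss of mass along the halflines *)

Section tightness.
Context {R : realType}.
Local Notation MR := (measurableTypeR R).
Local Notation leb := (@lebesgue_measure R).

Context (p : R) (p2 : 2 < p) (p6 : p < 6).
Let p_gt0 : 0 < p. Proof. by apply: lt_trans p2. Qed.
Let q_gt0 : 0 < p / 2 - 1. Proof. by rewrite subr_gt0 ltr_pdivlMr// mul1r. Qed.

Lemma sum_ray (F : 'I_4 -> R) (k : R) : (forall i, i != tip -> F i <= k) ->
  \sum_(i | i != tip) F i <= 3 * k.
Proof. by move=> h; rewrite -sum_ray_cst; apply: ler_sum => i it; exact: h. Qed.

Section tight.
Variables (l mu I M b0 : R).
Hypotheses (l0 : 0 < l) (mu0 : 0 < mu) (Ile : I <= lev p 2 mu) (M0 : 0 < M) (b00 : 0 < b0).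
Hypothesis hI : forall V K, inH l V K -> sqn l V = mu -> I <= ener p l V K.

Let I0 : I < 0. Proof. exact: le_lt_trans Ile (lev_lt0 p2 p6 (ltr0n _ 2) mu0). Qed.

(* Cutting at points where the function is small: the inner piece is an admissible
   competitor of mass [nu], the outer ones are controlled by the soliton level. *)
Lemma cut_energy (U G : 'I_4 -> R -> R) (x : 'I_4 -> R) (e : R) :
  inH l U G -> sqn l U = mu -> bnd l U M ->
  (forall i, i != tip -> 0 <= x i /\ U i (x i) ^+ 2 <= e) ->
  b0 <= itg (sgm 0 l) (fun t => `|U tip t| `^ p) ->
  let N2 := \sum_(i | i != tip) itg (ray (x i)) (fun t => U i t ^+ 2) in
  exists nu, [/\ 0 < nu, nu <= mu - N2 + 3 * e &
    nu / mu * I + N2 / mu * I + p^-1 * b0 * ((mu / nu) `^ (p / 2 - 1) - 1)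
      - (3 / 2 + 3 * M `^ (p / 2 - 1)) * e <= ener p l U G \/ mu <= nu].
Proof.
move=> hU Umu bM hx hb N2.
have /choice[ug hug] : forall i, exists ug : (R -> R) * (R -> R), i != tip ->
  [/\ H1 (ray 0) ug.1 ug.2, ug.1 0 = U i 0,
   itg (sgm 0 (x i)) (fun t => U i t ^+ 2) <= itg (ray 0) (fun t => ug.1 t ^+ 2)
     <= itg (sgm 0 (x i)) (fun t => U i t ^+ 2) + U i (x i) ^+ 2,
   itg (ray 0) (fun t => ug.2 t ^+ 2) <= itg (sgm 0 (x i)) (fun t => G i t ^+ 2) + U i (x i) ^+ 2 &
   itg (sgm 0 (x i)) (fun t => `|U i t| `^ p) <= itg (ray 0) (fun t => `|ug.1 t| `^ p)].
  move=> i; have [it|it] := eqVneq i tip; first by exists (U i, G i).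
  have [xi0 _] := hx i it; have := hU.1 i; rewrite dom_ray// => hi.
  by have [ug h] := cut_ray p2 xi0 hi; exists ug.
pose V i := if i == tip then U tip else (ug i).1.
pose K i := if i == tip then G tip else (ug i).2.
have Vr i : i != tip -> V i = (ug i).1 by rewrite /V => /negPf ->.
have Kr i : i != tip -> K i = (ug i).2 by rewrite /K => /negPf ->.
have Vt : V tip = U tip by rewrite /V eqxx.
have Kt : K tip = G tip by rewrite /K eqxx.
have hV : inH l V K.
  split => i; have [->|it] := eqVneq i tip => //.
  - by rewrite Vt Kt; exact: hU.1.
  - by rewrite Vr// Kr// dom_ray//; have [] := hug i it.
  - by rewrite Vr// Vt; have [_ -> _ _ _] := hug i it; exact: hU.2.
have Hr i : i != tip -> H1 (ray 0) (U i) (G i) by move=> it; have := hU.1 i; rewrite dom_ray.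
have bMr i : i != tip -> forall t : R, 0 <= t -> `|U i t| <= M.
  by move=> it t t0; apply: bM; rewrite dom_ray.
have xi0 i : i != tip -> 0 <= x i by move=> it; have [] := hx i it.
have su i : i != tip -> igr (ray 0) (fun t => U i t ^+ 2).
  by move=> it; case: (Hr i it).
have sg i : i != tip -> igr (ray 0) (fun t => G i t ^+ 2).
  by move=> it; case: (H1_dsq (Hr i it)).
have sp i : i != tip -> igr (ray 0) (fun t => `|U i t| `^ p).
  by move=> it; apply: (igr_powp p2 (mray 0) (H1_sq edge_ray (Hr i it))); exact: bMr.
set Nt := itg (dom l tip) (fun t => U tip t ^+ 2).
set At := itg (dom l tip) (fun t => G tip t ^+ 2).
set Bt := itg (dom l tip) (fun t => `|U tip t| `^ p).
set N1 := \sum_(i | i != tip) itg (sgm 0 (x i)) (fun t => U i t ^+ 2).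
set A1 := \sum_(i | i != tip) itg (sgm 0 (x i)) (fun t => G i t ^+ 2).
set B1 := \sum_(i | i != tip) itg (sgm 0 (x i)) (fun t => `|U i t| `^ p).
set A2 := \sum_(i | i != tip) itg (ray (x i)) (fun t => G i t ^+ 2).
set B2 := \sum_(i | i != tip) itg (ray (x i)) (fun t => `|U i t| `^ p).
have splitU (F : 'I_4 -> R -> R) : (forall i, i != tip -> igr (ray 0) (F i)) ->
    \sum_i itg (dom l i) (F i) = itg (dom l tip) (F tip) +
      \sum_(i | i != tip) itg (sgm 0 (x i)) (F i) + \sum_(i | i != tip) itg (ray (x i)) (F i).
  move=> hF; rewrite sum_tip -addrA -big_split; congr (_ + _); apply: eq_bigr => i it /=.
  by rewrite dom_ray//; apply: int_split_ray; [exact: xi0|exact: hF].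
have eN : mu = Nt + N1 + N2 by rewrite -Umu; exact: splitU.
have eA : sqn l G = At + A1 + A2 by exact: splitU.
have eB : pn p l U = Bt + B1 + B2 by exact: (splitU (fun i t => `|U i t| `^ p)).
have hN : Nt + N1 <= sqn l V <= Nt + N1 + 3 * e.
  rewrite /sqn sum_tip Vt -/Nt -addrA !lerD2l.
  have -> : \sum_(i | i != tip) itg (dom l i) (fun t => V i t ^+ 2) =
      \sum_(i | i != tip) itg (ray 0) (fun t => (ug i).1 t ^+ 2).
    by apply: eq_bigr => i it; rewrite dom_ray// Vr.
  apply/andP; split; first by apply: ler_sum => i it; have [_ _ /andP[]] := hug i it.
  rewrite -sum_ray_cst -big_split; apply: ler_sum => i it /=.
  have [_ _ /andP[_ h] _ _] := hug i it; apply: le_trans h _.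
  by rewrite lerD2l; have [] := hx i it.
have hA : sqn l K <= At + A1 + 3 * e.
  rewrite /sqn sum_tip Kt -/At -addrA lerD2l.
  rewrite -sum_ray_cst -big_split; apply: ler_sum => i it /=.
  rewrite dom_ray// Kr//; have [_ _ _ h _] := hug i it; apply: le_trans h _.
  by rewrite lerD2l; have [] := hx i it.
have hB : Bt + B1 <= pn p l V.
  rewrite /pn sum_tip Vt -/Bt lerD2l; apply: ler_sum => i it.
  by rewrite (dom_ray _ it) (Vr i it); have [_ _ _ _ h] := hug i it; exact: h.
have hout : N2 / mu * I - 3 * (M `^ (p / 2 - 1) * e) <= 2^-1 * A2 - p^-1 * B2.
  rewrite /N2 /A2 /B2 -sum_ray_cst !mulr_suml !mulr_sumr -!sumrB; apply: ler_sum => i it.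
  have h := outer_bound p2 p6 (xi0 i it) (Hr i it) M0 (bMr i it) mu0.
  have leN : itg (ray (x i)) (fun t => U i t ^+ 2) <= mu.
    rewrite eN; apply: (@le_trans _ _ N2); last first.
      rewrite lerDr addr_ge0//; first by apply: int_ge0 => t _; exact: sqr_ge0.
      by apply: sumr_ge0 => j _; apply: int_ge0 => t _; exact: sqr_ge0.
    rewrite /N2 (bigD1 i)//= lerDl; apply: sumr_ge0 => j _.
    by apply: int_ge0 => t _; exact: sqr_ge0.
  apply: le_trans (h leN); have [_ hxe] := hx i it.
  set n := itg _ _; have n0 : 0 <= n by apply: int_ge0 => t _; exact: sqr_ge0.
  apply: lerD; first by rewrite ler_wpM2l// divr_ge0// ltW.
  by rewrite lerN2 ler_wpM2l// powR_ge0.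
have sUt : sq (dom l tip) (U tip) by exact: (inH_sqg (ltW l0) hU).
have Bt0 : b0 <= Bt by rewrite /Bt dom_tip.
have Nt0 : 0 < Nt.
  have leB : Bt <= M `^ (p - 2) * Nt.
    case: (sUt) => _ iu; rewrite -intZ//; apply: int_le => //; [|exact: igrZ|].
      by apply: (igr_powp p2 (mdom l tip) sUt) => t dt; exact: bM.
    by move=> t dt; apply: powR_le_sqr; [exact: ltW|exact: bM].
  have := lt_le_trans b00 (le_trans Bt0 leB); rewrite pmulr_rgt0// powR_gt0//.
have N10 : 0 <= N1 by apply: sumr_ge0 => i _; apply: int_ge0 => t _; exact: sqr_ge0.
have B10 : 0 <= B1 by apply: sumr_ge0 => i _; apply: int_ge0 => t _; exact: powR_ge0.
clearbody Nt At Bt N1 A1 B1 A2 B2 N2 V K.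
move: hN => /andP[hN1 hN2].
have nu0 : 0 < sqn l V by apply: lt_le_trans hN1; rewrite ltr_pwDl.
exists (sqn l V); split => //.
  by rewrite (_ : mu - N2 = Nt + N1)// eN; ring.
(* The affine pieces may bring the mass [nu] up to [mu] or beyond; that case is handed back, since
   [(mu / nu)^(p/2-1) - 1] is then no gain. *)
case: (leP mu (sqn l V)) => numu; [by right|left].
have := scaling p2 (ltW l0) mu0 hI hV nu0.
set y := (mu / sqn l V) `^ _.
have y1 : 1 <= y.
  have := @ge0_ler_powR R (p / 2 - 1) (ltW q_gt0) 1 (mu / sqn l V).
  rewrite powR1 !nnegrE ler01 divr_ge0 ?(ltW mu0) ?(ltW nu0)//; apply => //.
  by rewrite ler_pdivlMr// mul1r ltW.
have gain : p^-1 * b0 * (y - 1) <= p^-1 * pn p l V * (y - 1).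
  apply: ler_wpM2r; first by rewrite subr_ge0.
  apply: ler_wpM2l; first by rewrite invr_ge0 ltW.
  by apply: le_trans Bt0 (le_trans _ hB); rewrite lerDl.
have hBp : p^-1 * (Bt + B1) <= p^-1 * pn p l V.
  by apply: ler_wpM2l => //; rewrite invr_ge0 ltW.
have -> : ener p l U G = 2^-1 * (At + A1) - p^-1 * (Bt + B1) + (2^-1 * A2 - p^-1 * B2).
  by rewrite /ener eA eB; ring.
rewrite /ener; move: hout gain hBp hA.
move: (p^-1 * b0 * (y - 1)) (p^-1 * pn p l V * (y - 1)) (p^-1 * (Bt + B1)) (p^-1 * pn p l V) (p^-1 * B2)
  (sqn l K) (sqn l V / mu * I) (N2 / mu * I) => z1 z2 z3 z4 z5 z6 z7 z8.
move: (At + A1) (M `^ (p / 2 - 1)) => z9 z11; lra.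
Qed.

(** If more than [dl] of the mass were far out, the inner piece would have mass at most [mu - d1],
    and its rescaling would gain at least [g]. The cuts cost at most [g / 4] and the energy exceeds
    [I] by at most [g / 4], which is a contradiction. *)
Lemma tightness (dl : R) : 0 < dl -> exists T0 e0 : R, [/\ 0 < T0, 0 < e0 &
  forall U G, inH l U G -> sqn l U = mu -> bnd l U M ->
  b0 <= itg (sgm 0 l) (fun t => `|U tip t| `^ p) -> ener p l U G <= I + e0 ->
  forall i, i != tip -> itg (ray T0) (fun t => U i t ^+ 2) <= dl].
Proof.
(* Of the lost mass [dl], the cuts may give back [3 e <= dl / 2]; the minimum with [mu] keeps
   [mu - d1] positive. *)
move=> d0; pose d1 := Num.min dl mu / 2.
have d10 : 0 < d1 by rewrite divr_gt0// lt_min d0.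
have d1m : d1 < mu.
  have h : Num.min dl mu <= mu by rewrite ge_min lexx orbT.
  by rewrite /d1 ltr_pdivrMr//; apply: le_lt_trans h _; move: mu0; lra.
have d1d : d1 <= dl / 2 by rewrite /d1 ler_pdivrMr// divfK// ?ge_min ?lexx// pnatr_eq0.
pose q := p / 2 - 1.
pose eta := (mu / (mu - d1)) `^ q - 1.
have eta0 : 0 < eta.
  rewrite subr_gt0; have := @gt0_ltr_powR R q q_gt0 1 (mu / (mu - d1)).
  rewrite powR1 !nnegrE ler01 divr_ge0 ?subr_ge0 ?(ltW mu0) ?(ltW d1m)//; apply => //.
  by rewrite ltr_pdivlMr ?subr_gt0// mul1r gtrBl.
pose g := p^-1 * b0 * eta; have g0 : 0 < g by rewrite !mulr_gt0 ?invr_gt0.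
pose C := 3 / 2 + 3 * M `^ q - 3 * I / mu.
have C0 : 0 < C.
  have h1 : 0 <= M `^ q by exact: powR_ge0.
  have h2 : 0 < - I / mu by rewrite divr_gt0// oppr_gt0.
  rewrite /C -[3 * I / mu]mulrA (_ : I / mu = - (- I / mu)); last by rewrite mulNr opprK.
  lra.
pose e := Num.min (g / (4 * C)) (dl / 6).
have e0 : 0 < e by rewrite lt_min !divr_gt0// mulr_gt0.
have eC : C * e <= g / 4.
  have : e <= g / (4 * C) by rewrite ge_min lexx.
  rewrite -(ler_pM2l C0) => h; apply: le_trans h _; rewrite le_eqVlt; apply/orP; left; apply/eqP.
  by field; rewrite gt_eqF.
have ed : 3 * e <= dl / 2 by have : e <= dl / 6 by [rewrite ge_min lexx orbT]; lra.
(* So long that [U^2] cannot exceed [e] throughout [[T, 2 T]], because [e T = 2 mu] is more than the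
   total mass. *)
pose T := 2 * mu / e; have T0 : 0 < T by rewrite divr_gt0// mulr_gt0.
exists (2 * T), (g / 4); split; [by rewrite mulr_gt0|by rewrite divr_gt0|].
move=> U G hU Umu bM hb hE.
have Hr i : i != tip -> H1 (ray 0) (U i) (G i) by move=> it; have := hU.1 i; rewrite dom_ray.
have nle i : i != tip -> itg (ray 0) (fun t => U i t ^+ 2) <= mu.
  move=> it; rewrite -Umu /sqn (bigD1 i)//= dom_ray// lerDl; apply: sumr_ge0 => j _.
  by apply: int_ge0 => t _; exact: sqr_ge0.
have /choice[x hx] : forall i, exists x : R, i != tip -> T <= x <= 2 * T /\ U i x ^+ 2 <= e.
  move=> i; have [it|it] := eqVneq i tip; first by exists 0.
  have [ui _] := Hr i it.
  have TT : T <= 2 * T by lra.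
  have sub : sgm T (2 * T) `<=` ray 0 by move=> t /andP[Tt _]; exact: le_trans (ltW T0) Tt.
  have ui' := igrS (mray 0) (msgm T (2 * T)) sub ui.
  have : itg (sgm T (2 * T)) (fun t => U i t ^+ 2) < e * (2 * T - T).
    apply: le_lt_trans (itg_sub _ _ sub ui _) _ => //; first by move=> t _; exact: sqr_ge0.
    apply: le_lt_trans (nle i it) _.
    have -> : e * (2 * T - T) = 2 * mu by rewrite /T; field; rewrite gt_eqF.
    lra.
  by move=> /(itg_lt_exists TT ui')[x xT h]; exists x => _; split => //; exact: ltW.
have hx' i : i != tip -> 0 <= x i /\ U i (x i) ^+ 2 <= e.
  by move=> it; have [/andP[Tx _] h] := hx i it; split => //; exact: le_trans (ltW T0) Tx.
have [nu [nu0 nule hcase]] := cut_energy hU Umu bM hx' hb.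
set N2 := \sum_(i | i != tip) _ in nule hcase.
have N2le : N2 <= dl.
  rewrite leNgt; apply/negP => hN2.
  have nu1 : nu <= mu - d1 by lra.
  case: hcase => [hE'|]; last by move=> h; lra.
  have ge : eta <= (mu / nu) `^ q - 1.
    rewrite lerD2r; apply: ge0_ler_powR; rewrite ?nnegrE ?divr_ge0 ?(ltW mu0) ?(ltW nu0) ?(ltW q_gt0)//.
      by rewrite subr_ge0 ltW.
    by rewrite ler_pM2l// lef_pV2 ?posrE ?subr_gt0.
  have g1 : g <= p^-1 * b0 * ((mu / nu) `^ q - 1).
    by rewrite ler_wpM2l// mulr_ge0// ?invr_ge0 ltW.
  have s1 : I + 3 * e * I / mu <= nu / mu * I + N2 / mu * I.
    have -> : I + 3 * e * I / mu = (mu + 3 * e) * (I / mu) by field; rewrite gt_eqF.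
    have -> : nu / mu * I + N2 / mu * I = (nu + N2) * (I / mu) by ring.
    rewrite ler_wnM2r//; first by rewrite mulr_le0_ge0 ?invr_ge0 ?ltW.
    lra.
  move: hE' eC hE g1 s1; rewrite -/q /C.
  have -> : (3 / 2 + 3 * M `^ q - 3 * I / mu) * e = (3 / 2 + 3 * M `^ q) * e - 3 * e * I / mu by ring.
  move: (nu / mu * I) (N2 / mu * I) (p^-1 * b0 * _) ((3 / 2 + 3 * M `^ q) * e) (3 * e * I / mu) (ener p l U G) => z1 z2 z3 z4 z5 z6.
  move: g0; lra.
move=> i it; apply: le_trans N2le; have [/andP[_ x2] _] := hx i it.
have sub : ray (2 * T) `<=` ray (x i) by move=> t; exact: le_trans.
have ui : igr (ray (x i)) (fun t => U i t ^+ 2).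
  have [ui _] := Hr i it; apply: igrS ui => // t; apply: le_trans; by case: (hx' i it).
apply: (@le_trans _ _ (itg (ray (x i)) (fun t => U i t ^+ 2))).
  by apply: itg_sub => // t _; exact: sqr_ge0.
rewrite /N2 (bigD1 i)//= lerDl; apply: sumr_ge0 => j _.
by apply: int_ge0 => t _; exact: sqr_ge0.
Qed.

End tight.

End tightness.

(** * Limits along an ultrafilter and midpoint estimates *)

Section compactness.
Context {R : realType}.
Local Notation MR := (measurableTypeR R).
Local Notation leb := (@lebesgue_measure R).

(** A single ultrafilter provides the limits of all bounded sequences at once, in place of diagonal
    extractions; the limit is the supremum of the thresholds that [a] exceeds [F]-often. *)
Lemma ultra_lim (F : set_system nat) (a : nat -> R) (M : R) : UltraFilter F ->
  (forall n, `|a n| <= M) -> exists y : R, forall e : R, 0 < e -> F [set n | `|a n - y| < e].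
Proof.
move=> FU aM; pose S := [set t : R | F [set n | t <= a n]].
have ub : ubound S M.
  move=> t /(@filter_ex _ F _)[n /= h]; apply: le_trans h _.
  by apply: le_trans (aM n); exact: ler_norm.
have S0 : S (- M).
  by apply: filterS filterT => n _ /=; have := aM n; rewrite ler_norml => /andP[].
have hS : has_sup S by split; [by exists (- M) | by exists M].
exists (sup S) => e e0.
have [t St ht] := sup_adherent e0 hS.
have h2 : F [set n | a n < sup S + e / 2].
  case: (in_ultra_setVsetC [set n | sup S + e / 2 <= a n] FU) => [h|h].
    have : sup S + e / 2 <= sup S by apply: ub_le_sup; [exists M|exact: h].
    by move=> h'; exfalso; lra.
  by apply: filterS h => n /= /negP; rewrite -ltNge.
apply: filterS (filterI St h2) => n /= [h3 h4].
by rewrite ltr_norml; apply/andP; split; lra.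
Qed.

Context (p : R) (p2 : 2 < p) (p6 : p < 6).
Let p_gt0 : 0 < p. Proof. by apply: lt_trans p2. Qed.

(** The Hölder bound keeps [|U| >= c / 2] on a segment of length [d] ending or starting at [x]:
    [d * A <= (c / 2)^2], and [d <= l / 2] leaves room on one side of [x]. *)
Lemma tip_lower (l A c : R) : 0 < l -> 0 <= A -> 0 < c -> exists2 b0 : R, 0 < b0 &
  forall U G, inH l U G -> sqn l G <= A -> (exists2 x : R, 0 <= x <= l & c <= `|U tip x|) ->
  b0 <= itg (sgm 0 l) (fun t => `|U tip t| `^ p).
Proof.
move=> l0 A0 c0; pose d := Num.min (l / 2) (c ^+ 2 / (4 * (A + 1))).
have A1 : 0 < A + 1 by rewrite ltr_wpDl.
have d0 : 0 < d by rewrite lt_min !divr_gt0// ?exprn_gt0// mulr_gt0.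
have dl : d <= l / 2 by rewrite ge_min lexx.
have dA : d * A <= (c / 2) ^+ 2.
  have : d <= c ^+ 2 / (4 * (A + 1)) by rewrite ge_min lexx orbT.
  rewrite ler_pdivlMr ?mulr_gt0// => h.
  have -> : (c / 2) ^+ 2 = c ^+ 2 / 4 by field.
  by rewrite ler_pdivlMr//; nra.
exists ((c / 2) `^ p * d); first by rewrite mulr_gt0// powR_gt0// divr_gt0.
move=> U G hU hA [x /andP[x0 xl] cx].
have ed := edge_dom tip (ltW l0); have ht := hU.1 tip; rewrite dom_tip in ed ht.
have [a [a0 al ax]] : exists a : R, [/\ 0 <= a, a + d <= l & forall t : R, a <= t <= a + d -> `|t - x| <= d].
  case: (leP x (l / 2)) => xl2.
    exists x; split => //; first lra.
    by move=> t /andP[h1 h2]; rewrite ger0_norm ?subr_ge0//; lra.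
  exists (x - d); split; [lra|by rewrite subrK|].
  by move=> t; rewrite subrK => /andP[h1 h2]; rewrite distrC ger0_norm ?subr_ge0//; lra.
have sub : sgm a (a + d) `<=` sgm 0 l by exact: sgm_sub.
have gle : itg (sgm 0 l) (fun t => G tip t ^+ 2) <= A.
  apply: le_trans hA; rewrite /sqn (bigD1 tip)//= dom_tip lerDl; apply: sumr_ge0 => j _.
  by apply: int_ge0 => t _; exact: sqr_ge0.
have low (t : R) : a <= t <= a + d -> c / 2 <= `|U tip t|.
  move=> tad; have xd : sgm 0 l x by rewrite /sgm /= x0.
  have hh := H1_holder ed ht xd (sub t tad).
  have : (U tip t - U tip x) ^+ 2 <= (c / 2) ^+ 2.
    apply: le_trans hh (le_trans _ dA); apply: ler_pM => //.
      by apply: int_ge0 => s _; exact: sqr_ge0.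
    exact: ax.
  move=> /sqr_le_norm; rewrite divr_ge0 ?(ltW c0)// => /(_ isT) h.
  have := lerB_dist (U tip x) (U tip t); rewrite distrC; lra.
have [M M0 bM] := inH_bounded (ltW l0) hU.
have pi : igr (sgm 0 l) (fun t => `|U tip t| `^ p).
  apply: (igr_powp p2 (msgm 0 l) (H1_sq ed ht)) => t tl; apply: (bM tip); by rewrite dom_tip.
apply: le_trans (itg_sub (msgm 0 l) (msgm _ _) sub pi (fun t _ => powR_ge0 _ _)).
have -> : (c / 2) `^ p * d = itg (sgm a (a + d)) (fun=> (c / 2) `^ p).
  by rewrite int_cst ?lerDl ?(ltW d0)//; congr (_ * _); ring.
apply: int_le => //; [exact: igr_cst|exact: igrS pi|].
move=> t /low h; apply: ge0_ler_powR; rewrite ?nnegrE ?(ltW p_gt0)//.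
by rewrite divr_ge0// ltW.
Qed.

(** A function of smaller mass is scaled up to mass [mu], and both resulting terms help because
    [I <= 0]. This serves for midpoints, whose mass may drop. *)
Lemma relaxed (l mu I : R) U G : 0 <= l -> 0 < mu -> I <= 0 ->
  (forall V K, inH l V K -> sqn l V = mu -> I <= ener p l V K) ->
  inH l U G -> sqn l U <= mu -> I <= ener p l U G.
Proof.
move=> l0 mu0 I0 hI hU le; have [M M0 bM] := inH_bounded l0 hU.
have B0 := pn_ge0 p l U; have A0 := sqn_ge0 l G.
have := sqn_ge0 l U; rewrite le_eqVlt => /orP[/eqP z|n0].
  have := pn_le p2 l0 hU bM; rewrite -z mulr0 => B1.
  have -> : ener p l U G = 2^-1 * sqn l G.
    by rewrite /ener (_ : pn p l U = 0) ?mulr0 ?subr0//; apply/eqP; rewrite eq_le B1.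
  by apply: le_trans I0 _; rewrite mulr_ge0// invr_ge0.
apply: le_trans (scaling p2 l0 mu0 hI hU n0).
set y := (mu / sqn l U) `^ _.
have y1 : 1 <= y.
  have q0 : 0 <= p / 2 - 1 by rewrite subr_ge0 ler_pdivlMr// mul1r ltW.
  have := @ge0_ler_powR R (p / 2 - 1) q0 1 (mu / sqn l U).
  rewrite powR1 !nnegrE ler01 divr_ge0 ?(ltW mu0) ?(ltW n0)//; apply => //.
  by rewrite ler_pdivlMr// mul1r.
have g0 : 0 <= p^-1 * pn p l U * (y - 1).
  by apply: mulr_ge0; [rewrite mulr_ge0// invr_ge0 ltW|rewrite subr_ge0].
have : I <= sqn l U / mu * I.
  have h : sqn l U / mu <= 1 by rewrite ler_pdivrMr// mul1r.
  have h0 : 0 <= sqn l U / mu by rewrite divr_ge0// ltW.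
  by nra.
by move: g0; lra.
Qed.

Lemma midpoint_arith (th mu k E nW I D sG sK nL bU bV bW : R) :
  0 < th -> 0 <= k -> 0 <= E -> nW <= mu ->
  nL = 2^-1 * sG + 2^-1 * sK - 4^-1 * D -> I <= 2^-1 * nL - p^-1 * bW ->
  bU - bW <= p * k * (th * (mu + nW) + th^-1 * (4^-1 * E)) ->
  bV - bW <= p * k * (th * (mu + nW) + th^-1 * (4^-1 * E)) ->
  D <= 4 * (2^-1 * sG - p^-1 * bU + (2^-1 * sK - p^-1 * bV) - 2 * I) +
    8 * (k * (th * (2 * mu) + th^-1 * E)).
Proof.
move=> t0 k0 E0 Wmu pL EW d1 d2; have t1 : 0 < th^-1 by rewrite invr_gt0.
have up : th * (mu + nW) + th^-1 * (4^-1 * E) <= th * (2 * mu) + th^-1 * E.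
  apply: lerD; first by rewrite (ler_pM2l t0); move: Wmu; lra.
  by rewrite (ler_pM2l t1); move: E0; lra.
move: up d1 d2; set Y := th * (mu + nW) + _; set Z := th * (2 * mu) + _ => up d1 d2.
have pk0 : 0 <= p * k by rewrite mulr_ge0// ltW.
have q (b : R) : b - bW <= p * k * Y -> p^-1 * b - p^-1 * bW <= k * Z.
  move=> h; rewrite -mulrBr [p^-1 * _]mulrC ler_pdivrMr//.
  apply: le_trans h (le_trans (ler_wpM2l pk0 up) _).
  by rewrite le_eqVlt; apply/orP; left; apply/eqP; ring.
have r1 := q _ d1; have r2 := q _ d2; rewrite pL in EW.
move: EW r1 r2; move: (p^-1 * bU) (p^-1 * bV) (p^-1 * bW) (k * Z) => z1 z2 z3 z4; lra.
Qed.

(** The midpoint of [U] and [V] has mass at most [mu], hence energy at least [I]. The parallelogram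
    identity turns this into a bound on the distance of the derivatives, the [L^p] terms being
    controlled by the [L^2] distance of [U] and [V]. *)
Lemma grad_close (l mu I M : R) U G V K : 0 < l -> 0 < mu -> I <= 0 -> 0 < M ->
  (forall V K, inH l V K -> sqn l V = mu -> I <= ener p l V K) ->
  inH l U G -> inH l V K -> sqn l U = mu -> sqn l V = mu -> bnd l U M -> bnd l V M ->
  forall th : R, 0 < th ->
  sqn l (lin 1 G (-1) K) <= 4 * (ener p l U G + ener p l V K - 2 * I) +
    8 * (M `^ (p - 2) * (th * (2 * mu) + th^-1 * sqn l (lin 1 U (-1) V))).
Proof.
move=> l0 mu0 I0 M0 hI hU hV Umu Vmu bU bV th t0.
have sU := inH_sqg (ltW l0) hU; have sV := inH_sqg (ltW l0) hV.
have sG := inH_sqgd hU; have sK := inH_sqgd hV.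
set W := lin 2^-1 U 2^-1 V; set L := lin 2^-1 G 2^-1 K.
have hW : inH l W L by exact: inH_lin (ltW l0) hU hV.
have sW := inH_sqg (ltW l0) hW.
have bW : bnd l W M.
  move=> i x dx; rewrite /W /lin; have := bU i x dx; have := bV i x dx.
  by rewrite !ler_norml => /andP[? ?] /andP[? ?]; apply/andP; split; lra.
have pW := sqn_par sU sV; have pL := sqn_par sG sK; rewrite -/W in pW; rewrite -/L in pL.
set D := sqn l (lin 1 G (-1) K) in pL *; set E := sqn l (lin 1 U (-1) V) in pW *.
have E0 : 0 <= E by exact: sqn_ge0.
have Wmu : sqn l W <= mu by rewrite pW Umu Vmu; move: E0; lra.
have EW := relaxed (ltW l0) mu0 I0 hI hW Wmu.
have half (X Y : 'I_4 -> R -> R) : sqg l X -> sqg l Y ->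
    sqn l (lin 1 X (-1) (lin 2^-1 X 2^-1 Y)) = 4^-1 * sqn l (lin 1 X (-1) Y).
  move=> sX sY; rewrite (_ : 4^-1 = (2^-1) ^+ 2); last by field.
  rewrite -sqn_Z; last by move=> i; apply: sqD => //; exact: sqZ.
  by congr sqn; apply/funext => i; apply/funext => x; rewrite /lin; by field.
have d1 := pn_dist p2 t0 sU sW bU bW; rewrite /W half// -/W -/E Umu in d1.
have d2 := pn_dist p2 t0 sV sW bV bW.
have e2 : sqn l (lin 1 V (-1) W) = 4^-1 * E.
  have -> : W = lin 2^-1 V 2^-1 U by apply/funext => i; apply/funext => x; rewrite /W /lin addrC.
  rewrite half// /E; congr (_ * _).
  have -> : lin 1 V (-1) U = (fun i x => -1 * lin 1 U (-1) V i x).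
    by apply/funext => i; apply/funext => x; rewrite /lin; ring.
  rewrite sqn_Z ?sqrrN ?expr1n ?mul1r//.
  by move=> i; apply: sqD => //; exact: sqZ.
rewrite e2 Vmu in d2.
exact: (midpoint_arith t0 (powR_ge0 _ _) E0 Wmu pL EW d1 d2).
Qed.

Lemma grid (T h t : R) (k : nat) : 0 < h -> T <= k%:R * h -> 0 <= t <= T ->
  exists2 j, (j <= k)%N & `|t - j%:R * h| <= h.
Proof.
move=> h0 Th /andP[t0 tT]; pose j := Num.truncn (t / h).
have th0 : 0 <= t / h by rewrite divr_ge0// ltW.
have /andP[j1 j2] := truncn_itv th0; rewrite -/j in j1 j2.
move: j1 j2; rewrite ler_pdivlMr// ltr_pdivrMr// => j1 j2.
exists j.
  have : j%:R * h <= k%:R * h by exact: le_trans j1 (le_trans tT Th).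
  by rewrite ler_pM2r// ler_nat.
rewrite ger0_norm ?subr_ge0//; move: j2; rewrite -natr1 mulrDl mul1r; lra.
Qed.

End compactness.

(** * Convergence of a minimizing sequence *)

Section existence.
Context {R : realType}.
Local Notation MR := (measurableTypeR R).
Local Notation leb := (@lebesgue_measure R).

Lemma small_pow (z C e : R) : 0 < z < 1 -> 0 <= C -> 0 < e -> exists k, C * z ^+ k <= e.
Proof.
move=> /andP[z0 z1] C0 e0.
have h : z ^+ k @[k --> \oo] --> (0 : R).
  by apply: cvg_expr; rewrite ger0_norm ?ltW.
have e10 : 0 < e / (C + 1) by rewrite divr_gt0// ltr_wpDl.
have /cvgrPdist_lt/(_ _ e10)[k _ /(_ k (leqnn k))] := h.
rewrite /= sub0r normrN ger0_norm ?exprn_ge0 ?ltW// ltr_pdivlMr ?ltr_wpDl// => hk.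
exists k; have := exprn_ge0 k (ltW z0); nra.
Qed.

Lemma le_small (x y C : R) : 0 <= C -> (forall th : R, 0 < th -> x <= y + th * C) -> x <= y.
Proof.
move=> C0 h; apply/ler_addgt0Pl => e e0; rewrite addrC.
have t0 : 0 < e / (C + 1) by rewrite divr_gt0// ltr_wpDl.
apply: le_trans (h _ t0) _; rewrite lerD2l mulrAC ler_pdivrMr ?ltr_wpDl//; nra.
Qed.

Lemma quarter01 : 0 < (4^-1 : R) < 1.
Proof. by rewrite invr_gt0 invf_lt1// ltr0n ltr1n. Qed.

Context (p : R) (p2 : 2 < p) (p6 : p < 6).
Let p_gt0 : 0 < p. Proof. by apply: lt_trans p2. Qed.

Section sequence.
Variables (l mu I : R).
Hypotheses (l0 : 0 < l) (mu0 : 0 < mu) (Ile : I <= lev p 2 mu).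
Hypothesis hI : forall V K, inH l V K -> sqn l V = mu -> I <= ener p l V K.
Variables (U G : nat -> 'I_4 -> R -> R) (F : set_system nat) (M A b0 : R).
Hypotheses (FU : UltraFilter F) (Foo : forall N, F [set n | (N <= n)%N]).
Hypotheses (M0 : 0 < M) (A0 : 0 <= A) (b00 : 0 < b0).
Hypothesis hU : forall n, inH l (U n) (G n).
Hypothesis Umu : forall n, sqn l (U n) = mu.
Hypothesis bU : forall n, bnd l (U n) M.
Hypothesis gU : forall n, sqn l (G n) <= A.
Hypothesis tU : forall n, b0 <= itg (sgm 0 l) (fun t => `|U n tip t| `^ p).
Hypothesis eU : forall e : R, 0 < e -> exists N, forall n, (N <= n)%N -> ener p l (U n) (G n) <= I + e.

Let I0 : I < 0. Proof. exact: le_lt_trans Ile (lev_lt0 p2 p6 (ltr0n _ 2) mu0). Qed.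
Let sU n : sqg l (U n). Proof. exact: inH_sqg (ltW l0) (hU n). Qed.
Let sG n : sqg l (G n). Proof. exact: inH_sqgd (hU n). Qed.

Lemma energies (e : R) : 0 < e -> F [set n | ener p l (U n) (G n) <= I + e].
Proof. by move=> /eU[N hN]; apply: filterS (Foo N) => n /= /hN. Qed.

(** The Arzelà-Ascoli argument along the ultrafilter: the bound on the derivatives makes the
    functions equicontinuous, and it suffices to control their values on a finite grid. *)
Lemma local_close (T k : R) i : 0 < T -> 0 < k -> sgm 0 T `<=` dom l i ->
  exists2 S, F S & forall n m, S n -> S m -> forall t : R, 0 <= t <= T -> `|U n i t - U m i t| <= k.
Proof.
move=> T0 k0 Td.
have ed := edge_dom i (ltW l0).
(* Two oscillations over one grid step and two distances to the limit value, each at most [k / 4],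
   add up to [k]. *)
pose h := Num.min T ((k / 4) ^+ 2 / (A + 1)).
have A1 : 0 < A + 1 by rewrite ltr_wpDl.
have h0 : 0 < h by rewrite lt_min T0 divr_gt0// exprn_gt0// divr_gt0.
have hA : h * A <= (k / 4) ^+ 2.
  have : h <= (k / 4) ^+ 2 / (A + 1) by rewrite ge_min lexx orbT.
  by rewrite ler_pdivlMr//; have := ltW h0; nra.
pose K := (Num.truncn (T / h)).+1.
have TK : T <= K%:R * h.
  rewrite -ler_pdivrMr//; have /andP[_ /ltW] := truncn_itv (ltW (divr_gt0 T0 h0)); exact.
pose tt (j : nat) : R := Num.min T (j%:R * h).
have tT j : 0 <= tt j <= T.
  by rewrite /tt le_min (ltW T0) mulr_ge0 ?(ltW h0)//= ge_min lexx.
have bj j n : `|U n i (tt j)| <= M by apply: bU; apply: Td; exact: tT.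
have /choice[y hy] : forall j, exists y : R, forall e : R, 0 < e -> F [set n | `|U n i (tt j) - y| < e].
  by move=> j; exact: (ultra_lim FU (bj j)).
have FS q : F [set n | forall j, (j <= q)%N -> `|U n i (tt j) - y j| < k / 4].
  have k40 : 0 < k / 4 by rewrite divr_gt0.
  elim: q => [|q IH].
    by apply: filterS (hy 0%N _ k40) => n /= h' j; rewrite leqn0 => /eqP ->.
  apply: filterS (filterI IH (hy q.+1 _ k40)) => n /= [h1 h2] j.
  by rewrite leq_eqVlt => /orP[/eqP ->//|]; exact: h1.
exists [set n | forall j, (j <= K)%N -> `|U n i (tt j) - y j| < k / 4] => // n m Sn Sm t tT'.
have [j jK jt] := grid h0 TK tT'.
have jt' : `|t - tt j| <= h.
  rewrite /tt; case: (leP T (j%:R * h)) => // Tj; move: jt; rewrite !ler_norml => /andP[? ?].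
  by move: tT' => /andP[? ?]; apply/andP; split; have := ltW h0; lra.
have hold q : `|U q i t - U q i (tt j)| <= k / 4.
  apply: sqr_le_norm; first by rewrite divr_ge0// ltW.
  have := H1_holder ed ((hU q).1 i) (Td _ (tT j)) (Td _ tT').
  move=> hh; apply: le_trans hh (le_trans _ hA); apply: ler_pM => //.
    by apply: int_ge0 => s _; exact: sqr_ge0.
  apply: le_trans (gU q); rewrite /sqn (bigD1 i)//= lerDl; apply: sumr_ge0 => j' _.
  by apply: int_ge0 => s _; exact: sqr_ge0.
have := hold n; have := hold m; have := Sn j jK; have := Sm j jK.
rewrite !ltr_norml !ler_norml => /andP[? ?] /andP[? ?] /andP[? ?] /andP[? ?].
by apply/andP; split; lra.
Qed.

Lemma sqr_close (e : R) : 0 < e ->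
  exists2 S, F S & forall n m, S n -> S m -> sqn l (lin 1 (U n) (-1) (U m)) <= e.
Proof.
move=> e0; have e320 : 0 < e / 32 by rewrite divr_gt0.
have [T [e1 [T0 e10 tight]]] := tightness p2 p6 l0 mu0 Ile M0 b00 hI e320.
pose TT i := if i == tip then l else T.
have TT0 i : 0 < TT i by rewrite /TT; case: ifP.
have sub i : sgm 0 (TT i) `<=` dom l i.
  by rewrite /TT /dom; case: ifP => _ // x /andP[].
(* Each compact part contributes at most [k^2 (l + T) = e / 8], each tail at most
   [2 (e / 32 + e / 32) = e / 8]; over the tip and three halflines this is [7 e / 8]. *)
pose k := Num.sqrt (e / (8 * (l + T))).
have lT : 0 < l + T by rewrite addr_gt0.
have k0 : 0 < k by rewrite sqrtr_gt0 divr_gt0// mulr_gt0.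
have k2 : k ^+ 2 = e / (8 * (l + T)) by rewrite sqr_sqrtr// divr_ge0 ?mulr_ge0 ?ltW.
have /choice[S hS] : forall i, exists S, F S /\ forall n m, S n -> S m ->
    forall t : R, 0 <= t <= TT i -> `|U n i t - U m i t| <= k.
  by move=> i; have [S FS hS] := local_close (TT0 i) k0 (sub i); exists S.
have FI : F [set n | forall i, S i n].
  have FS q : F [set n | forall i : 'I_4, (i < q)%N -> S i n].
    elim: q => [|q IH]; first by apply: filterS filterT.
    case: (ltnP q 4) => q4; last by apply: filterS IH => n hn i _; apply: hn; exact: leq_trans (ltn_ord i) q4.
    have [Fq _] := hS (Ordinal q4).
    apply: filterS (filterI IH Fq) => n /= [h1 h2] i; rewrite ltnS leq_eqVlt => /orP[/eqP iq|]; last exact: h1.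
    by have -> : i = Ordinal q4 by apply/val_inj.
  by apply: filterS (FS 4%N) => n hn i; apply: hn; exact: ltn_ord.
exists ([set n | forall i, S i n] `&` [set n | ener p l (U n) (G n) <= I + e1]).
  by apply: filterI => //; exact: energies.
move=> n m [Sn En] [Sm Em].
pose D i x := lin 1 (U n) (-1) (U m) i x ^+ 2.
have sD i : sq (dom l i) (lin 1 (U n) (-1) (U m) i).
  by apply: sqD => //; apply: sqZ => //; exact: sU.
have loc i : itg (sgm 0 (TT i)) (D i) <= e / 8.
  have -> : e / 8 = k ^+ 2 * (l + T) by rewrite k2; field; rewrite gt_eqF.
  apply: (@le_trans _ _ (k ^+ 2 * (TT i - 0))); last first.
    rewrite ler_wpM2l ?sqr_ge0// subr0 /TT; case: ifP => _; [rewrite lerDl|rewrite lerDr]; exact: ltW.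
  rewrite -int_cst ?(ltW (TT0 i))//; apply: int_le => //.
  - by apply: igrS (sub i) _ => //; case: (sD i).
  - exact: igr_cst.
  - move=> t tT; rewrite /D /lin mul1r mulN1r; have [_ hSi] := hS i.
    have := hSi n m (Sn i) (Sm i) t tT.
    by rewrite ler_norml => /andP[? ?]; nra.
rewrite /sqn sum_tip.
have ht : itg (dom l tip) (D tip) <= e / 8 by have := loc tip; rewrite /TT eqxx dom_tip.
have hr i : i != tip -> itg (dom l i) (D i) <= e / 4.
  move=> it; rewrite dom_ray//; have iD : igr (ray 0) (D i) by have := (sD i).2; rewrite dom_ray.
  rewrite (int_split_ray (ltW T0) iD).
  have h1 : itg (sgm 0 T) (D i) <= e / 8 by have := loc i; rewrite /TT (negPf it).
  have sub' : ray T `<=` ray 0 by move=> x; exact: le_trans (ltW T0).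
  have iu q : igr (ray T) (fun t => U q i t ^+ 2).
    by have := (sU q i).2; rewrite dom_ray// => h; apply: igrS h.
  have h2 : itg (ray T) (D i) <= e / 8.
    apply: (@le_trans _ _ (itg (ray T) (fun t => 2 * (U n i t ^+ 2 + U m i t ^+ 2)))).
      apply: int_le => //; first exact: igrS iD.
        by apply: igrZ => //; exact: igrD.
      move=> t _; rewrite /D /lin mul1r mulN1r.
      by have := sqr_ge0 (U n i t + U m i t); nra.
    have hn := tight _ _ (hU n) (Umu n) (@bU n) (tU n) En i it.
    have hm := tight _ _ (hU m) (Umu m) (@bU m) (tU m) Em i it.
    rewrite intZ//; last exact: igrD.
    by rewrite intD//; lra.
  by lra.
have := sum_ray hr; rewrite /D in ht *; move: ht; rewrite /D.
move: (\sum_(i | _) _) (itg _ _) => z1 z2; move: e0; lra.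
Qed.

Lemma both_close (e : R) : 0 < e -> exists2 S, F S & forall n m, S n -> S m ->
  sqn l (lin 1 (U n) (-1) (U m)) <= e /\ sqn l (lin 1 (G n) (-1) (G m)) <= e.
Proof.
move=> e0; set k := M `^ (p - 2); have k0 : 0 <= k by exact: powR_ge0.
have k1 : 0 < k + 1 by rewrite ltr_wpDl.
(* In [grad_close] the energies account for [e / 2], and [th] and [d] are tuned so that each of the
   two remaining terms accounts for [e / 4]. *)
pose th := e / (64 * (k + 1) * mu).
have th0 : 0 < th by rewrite divr_gt0// !mulr_gt0.
pose d := Num.min e (th * e / (32 * (k + 1))).
have d0 : 0 < d by rewrite lt_min e0 divr_gt0// mulr_gt0.
have [S FS hS] := sqr_close d0.
have e160 : 0 < e / 16 by rewrite divr_gt0.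
exists (S `&` [set n | ener p l (U n) (G n) <= I + e / 16]).
  by apply: filterI => //; exact: energies.
move=> n m [Sn En] [Sm Em]; have hd := hS n m Sn Sm; split.
  by apply: le_trans hd _; rewrite ge_min lexx.
have := grad_close p2 l0 mu0 (ltW I0) M0 hI (hU n) (hU m) (Umu n) (Umu m) (@bU n) (@bU m) th0.
rewrite -/k; set D := sqn l (lin 1 (U n) (-1) (U m)) in hd *.
move=> h; apply: le_trans h _.
have D0 : 0 <= D by exact: sqn_ge0.
have t1 : k * (th * (2 * mu)) <= e / 32.
  have -> : e / 32 = (k + 1) * (th * (2 * mu)) by rewrite /th; field; rewrite !gt_eqF.
  apply: ler_wpM2r; last by rewrite lerDl.
  by apply: mulr_ge0; [exact: ltW|rewrite mulr_ge0// ltW].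
have t2 : k * (th^-1 * D) <= e / 32.
  have hd' : D <= th * e / (32 * (k + 1)) by apply: le_trans hd _; rewrite ge_min lexx orbT.
  have -> : e / 32 = (k + 1) * (th^-1 * (th * e / (32 * (k + 1)))).
    by field; rewrite !gt_eqF.
  have hd2 : th^-1 * D <= th^-1 * (th * e / (32 * (k + 1))).
    by rewrite ler_pM2l// invr_gt0.
  apply: ler_pM => //; last by rewrite lerDl.
  by rewrite mulr_ge0// invr_ge0 ltW.
move: En Em => /=; rewrite [k * (_ + _)]mulrDr.
move: (ener p l (U n) (G n)) (ener p l (U m) (G m)) (k * (th * (2 * mu))) (k * (th^-1 * D)) t1 t2.
move=> z1 z2 z3 z4; lra.
Qed.

(** The index [ph k] is taken in the intersection of the first [k + 1] sets of the ultrafilter, so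
    that [ph k] and every later [ph m] lie in the [k]-th set; monotonicity of [ph] is not asked
    for. *)
Lemma subsequence : exists (ph : nat -> nat) (y : R), forall k,
  [/\ forall m, (k <= m)%N -> sqn l (lin 1 (U (ph k)) (-1) (U (ph m))) <= (4^-1) ^+ k,
      forall m, (k <= m)%N -> sqn l (lin 1 (G (ph k)) (-1) (G (ph m))) <= (4^-1) ^+ k,
      `|U (ph k) tip 0 - y| <= (4^-1) ^+ k & ener p l (U (ph k)) (G (ph k)) <= I + (4^-1) ^+ k].
Proof.
have d0 : dom l tip 0 by have [] := edge_dom tip (ltW l0).
have [y hy] := ultra_lim FU (fun n => @bU n tip 0 d0).
have q0 k : 0 < (4^-1 : R) ^+ k by rewrite exprn_gt0// invr_gt0.
have /choice[S hS] : forall k, exists S, F S /\ forall n, S n ->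
    [/\ forall m, S m -> sqn l (lin 1 (U n) (-1) (U m)) <= (4^-1) ^+ k,
      forall m, S m -> sqn l (lin 1 (G n) (-1) (G m)) <= (4^-1) ^+ k,
      `|U n tip 0 - y| <= (4^-1) ^+ k & ener p l (U n) (G n) <= I + (4^-1) ^+ k].
  move=> k; have [S FS hS] := both_close (q0 k).
  exists (S `&` [set n | `|U n tip 0 - y| < (4^-1) ^+ k] `&`
    [set n | ener p l (U n) (G n) <= I + (4^-1) ^+ k]); split.
    by do 2 ?[apply: filterI => //]; [exact: hy|exact: energies].
  move=> n [[Sn /= h1] h2]; split => //; [| |exact: ltW].
  - by move=> m [[Sm _] _]; have [] := hS n m Sn Sm.
  - by move=> m [[Sm _] _]; have [] := hS n m Sn Sm.
have FS k : F [set n | forall j, (j <= k)%N -> S j n].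
  elim: k => [|k IH].
    by have [F0 _] := hS 0%N; apply: filterS F0 => n h j; rewrite leqn0 => /eqP ->.
  have [Fk _] := hS k.+1; apply: filterS (filterI IH Fk) => n [h1 h2] j.
  by rewrite leq_eqVlt => /orP[/eqP ->//|]; exact: h1.
have /choice[ph hph] : forall k, exists n, forall j, (j <= k)%N -> S j n.
  by move=> k; have [n hn] := filter_ex (FS k); exists n.
exists ph, y => k; have [_ hk] := hS k; have [h1 h2 h3 h4] := hk _ (hph k k (leqnn k)).
by split => // m km; [apply: h1|apply: h2]; exact: hph.
Qed.

(** The limit is built from its derivative: [K] is the [L^2] limit of the derivatives and [V] its
    primitive starting from the limit [y] of the vertex values. Pointwise convergence follows, and
    Fatou upgrades it to [L^2]; the factor [4] counts the edges. *)
Lemma limit_exists : exists V K, [/\ inH l V K, bnd l V M &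
  exists ph : nat -> nat, forall k,
  [/\ sqn l (lin 1 (U (ph k)) (-1) V) <= 4 * (4^-1) ^+ k,
      sqn l (lin 1 (G (ph k)) (-1) K) <= 4 * (4^-1) ^+ k &
      ener p l (U (ph k)) (G (ph k)) <= I + (4^-1) ^+ k]].
Proof.
have [ph [y hph]] := subsequence.
have ed i := edge_dom i (ltW l0).
have part (X : 'I_4 -> R -> R) i : itg (dom l i) (fun x => X i x ^+ 2) <= sqn l X.
  rewrite /sqn (bigD1 i)//= lerDl; apply: sumr_ge0 => j _.
  by apply: int_ge0 => s _; exact: sqr_ge0.
have lE (X Y : 'I_4 -> R -> R) i : (fun x => (X i x - Y i x) ^+ 2) = (fun x => lin 1 X (-1) Y i x ^+ 2).
  by apply/funext => x; rewrite /lin mul1r mulN1r.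
have /choice[K hK] : forall i, exists K : R -> R, sq (dom l i) K /\
    forall k, itg (dom l i) (fun x => (G (ph k) i x - K x) ^+ 2) <= (4^-1) ^+ k.
  move=> i; have [|k m km|K sK hK] := @riesz_fischer R (dom l i) (fun k => G (ph k) i) (mdom l i).
  - by move=> k; exact: sG.
  - by rewrite lE; apply: le_trans (part _ i) _; have [_ h _ _] := hph k; exact: h.
  - by exists K.
pose V i x := y + itg (sgm 0 x) (K i).
have V0 i : V i 0 = y by rewrite /V int_pt addr0.
have sKs i (x : R) : dom l i x -> sq (sgm 0 x) (K i).
  by move=> dx; have [sK _] := hK i; apply: sqS sK => //; exact: edge_sub (ed i) dx (lexx 0).
have dom0 i (x : R) : dom l i x -> 0 <= x by have [_ h _ _] := ed i; exact: h.
have acV i (x : R) : dom l i x -> acf 0 x (V i) (K i).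
  move=> dx; split; first exact: sq_igr (sKs i x dx).
  by move=> t _; rewrite V0.
have close i x k : dom l i x -> (U (ph k) i x - V i x) ^+ 2 <= (2 + 2 * x) * (4^-1) ^+ k.
  move=> dx; have x0 := dom0 i x dx.
  have acU := H1_acf (ed i) ((hU (ph k)).1 i) (lexx 0) x0 dx.
  have acD := acf_lin 1 (-1) acU (acV i x dx).
  have sub := edge_sub (ed i) dx (lexx 0).
  have sd : sq (dom l i) (fun x => 1 * G (ph k) i x + -1 * K i x).
    by apply: sqD => //; apply: sqZ => //; [exact: sG|have [] := hK i].
  have hh := acf_holder x0 acD (sqS (mdom l i) (msgm 0 x) sub sd).
  rewrite /= V0 subr0 !mul1r !mulN1r in hh.
  have le4 : itg (sgm 0 x) (fun t => (1 * G (ph k) i t + -1 * K i t) ^+ 2) <= (4^-1) ^+ k.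
    have [_ hKk] := hK i; apply: le_trans (hKk k).
    have -> : (fun x => (G (ph k) i x - K i x) ^+ 2) = (fun x => (1 * G (ph k) i x + -1 * K i x) ^+ 2).
      by apply/funext => t; rewrite mul1r mulN1r.
    by apply: itg_sub => //; [case: sd|move=> t _; exact: sqr_ge0].
  have [_ _ h3 _] := hph k; rewrite (hU (ph k)).2 in hh.
  have q1 : (4^-1 : R) ^+ k <= 1 by rewrite exprn_ile1// ?invr_ge0// invf_le1// ler1n.
  have q0 : 0 <= (4^-1 : R) ^+ k by rewrite exprn_ge0// invr_ge0.
  set a := U (ph k) i x - V i x in hh *; set b := U (ph k) tip 0 - y in hh h3 *.
  have b2 : b ^+ 2 <= (4^-1) ^+ k.
    rewrite -real_normK ?num_real//; have := normr_ge0 b; nra.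
  have h5 : (a - b) ^+ 2 <= x * (4^-1) ^+ k by apply: le_trans hh _; rewrite ler_wpM2l.
  by have := sqr_ge0 (a - 2 * b); nra.
have cvgV i x : dom l i x -> U (ph k) i x @[k --> \oo] --> V i x.
  move=> dx; apply/cvgrPdist_le => e e0.
  have x0 := dom0 i x dx.
  have C0 : 0 <= 2 + 2 * x by rewrite addr_ge0// mulr_ge0.
  have [k0 hk0] := small_pow quarter01 C0 (exprn_gt0 2 e0).
  exists k0 => //= k kk; rewrite distrC; apply: sqr_le_norm; first exact: ltW.
  apply: le_trans (close i x k dx) (le_trans _ hk0); rewrite ler_wpM2l//.
  by have /andP[a0 a1] := quarter01; apply: ler_wiXn2l; rewrite ?ltW.
have bV : bnd l V M.
  move=> i x dx; apply/ler_addgt0Pl => e e0.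
  have /cvgrPdist_le/(_ e e0)[k0 _ /(_ k0 (leqnn k0)) /= h] := cvgV i x dx.
  have := @bU (ph k0) i x dx; move: h; rewrite !ler_norml => /andP[? ?] /andP[? ?].
  by apply/andP; split; lra.
have fat i k : igr (dom l i) (fun x => (U (ph k) i x - V i x) ^+ 2) /\
    itg (dom l i) (fun x => (U (ph k) i x - V i x) ^+ 2) <= (4^-1) ^+ k.
  apply: (@itg_fatou R (dom l i) (fun m x => (U (ph k) i x - U (ph (m + k)%N) i x) ^+ 2)) => //.
  - by move=> m; case: (sqB (mdom l i) (sU (ph k) i) (sU (ph (m + k)%N) i)).
  - by move=> m x _; exact: sqr_ge0.
  - move=> m; rewrite lE; apply: le_trans (part _ i) _; have [h _ _ _] := hph k; apply: h.
    exact: leq_addl.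
  - move=> x dx; have c1 := cvgV i x dx; rewrite -(cvg_shiftn k) in c1.
    have c2 : (U (ph k) i x - U (ph (m + k)%N) i x) @[m --> \oo] --> U (ph k) i x - V i x.
      by apply: cvgB => //; exact: cvg_cst.
    exact: (cvgM c2 c2).
have cV i : cont_on (dom l i) (V i).
  have [mK _] := hK i.
  move=> x dx e e0; set N := itg (dom l i) (fun x => K i x ^+ 2).
  have N0 : 0 <= N by apply: int_ge0 => ? _; exact: sqr_ge0.
  exists (e ^+ 2 / (N + 1)); first by rewrite divr_gt0 ?exprn_gt0// ltr_wpDl.
  move=> t dt; rewrite ltr_pdivlMr ?ltr_wpDl// => tx; apply: sqr_lt_norm; first exact: ltW.
  have gen (a b : R) : dom l i a -> dom l i b -> a <= b -> (V i b - V i a) ^+ 2 <= (b - a) * N.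
    move=> da db ab; have a0 := dom0 i a da.
    have acab := acf_sub (acV i b db) a0 ab (lexx b).
    have sub := edge_sub (ed i) db a0.
    apply: le_trans (acf_holder ab acab (sqS (mdom l i) (msgm a b) sub mK)) _.
    rewrite ler_wpM2l ?subr_ge0//; apply: itg_sub => //; first by case: mK.
    by move=> s _; exact: sqr_ge0.
  have : (V i t - V i x) ^+ 2 <= `|t - x| * N.
    case: (leP x t) => xt; first by rewrite ger0_norm ?subr_ge0// gen.
    have h := gen t x dt dx (ltW xt).
    by rewrite distrC [`|x - t|]ger0_norm ?subr_ge0 ?(ltW xt)// -(opprB (V i x) (V i t)) sqrrN.
  by have := normr_ge0 (t - x); nra.
have sV i : sq (dom l i) (V i).
  have s1 : sq (dom l i) (fun x => U (ph 0%N) i x - V i x).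
    split; last by have [] := fat i 0%N.
    by apply: measurable_funB; [case: (sU (ph 0%N) i)|exact: cont_on_meas].
  have := sqB (mdom l i) (sU (ph 0%N) i) s1; congr sq; apply/funext => x; ring.
exists V, K; split => //.
  split => i; last by rewrite !V0.
  have [[mK iK] _] := hK i; split; first by case: (sV i).
  split => //; split => // x dx; split; first exact: sq_igr (sKs i x dx).
  by rewrite V0.
exists ph => k.
have s4 (X : 'I_4 -> R -> R) (c : R) : (forall i, itg (dom l i) (fun x => X i x ^+ 2) <= c) -> sqn l X <= 4 * c.
  move=> hX; rewrite /sqn; apply: (@le_trans _ _ (\sum_(i < 4) c)); first exact: ler_sum.
  by rewrite sumr_const card_ord mulr_natl.
have [_ _ _ h4] := hph k; split => //.
- by apply: s4 => i; rewrite -lE; have [] := fat i k.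
- by apply: s4 => i; rewrite -lE; have [_ h] := hK i; exact: h.
Qed.

Lemma minimizer_exists : exists V K, [/\ inH l V K, sqn l V = mu & ener p l V K = I].
Proof.
have [V [K [hV bV [ph hph]]]] := limit_exists.
have sV := inH_sqg (ltW l0) hV; have sK := inH_sqgd hV.
have flip (X Y : 'I_4 -> R -> R) : sqg l X -> sqg l Y -> sqn l (lin 1 Y (-1) X) = sqn l (lin 1 X (-1) Y).
  move=> sX sY; have -> : lin 1 Y (-1) X = (fun i x => -1 * lin 1 X (-1) Y i x).
    by apply/funext => i; apply/funext => x; rewrite /lin; ring.
  rewrite sqn_Z ?sqrrN ?expr1n ?mul1r//.
  by move=> i; apply: sqD => //; exact: sqZ.
(* The distance estimates hold up to a weight [th]; one lets [k] tend to infinity first, then [th]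
   to [0]. *)
have vanish (x y C : R) : 0 <= C -> (forall th : R, 0 < th -> exists2 D : R, 0 <= D &
    forall k, x <= y + th * C + D * (4^-1) ^+ k) -> x <= y.
  move=> C0 h; apply: (le_small C0) => th t0; have [D D0 hD] := h th t0.
  apply/ler_addgt0Pl => e e0; have [k hk] := small_pow quarter01 D0 e0.
  by apply: le_trans (hD k) _; rewrite addrC lerD2r.
have Vmu : sqn l V = mu.
  apply/eqP; rewrite eq_le; apply/andP; split.
    apply: (vanish _ _ mu (ltW mu0)) => th t0.
    exists ((1 + th^-1) * 4); first by rewrite mulr_ge0// addr_ge0// invr_ge0 ltW.
    move=> k; have := sqn_dist t0 sV (sU (ph k)); rewrite (flip _ _ (sU (ph k)) sV) Umu.
    have [h _ _] := hph k => h'; apply: le_trans h' _; rewrite mulrDl mul1r lerD2l -mulrA ler_wpM2l//.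
    by rewrite addr_ge0// invr_ge0 ltW.
  apply: (vanish _ _ (sqn l V) (sqn_ge0 _ _)) => th t0.
  exists ((1 + th^-1) * 4); first by rewrite mulr_ge0// addr_ge0// invr_ge0 ltW.
  move=> k; have := sqn_dist t0 (sU (ph k)) sV; rewrite Umu.
  have [h _ _] := hph k => h'; apply: le_trans h' _; rewrite mulrDl mul1r lerD2l -mulrA ler_wpM2l//.
  by rewrite addr_ge0// invr_ge0 ltW.
exists V, K; split => //; apply/eqP; rewrite eq_le; apply/andP; split; last exact: hI.
set q := M `^ (p - 2); have q0 : 0 <= q by exact: powR_ge0.
have C0 : 0 <= A / 2 + q * (2 * mu) by rewrite addr_ge0 ?divr_ge0// !mulr_ge0// ltW.
apply: (vanish _ _ _ C0) => th t0; have ti : 0 < th^-1 by rewrite invr_gt0.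
exists (1 + (1 + th^-1) * 2 + q * (th^-1 * 4)).
  by rewrite !addr_ge0// !mulr_ge0// ?addr_ge0// ltW.
move=> k; have [h1 h2 h3] := hph k.
have a1 := sqn_dist t0 sK (sG (ph k)); rewrite (flip _ _ (sG (ph k)) sK) in a1.
have a2 := pn_dist p2 t0 (sU (ph k)) sV (@bU (ph k)) bV; rewrite Umu Vmu -/q in a2.
have b1 : (1 + th^-1) * sqn l (lin 1 (G (ph k)) (-1) K) <= (1 + th^-1) * (4 * (4^-1) ^+ k).
  by rewrite ler_wpM2l// addr_ge0// ltW.
have b2 : th * sqn l (G (ph k)) <= th * A by rewrite ler_wpM2l ?(ltW t0)// gU.
have b3 : p^-1 * (pn p l (U (ph k)) - pn p l V) <= q * (th * (2 * mu) + th^-1 * (4 * (4^-1) ^+ k)).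
  rewrite [p^-1 * _]mulrC ler_pdivrMr//; apply: le_trans a2 _.
  have -> : q * (th * (2 * mu) + th^-1 * (4 * 4^-1 ^+ k)) * p = p * q * (th * (mu + mu) + th^-1 * (4 * 4^-1 ^+ k)) by ring.
  apply: ler_wpM2l; first by rewrite mulr_ge0// ltW.
  by rewrite lerD2l ler_wpM2l// ltW.
move: h3 a1 b1 b2 b3; rewrite /ener !mulrBr.
move: (sqn l (G (ph k))) (sqn l K) (p^-1 * pn p l (U (ph k))) (p^-1 * pn p l V)
  (sqn l (lin 1 (G (ph k)) (-1) K)) ((4^-1 : R) ^+ k) => z1 z2 z3 z4 z5 z6.
move=> e1 e2 e3 e4 e5.
have -> : I + th * (A / 2 + q * (2 * mu)) + (1 + (1 + th^-1) * 2 + q * (th^-1 * 4)) * z6 =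
  I + z6 + 2^-1 * (th * A) + 2^-1 * ((1 + th^-1) * (4 * z6)) + q * (th * (2 * mu) + th^-1 * (4 * z6)) by field; rewrite gt_eqF.
move: e2; rewrite mulrDl mul1r; move: e1 e3 e4 e5.
move: (q * _) ((1 + th^-1) * (4 * z6)) ((1 + th^-1) * z5) (th * A) (th * z1) => y1 y2 y3 y4 y5.
lra.
Qed.

End sequence.

End existence.

(** * Lengths with energy below the soliton level *)

Section thresholds.
Context {R : realType}.
Local Notation MR := (measurableTypeR R).
Local Notation leb := (@lebesgue_measure R).

Lemma shorten_arith (a a' b b' L m : R) : 2^-1 * (a + a') - (b + b') < L -> b' <= m / 2 ->
  0 <= a' -> 2^-1 * a - b <= L + m / 2.
Proof. lra. Qed.

Lemma three_small (x y z m : R) : 0 < x -> 0 < y -> 0 < z -> x + y + z <= m / 2 ->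
  [/\ x <= m / 2, y <= m / 2 & z <= m / 2].
Proof. by move=> *; split; lra. Qed.

Lemma neg_half (L m : R) : 0 < m -> m <= - L -> L + m / 2 <= 0.
Proof. lra. Qed.

Lemma half_lt (x a b m : R) : 0 < m -> m <= a -> x <= m / 2 -> b + x = a -> 0 < b.
Proof. lra. Qed.

Lemma half_le (m e L : R) : 0 < m -> m <= e -> L + m / 2 <= L + e.
Proof. lra. Qed.

Lemma half_half (m c : R) : 0 < m -> m <= c -> m / 2 <= c.
Proof. lra. Qed.

Lemma norm_half (a b c : R) : c <= `|a| -> `|a - b| <= c / 2 -> c / 2 <= `|b|.
Proof. by move=> ca h; have := lerB_dist a b; lra. Qed.

Context (p : R) (p2 : 2 < p) (p6 : p < 6).
Let p_gt0 : 0 < p. Proof. by apply: lt_trans p2. Qed.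
Let ip1 : p^-1 <= 1. Proof. by rewrite invf_le1// (le_trans _ (ltW p2))// ler1n. Qed.
Let pm2 : 0 < p - 2. Proof. by rewrite subr_gt0. Qed.

Definition below_soliton (mu l : R) : Prop :=
  exists U G, [/\ inH l U G, sqn l U = mu & ener p l U G < lev p 2 mu].
Definition has_min (mu l : R) : Prop :=
  exists U G, [/\ inH l U G, sqn l U = mu &
    forall V K, inH l V K -> sqn l V = mu -> ener p l U G <= ener p l V K].

Lemma compactness (l mu I c0 : R) : 0 < l -> 0 < mu -> I <= lev p 2 mu -> 0 < c0 ->
  (forall V K, inH l V K -> sqn l V = mu -> I <= ener p l V K) ->
  (forall e : R, 0 < e -> exists U G, [/\ inH l U G, sqn l U = mu, ener p l U G <= I + e &
     exists2 x : R, 0 <= x <= l & c0 <= `|U tip x|]) ->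
  has_min mu l.
Proof.
move=> l0 mu0 Ile c00 hI hE.
have I0 : I < 0 by exact: le_lt_trans Ile (lev_lt0 p2 p6 (ltr0n _ 2) mu0).
(* The shift by [2] keeps [I + ep n] negative from the first index on, as the a priori bounds
   require. *)
pose ep (n : nat) : R := - I / (n.+2)%:R.
have ep0 n : 0 < ep n by rewrite divr_gt0// oppr_gt0.
have /choice[UG hUG] : forall n, exists UG : ('I_4 -> R -> R) * ('I_4 -> R -> R),
    [/\ inH l UG.1 UG.2, sqn l UG.1 = mu, ener p l UG.1 UG.2 <= I + ep n &
     exists2 x : R, 0 <= x <= l & c0 <= `|UG.1 tip x|].
  by move=> n; have [U [G h]] := hE _ (ep0 n); exists (U, G).
pose U n := (UG n).1; pose G n := (UG n).2.
have hU n : inH l (U n) (G n) by case: (hUG n).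
have Umu n : sqn l (U n) = mu by case: (hUG n).
have eneg n : ener p l (U n) (G n) < 0.
  have [_ _ h _] := hUG n; apply: le_lt_trans h _.
  suff : ep n < - I by lra.
  by rewrite ltr_pdivrMr// ltr_pMr ?oppr_gt0// ltr1n.
pose Mx := (mu / (p * Hk p 1)) `^ (2 / (6 - p)).
have Mx0 : 0 < Mx by rewrite powR_gt0// divr_gt0// mulr_gt0// Hk1_gt0.
have bU n : bnd l (U n) Mx.
  have [M hM] := maxval_ex (ltW l0) mu0 (hU n) (Umu n).
  have := maxval_upper p2 p6 (ltW l0) mu0 (hU n) (Umu n) hM (eneg n).
  by move=> h i x dx; have [_ bM _] := hM; exact: le_trans (bM i x dx) h.
pose A := 2 / p * (Mx `^ (p - 2) * mu).
have gU n : sqn l (G n) <= A.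
  exact: (grad_upper p2 (ltW l0) (hU n) (Umu n) (bU n) (eneg n)).
have A0 : 0 <= A by apply: le_trans (gU 0%N); exact: sqn_ge0.
have [b0 b00 hb] := tip_lower p2 l0 A0 c00.
have [F [FU Foo]] := ultraFilterLemma (@eventually_filter).
have Foo' N : F [set n | (N <= n)%N] by apply: Foo; exists N.
have eU e : 0 < e -> exists N, forall n, (N <= n)%N -> ener p l (U n) (G n) <= I + e.
  move=> e0; pose N := Num.truncn (- I / e); exists N => n Nn.
  have [_ _ h _] := hUG n; apply: le_trans h _; rewrite lerD2l ler_pdivrMr//.
  rewrite mulrC -ler_pdivrMr//; have Ie : 0 <= - I / e by rewrite divr_ge0 ?oppr_ge0 ?ltW.
  have /andP[_ /ltW h2] := truncn_itv Ie; apply: le_trans h2 _; rewrite ler_nat.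
  by rewrite ltnS; exact: leq_trans Nn (leqnSn n).
have tU n : b0 <= itg (sgm 0 l) (fun t => `|U n tip t| `^ p).
  by have [_ _ _ hx] := hUG n; exact: hb (hU n) (gU n) hx.
have [V [K [hV Vmu VI]]] := minimizer_exists p2 p6 l0 mu0 Ile hI FU Foo' Mx0 A0 b00 hU Umu bU gU tU eU.
exists V, K; split; [exact: hV|exact: Vmu|].
by move=> W L hW Wmu; rewrite VI; apply: hI.
Qed.

(** Competitors close to the infimum also lie below the soliton level, so their maxima sit on the
    tip, at height at least [c0]; this is the nonvanishing that [compactness] asks for. [Phi 1]
    bounds the energies from below. *)
Lemma below_min (l mu : R) : 0 < l -> 0 < mu -> below_soliton mu l -> has_min mu l.
Proof.
move=> l0 mu0 [U0 [G0 [hU0 U0mu E0]]].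
pose S := [set y : R | exists U G, [/\ inH l U G, sqn l U = mu & y = ener p l U G]].
have lb : lbound S (lev p 1 mu).
  move=> _ [U [G [hU Umu ->]]]; have [M hM] := maxval_ex (ltW l0) mu0 hU Umu.
  apply: le_trans (ener_Phi1 p2 (ltW l0) hU Umu hM).
  by apply: (lev_le p2 p6 ltr01 mu0); case: hM.
have hS : has_inf S by split; [by exists (ener p l U0 G0), U0, G0 | by exists (lev p 1 mu)].
have hI V K : inH l V K -> sqn l V = mu -> inf S <= ener p l V K.
  by move=> hV Vmu; apply: ge_inf; [exists (lev p 1 mu)|exists V, K].
have I2 : inf S < lev p 2 mu by apply: le_lt_trans E0; exact: hI.
have e20 := lev_lt0 p2 p6 (ltr0n _ 2) mu0.
pose c0 := (- lev p 2 mu * p / mu) `^ ((p - 2)^-1).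
have c00 : 0 < c0 by rewrite powR_gt0// divr_gt0// mulr_gt0// oppr_gt0.
apply: (compactness l0 mu0 (ltW I2) c00 hI) => e e0.
have e'0 : 0 < Num.min e (lev p 2 mu - inf S) by rewrite lt_min e0 subr_gt0.
have [_ [U [G [hU Umu ->]]]] := inf_adherent e'0 hS; rewrite -ltrBlDl lt_min => /andP[h1 h2].
exists U, G; split => //; first by rewrite addrC -lerBlDr; exact: ltW.
have E2 : ener p l U G < lev p 2 mu.
  by move: h2; rewrite ltrD2r.
have [M hM] := maxval_ex (ltW l0) mu0 hU Umu.
have [x xl xM] := ener_lev2 p2 p6 (ltW l0) mu0 hU Umu hM E2.
exists x => //; rewrite xM.
apply: le_trans (maxval_lower p2 (ltW l0) mu0 hU Umu hM (lt_trans E2 e20)).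
apply: ge0_ler_powR; rewrite ?nnegrE ?invr_ge0 ?(ltW pm2)//.
- by rewrite divr_ge0 ?mulr_ge0 ?oppr_ge0 ?(ltW p_gt0) ?(ltW mu0) ?(ltW e20).
- by rewrite divr_ge0 ?mulr_ge0 ?oppr_ge0 ?(ltW p_gt0) ?(ltW mu0) ?(ltW (lt_trans E2 e20)).
- by rewrite ler_pM2r ?invr_gt0// ler_pM2r// lerN2 ltW.
Qed.

(** For [k >= 1] one has [k^p >= k^2], so multiplication by [k] sends the energy below [k^2] times
    itself, and the energy is nonpositive. *)
Lemma scale_up (l mu : R) U G : 0 <= l -> inH l U G -> 0 < sqn l U -> sqn l U <= mu ->
  ener p l U G <= 0 -> exists k : R, [/\ 1 <= k, inH l (fun i x => k * U i x) (fun i x => k * G i x),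
    sqn l (fun i x => k * U i x) = mu &
    ener p l (fun i x => k * U i x) (fun i x => k * G i x) <= ener p l U G].
Proof.
move=> l0 hU n0 nmu E0; set nu := sqn l U in n0 nmu *.
have [M M0 bM] := inH_bounded l0 hU.
have sU := inH_sqg l0 hU; have sG := inH_sqgd hU.
pose k := Num.sqrt (mu / nu).
have k2 : k ^+ 2 = mu / nu by rewrite sqr_sqrtr// divr_ge0// ?ltW// (lt_le_trans n0).
have k1 : 1 <= k by rewrite -[leLHS]sqrtr1; apply: ler_wsqrtr; rewrite ler_pdivlMr// mul1r.
have k0 : 0 <= k by exact: le_trans k1.
exists k; split; [exact: k1|exact: (inH_Z k l0 hU)| |].
  by rewrite (sqn_Z k sU) k2 -/nu mulfVK// gt_eqF.
rewrite /ener (sqn_Z k sG) (pn_Z p2 k0 sU bM).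
have kp : k ^+ 2 <= k `^ p by rewrite -powR_mulrn// ler_powR// ltW.
have k21 : 1 <= k ^+ 2 by rewrite exprn_ege1.
move: E0; rewrite /ener; have := pn_ge0 p l U; move: (sqn l G) (pn p l U) => a b b0.
have ip : 0 < p^-1 by rewrite invr_gt0.
have : p^-1 * (k ^+ 2 * b) <= p^-1 * (k `^ p * b) by rewrite ler_pM2l// ler_wpM2r.
rewrite mulrCA; move: (p^-1 * b) (p^-1 * _) (k ^+ 2) k21 => z1 z2 z3 z31 h E; nra.
Qed.

Lemma inH_shorten (l l' : R) U G : 0 <= l -> l <= l' -> inH l' U G -> inH l U G.
Proof.
move=> l0 ll' [hU cU]; split => // i.
apply: H1_restrict (hU i); [exact: edge_dom (le_trans l0 ll')|exact: edge_dom|].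
by rewrite /dom; case: ifP => _; [exact: sgm_sub|exact: subset_refl].
Qed.

Lemma sum_dom_split (l l' : R) (f : 'I_4 -> R -> R) : 0 <= l -> l <= l' ->
  (forall i, igr (dom l' i) (f i)) ->
  \sum_i itg (dom l' i) (f i) = \sum_i itg (dom l i) (f i) + itg (sgm l l') (f tip).
Proof.
move=> l0 ll' hf; rewrite !(@sum_tip R) !dom_tip (@int_split _ 0 l l')//; last first.
  by have := hf tip; rewrite dom_tip.
by rewrite addrAC; congr (_ + _ + _); apply: eq_bigr => i it; rewrite !dom_ray.
Qed.

(** Restricting a function from a slightly longer tip loses little mass and [L^p] norm and no
    kinetic energy in the unfavourable direction; scaling up restores the mass. Since [l] is not
    good, the soliton level is then the infimum. *)
Lemma limit_min (l mu : R) : 0 < l -> 0 < mu -> ~ below_soliton mu l ->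
  (forall d : R, 0 < d -> exists2 l' : R, l < l' < l + d & below_soliton mu l') -> has_min mu l.
Proof.
move=> l0 mu0 nb hb; have e20 := lev_lt0 p2 p6 (ltr0n _ 2) mu0.
pose c0 := (- lev p 2 mu * p / mu) `^ ((p - 2)^-1).
have c00 : 0 < c0 by rewrite powR_gt0// divr_gt0// mulr_gt0// oppr_gt0.
have hI V K : inH l V K -> sqn l V = mu -> lev p 2 mu <= ener p l V K.
  by move=> hV Vmu; rewrite leNgt; apply/negP => h; apply: nb; exists V, K.
have c20 : 0 < c0 / 2 by rewrite divr_gt0.
apply: (compactness l0 mu0 (lexx _) c20 hI) => e e0.
pose Mx := (mu / (p * Hk p 1)) `^ (2 / (6 - p)).
have Mx0 : 0 < Mx by rewrite powR_gt0// divr_gt0// mulr_gt0// Hk1_gt0.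
pose A := 2 / p * (Mx `^ (p - 2) * mu).
have A0 : 0 < A by rewrite mulr_gt0 ?divr_gt0// mulr_gt0// powR_gt0.
pose Q := Mx `^ p + Mx ^+ 2 + A + 1.
have Mp0 : 0 < Mx `^ p by exact: powR_gt0.
have M20 : 0 < Mx ^+ 2 by exact: exprn_gt0.
have Q0 : 0 < Q by rewrite /Q !addr_gt0.
(* Four demands: energy within [e] of the level, energy still nonpositive, mass left after the
   restriction, and a value at least [c0 / 2] at the new end when the maximum was cut off. *)
pose m := Num.min (Num.min e (- lev p 2 mu)) (Num.min mu ((c0 / 2) ^+ 2)).
have m0 : 0 < m by rewrite !lt_min e0 oppr_gt0 e20 mu0 exprn_gt0.
have d0 : 0 < m / (2 * Q) by rewrite divr_gt0// mulr_gt0.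
have [l' /andP[ll' ld] [U [G [hU Umu E2]]]] := hb _ d0.
have l'0 : 0 < l' by exact: lt_trans ll'.
have dQ : (l' - l) * Q <= m / 2.
  have : l' - l <= m / (2 * Q) by rewrite lerBlDl ltW.
  by rewrite ler_pdivlMr ?mulr_gt0//; lra.
have [m1 m2 m3 m4] : [/\ m <= e, m <= - lev p 2 mu, m <= mu & m <= (c0 / 2) ^+ 2].
  by rewrite /m; split; rewrite !ge_min lexx ?orbT.
have dl0 : 0 < l' - l by rewrite subr_gt0.
have E0 : ener p l' U G < 0 by exact: lt_trans E2 e20.
have [M hM] := maxval_ex (ltW l'0) mu0 hU Umu; have [M0 bM _] := hM.
have MMx : M <= Mx := maxval_upper p2 p6 (ltW l'0) mu0 hU Umu hM E0.
have bU : bnd l' U Mx by move=> i x dx; exact: le_trans (bM i x dx) MMx.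
have gA : sqn l' G <= A := grad_upper p2 (ltW l'0) hU Umu bU E0.
have [x xl xM] := ener_lev2 p2 p6 (ltW l'0) mu0 hU Umu hM E2.
have cM : c0 <= M.
  apply: le_trans (maxval_lower p2 (ltW l'0) mu0 hU Umu hM E0).
  apply: ge0_ler_powR; rewrite ?nnegrE ?invr_ge0 ?(ltW pm2)//.
  - by rewrite divr_ge0 ?mulr_ge0 ?oppr_ge0 ?(ltW p_gt0) ?(ltW mu0) ?(ltW e20).
  - by rewrite divr_ge0 ?mulr_ge0 ?oppr_ge0 ?(ltW p_gt0) ?(ltW mu0) ?(ltW E0).
  - by rewrite ler_pM2r ?invr_gt0// ler_pM2r// lerN2 ltW.
have sU := inH_sqg (ltW l'0) hU; have sG := inH_sqgd hU.
have hV := inH_shorten (ltW l0) (ltW ll') hU.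
have sub : sgm l l' `<=` dom l' tip by rewrite dom_tip; apply: sgm_sub => //; exact: ltW.
have m_l' : sqn l' U = sqn l U + itg (sgm l l') (fun x => U tip x ^+ 2).
  by apply: (@sum_dom_split l l' (fun i x => U i x ^+ 2) (ltW l0) (ltW ll')) => i; case: (sU i).
have g_l' : sqn l' G = sqn l G + itg (sgm l l') (fun x => G tip x ^+ 2).
  by apply: (@sum_dom_split l l' (fun i x => G i x ^+ 2) (ltW l0) (ltW ll')) => i; case: (sG i).
have ip i : igr (dom l' i) (fun x => `|U i x| `^ p).
  by apply: (igr_powp p2 (mdom l' i) (sU i)) => y; exact: bU.
have p_l' : pn p l' U = pn p l U + itg (sgm l l') (fun x => `|U tip x| `^ p).
  exact: (@sum_dom_split l l' (fun i x => `|U i x| `^ p) (ltW l0) (ltW ll')).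
have r1 : itg (sgm l l') (fun x => U tip x ^+ 2) <= Mx ^+ 2 * (l' - l).
  rewrite -int_cst ?(ltW ll')//; apply: int_le => //.
  - by apply: igrS sub _ => //; case: (sU tip).
  - exact: igr_cst.
  - move=> t tl; rewrite -real_normK ?num_real// ler_sqr ?nnegrE ?(ltW Mx0)//.
    by apply: bU; exact: sub.
have r2 : itg (sgm l l') (fun x => `|U tip x| `^ p) <= Mx `^ p * (l' - l).
  rewrite -int_cst ?(ltW ll')//; apply: int_le => //.
  - exact: igrS sub (ip tip).
  - exact: igr_cst.
  - move=> t tl; apply: ge0_ler_powR; rewrite ?nnegrE ?(ltW Mx0) ?(ltW p_gt0)//.
    by apply: bU; exact: sub.
have r3 : 0 <= itg (sgm l l') (fun x => G tip x ^+ 2) by apply: int_ge0 => ? _; exact: sqr_ge0.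
have r0 : 0 <= itg (sgm l l') (fun x => U tip x ^+ 2) by apply: int_ge0 => ? _; exact: sqr_ge0.
have dQ' : (l' - l) * Mx `^ p + (l' - l) * Mx ^+ 2 + (l' - l) * A <= m / 2.
  by apply: le_trans dQ; rewrite /Q !mulrDr mulr1 lerDl ltW.
have t1 := mulr_gt0 dl0 Mp0; have t2 := mulr_gt0 dl0 M20; have t3 := mulr_gt0 dl0 A0.
have [q1 q2 q3] := three_small t1 t2 t3 dQ'.
have EV : ener p l U G <= lev p 2 mu + m / 2.
  have z : p^-1 * itg (sgm l l') (fun x => `|U tip x| `^ p) <= m / 2.
    apply: le_trans q1; rewrite -[leRHS]mul1r [(l' - l) * _]mulrC.
    apply: ler_pM => //; first by rewrite invr_ge0 (ltW p_gt0).
    by apply: int_ge0 => t _; exact: powR_ge0.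
  move: E2; rewrite /ener g_l' p_l' [p^-1 * (_ + _)]mulrDr => E2.
  exact: shorten_arith E2 z r3.
have nu0 : 0 < sqn l U.
  apply: half_lt m0 m3 (le_trans r1 _) (esym (etrans (esym Umu) m_l')).
  by rewrite mulrC.
have numu : sqn l U <= mu by rewrite -Umu m_l' lerDl.
have EV0 : ener p l U G <= 0 by exact: le_trans EV (neg_half m0 m2).
have [k [k1 hW Wmu EW]] := scale_up (ltW l0) hV nu0 numu EV0.
have k0 : 0 <= k by exact: le_trans k1.
exists (fun i x => k * U i x), (fun i x => k * G i x); split => //.
  exact: le_trans EW (le_trans EV (half_le _ m0 m1)).
have big (y : R) : c0 / 2 <= `|U tip y| -> c0 / 2 <= `|k * U tip y|.
  by move=> h; rewrite normrM (ger0_norm k0); apply: le_trans h _; rewrite ler_peMl.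
case: (leP x l) => xl'.
  exists x; first by move: xl => /andP[-> _].
  by apply: big; rewrite xM; apply: le_trans cM; rewrite ler_pdivrMr// ler_pMr// ler1n.
exists l; first by rewrite (ltW l0) lexx.
apply: big.
have dl : dom l' tip l by rewrite dom_tip /sgm /= !ltW.
have dx : dom l' tip x by rewrite dom_tip.
have hh := H1_holder (edge_dom tip (ltW l'0)) (hU.1 tip) dl dx.
have gt : itg (dom l' tip) (fun x => G tip x ^+ 2) <= A.
  apply: le_trans gA; rewrite /sqn (bigD1 tip)//= lerDl; apply: sumr_ge0 => j _.
  by apply: int_ge0 => t _; exact: sqr_ge0.
have : `|U tip x - U tip l| <= c0 / 2.
  apply: sqr_le_norm; first exact: ltW.
  apply: le_trans hh _; apply: (@le_trans _ _ ((l' - l) * A)); last exact: le_trans q3 (half_half m0 m4).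
  apply: ler_pM => //; first by apply: int_ge0 => t _; exact: sqr_ge0.
  by rewrite ger0_norm ?subr_ge0 ?(ltW xl')// lerD2r; move: xl => /andP[_].
by apply: norm_half; rewrite xM.
Qed.

End thresholds.

(** * Affine changes of variables *)

Section affine.
Context {R : realType}.
Local Notation MR := (measurableTypeR R).
Local Notation leb := (@lebesgue_measure R).

Definition aff (s b x : R) : R := b + s * x.

Lemma aff_meas (s b : R) : measurable_fun setT (aff s b : MR -> MR).
Proof.
apply: measurable_funD; first exact: measurable_cst.
by apply: measurable_funM; [exact: measurable_cst|exact: measurable_id].
Qed.

Lemma leb_aff_itv (s b : R) (A : set MR) : s != 0 -> ocitv A ->
  leb A = (`|s|%:E * leb (aff s b @^-1` A))%E.
Proof.
move=> s0 [[x y]] _ <- /=; case: (ltP x y) => xy; last first.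
  by rewrite set_itv_ge ?preimage_set0 ?measure0 ?mule0// bnd_simp -leNgt.
rewrite lebesgue_measure_itv /= lte_fin xy.
case: (ltgtP 0 s) s0 => // [s0|s0] _.
- have -> : aff s b @^-1` `]x, y] = `](x - b) / s, (y - b) / s]%classic.
    apply/seteqP; split => t /=; rewrite /aff !in_itv /= ltr_pdivrMr// ler_pdivlMr//.
      by move=> /andP[? ?]; apply/andP; split; lra.
    by move=> /andP[? ?]; apply/andP; split; lra.
  rewrite lebesgue_measure_itv /= lte_fin ltr_pM2r ?invr_gt0// ltrD2r xy gtr0_norm//.
  by rewrite -!EFinD -EFinM; congr EFin; field; rewrite gt_eqF.
- have -> : aff s b @^-1` `]x, y] = `[(y - b) / s, (x - b) / s[%classic.
    apply/seteqP; split => t /=; rewrite /aff !in_itv /= ltr_ndivlMr// ler_ndivrMr//.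
      by move=> /andP[? ?]; apply/andP; split; lra.
    by move=> /andP[? ?]; apply/andP; split; lra.
  rewrite lebesgue_measure_itv /= lte_fin ltr_nM2r ?invr_lt0// ltrD2r xy ltr0_norm//.
  by rewrite -!EFinD -EFinM; congr EFin; field; rewrite lt_eqF.
Qed.

(** The rescaled pushforward agrees with Lebesgue measure on half-open intervals, and uniqueness of
    the measure does the rest; negative [s] is included for reflections. *)
Lemma leb_aff (s b : R) (A : set MR) : s != 0 -> measurable A ->
  leb A = (`|s|%:E * leb (aff s b @^-1` A))%E.
Proof.
move=> s0 mA.
unshelve epose (nu := mscale (NngNum (normr_ge0 s)) (pushforward leb (aff s b : MR -> MR)) : {measure set MR -> \bar R}).
  exact: aff_meas.
have := @lebesgue_measure_unique R nu; apply => // X oX; exact: leb_aff_itv.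
Qed.

Lemma itg_aff_ge0 (s b : R) (D : set MR) (f : R -> R) : s != 0 -> measurable D -> igr D f ->
  (forall x, D x -> 0 <= f x) ->
  igr (aff s b @^-1` D) (fun x => f (aff s b x)) /\
  itg (aff s b @^-1` D) (fun x => f (aff s b x)) = `|s|^-1 * itg D f.
Proof.
move=> s0 mD fi f0.
unshelve epose (nu := pushforward leb (aff s b : MR -> MR) : {measure set MR -> \bar R}).
  exact: aff_meas.
have mf := igr_meas fi; have mf' : measurable_fun D (EFin \o (f : MR -> R)) by exact/measurable_EFinP.
have mP : measurable (aff s b @^-1` D) by rewrite -[X in measurable X]setTI; exact: (aff_meas s b).
have e : (\int[leb]_(x in D) (f x)%:E = `|s|%:E * \int[leb]_(x in aff s b @^-1` D) (f (aff s b x))%:E)%E.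
  transitivity (\int[mscale (NngNum (normr_ge0 s)) nu]_(x in D) (f x)%:E)%E.
    by apply: eq_measure_integral => A mA AD; exact: (leb_aff b s0 mA).
  rewrite ge0_integral_mscale//.
  congr (_ * _)%E; rewrite (@ge0_integral_pushforward _ _ _ _ _ (aff s b : MR -> MR) (aff_meas s b))//.
  by move=> x Dx; rewrite lee_fin f0// -inE.
have n0 : 0 < `|s| by rewrite normr_gt0.
have fin : (\int[leb]_(x in aff s b @^-1` D) (f (aff s b x))%:E < +oo)%E.
  have : (\int[leb]_(x in D) (f x)%:E < +oo)%E.
    by have /integral_fune_lt_pinfty := fi; apply.
  by rewrite e; case: (\int[leb]_(x in _) _)%E => [r| |]; rewrite ?ltry// gt0_muley.
have mc : measurable_fun (aff s b @^-1` D) (fun x => f (aff s b x) : MR).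
  apply: (@measurable_comp _ _ _ _ _ _ D (f : MR -> MR)) => //; first by move=> _ [x ? <-].
  exact: measurable_funS (aff_meas s b).
have ig : igr (aff s b @^-1` D) (fun x => f (aff s b x)).
  apply/integrableP; split; first exact/measurable_EFinP.
  apply: le_lt_trans fin; rewrite le_eqVlt; apply/orP; left; apply/eqP/eq_integral => x.
  by rewrite inE => /= Dx; rewrite ger0_norm// f0.
split => //; rewrite /Rintegral e fineM//; first by rewrite mulrA mulVf ?mul1r// gt_eqF.
exact: integrable_fin_num.
Qed.

(** Reduced to nonnegative functions by [f = |f| - (|f| - f)]. *)
Lemma itg_aff (s b : R) (D : set MR) (f : R -> R) : s != 0 -> measurable D -> igr D f ->
  igr (aff s b @^-1` D) (fun x => f (aff s b x)) /\
  itg (aff s b @^-1` D) (fun x => f (aff s b x)) = `|s|^-1 * itg D f.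
Proof.
move=> s0 mD fi; have ni := igr_norm mD fi.
have mP : measurable (aff s b @^-1` D).
  by rewrite -[X in measurable X]setTI; exact: aff_meas.
have di := igrB mD ni fi.
have [i1 e1] := itg_aff_ge0 b s0 mD ni (fun x _ => normr_ge0 _).
have [i2 e2] := itg_aff_ge0 b s0 mD di (fun x _ => eq_ind_r is_true (ler_norm (f x)) (subr_ge0 _ _)).
have i3 := igrB mP i1 i2.
have i4 : igr (aff s b @^-1` D) (fun x => f (aff s b x)).
  by apply: igr_eq i3 => // x _; ring.
split => //; transitivity (itg (aff s b @^-1` D) (fun x => `|f (aff s b x)| - (`|f (aff s b x)| - f (aff s b x)))).
  by apply: int_eq => x _; ring.
by rewrite intB// e1 e2 -mulrBr (intB mD ni fi); ring.
Qed.

Lemma aff_sgm_pos (s b x y : R) : 0 < s -> aff s b @^-1` sgm x y = sgm ((x - b) / s) ((y - b) / s).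
Proof.
move=> s0; apply/seteqP; split => t; rewrite /sgm /aff /= ler_pdivrMr// ler_pdivlMr// => /andP[? ?];
  by apply/andP; split; lra.
Qed.

Lemma aff_sgm_neg (s b x y : R) : s < 0 -> aff s b @^-1` sgm x y = sgm ((y - b) / s) ((x - b) / s).
Proof.
move=> s0; apply/seteqP; split => t; rewrite /sgm /aff /= ler_ndivrMr// ler_ndivlMr// => /andP[? ?];
  by apply/andP; split; lra.
Qed.

Lemma aff_ray (b x : R) : aff 1 b @^-1` ray x = ray (x - b).
Proof. by apply/seteqP; split => t; rewrite /ray /aff /= mul1r lerBlDl. Qed.

Lemma aff_itgP (s b x y : R) f : 0 < s -> igr (sgm (aff s b x) (aff s b y)) f ->
  igr (sgm x y) (fun t => f (aff s b t)) /\
  itg (sgm x y) (fun t => f (aff s b t)) = s^-1 * itg (sgm (aff s b x) (aff s b y)) f.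
Proof.
move=> s0 fi; have := itg_aff b (lt0r_neq0 s0) (msgm _ _) fi.
have affK (z : R) : (aff s b z - b) / s = z by rewrite /aff; field; rewrite gt_eqF.
by rewrite (aff_sgm_pos _ _ _ s0) !affK (gtr0_norm s0).
Qed.

Lemma aff_itgN (s b x y : R) f : s < 0 -> igr (sgm (aff s b y) (aff s b x)) f ->
  igr (sgm x y) (fun t => f (aff s b t)) /\
  itg (sgm x y) (fun t => f (aff s b t)) = - s^-1 * itg (sgm (aff s b y) (aff s b x)) f.
Proof.
move=> s0 fi; have := itg_aff b (ltr0_neq0 s0) (msgm _ _) fi.
have affK (z : R) : (aff s b z - b) / s = z by rewrite /aff; field; rewrite lt_eqF.
by rewrite (aff_sgm_neg _ _ _ s0) !affK (ltr0_norm s0) invrN.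
Qed.

Lemma acf_affP (s b x y : R) u g : 0 < s -> x <= y -> acf (aff s b x) (aff s b y) u g ->
  acf x y (fun t => u (aff s b t)) (fun t => s * g (aff s b t)).
Proof.
move=> s0 xy [gi h].
have mono (z t : R) : z <= t -> aff s b z <= aff s b t by move=> zt; rewrite lerD2l ler_pM2l.
split; first by apply: igrZ => //; have [] := aff_itgP s0 gi.
move=> t /andP[xt ty]; have sub : sgm (aff s b x) (aff s b t) `<=` sgm (aff s b x) (aff s b y).
  by apply: sgm_sub => //; exact: mono.
have [i1 e1] := aff_itgP s0 (igrS (msgm _ _) (msgm _ _) sub gi).
by rewrite intZ// e1 mulrA divff ?gt_eqF// mul1r h// !mono.
Qed.

Lemma acf_affN (s b x y : R) u g : s < 0 -> x <= y -> acf (aff s b y) (aff s b x) u g ->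
  acf x y (fun t => u (aff s b t)) (fun t => s * g (aff s b t)).
Proof.
move=> s0 xy ac; have [gi h] := ac.
have mono (z t : R) : z <= t -> aff s b t <= aff s b z by move=> zt; rewrite lerD2l ler_nM2l.
split; first by apply: igrZ => //; have [] := aff_itgN s0 gi.
move=> t /andP[xt ty]; have sub : sgm (aff s b t) (aff s b x) `<=` sgm (aff s b y) (aff s b x).
  by apply: sgm_sub => //; exact: mono.
have [i1 e1] := aff_itgN s0 (igrS (msgm _ _) (msgm _ _) sub gi).
have d := acf_diff ac (mono _ _ ty) (mono _ _ xt) (lexx _).
by rewrite intZ// e1 mulNr mulrN mulrA divff ?lt_eqF// mul1r -d; ring.
Qed.

Lemma sq_affN (s b x y : R) g : s < 0 -> sq (sgm (aff s b y) (aff s b x)) g ->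
  sq (sgm x y) (fun t => s * g (aff s b t)).
Proof.
move=> s0 [mg ig]; apply: sqZ => //.
have [i _] := aff_itgN s0 ig; split => //.
have affK (z : R) : (aff s b z - b) / s = z by rewrite /aff; field; rewrite lt_eqF.
have e := aff_sgm_neg b (aff s b y) (aff s b x) s0; rewrite !affK in e.
apply: (@measurable_comp _ _ _ _ _ _ (sgm (aff s b y) (aff s b x)) (g : MR -> MR)) => //.
  by rewrite -e => _ [z ? <-].
exact: measurable_funS (aff_meas s b).
Qed.

End affine.

(** * Solitons and test functions *)

Section soliton.
Context {R : realType}.
Local Notation MR := (measurableTypeR R).
Local Notation leb := (@lebesgue_measure R).

Lemma is_derive_fD (f g : R -> R) (x a b : R) : is_derive x 1 f a -> is_derive x 1 g b ->
  is_derive x 1 (fun t => f t + g t) (a + b).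
Proof. exact: is_deriveD. Qed.

Lemma is_derive_fM (f g : R -> R) (x a b : R) : is_derive x 1 f a -> is_derive x 1 g b ->
  is_derive x 1 (fun t => f t * g t) (a * g x + f x * b).
Proof.
move=> hf hg; apply: (is_derive_eq (is_deriveM hf hg)).
by rewrite /GRing.scale /=; ring.
Qed.

Lemma is_derive_fZ (f : R -> R) (x k a : R) : is_derive x 1 f a -> is_derive x 1 (fun t => k * f t) (k * a).
Proof.
by move=> hf; apply: (is_derive_eq (is_derive_fM (is_derive_cst k x 1) hf)); rewrite mul0r add0r.
Qed.

Lemma is_derive_fcomp (f g : R -> R) (x a b : R) : is_derive (g x) 1 f a -> is_derive x 1 g b ->
  is_derive x 1 (fun t => f (g t)) (a * b).
Proof. exact: is_derive1_comp. Qed.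

Lemma is_derive_continuous (f f' : R -> R) : (forall t : R, is_derive t 1 f (f' t)) -> continuous f.
Proof.
by move=> h t; apply: differentiable_continuous; apply/derivable1_diffP; case: (h t).
Qed.

Lemma cont_onT (D : set MR) (f : R -> R) : continuous f -> cont_on D f.
Proof. by move=> h; apply/cont_onP; exact: continuous_subspaceT. Qed.

Lemma acf_C1T (a b : R) (f f' : R -> R) : a <= b -> (forall t : R, is_derive t 1 f (f' t)) ->
  continuous f' -> acf a b f f'.
Proof.
move=> ab h cf'; apply: acf_C1 => //; first exact: cont_onT.
exact/cont_onT/(is_derive_continuous h).
Qed.

Context (p : R) (p2 : 2 < p) (M : R) (M0 : 0 < M).
Let p_gt0 : 0 < p. Proof. by apply: lt_trans p2. Qed.
Let pm2 : 0 < p - 2. Proof. by rewrite subr_gt0. Qed.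

(** The exponential decay rate of the soliton: for small [u] its first integral is close to
    [u'^2 = (2/p) M^(p-2) u^2]. *)
Definition srate : R := Num.sqrt (2 / p * M `^ (p - 2)).
Definition sexp : R := srate * (p - 2) / 2.
Local Notation b := sexp.
Definition ch (x : R) : R := (expR (b * x) + expR (- b * x)) / 2.
Definition sh (x : R) : R := (expR (b * x) - expR (- b * x)) / 2.
(** The soliton [M sech^(2/(p-2)) (b x)], the power written through [expR] and [ln] so that it can
    be differentiated directly. *)
Definition sol (x : R) : R := M * expR (- (2 / (p - 2)) * ln (ch x)).
Definition dsol (x : R) : R := - srate * (sh x / ch x) * sol x.

Let ch0 (x : R) : 0 < ch x. Proof. by rewrite divr_gt0// addr_gt0// expR_gt0. Qed.
Lemma srate2 : srate ^+ 2 = 2 / p * M `^ (p - 2).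
Proof. by rewrite sqr_sqrtr// mulr_ge0 ?powR_ge0// divr_ge0// ltW. Qed.
Lemma srate_gt0 : 0 < srate.
Proof. by rewrite sqrtr_gt0 mulr_gt0 ?powR_gt0// divr_gt0. Qed.
Let b0 : 0 < b. Proof. by rewrite divr_gt0// mulr_gt0// srate_gt0. Qed.

Let ch_sh (x : R) : ch x ^+ 2 - sh x ^+ 2 = 1.
Proof.
have h : expR (b * x) * expR (- b * x) = 1 by rewrite -expRD mulNr subrr expR0.
by rewrite /ch /sh -[RHS]h; field.
Qed.

Let dexp (k x : R) : is_derive x 1 (fun t => expR (k * t)) (expR (k * x) * k).
Proof.
by apply: is_derive_fcomp; apply: (is_derive_eq (is_derive_fZ k (is_derive_id x 1))); rewrite mulr1.
Qed.

Let dch (x : R) : is_derive x 1 ch (b * sh x).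
Proof.
have h := is_derive_fZ 2^-1 (is_derive_fD (dexp b x) (dexp (- b) x)).
have -> : ch = (fun t => 2^-1 * (expR (b * t) + expR (- b * t))) by apply/funext => t; rewrite /ch mulrC.
by apply: (is_derive_eq h); rewrite /sh; ring.
Qed.

Let dsh (x : R) : is_derive x 1 sh (b * ch x).
Proof.
have h := is_derive_fZ 2^-1 (is_derive_fD (dexp b x) (is_derive_fZ (-1) (dexp (- b) x))).
have -> : sh = (fun t => 2^-1 * (expR (b * t) + -1 * expR (- b * t))) by apply/funext => t; rewrite /sh mulrC mulN1r.
by apply: (is_derive_eq h); rewrite /ch; ring.
Qed.

Let dth (x : R) : is_derive x 1 (fun t => sh t / ch t) (b * (1 - (sh x / ch x) ^+ 2)).
Proof.
have dV : is_derive x 1 (fun t => (ch t)^-1) (- (ch x ^- 2) * (b * sh x)).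
  have h := @is_deriveV R ch x (b * sh x) 1 (lt0r_neq0 (ch0 x)).
  exact: (is_derive_eq (h (dch x))).
apply: (is_derive_eq (is_derive_fM (dsh x) dV)); field.
by rewrite gt_eqF.
Qed.

Lemma is_derive_sol (x : R) : is_derive x 1 sol (dsol x).
Proof.
have h := is_derive_fZ M (is_derive_fcomp (is_derive_expR _) (is_derive_fZ (- (2 / (p - 2))) (is_derive_fcomp (is_derive1_ln (ch0 x)) (dch x)))).
apply: (is_derive_eq h); rewrite /dsol /sol /sexp; field.
by rewrite !gt_eqF.
Qed.

Lemma sol_gt0 (x : R) : 0 < sol x.
Proof. by rewrite mulr_gt0// expR_gt0. Qed.

Let sol_p (x : R) : sol x `^ p = M `^ (p - 2) * sol x ^+ 2 * (1 - (sh x / ch x) ^+ 2).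
Proof.
have s0 := sol_gt0 x.
have -> : p = (p - 2) + 2 by ring.
rewrite powRD ?(gt_eqF s0) ?implybT// (_ : p - 2 + 2 - 2 = p - 2); last ring.
rewrite [sol x `^ 2](_ : _ = sol x ^+ 2) ?powR_mulrn ?(ltW s0)//.
have -> : sol x `^ (p - 2) = M `^ (p - 2) * (1 - (sh x / ch x) ^+ 2); last ring.
rewrite powRM ?expR_ge0 ?(ltW M0)//; congr (_ * _).
rewrite -expRM (_ : _ * (p - 2) = - (ln (ch x) + ln (ch x))); last first.
  by field; rewrite gt_eqF.
rewrite expRN expRD lnK ?posrE ?ch0//.
have e := ch_sh x; have c0 := ch0 x.
rewrite expr_div_n -[X in X - _](divff (lt0r_neq0 (exprn_gt0 2 c0))) -mulrBl e expr2 mul1r.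
by [].
Qed.

Lemma dsol_sqr (x : R) : 2^-1 * dsol x ^+ 2 = p^-1 * (M `^ (p - 2) * sol x ^+ 2 - sol x `^ p).
Proof.
rewrite sol_p /dsol; move: (sh x / ch x) (sol x) => t s.
rewrite !exprMn sqrrN srate2.
by field; rewrite gt_eqF.
Qed.

(** The bracket is [sol] times its second derivative, that is, the soliton equation multiplied by
    the soliton. *)
Lemma is_derive_sol_dsol (x : R) : is_derive x 1 (fun t => sol t * dsol t)
  (dsol x ^+ 2 + (2 / p * M `^ (p - 2) * sol x ^+ 2 - sol x `^ p)).
Proof.
have d2 := is_derive_fM (is_derive_fZ (- srate) (dth x)) (is_derive_sol x).
apply: (is_derive_eq (is_derive_fM (is_derive_sol x) d2)).
have e := srate2; rewrite sol_p /dsol /sexp.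
move: (sh x / ch x) (sol x) => t s.
transitivity (srate ^+ 2 * ((t * s) ^+ 2 + s ^+ 2 * t ^+ 2 - (p - 2) / 2 * s ^+ 2 * (1 - t ^+ 2))).
  by field.
transitivity (srate ^+ 2 * (t * s) ^+ 2 + (srate ^+ 2 * s ^+ 2 - p / 2 * srate ^+ 2 * s ^+ 2 * (1 - t ^+ 2))).
  by field.
rewrite [(- srate * t * s) ^+ 2](_ : _ = srate ^+ 2 * (t * s) ^+ 2); last by ring.
by rewrite e; field; rewrite gt_eqF.
Qed.

Lemma dsol_cont : continuous dsol.
Proof.
exact: (is_derive_continuous (fun x => is_derive_fM (is_derive_fZ (- srate) (dth x)) (is_derive_sol x))).
Qed.

Lemma sol_cont : continuous sol.
Proof. exact: is_derive_continuous is_derive_sol. Qed.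

Lemma sol0 : sol 0 = M.
Proof. by rewrite /sol /ch !mulr0 expR0 (_ : (1 + 1) / 2 = 1 :> R) ?ln1 ?mulr0 ?expR0 ?mulr1//; field. Qed.

Lemma dsol0 : dsol 0 = 0.
Proof. by rewrite /dsol /sh !mulr0 subrr mul0r mul0r mulr0 mul0r. Qed.

Let sh_ge0 (x : R) : 0 <= x -> 0 <= sh x.
Proof.
move=> x0; rewrite divr_ge0// subr_ge0 ler_expR ler_wpM2r//.
by have := b0; lra.
Qed.

Lemma dsol_le0 (x : R) : 0 <= x -> dsol x <= 0.
Proof.
move=> x0; rewrite /dsol !mulNr oppr_le0 mulr_ge0 ?(ltW (sol_gt0 x))// mulr_ge0 ?(ltW srate_gt0)//.
by rewrite divr_ge0 ?sh_ge0// ltW.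
Qed.


Lemma dsol_ge (x : R) : - (srate * sol x) <= dsol x.
Proof.
have c0 := ch0 x; have h : sh x / ch x <= 1.
  rewrite ler_pdivrMr// mul1r /sh /ch ler_pM2r ?invr_gt0// lerD2l.
  by have := expR_gt0 (- b * x); lra.
rewrite /dsol; have := mulr_gt0 srate_gt0 (sol_gt0 x).
move: (sh x / ch x) (sol x) h => t s h; rewrite [- srate * t * s](_ : _ = - (t * (srate * s))); last ring.
by move=> k0; rewrite lerN2 -[leRHS]mul1r ler_wpM2r// ltW.
Qed.

Lemma sol_mono (x y : R) : 0 <= x -> x <= y -> sol y <= sol x.
Proof.
move=> x0 xy; have [c /andP[c0 _] h] := mvt_seg is_derive_sol xy.
rewrite -subr_le0 h mulr_le0_ge0 ?subr_ge0//.
by apply: dsol_le0; exact: le_trans c0.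
Qed.

Lemma sol_leM (x : R) : 0 <= x -> sol x <= M.
Proof. by move=> x0; rewrite -sol0 sol_mono. Qed.

Lemma sol_small (e : R) : 0 < e -> exists2 y : R, 0 <= y & sol y <= e.
Proof.
(* The point [y] is chosen so that [sol y <= M exp (- w)], and [exp w >= w] makes this at most
   [e]. *)
move=> e0; pose w := M / e; have w0 : 0 < w by rewrite divr_gt0.
have ln2 : 0 <= ln (2 : R) by rewrite ln_ge0// ler1n.
have th0 : 0 < 2 / (p - 2) by rewrite divr_gt0.
pose y := (w / (2 / (p - 2)) + ln 2) / b.
have y0 : 0 <= y by rewrite divr_ge0 ?(ltW b0)// addr_ge0// ltW// divr_gt0.
exists y => //.
have lc : w / (2 / (p - 2)) <= ln (ch y).
  have -> : w / (2 / (p - 2)) = b * y - ln 2 by rewrite /y; field; rewrite !gt_eqF.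
  rewrite -[b * y]expRK -ln_div ?posrE ?expR_gt0// ler_ln ?posrE ?ch0 ?divr_gt0 ?expR_gt0//.
  by rewrite ler_pM2r ?invr_gt0// lerDl expR_ge0.
have le : expR (- (2 / (p - 2)) * ln (ch y)) <= expR (- w).
  rewrite ler_expR mulNr lerN2; move: lc; rewrite ler_pdivrMr// mulrC; exact.
apply: (@le_trans _ _ (M * expR (- w))); first by rewrite ler_wpM2l ?(ltW M0).
rewrite expRN ler_pdivrMr ?expR_gt0//.
apply: (@le_trans _ _ (e * w)); first by rewrite /w mulrCA divff ?mulr1// gt_eqF.
rewrite ler_wpM2l ?(ltW e0)//; apply: le_trans (expR_ge1Dx w); first by rewrite lerDr.
Qed.

Let Ks (x : R) : R := M `^ (p / 2) * M * Hk p (sol x / M).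

Let is_derive_Ks (x : R) : 0 <= x -> is_derive x 1 Ks (- dsol x ^+ 2).
Proof.
move=> x0; have h1 : is_derive x 1 (fun t => sol t / M) (dsol x / M).
  have -> : (fun t => sol t / M) = (fun t => M^-1 * sol t) by apply/funext => t; rewrite mulrC.
  by apply: (is_derive_eq (is_derive_fZ M^-1 (is_derive_sol x))); rewrite mulrC.
apply: (is_derive_eq (is_derive_fZ (M `^ (p / 2) * M) (is_derive_fcomp (is_derive_Hk p2 _) h1))).
have s0 := sol_gt0 x; have sM := sol_leM x0.
suff e : M `^ (p / 2) * gk p (sol x / M) = - dsol x.
  transitivity (M `^ (p / 2) * gk p (sol x / M) * dsol x * (M / M)); first ring.
  by rewrite divff ?gt_eqF// e; ring.
have n1 : `|sol x / M| = sol x / M by rewrite ger0_norm// divr_ge0// ltW.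
have le1 : `|sol x / M| <= 1 by rewrite n1 ler_pdivrMr// mul1r.
apply/eqP; rewrite -(@eqrXn2 _ 2)//; last 2 first.
- by rewrite mulr_ge0 ?powR_ge0// gk_ge0.
- by rewrite oppr_ge0 dsol_le0.
apply/eqP; rewrite exprMn gk_sqr// sqrrN n1 powRM ?invr_ge0 ?(ltW M0) ?(ltW s0)//.
have M1 : M `^ (p / 2) ^+ 2 = M `^ p.
  by rewrite -powR_mulrn ?powR_ge0// -powRrM; congr (_ `^ _); field.
have M2 : M `^ p = M `^ (p - 2) * M ^+ 2.
  rewrite -[M ^+ 2]powR_mulrn ?(ltW M0)// -powRD ?(gt_eqF M0) ?implybT//.
  by congr (_ `^ _); ring.
have M3 : (M^-1) `^ (p - 2) = (M `^ (p - 2))^-1 by rewrite -(powR_inv1 (ltW M0)) -powRrM mulN1r powRN.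
have s1 : sol x `^ p = sol x `^ (p - 2) * sol x ^+ 2.
  rewrite -[sol x ^+ 2]powR_mulrn ?(ltW s0)// -powRD ?(gt_eqF s0) ?implybT//.
  by congr (_ `^ _); ring.
have d2 : dsol x ^+ 2 = 2 / p * (M `^ (p - 2) * sol x ^+ 2 - sol x `^ (p - 2) * sol x ^+ 2).
  have := dsol_sqr x; rewrite s1; move: (dsol x ^+ 2) (M `^ _ * _ - _) => u v h.
  by rewrite [u](_ : _ = 2 * (2^-1 * u)); [rewrite h; ring|field].
rewrite d2 M1 M2 M3; have q0 : 0 < M `^ (p - 2) by exact: powR_gt0.
move: (M `^ (p - 2)) (sol x `^ (p - 2)) (sol x) q0 => q r s q0.
by field; rewrite !gt_eqF.
Qed.

Let cD : continuous (fun x => dsol x ^+ 2).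
Proof.
move=> x; apply: (@continuous_comp _ _ _ dsol (fun t : R => t ^+ 2)); first exact: dsol_cont.
exact: exprn_continuous.
Qed.

Let cS : continuous (fun x => sol x ^+ 2).
Proof.
move=> x; apply: (@continuous_comp _ _ _ sol (fun t : R => t ^+ 2)); first exact: sol_cont.
exact: exprn_continuous.
Qed.

Let cP : continuous (fun x => `|sol x| `^ p).
Proof.
move=> x; apply: (@continuous_comp _ _ _ sol (fun t : R => `|t| `^ p)); first exact: sol_cont.
exact: continuous_powR_norm.
Qed.

Let nsol (x : R) : `|sol x| = sol x. Proof. by rewrite gtr0_norm// sol_gt0. Qed.

Section cut.
Variable y : R.
Hypothesis y0 : 0 <= y.
Let A := itg (sgm 0 y) (fun x => dsol x ^+ 2).
Let X := itg (sgm 0 y) (fun x => sol x ^+ 2).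
Let B := itg (sgm 0 y) (fun x => `|sol x| `^ p).

(** The equality case of Young's inequality: along the decreasing branch [Kal] loses exactly
    [dsol^2] per unit length. *)
Lemma sol_grad : A = Kal p M M - Kal p M (sol y).
Proof.
have cK : continuous Ks.
  have h (t : R) : is_derive t 1 Ks (M `^ (p / 2) * M * (gk p (sol t / M) * (dsol t / M))).
    have h1 : is_derive t 1 (fun t => sol t / M) (dsol t / M).
      have -> : (fun t => sol t / M) = (fun t => M^-1 * sol t) by apply/funext => z; rewrite mulrC.
      by apply: (is_derive_eq (is_derive_fZ M^-1 (is_derive_sol t))); rewrite mulrC.
    exact: (is_derive_fZ (M `^ (p / 2) * M) (is_derive_fcomp (is_derive_Hk p2 _) h1)).
  exact: is_derive_continuous h.
have ac : acf 0 y Ks (fun x => - dsol x ^+ 2).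
  apply: acf_C1 => //; [|exact: cont_onT|].
    by apply: cont_onT => x; apply: (@continuousN _ _ _ (fun x => dsol x ^+ 2)); exact: cD.
  by move=> x /andP[x0 _]; apply: is_derive_Ks; exact: ltW.
have := acf_diff ac (lexx 0) y0 (lexx y).
rewrite (int_eq (g := fun x => -1 * dsol x ^+ 2)); last by move=> x _; rewrite mulN1r.
rewrite intZ//; last exact/cont_on_igr/cont_onT.
by rewrite -/A /Ks sol0 /Kal nsol (gtr0_norm M0); lra.
Qed.

Lemma sol_virial : 2^-1 * A = p^-1 * (M `^ (p - 2) * X - B) /\
  sol y * dsol y = A + (2 / p * M `^ (p - 2) * X - B).
Proof.
have iA : igr (sgm 0 y) (fun x => dsol x ^+ 2) by exact/cont_on_igr/cont_onT.
have iX : igr (sgm 0 y) (fun x => sol x ^+ 2) by exact/cont_on_igr/cont_onT.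
have iB : igr (sgm 0 y) (fun x => `|sol x| `^ p) by exact/cont_on_igr/cont_onT.
split.
  have iMX := igrZ (M `^ (p - 2)) (msgm 0 y) iX.
  transitivity (itg (sgm 0 y) (fun x => 2^-1 * dsol x ^+ 2)); first by rewrite intZ.
  transitivity (itg (sgm 0 y) (fun x => p^-1 * (M `^ (p - 2) * sol x ^+ 2 - `|sol x| `^ p))).
    by apply: int_eq => x _; rewrite nsol dsol_sqr.
  rewrite intZ//; last exact: igrB.
  by rewrite intB// intZ.
have ac : acf 0 y (fun t => sol t * dsol t)
    (fun x => dsol x ^+ 2 + (2 / p * M `^ (p - 2) * sol x ^+ 2 - `|sol x| `^ p)).
  have hd (t : R) : is_derive t 1 (fun t => sol t * dsol t)
      (dsol t ^+ 2 + (2 / p * M `^ (p - 2) * sol t ^+ 2 - `|sol t| `^ p)).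
    by have := is_derive_sol_dsol t; rewrite (nsol t).
  apply: (acf_C1T y0 hd).
  move=> x; apply: (@continuousD _ _ _ (fun x => dsol x ^+ 2)); first exact: cD.
  apply: (@continuousB _ _ _ (fun x => _ * sol x ^+ 2)); last exact: cP.
  by apply: (@continuousM _ _ (cst _)); [exact: cvg_cst|exact: cS].
have := acf_diff ac (lexx 0) y0 (lexx y).
rewrite intD//; last by apply: igrB => //; exact: igrZ.
rewrite intB//; last exact: igrZ.
rewrite (intZ _ (msgm 0 y) iX) -/A -/X -/B => e; rewrite -{}e dsol0 mulr0 subr0.
by [].
Qed.

(** The [L^p] integral is eliminated between the integrated first integral and the integrated
    equation. Without the boundary term and with [A = Kal p M M] this is the critical point equation
    of [Phi], which identifies [Mst] as the height of a soliton of prescribed mass. *)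
Lemma sol_mass : (p - 2) * (M `^ (p - 2) * X) = p * (p + 2) / 2 * A - p * (sol y * dsol y).
Proof.
have [e1 e2] := sol_virial.
have {}e1 : B = M `^ (p - 2) * X - p / 2 * A.
  have : p * (2^-1 * A) = p * (p^-1 * (M `^ (p - 2) * X - B)) by rewrite e1.
  by rewrite !mulrA divff ?gt_eqF// mul1r; lra.
by rewrite e2 e1; field; rewrite gt_eqF.
Qed.

End cut.

End soliton.

(** * Truncated solitons as competitors *)

Section testfunctions.
Context {R : realType}.
Local Notation MR := (measurableTypeR R).
Local Notation leb := (@lebesgue_measure R).

(** Here [K] is [Kal] at height [M], [X] and [x] are [M^(p-2)] times the mass of the full and of the
    truncated half soliton, [A] is the truncated kinetic integral, [kp] and [q] are [Kal] and
    [- sol * dsol] at the cut, and [s2] is the kinetic integral of the affine end. *)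
Lemma energy_arith (p K A X x kp s2 q e : R) : 0 < p -> 2 < p -> p < 6 ->
  K * (p + 2) * p = 2 * (p - 2) * X -> (p - 2) * x = p * (p + 2) / 2 * A + p * q -> 0 <= q ->
  K - kp <= A -> 0 <= kp -> 4 * kp + (p - 2) * s2 <= 2 * (p - 2) * e ->
  A - p^-1 * x + s2 / 2 <= K - p^-1 * X + e.
Proof.
move=> p0 p2 p6 hX hx q0 hA k0 he.
have pm : 0 < p - 2 by rewrite subr_gt0.
have eX : p^-1 * X = K * (p + 2) / (2 * (p - 2)).
  have : X = K * (p + 2) * p / (2 * (p - 2)) by rewrite hX; field; rewrite gt_eqF.
  by move=> ->; field; rewrite !gt_eqF.
have ex : p^-1 * x = A * (p + 2) / (2 * (p - 2)) + q / (p - 2).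
  have : x = (p * (p + 2) / 2 * A + p * q) / (p - 2) by rewrite -hx; field; rewrite gt_eqF.
  by move=> ->; field; rewrite !gt_eqF.
rewrite eX ex -(ler_pM2r (mulr_gt0 (ltr0n R 2) pm)).
have -> : (A - (A * (p + 2) / (2 * (p - 2)) + q / (p - 2)) + s2 / 2) * (2 * (p - 2)) =
   A * (p - 6) - 2 * q + (p - 2) * s2 by field; rewrite gt_eqF.
have -> : (K - K * (p + 2) / (2 * (p - 2)) + e) * (2 * (p - 2)) = K * (p - 6) + 2 * (p - 2) * e.
  by field; rewrite gt_eqF.
have h1 : 0 <= (A - K + kp) * (6 - p) by rewrite mulr_ge0; lra.
have h2 : kp * (6 - p) <= kp * 4 by rewrite ler_wpM2l//; lra.
move: h1; rewrite mulrDl mulrBl; lra.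
Qed.

Lemma tangent_arith (s k d X : R) : - (k * s) * d <= X - s -> s * (1 - k * d) <= X.
Proof. lra. Qed.

Lemma half_arith (K q X : R) : K * (q + 2) * q = 2 * (q - 2) * X -> (q - 2) * X = q * (q + 2) / 2 * K.
Proof. lra. Qed.

Lemma coef_arith (K m s q k : R) : K <= m * s -> 4 * K + q * (k * s) <= (4 * m + q * k) * s.
Proof. lra. Qed.

Lemma double_arith (a b q L e : R) : 2^-1 * a - q * b <= L + e / 4 -> 0 < e ->
  2^-1 * (a + a) - q * (b + b) < 2 * L + e.
Proof. lra. Qed.

Lemma double_half (a m : R) : a <= m / 2 -> a + a <= m.
Proof. lra. Qed.

Lemma sqr_mono (a b : R) : 0 <= a -> a <= b -> a ^+ 2 <= b ^+ 2.
Proof. by move=> a0 ab; rewrite ler_sqr ?nnegrE// (le_trans a0). Qed.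

Lemma tail_arith (A k2 MX B Bw : R) : 2^-1 * A = MX - B -> B <= Bw ->
  2^-1 * A + 2^-1 * k2 - Bw <= A - MX + k2 / 2.
Proof. lra. Qed.

Context (p : R) (p2 : 2 < p) (p6 : p < 6).
Let p_gt0 : 0 < p. Proof. by apply: lt_trans p2. Qed.
Let pm2 : 0 < p - 2. Proof. by rewrite subr_gt0. Qed.

Section half.
Variables (M X : R).
Hypotheses (M0 : 0 < M) (hX : Kal p M M * (p + 2) * p = 2 * (p - 2) * (M `^ (p - 2) * X)).
Local Notation sol := (sol p M).
Local Notation dsol := (dsol p M).
Local Notation k := (srate p M).
Let k0 : 0 < k. Proof. exact: srate_gt0. Qed.
Let q0 : 0 < M `^ (p - 2). Proof. exact: powR_gt0. Qed.

Let iS (y : R) : igr (sgm 0 y) (fun x => sol x ^+ 2).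
Proof.
apply: cont_on_igr; apply: cont_onT => x.
apply: (@continuous_comp _ _ _ sol (fun t : R => t ^+ 2)); first exact: sol_cont.
exact: exprn_continuous.
Qed.

(** Enlarge [T] until [sol] is small there: [sol_mass] then bounds the mass by [X] up to the
    boundary term [- sol * dsol], which is at most [srate * sol^2]. *)
Lemma sol_mass_le (T : R) : 0 <= T -> itg (sgm 0 T) (fun x => sol x ^+ 2) <= X.
Proof.
move=> T0; apply/ler_addgt0Pl => e e0.
pose d := Num.min 1 (e * ((p - 2) * M `^ (p - 2)) / (p * k)).
have pk : 0 < p * k by rewrite mulr_gt0.
have d0 : 0 < d by rewrite lt_min ltr01 divr_gt0// !mulr_gt0.
have [y1 y10 hy1] := sol_small p2 M0 d0.
pose y := Num.max T y1; have y0 : 0 <= y by rewrite le_max T0.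
have Ty : T <= y by rewrite le_max lexx.
have sy : sol y <= d by apply: le_trans (sol_mono p2 M0 y10 _) hy1; rewrite le_max lexx orbT.
apply: (@le_trans _ _ (itg (sgm 0 y) (fun x => sol x ^+ 2))).
  by apply: itg_sub => //; [exact: sgm_sub|move=> x _; exact: sqr_ge0].
have hm := sol_mass p2 M0 y0; have hg := sol_grad p2 M0 y0.
have g1 := Kal_ge0 p2 (sol y) (ltW M0).
have ge := dsol_ge p2 M0 y; have s0 := sol_gt0 p M0 y.
have d1 : d <= 1 by rewrite ge_min lexx.
have d2 : p * (k * d) <= e * ((p - 2) * M `^ (p - 2)).
  by rewrite mulrA mulrC -ler_pdivlMr// ge_min lexx orbT.
have t1 : - (sol y * dsol y) <= k * d.
  apply: (@le_trans _ _ (k * (sol y * sol y))); last first.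
    rewrite ler_wpM2l ?(ltW k0)// -[leRHS]mulr1.
    by apply: ler_pM => //; [exact: ltW|exact: ltW|exact: le_trans sy d1].
  have := ler_wpM2l (ltW s0) ge; rewrite mulrN [sol y * (k * _)]mulrCA; by rewrite lerNl.
have t2 : p * - (sol y * dsol y) <= p * (k * d) by rewrite ler_wpM2l// ltW.
have pq : 0 < (p - 2) * M `^ (p - 2) by rewrite mulr_gt0.
rewrite -(ler_pM2l pq) -mulrA hm hg.
have t3 : p * (p + 2) / 2 * (Kal p M M - Kal p M (sol y)) <= (p - 2) * (M `^ (p - 2) * X).
  have -> : (p - 2) * (M `^ (p - 2) * X) = p * (p + 2) / 2 * Kal p M M.
    exact: half_arith hX.
  by rewrite ler_wpM2l ?gerBl// divr_ge0// mulr_ge0 ?addr_ge0// ltW.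
move: t3 t2 d2; rewrite mulrN.
have -> : (p - 2) * M `^ (p - 2) * (e + X) = e * ((p - 2) * M `^ (p - 2)) + (p - 2) * (M `^ (p - 2) * X) by ring.
move=> t3 t2 d2; rewrite [leRHS]addrC; exact: lerD t3 (le_trans t2 d2).
Qed.

(** Cut at [y], then continue affinely to [0] with slope [- srate * sol y]. Since
    [dsol >= - srate * sol], this end stays below the soliton and the mass does not exceed [X]; its
    kinetic integral is only [srate * s^2]. *)
Lemma half_soliton (e : R) : 0 < e -> exists (T : R) (w g : R -> R),
  [/\ 0 < T, acf 0 T w g, sq (sgm 0 T) g /\ w T = 0, itg (sgm 0 T) (fun x => w x ^+ 2) <= X &
   2^-1 * itg (sgm 0 T) (fun x => g x ^+ 2) - p^-1 * itg (sgm 0 T) (fun x => `|w x| `^ p)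
     <= Kal p M M - p^-1 * (M `^ (p - 2) * X) + e].
Proof.
(* By [Kal_le_sqr], [C s^2] bounds the errors at the cut in the form that [energy_arith] asks for;
   [d] makes it at most [2 (p - 2) e]. *)
move=> e0; pose C := 4 * (M `^ (p / 2) / M) + (p - 2) * k.
have C0 : 0 < C by rewrite addr_gt0// mulr_gt0// divr_gt0// powR_gt0.
pose d := Num.min 1 (2 * (p - 2) * e / C).
have d0 : 0 < d by rewrite lt_min ltr01 divr_gt0// !mulr_gt0.
have [y y0 sy] := sol_small p2 M0 d0; set s := sol y in sy.
have s0 : 0 < s by exact: sol_gt0.
have Cs : C * s ^+ 2 <= 2 * (p - 2) * e.
  have d1 : d <= 1 by rewrite ge_min lexx.
  have : d <= 2 * (p - 2) * e / C by rewrite ge_min lexx orbT.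
  rewrite ler_pdivlMr// => hd; apply: le_trans hd; rewrite mulrC ler_wpM2r ?(ltW C0)//.
  by have := ltW s0; nra.
pose T := y + k^-1; have yT : y < T by rewrite ltrDl invr_gt0.
pose w x := if x <= y then sol x else s * (1 - k * (x - y)).
pose g x := if x <= y then dsol x else - (k * s).
have T0 : 0 < T by exact: le_lt_trans yT.
have ac1 : acf 0 y w g.
  have ac0 : acf 0 y sol dsol := acf_C1T y0 (is_derive_sol p2 M) (@dsol_cont _ _ p2 M).
  by apply: (acf_eq ac0 y0) => x /andP[_ xy]; rewrite /w /g xy.
have ac2 : acf y T w g.
  have cl : forall t : R, is_derive t 1 (fun t : R => s * (1 - k * (t - y))) (- (k * s)).
    move=> t; have h := is_derive_fZ s (is_derive_fD (is_derive_cst (1 + k * y) t 1) (is_derive_fZ (- k) (is_derive_id t 1))).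
    have -> : (fun t : R => s * (1 - k * (t - y))) = (fun t => s * (cst (1 + k * y) t + - k * id t)).
      by apply/funext => x /=; ring.
    by apply: (is_derive_eq h); ring.
  have ac := acf_C1T (ltW yT) cl (@cst_continuous _ _ (- (k * s))).
  apply: (acf_eq_oc ac (ltW yT)) => x /andP[yx xT].
    rewrite /w; case: ifP => // xy; have -> : x = y by apply/eqP; rewrite eq_le xy.
    by rewrite subrr mulr0 subr0 mulr1.
  by rewrite /g leNgt yx.
have ac := acf_join y0 (ltW yT) ac1 ac2.
have ig1 : igr (sgm 0 y) (fun x => g x ^+ 2) /\ itg (sgm 0 y) (fun x => g x ^+ 2) = itg (sgm 0 y) (fun x => dsol x ^+ 2).
  have i : igr (sgm 0 y) (fun x => dsol x ^+ 2).
    apply: cont_on_igr; apply: cont_onT => x.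
    apply: (@continuous_comp _ _ _ dsol (fun t : R => t ^+ 2)); first exact: dsol_cont.
    exact: exprn_continuous.
  split; first by apply: igr_eq i => // x /andP[_ xy]; rewrite /g xy.
  by apply: int_eq => x /andP[_ xy]; rewrite /g xy.
have ig2 : igr (sgm y T) (fun x => g x ^+ 2) /\ itg (sgm y T) (fun x => g x ^+ 2) = k * s ^+ 2.
  have h (x : R) : y < x <= T -> (k * s) ^+ 2 = g x ^+ 2.
    by move=> /andP[yx _]; rewrite /g leNgt yx /= sqrrN.
  split; first exact: igr_eq_oc (ltW yT) (igr_cst y T _) h.
  rewrite -(itg_eq_oc (ltW yT) (igr_cst y T _) h) int_cst ?(ltW yT)// /T.
  by field; rewrite gt_eqF.
have igg : igr (sgm 0 T) (fun x => g x ^+ 2) := igr_join y0 (ltW yT) ig1.1 ig2.1.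
have sg : sq (sgm 0 T) g.
  by split => //; apply: igr_meas; case: ac.
have wT : w T = 0.
  by rewrite /w leNgt yT /= /T addrAC subrr add0r divff ?gt_eqF// subrr mulr0.
have w_sol (x : R) : 0 <= x <= T -> 0 <= w x <= sol x.
  move=> /andP[x0 xT]; rewrite /w; case: ifP => xy; first by rewrite lexx (ltW (sol_gt0 p M0 x)).
  have yx : y <= x by rewrite ltW// ltNge xy.
  apply/andP; split.
    rewrite mulr_ge0 ?(ltW s0)// subr_ge0 mulrC -ler_pdivlMr// div1r lerBlDl; exact: xT.
  have [c /andP[yc cx] h] := mvt_seg (is_derive_sol p2 M) yx.
  have h1 := dsol_ge p2 M0 c; have h2 : sol c <= s by exact: sol_mono.
  have : - (k * s) * (x - y) <= sol x - s.
    rewrite h; apply: ler_wpM2r; first by rewrite subr_ge0.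
    by apply: le_trans h1; rewrite lerN2 ler_wpM2l ?(ltW k0).
  exact: tangent_arith.
have cw : cont_on (sgm 0 T) w := acf_cont (ltW T0) ac.
have iw : igr (sgm 0 T) (fun x => w x ^+ 2).
  apply: cont_on_igr; apply: (cont_on_comp (G := fun x => x ^+ 2) cw); exact: exprn_continuous.
have ip : igr (sgm 0 T) (fun x => `|w x| `^ p).
  apply: cont_on_igr; apply: (cont_on_comp (G := fun x : R => `|x| `^ p) cw).
  exact: continuous_powR_norm.
exists T, w, g; split => //.
  apply: le_trans (sol_mass_le (ltW T0)); apply: int_le => // x xT.
  by have /andP[w0 ws] := w_sol x xT; exact: sqr_mono.
rewrite (int_split y0 (ltW yT) igg) ig1.2 ig2.2.
have [v1 v2] := sol_virial p2 M0 y0.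
have hm := sol_mass p2 M0 y0; have hg := sol_grad p2 M0 y0.
set A := itg (sgm 0 y) (fun x => dsol x ^+ 2) in v1 v2 hm hg *.
have Bw : itg (sgm 0 y) (fun x => `|sol x| `^ p) <= itg (sgm 0 T) (fun x => `|w x| `^ p).
  apply: (@le_trans _ _ (itg (sgm 0 y) (fun x => `|w x| `^ p))).
    by rewrite le_eqVlt; apply/orP; left; apply/eqP/int_eq => x /andP[_ xy]; rewrite /w xy.
  apply: (itg_sub (msgm 0 T) (msgm 0 y) _ ip) => [|x _]; last exact: powR_ge0.
  exact: sgm_sub (lexx 0) (ltW yT).
have {}Bw := ler_wpM2l (ltW (eq_ind_r is_true p_gt0 (invr_gt0 p))) Bw.
set x := M `^ (p - 2) * itg (sgm 0 y) (fun x => sol x ^+ 2) in v1 hm.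
have kp := Kal_le_sqr p2 s M0.
have kp0 := Kal_ge0 p2 s (ltW M0).
have q1 : 0 <= - (s * dsol y).
  by rewrite -mulrN mulr_ge0 ?(ltW s0)// oppr_ge0 dsol_le0.
have hm' : (p - 2) * x = p * (p + 2) / 2 * A + p * (- (s * dsol y)) by rewrite mulrN; exact: hm.
have hA : Kal p M M - Kal p M s <= A by rewrite hg.
have hE : 4 * Kal p M s + (p - 2) * (k * s ^+ 2) <= 2 * (p - 2) * e.
  exact: le_trans (coef_arith _ _ kp) Cs.
have := energy_arith p_gt0 p2 p6 hX hm' q1 hA kp0 hE.
apply: le_trans.
rewrite mulrDr; move: v1; rewrite mulrBr => v1; exact: tail_arith v1 Bw.
Qed.

End half.

Definition single (j : 'I_4) (u : R -> R) (i : 'I_4) (x : R) : R := if i == j then u x else 0.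

Lemma itg0 (I : set MR) : itg I (fun _ => 0) = 0 :> R.
Proof. by rewrite /Rintegral integral0. Qed.

Lemma H1_zero (I : set MR) : is_edge I -> H1 I (fun _ => 0) (fun _ => 0).
Proof.
move=> [mI I0 _ _]; have i0 (D : set MR) : igr D (fun _ => 0 : R) by exact: integrable0.
have e0 : (fun _ : R => (0 : R) ^+ 2) = (fun _ => 0) by apply/funext => x; rewrite expr0n.
by split; rewrite ?e0//; split => //; split => // x _; split => //; rewrite itg0 addr0.
Qed.

Lemma inH_single (l : R) j u g : 0 <= l -> H1 (dom l j) u g -> u 0 = 0 ->
  inH l (single j u) (single j g).
Proof.
move=> l0 hu u0; split => i; last by rewrite /single !u0 !if_same.
rewrite /single; have [->//|_] := eqVneq i j; exact: H1_zero (edge_dom i l0).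
Qed.

Lemma sum_single (l : R) j u (F : R -> R) : F 0 = 0 ->
  \sum_i itg (dom l i) (fun x => F (single j u i x)) = itg (dom l j) (fun x => F (u x)).
Proof.
move=> F0; rewrite (bigD1 j)//= big1 ?addr0.
  by apply: int_eq => x _; rewrite /single eqxx.
move=> i ij; rewrite -[RHS](itg0 (dom l i)); apply: int_eq => x _.
by rewrite /single (negPf ij) F0.
Qed.

Lemma ener_single (l : R) j u g : ener p l (single j u) (single j g) =
  2^-1 * itg (dom l j) (fun x => g x ^+ 2) - p^-1 * itg (dom l j) (fun x => `|u x| `^ p).
Proof.
have e1 := @sum_single l j g (fun x => x ^+ 2) (expr0n _ 2).
have h0 : `|0 : R| `^ p = 0 by rewrite normr0 powR0// gt_eqF.
have e2 := @sum_single l j u (fun x => `|x| `^ p) h0.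
by rewrite /ener /sqn /pn e1 e2.
Qed.

Lemma sqn_single (l : R) j u : sqn l (single j u) = itg (dom l j) (fun x => u x ^+ 2).
Proof. exact: (@sum_single l j u (fun x => x ^+ 2) (expr0n _ 2)). Qed.

Lemma neg_sqn_gt0 (l : R) U G : 0 <= l -> inH l U G -> ener p l U G < 0 -> 0 < sqn l U.
Proof.
move=> l0 hU; apply: contraTT; rewrite -!leNgt => s0.
have {}s0 : sqn l U = 0 by apply/eqP; rewrite eq_le s0 sqn_ge0.
have [M M0 bM] := inH_bounded l0 hU; have := pn_le p2 l0 hU bM.
have := sqn_ge0 l G; have := pn_ge0 p l U; rewrite s0 mulr0 /ener => h1 h2 h3.
have -> : pn p l U = 0 by apply/eqP; rewrite eq_le h1 h3.
by rewrite mulr0 subr0 mulr_ge0.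
Qed.

Lemma adjust_mass (l mu E : R) U G : 0 <= l -> inH l U G -> sqn l U <= mu ->
  ener p l U G < E -> E <= 0 -> exists V K, [/\ inH l V K, sqn l V = mu & ener p l V K < E].
Proof.
move=> l0 hU sU EU E0; have EU0 := lt_le_trans EU E0.
have [k [_ h1 h2 h3]] := scale_up p2 l0 hU (neg_sqn_gt0 l0 hU EU0) sU (ltW EU0).
exists (fun i x => k * U i x), (fun i x => k * G i x).
by split; [exact: h1|exact: h2|exact: le_lt_trans h3 EU].
Qed.

(** A half soliton of height [Mst p k mu] has mass [mu / k]: all of it for [k = 1], one of the two
    symmetric halves for [k = 2]. *)
Lemma Kal_crit (k mu : R) : 0 < k -> 0 < mu -> let M := Mst p k mu in
  Kal p M M * (p + 2) * p = 2 * (p - 2) * (M `^ (p - 2) * (mu / k)).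
Proof.
move=> k0 mu0 M; have := Mst_crit p2 p6 k0 mu0; rewrite -/M /= Kal_max ?Mst_gt0//.
move: (M `^ (p / 2) * M) (M `^ (p - 2)) => z1 z2 h.
have -> : z2 * (mu / k) = (z2 * mu) / k by ring.
have -> : 2 * (p - 2) * (z2 * mu / k) = (2 * (p - 2) * (z2 * mu)) / k by ring.
by rewrite -h; field; rewrite gt_eqF.
Qed.

(** A half soliton of mass [mu] is reflected so that its maximum is at the free end of the tip and
    its zero at the vertex; its energy is close to [lev 1], which lies strictly below [lev 2]. *)
Lemma long_tip (mu : R) : 0 < mu -> exists2 l : R, 0 < l & below_soliton p mu l.
Proof.
move=> mu0; have M0 := Mst_gt0 p2 ltr01 mu0; set M := Mst p 1 mu in M0.
have gap : 0 < (lev p 2 mu - lev p 1 mu) / 2 by rewrite divr_gt0// subr_gt0 lev12.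
have hX := Kal_crit ltr01 mu0; rewrite /= divr1 -/M in hX.
have [T [w [g [T0 ac [sg wT] mw ew]]]] := half_soliton M0 hX gap.
have aT : aff (-1) T T = 0 by rewrite /aff mulN1r subrr.
have a0 : aff (-1) T 0 = T by rewrite /aff mulr0 addr0.
have ac' : acf (aff (-1) T T) (aff (-1) T 0) w g by rewrite aT a0.
have sg' : sq (sgm (aff (-1) T T) (aff (-1) T 0)) g by rewrite aT a0.
pose v x := w (aff (-1) T x); pose h x := -1 * g (aff (-1) T x).
have av : acf 0 T v h := acf_affN (ltrN10 _) (ltW T0) ac'.
have sh : sq (sgm 0 T) h := sq_affN (ltrN10 _) sg'.
have cw := acf_cont (ltW T0) ac.
have flip f : igr (sgm 0 T) f -> itg (sgm 0 T) (fun x => f (aff (-1) T x)) = itg (sgm 0 T) f.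
  move=> fi; have fi' : igr (sgm (aff (-1) T T) (aff (-1) T 0)) f by rewrite aT a0.
  by have [_ ->] := aff_itgN (ltrN10 _) fi'; rewrite aT a0 invrN1 opprK mul1r.
have v0 : v 0 = 0 by rewrite /v a0.
have hH : H1 (dom T tip) v h by rewrite dom_tip; exact: H1_sgm (ltW T0) av sh.
have hU := inH_single (ltW T0) hH v0.
have iw : igr (sgm 0 T) (fun x => w x ^+ 2).
  apply: cont_on_igr; apply: (cont_on_comp (G := fun x => x ^+ 2) cw); exact: exprn_continuous.
have ip : igr (sgm 0 T) (fun x => `|w x| `^ p).
  apply: cont_on_igr; apply: (cont_on_comp (G := fun x : R => `|x| `^ p) cw).
  exact: continuous_powR_norm.
have m1 : sqn T (single tip v) <= mu.
  by rewrite sqn_single dom_tip /v (flip (fun x => w x ^+ 2)).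
have E1 : ener p T (single tip v) (single tip h) < lev p 2 mu.
  rewrite ener_single dom_tip.
  have -> : itg (sgm 0 T) (fun x => h x ^+ 2) = itg (sgm 0 T) (fun x => g x ^+ 2).
    rewrite -[RHS](flip (fun x => g x ^+ 2)); last by case: sg.
    by apply: int_eq => x _; rewrite /h mulN1r sqrrN.
  rewrite /v (flip (fun x => `|w x| `^ p))//; apply: le_lt_trans ew _.
  have -> : Kal p M M - p^-1 * (M `^ (p - 2) * mu) = lev p 1 mu.
    by rewrite /lev /Phi -/M Kal_max// mul1r [_ * Hk p 1]mulrC.
  by move: gap; move: (lev p 1 mu) (lev p 2 mu) => z1 z2; lra.
exists T => //; exact: adjust_mass (ltW T0) hU m1 E1 (ltW (lev_lt0 p2 p6 (ltr0n _ 2) mu0)).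
Qed.

(** Two half solitons of mass [mu / 2], one reflected, are glued at their common maximum and placed
    on a single halfline, where they vanish at the vertex. *)
Lemma near_soliton (l mu e : R) : 0 < l -> 0 < mu -> 0 < e ->
  exists U G, [/\ inH l U G, sqn l U = mu & ener p l U G < lev p 2 mu + e].
Proof.
(* Restoring the mass lowers the energy only if that is not positive, so [e] is first made small. *)
move=> l0 mu0; wlog e1 : e / lev p 2 mu + e <= 0.
  move=> hw e0; case: (leP (lev p 2 mu + e) 0) => h; first exact: hw.
  have n0 : 0 < - lev p 2 mu by rewrite oppr_gt0 lev_lt0.
  have [|U [G [h1 h2 h3]]] := hw (- lev p 2 mu) _ n0; first by rewrite subrr.
  by exists U, G; split => //; apply: lt_trans h3 _; rewrite subrr.
move=> e0; have M0 := Mst_gt0 p2 (ltr0n _ 2) mu0; set M := Mst p 2 mu in M0.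
have hX := Kal_crit (ltr0n _ 2) mu0; rewrite /= -/M in hX.
have e40 : 0 < e / 4 by rewrite divr_gt0.
have [T [w [g [T0 ac [sg wT] mw ew]]]] := half_soliton M0 hX e40.
have aT : aff (-1) T T = 0 by rewrite /aff mulN1r subrr.
have a0 : aff (-1) T 0 = T by rewrite /aff mulr0 addr0.
have bT : aff 1 (- T) T = 0 by rewrite /aff mul1r addNr.
have b2 : aff 1 (- T) (2 * T) = T by rewrite /aff mul1r; ring.
have TT : T <= 2 * T by rewrite ler_pMl// ler1n.
have T20 : 0 <= 2 * T by exact: le_trans (ltW T0) TT.
pose bump (f1 f2 : R -> R) x := if x <= T then f1 (aff (-1) T x) else f2 (aff 1 (- T) x).
have bumpI (f1 f2 : R -> R) : igr (sgm 0 T) f1 -> igr (sgm 0 T) f2 -> igr (sgm 0 (2 * T)) (bump f1 f2) /\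
    itg (sgm 0 (2 * T)) (bump f1 f2) = itg (sgm 0 T) f1 + itg (sgm 0 T) f2.
  move=> i1 i2.
  have i1' : igr (sgm (aff (-1) T T) (aff (-1) T 0)) f1 by rewrite aT a0.
  have i2' : igr (sgm (aff 1 (- T) T) (aff 1 (- T) (2 * T))) f2 by rewrite bT b2.
  have [j1 k1] := aff_itgN (ltrN10 _) i1'; have [j2 k2] := aff_itgP ltr01 i2'.
  rewrite aT a0 in k1; rewrite bT b2 in k2.
  have h1 (x : R) : 0 <= x <= T -> f1 (aff (-1) T x) = bump f1 f2 x by move=> /andP[_ h]; rewrite /bump h.
  have h2 (x : R) : T < x <= 2 * T -> f2 (aff 1 (- T) x) = bump f1 f2 x.
    by move=> /andP[h _]; rewrite /bump leNgt h.
  have g1 : igr (sgm 0 T) (bump f1 f2) := igr_eq (msgm 0 T) h1 j1.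
  have g2 : igr (sgm T (2 * T)) (bump f1 f2) := igr_eq_oc TT j2 h2.
  have g3 := igr_join (ltW T0) TT g1 g2; split => //.
  rewrite (int_split (ltW T0) TT g3) -(int_eq h1) k1 -(itg_eq_oc TT j2 h2) k2.
  by rewrite invrN1 opprK invr1 !mul1r.
have ac1 : acf 0 T (fun x => w (aff (-1) T x)) (fun x => -1 * g (aff (-1) T x)).
  by apply: acf_affN (ltrN10 _) (ltW T0) _; rewrite aT a0.
have ac2 : acf T (2 * T) (fun x => w (aff 1 (- T) x)) (fun x => 1 * g (aff 1 (- T) x)).
  by apply: acf_affP ltr01 TT _; rewrite bT b2.
pose u := bump w w; pose h := bump (fun x => -1 * g x) (fun x => 1 * g x).
have au : acf 0 (2 * T) u h.
  apply: (acf_join (ltW T0) TT).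
    by apply: (acf_eq ac1 (ltW T0)) => x /andP[_ xT]; rewrite /u /h /bump xT.
  apply: (acf_eq_oc ac2 TT) => x /andP[xT _].
    rewrite /u /bump; case: ifP => // xT'; have -> : x = T by apply/eqP; rewrite eq_le xT xT'.
    by rewrite aT bT.
  by rewrite /h /bump leNgt xT.
have cw := acf_cont (ltW T0) ac.
have iw : igr (sgm 0 T) (fun x => w x ^+ 2).
  apply: cont_on_igr; apply: (cont_on_comp (G := fun x => x ^+ 2) cw); exact: exprn_continuous.
have ip : igr (sgm 0 T) (fun x => `|w x| `^ p).
  apply: cont_on_igr; apply: (cont_on_comp (G := fun x : R => `|x| `^ p) cw).
  exact: continuous_powR_norm.
have ig : igr (sgm 0 T) (fun x => g x ^+ 2) by case: sg.
have hE : (fun x => h x ^+ 2) = bump (fun x => g x ^+ 2) (fun x => g x ^+ 2).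
  by apply/funext => x; rewrite /h /bump; case: ifP => _; rewrite ?mulN1r ?sqrrN ?mul1r.
have uE : (fun x => u x ^+ 2) = bump (fun x => w x ^+ 2) (fun x => w x ^+ 2).
  by apply/funext => x; rewrite /u /bump; case: ifP.
have pE : (fun x => `|u x| `^ p) = bump (fun x => `|w x| `^ p) (fun x => `|w x| `^ p).
  by apply/funext => x; rewrite /u /bump; case: ifP.
have [ih ieh] := bumpI _ _ ig ig; rewrite -hE in ih ieh.
have [iu ieu] := bumpI _ _ iw iw; rewrite -uE in iu ieu.
have [iq ieq] := bumpI _ _ ip ip; rewrite -pE in iq ieq.
have sh : sq (sgm 0 (2 * T)) h by split => //; apply: igr_meas; case: au.
have u2T : u (2 * T) = 0.
  by rewrite /u /bump ifF ?b2//; apply/negbTE; rewrite -ltNge ltr_pMl// ltr1n.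
have hH := H1_zext T20 au sh u2T.
have nt : (ord0 : 'I_4) != tip by [].
have u0 : zext (2 * T) u 0 = 0 by rewrite /zext T20 /u /bump (ltW T0) a0.
have hU : inH l (single ord0 (zext (2 * T) u)) (single ord0 (zext (2 * T) h)).
  by apply: inH_single (ltW l0) _ u0; rewrite dom_ray.
have zE (f : R -> R) (F : R -> R) : F 0 = 0 -> igr (sgm 0 (2 * T)) (fun x => F (f x)) ->
    itg (ray 0) (fun x => F (zext (2 * T) f x)) = itg (sgm 0 (2 * T)) (fun x => F (f x)).
  by move=> F0 i; rewrite zext_comp//; have [_] := zext_ray T20 i.
have m1 : sqn l (single ord0 (zext (2 * T) u)) <= mu.
  rewrite sqn_single dom_ray// (zE u (fun x => x ^+ 2) (expr0n _ 2) iu) ieu.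
  exact: double_half.
have h0 : `|0 : R| `^ p = 0 by rewrite normr0 powR0// gt_eqF.
have E1 : ener p l (single ord0 (zext (2 * T) u)) (single ord0 (zext (2 * T) h)) < lev p 2 mu + e.
  rewrite ener_single dom_ray// (zE h (fun x => x ^+ 2) (expr0n _ 2) ih) ieh.
  rewrite (zE u (fun x => `|x| `^ p) h0 iq) ieq.
  have -> : lev p 2 mu = 2 * (Kal p M M - p^-1 * (M `^ (p - 2) * (mu / 2))).
    rewrite /lev /Phi -/M Kal_max//; move: (M `^ (p / 2) * M) (M `^ (p - 2)) (Hk p 1) => z1 z2 z3.
    by field; rewrite gt_eqF.
  exact: double_arith.
exact: adjust_mass (ltW l0) hU m1 E1 e1.
Qed.

End testfunctions.

(** * The Euler-Lagrange equation *)

Section power.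
Context {R : realType}.
Local Notation MR := (measurableTypeR R).
Local Notation leb := (@lebesgue_measure R).

(** The supporting lines at [t] and at [z] squeeze the difference quotient between [g t] and [g z],
    and [g] is continuous. *)
Lemma is_derive_convex (G g : R -> R) (t : R) :
  (forall a b : R, G a + g a * (b - a) <= G b) -> continuous g -> is_derive t 1 G (g t).
Proof.
move=> h cg; apply/is_derive1_caratheodory.
exists (fun z => if z == t then g t else (G z - G t) / (z - t)); split.
- move=> z; case: eqVneq => [->|zt]; first by rewrite !subrr mulr0.
  by rewrite mulfVK// subr_eq0.
- apply/cvgrPdist_lt => e e0; rewrite eqxx.
  have := cg t; move=> /cvgrPdist_lt/(_ e e0); apply: filterS => z.
  case: eqVneq => [->|zt]; first by rewrite subrr normr0.
  apply: le_lt_trans; have h1 := h t z; have h2 := h z t.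
  have [zt'|zt'] := ltP t z.
    have d0 : 0 < z - t by rewrite subr_gt0.
    have a1 : g t <= (G z - G t) / (z - t) by rewrite ler_pdivlMr//; lra.
    have a2 : (G z - G t) / (z - t) <= g z by rewrite ler_pdivrMr//; lra.
    rewrite distrC ger0_norm ?subr_ge0// [leRHS]distrC ger0_norm ?lerD2r//.
    by rewrite subr_ge0; exact: le_trans a2.
  have d0 : z - t < 0 by rewrite subr_lt0 lt_neqAle zt.
  have a1 : (G z - G t) / (z - t) <= g t by rewrite ler_ndivrMr//; lra.
  have a2 : g z <= (G z - G t) / (z - t) by rewrite ler_ndivlMr//; lra.
  rewrite ger0_norm ?subr_ge0// ger0_norm ?lerD2l ?lerN2//.
  by rewrite subr_ge0; exact: le_trans a1.
- by rewrite eqxx.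
Qed.

Definition fpow (q t : R) : R := `|t| `^ (q - 2) * t.

(** Convexity of [|t|^q], obtained from Young's inequality with exponents [q] and [q / (q - 1)]. *)
Lemma powR_tangent_line (q a b : R) : 1 < q -> `|a| `^ q + q * fpow q a * (b - a) <= `|b| `^ q.
Proof.
move=> q1; have q0 : 0 < q by exact: lt_trans q1.
have [->|a0] := eqVneq a 0.
  by rewrite /fpow normr0 mulr0 mulr0 mul0r addr0 powR0 ?gt_eqF// powR_ge0.
have na : 0 < `|a| by rewrite normr_gt0.
have aq : fpow q a * a = `|a| `^ q.
  rewrite /fpow -mulrA -expr2 -real_normK ?num_real// -powR_mulrn ?normr_ge0//.
  by rewrite -powRD_pos//; congr (_ `^ _); ring.
have nf : `|fpow q a| = `|a| `^ (q - 1).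
  rewrite /fpow normrM ger0_norm ?powR_ge0// -[X in _ * X]powRr1 ?normr_ge0//.
  by rewrite -powRD_pos//; congr (_ `^ _); ring.
have qm : 0 < q - 1 by rewrite subr_gt0.
have y := @conjugate_powR R `|b| (`|a| `^ (q - 1)) q (q / (q - 1)).
have {y} : `|b| * `|a| `^ (q - 1) <= `|b| `^ q / q + (`|a| `^ (q - 1)) `^ (q / (q - 1)) / (q / (q - 1)).
  apply: y; rewrite ?normr_ge0 ?powR_ge0 ?divr_gt0//.
  by field; rewrite !gt_eqF.
rewrite -powRrM (_ : (q - 1) * (q / (q - 1)) = q); last by field; rewrite gt_eqF.
move=> y; have y2 : q * (`|b| * `|a| `^ (q - 1)) <= `|b| `^ q + (q - 1) * `|a| `^ q.
  have := ler_wpM2l (ltW q0) y; congr (_ <= _); field.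
  by rewrite !gt_eqF.
have y3 : q * (fpow q a * b) <= q * (`|b| * `|a| `^ (q - 1)).
  rewrite ler_wpM2l ?(ltW q0)//; apply: le_trans (ler_norm _) _.
  by rewrite normrM nf mulrC.
have -> : q * fpow q a * (b - a) = q * (fpow q a * b) - q * (fpow q a * a) by ring.
by rewrite aq; move: y2 y3; lra.
Qed.

Lemma fpow_cont (q : R) : 2 < q -> continuous (fpow q).
Proof.
move=> q2 t; apply: (@continuousM _ _ (fun t : R => `|t| `^ (q - 2)) id); last exact: cvg_id.
by apply: continuous_powR_norm; rewrite subr_gt0.
Qed.

Lemma is_derive_powR_norm (q t : R) : 2 < q -> is_derive t 1 (fun t : R => `|t| `^ q) (q * fpow q t).
Proof.
move=> q2; apply: (@is_derive_convex (fun t : R => `|t| `^ q) (fun t => q * fpow q t)).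
  by move=> a b; apply: powR_tangent_line; apply: lt_trans q2; rewrite ltr1n.
move=> x; apply: (@continuousM _ _ (cst q)); first exact: cvg_cst.
exact: fpow_cont.
Qed.

(** For two points of the same sign, tangent lines for the exponent [q - 1]; for opposite signs,
    each value is bounded by [M^(q-2)] times its distance to [0]. *)
Lemma fpow_lip (q M a b : R) : 2 < q -> `|a| <= M -> `|b| <= M ->
  `|fpow q b - fpow q a| <= (q - 1) * M `^ (q - 2) * `|b - a|.
Proof.
move=> q2; wlog ab : a b / a <= b.
  move=> hw aM bM; case: (leP a b) => h; first exact: hw.
  by have := hw b a (ltW h) bM aM; rewrite distrC [`|a - b|]distrC.
move=> aM bM; have M0 : 0 <= M by exact: le_trans aM.
have k0 : 0 <= M `^ (q - 2) by exact: powR_ge0.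
have q10 : 1 <= q - 1 by lra.
have k1 : M `^ (q - 2) <= (q - 1) * M `^ (q - 2) by rewrite ler_peMl.
have Mq (c : R) : `|c| <= M -> `|c| `^ (q - 2) <= M `^ (q - 2).
  by move=> cM; apply: ge0_ler_powR; rewrite ?nnegrE ?normr_ge0//; lra.
have pos (x y : R) : 0 <= x -> x <= y -> `|y| <= M -> 0 <= fpow q y - fpow q x <= (q - 1) * M `^ (q - 2) * (y - x).
  move=> x0 xy yM; have y0 : 0 <= y by exact: le_trans xy.
  have fE (z : R) : 0 <= z -> fpow q z = `|z| `^ (q - 1).
    move=> z0; rewrite /fpow; have [->|zn] := eqVneq z 0.
      by rewrite mulr0 normr0 powR0// gt_eqF//; lra.
    rewrite [X in _ * X](_ : z = `|z| `^ 1); last by rewrite powRr1 ?normr_ge0// ger0_norm.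
    rewrite -powRD; first by congr (_ `^ _); ring.
    by rewrite normr_eq0 zn implybT.
  have q1' : 1 < q - 1 by lra.
  have t1 := powR_tangent_line x y q1'; have t2 := powR_tangent_line y x q1'.
  rewrite !fE// ; apply/andP; split.
    rewrite subr_ge0; apply: le_trans t1; rewrite lerDl mulr_ge0 ?subr_ge0//.
    by rewrite mulr_ge0 ?mulr_ge0 ?powR_ge0//; lra.
  have t3 : fpow (q - 1) y <= M `^ (q - 2).
    apply: le_trans (Mq _ yM); rewrite /fpow; have [->|yn] := eqVneq y 0; first by rewrite mulr0 powR_ge0.
    rewrite [X in _ * X](_ : y = `|y| `^ 1); last by rewrite powRr1 ?normr_ge0// ger0_norm.
    rewrite -powRD ?normr_eq0 ?yn ?implybT//.
    by rewrite (_ : q - 1 - 2 + 1 = q - 2)//; ring.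
  have d0 : 0 <= y - x by rewrite subr_ge0.
  have : (q - 1) * fpow (q - 1) y * (y - x) <= (q - 1) * M `^ (q - 2) * (y - x).
    by rewrite ler_wpM2r// ler_wpM2l//; lra.
  by move: t2; rewrite -[x - y]opprB mulrN; lra.
have odd (z : R) : fpow q (- z) = - fpow q z by rewrite /fpow normrN mulrN.
have d0 : 0 <= b - a by rewrite subr_ge0.
rewrite [`|b - a|]ger0_norm//.
case: (leP 0 a) => a0.
  by have /andP[h1 h2] := pos a b a0 ab bM; rewrite ger0_norm.
case: (leP b 0) => b0.
  have := pos (- b) (- a); rewrite oppr_ge0 lerN2 normrN !odd => /(_ b0 ab aM).
  rewrite !opprK [- fpow q a + _]addrC [- a + b]addrC => /andP[h1 h2].
  by rewrite ger0_norm.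
have e1 : fpow q b <= M `^ (q - 2) * b by rewrite /fpow ler_wpM2r ?(ltW b0)// Mq.
have e2 : - fpow q a <= M `^ (q - 2) * - a.
  by rewrite /fpow -mulrN ler_wpM2r ?oppr_ge0 ?(ltW a0)// Mq.
have p1 : 0 <= fpow q b by rewrite /fpow mulr_ge0 ?powR_ge0 ?(ltW b0).
have p2 : 0 <= - fpow q a by rewrite /fpow -mulrN mulr_ge0 ?powR_ge0 ?oppr_ge0 ?(ltW a0).
rewrite ger0_norm ?addr_ge0//; apply: (@le_trans _ _ (M `^ (q - 2) * (b - a))).
  by rewrite mulrBr; move: e1 e2; rewrite mulrN; lra.
by rewrite ler_wpM2r.
Qed.

Lemma powR_inv_tangent (x q : R) : 0 < x -> 0 <= q -> 1 - q * (x - 1) <= x^-1 `^ q.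
Proof.
move=> x0 q0; rewrite /powR gt_eqF ?invr_gt0// lnV ?posrE//.
apply: le_trans (expR_ge1Dx _); rewrite lerD2l mulrN lerN2 ler_wpM2l//.
have := ln_sublinear x0; have := le_ln1Dx (x := x - 1); rewrite addrCA subrr addr0.
by move=> h _; apply: h; lra.
Qed.

End power.

(** * First variation at a minimizer *)

Section eulerlagrange.
Context {R : realType}.
Local Notation MR := (measurableTypeR R).
Local Notation leb := (@lebesgue_measure R).

Lemma EL_arith (t mu I A b Bt a m n D b1 q r Y lam : R) : 0 < mu -> r = (2 * t * m + t ^+ 2 * n) / mu ->
  lam = 2 / mu * (q * b - I) -> I = 2^-1 * A - b -> 0 <= Bt -> 1 - q * r <= Y -> 0 <= 1 - q * r ->
  b + t * b1 <= Bt ->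
  (1 + r) * I + Bt * (Y - 1) <= 2^-1 * (A + 2 * t * a + t ^+ 2 * D) - Bt ->
  0 <= t * (a + lam * m - b1) + t ^+ 2 * (D / 2 + lam * n / 2) + t * b1 * (q * r).
Proof.
move=> mu0 rE lE IE B0 hY hr hB h.
have e1 : r * (q * b - I) = lam * (t * m + t ^+ 2 * n / 2).
  by rewrite rE lE; field; rewrite gt_eqF.
have e2 : Bt * (1 - q * r) <= Bt * Y by rewrite ler_wpM2l.
have e3 : (b + t * b1) * (1 - q * r) <= Bt * (1 - q * r) by rewrite ler_wpM2r.
move: e1 e2 e3 h; rewrite {}IE; move: (lam) => z; nra.
Qed.

Lemma increment_bound (t m n : R) : `|t| <= 1 -> 0 <= n ->
  `|2 * t * m + t ^+ 2 * n| <= `|t| * (2 * `|m| + n).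
Proof.
move=> t1 n0; rewrite (_ : _ + _ = t * (2 * m + t * n)); last by ring.
rewrite normrM ler_wpM2l//; apply: le_trans (ler_normD _ _) _; rewrite !normrM ger0_norm// lerD2l.
by rewrite (ger0_norm n0) -[leRHS]mul1r ler_wpM2r.
Qed.

Lemma small_ratio (q r : R) : 0 < q -> `|r| * (2 * (1 + q)) <= 1 -> 0 <= 1 - q * r /\ 0 < 1 + r.
Proof.
move=> q0; have := ler_norm r; have := ler_norm (- r); rewrite normrN; have := normr_ge0 r.
by move: (`|r|) => z *; split; nra.
Qed.

Lemma coef_bound (t d k n b q r s : R) : 0 <= n -> 0 < q -> `|r| <= `|t| * s ->
  t ^+ 2 * (d / 2 + k * n / 2) + t * b * (q * r) <= (d / 2 + `|k| * n / 2 + `|b| * (q * s)) * t ^+ 2.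
Proof.
move=> n0 q0 rs; have h1 : t ^+ 2 * (k * n / 2) <= t ^+ 2 * (`|k| * n / 2).
  by rewrite ler_wpM2l ?sqr_ge0// ler_wpM2r// ler_wpM2r// ler_norm.
have h2 : t * b * (q * r) <= `|t| * `|b| * (q * (`|t| * s)).
  apply: le_trans (ler_norm _) _; rewrite !normrM (gtr0_norm q0).
  by rewrite ler_wpM2l ?mulr_ge0// ler_wpM2l ?(ltW q0).
have h3 : `|t| * `|b| * (q * (`|t| * s)) = `|b| * (q * s) * t ^+ 2.
  by rewrite -[t ^+ 2]real_normK ?num_real//; ring.
by move: h1 h2; rewrite h3; lra.
Qed.

Lemma vanish_linear (L C t0 : R) : 0 < t0 -> 0 <= C ->
  (forall t : R, `|t| <= t0 -> 0 <= t * L + C * t ^+ 2) -> L = 0.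
Proof.
move=> t00 C0 h; apply/eqP; apply/negPn/negP => L0.
have n0 : 0 < `|L| by rewrite normr_gt0.
(* At [t = - s L] the hypothesis reads [0 <= s L^2 (s C - 1)], while [s (C + 1) <= 1]. *)
pose s := Num.min (t0 / `|L|) ((C + 1)^-1).
have C1 : 0 < C + 1 by rewrite ltr_wpDl.
have s0 : 0 < s by rewrite lt_min divr_gt0//= invr_gt0.
have s1 : s * `|L| <= t0 by rewrite -ler_pdivlMr// ge_min lexx.
have s2 : s * (C + 1) <= 1 by rewrite -ler_pdivlMr// div1r ge_min lexx orbT.
have := h (- s * L); rewrite normrM normrN (gtr0_norm s0) => /(_ s1).
have L2 : 0 < L ^+ 2 by rewrite -real_normK ?num_real// exprn_gt0.
have -> : - s * L * L + C * (- s * L) ^+ 2 = s * L ^+ 2 * (s * C - 1) by ring.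
have sL : 0 < s * L ^+ 2 by rewrite mulr_gt0.
by rewrite (pmulr_rge0 _ sL) subr_ge0 leNgt (lt_le_trans _ s2)// ltr_pM2l// ltrDl.
Qed.

Context (p : R) (p2 : 2 < p) (p6 : p < 6).
Let p_gt0 : 0 < p. Proof. by apply: lt_trans p2. Qed.
Let pm2 : 0 < p - 2. Proof. by rewrite subr_gt0. Qed.
Let q0 : 0 < p / 2 - 1. Proof. by rewrite subr_gt0 ltr_pdivlMr// mul1r. Qed.

Definition dot (l : R) (X Y : 'I_4 -> R -> R) : R := \sum_i itg (dom l i) (fun x => X i x * Y i x).

Lemma sqn_lin (l t : R) X Y : sqg l X -> sqg l Y ->
  sqn l (lin 1 X t Y) = sqn l X + 2 * t * dot l X Y + t ^+ 2 * sqn l Y.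
Proof.
move=> sX sY; rewrite /sqn /dot !mulr_sumr -!big_split /=; apply: eq_bigr => i _.
have mD := mdom l i; have [_ iX] := sX i; have [_ iY] := sY i.
have iXY := sq_mul mD (sX i) (sY i).
rewrite -intZ// -intZ// -intD//; last exact: igrZ.
rewrite -intD//; [|by apply: igrD => //; exact: igrZ|exact: igrZ].
by apply: int_eq => x _; rewrite /lin; ring.
Qed.

Section minimizer.
Variables (l mu : R) (U G : 'I_4 -> R -> R).
Hypotheses (l0 : 0 < l) (mu0 : 0 < mu) (hU : inH l U G) (Umu : sqn l U = mu).
Hypothesis hmin : forall V K, inH l V K -> sqn l V = mu -> ener p l U G <= ener p l V K.

(* The Lagrange multiplier, read off from the scaling [u |-> k u]. *)
Definition mult : R := 2 / mu * ((p / 2 - 1) * (p^-1 * pn p l U) - ener p l U G).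

Lemma sq_fpow (I : set MR) u (M : R) : measurable I -> sq I u -> (forall x, I x -> `|u x| <= M) ->
  sq I (fun x => fpow p (u x)).
Proof.
move=> mI [mu' iu] uM.
have mf : measurable_fun I ((fun x => fpow p (u x)) : MR -> MR).
  apply: (@measurable_comp _ _ _ _ _ _ setT (fpow p : MR -> MR)) => //.
  by apply: continuous_measurable_fun; exact: fpow_cont.
split => //; set k := M `^ (p - 2).
apply: (@igr_le _ I _ (fun x => k ^+ 2 * u x ^+ 2)) => //; first exact: measurable_funX.
  exact: igrZ.
move=> x Ix; have uMx := uM x Ix; have M0 : 0 <= M by exact: le_trans (normr_ge0 _) uMx.
rewrite ger0_norm ?sqr_ge0// /fpow exprMn ler_wpM2r ?sqr_ge0// ler_sqr ?nnegrE ?powR_ge0//.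
by apply: ge0_ler_powR; rewrite ?nnegrE ?normr_ge0// ltW.
Qed.

Lemma pn_tangent N N' (t : R) : inH l N N' ->
  p^-1 * pn p l U + t * dot l (fun i x => fpow p (U i x)) N <= p^-1 * pn p l (lin 1 U t N).
Proof.
move=> hN; have [M M0 bM] := inH_bounded (ltW l0) hU.
have hV := inH_lin 1 t (ltW l0) hU hN; have [M' M'0 bM'] := inH_bounded (ltW l0) hV.
have sU := inH_sqg (ltW l0) hU; have sN := inH_sqg (ltW l0) hN; have sV := inH_sqg (ltW l0) hV.
rewrite /pn /dot !mulr_sumr -big_split /=; apply: ler_sum => i _.
have mD := mdom l i.
have ip := igr_powp p2 mD (sU i) (bM i); have ip' := igr_powp p2 mD (sV i) (bM' i).
have ifp := sq_mul mD (sq_fpow mD (sU i) (bM i)) (sN i).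
rewrite -intZ// -intZ// -intD//; [|exact: igrZ|exact: igrZ].
rewrite -intZ//; apply: int_le => //; [by apply: igrD => //; exact: igrZ|exact: igrZ|].
move=> x _; have p1 : 1 < p by apply: lt_trans p2; rewrite ltr1n.
have := powR_tangent_line (U i x) (lin 1 U t N i x) p1.
rewrite /lin mul1r addrAC subrr add0r => h.
have ip0 : 0 < p^-1 by rewrite invr_gt0.
have := ler_wpM2l (ltW ip0) h; apply: le_trans.
rewrite mulrDr lerD2l (_ : p^-1 * _ = p^-1 * p * (t * (fpow p (U i x) * N i x))); last by ring.
by rewrite mulVf ?gt_eqF// mul1r.
Qed.

(** [scaling], with [I] the minimal energy, tests against [U + t N] whatever its mass [mu (1 + r)].
    Convexity of the powers keeps all estimates one-sided and leaves [0 <= t L + C t^2] for small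
    [t] of both signs. *)
Lemma weak_EL N N' : inH l N N' ->
  dot l G N' + mult * dot l U N - dot l (fun i x => fpow p (U i x)) N = 0.
Proof.
move=> hN; set a := dot l G N'; set m := dot l U N; set b1 := dot l _ N.
set n := sqn l N; set D := sqn l N'; set q := p / 2 - 1.
have n0 : 0 <= n by exact: sqn_ge0.
have D0 : 0 <= D by exact: sqn_ge0.
have sU := inH_sqg (ltW l0) hU; have sG := inH_sqgd hU.
have sN := inH_sqg (ltW l0) hN; have sN' := inH_sqgd hN.
pose S := 2 * `|m| + n; have S0 : 0 <= S by rewrite addr_ge0// mulr_ge0.
pose Q := 1 + q; have Q0 : 0 < Q by rewrite addr_gt0.
(* For [|t| <= t0] the relative change [r] of the mass satisfies [2 (1 + q) |r| <= 1], so [1 + r] is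
   positive and [1 - q r] nonnegative. *)
pose t0 := Num.min 1 (mu / (2 * Q * (S + 1))).
have S1 : 0 < S + 1 by rewrite ltr_wpDl.
have t00 : 0 < t0 by rewrite lt_min ltr01 divr_gt0// !mulr_gt0.
have t01 : t0 <= 1 by rewrite ge_min lexx.
have t02 : t0 * (2 * Q * (S + 1)) <= mu.
  by rewrite -ler_pdivlMr ?mulr_gt0// ge_min lexx orbT.
pose C := D / 2 + `|mult| * n / 2 + `|b1| * (q * (S / mu)).
have C0 : 0 <= C.
  by rewrite !addr_ge0// ?mulr_ge0// ?invr_ge0// ?(ltW mu0) ?(ltW q0).
apply: (vanish_linear t00 C0) => t tt0.
have [r1 r2] : `|2 * t * m + t ^+ 2 * n| <= `|t| * S /\ `|t| * S * (2 * Q) <= mu.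
  have nt := normr_ge0 t; split.
    exact: increment_bound (le_trans tt0 t01) n0.
  apply: le_trans t02; rewrite -mulrA; apply: ler_pM => //.
    by rewrite mulr_ge0// mulr_ge0// ltW.
  by rewrite mulrC ler_wpM2l ?mulr_ge0 ?(ltW Q0)// lerDl.
set r := (2 * t * m + t ^+ 2 * n) / mu.
have rS : `|r| <= `|t| * (S / mu).
  by rewrite /r normrM normfV (gtr0_norm mu0) mulrA ler_wpM2r// invr_ge0 ltW.
have rQ : `|r| * (2 * Q) <= 1.
  apply: (@le_trans _ _ (`|t| * (S / mu) * (2 * Q))).
    by rewrite ler_wpM2r// mulr_ge0// ltW.
  by rewrite mulrA mulrAC ler_pdivrMr// mul1r.
have [qr r1'] : 0 <= 1 - q * r /\ 0 < 1 + r.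
  exact: small_ratio q0 rQ.
have hV := inH_lin 1 t (ltW l0) hU hN.
have nu : sqn l (lin 1 U t N) = mu * (1 + r).
  by rewrite (sqn_lin t sU sN) Umu -/m -/n /r; field; rewrite gt_eqF.
have nu0 : 0 < sqn l (lin 1 U t N) by rewrite nu mulr_gt0.
have := scaling p2 (ltW l0) mu0 hmin hV nu0.
have e1 : sqn l (lin 1 U t N) / mu = 1 + r by rewrite nu mulrAC divff ?gt_eqF// mul1r.
have e2 : mu / sqn l (lin 1 U t N) = (1 + r)^-1 by rewrite -e1 invf_div.
rewrite e1 e2 {2}/ener (sqn_lin t sG sN') -/a -/D => hs.
have hY := powR_inv_tangent r1' (ltW q0); rewrite [1 + r - 1]addrAC subrr add0r -/q in hY.
have Bt0 : 0 <= p^-1 * pn p l (lin 1 U t N).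
  by rewrite mulr_ge0 ?pn_ge0// invr_ge0 ltW.
have := EL_arith mu0 (erefl r) (erefl mult) (erefl (ener p l U G)) Bt0 hY qr (pn_tangent t hN) hs.
rewrite -/b1 => fin; apply: le_trans fin _.
by rewrite -addrA lerD2l; exact: coef_bound.
Qed.

End minimizer.

End eulerlagrange.

(** * Regularity of minimizers and Kirchhoff's law *)

Section regularity.
Context {R : realType}.
Local Notation MR := (measurableTypeR R).
Local Notation leb := (@lebesgue_measure R).

Lemma sqr_le0 (x : R) : x ^+ 2 <= 0 -> x = 0.
Proof. by move=> h; apply/eqP; rewrite -sqrf_eq0 eq_le h sqr_ge0. Qed.

Section duboisreymond.
Variables (T : R) (g w : R -> R).
Hypotheses (T0 : 0 < T) (sg : sq (sgm 0 T) g) (cw : cont_on (sgm 0 T) w).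
Local Notation J := (sgm 0 T).
Let W (x : R) : R := itg (sgm 0 x) w.

Lemma acf_prim (c : R) : acf 0 T (fun x => W x + c) w.
Proof.
split; first exact: cont_on_igr.
by move=> x _; rewrite /W int_pt add0r addrC.
Qed.

Lemma sq_cont (u : R -> R) : cont_on J u -> sq J u.
Proof.
move=> cu; split; first exact: cont_on_meas.
by apply: cont_on_igr; apply: (cont_on_comp (G := fun x => x ^+ 2) cu); exact: exprn_continuous.
Qed.

(** The test function is the primitive [h] of [g - (W + c)] itself; integration by parts turns the
    weak equation into the vanishing of the integral of [h'^2]. The boundary term [h T (W T + c)]
    disappears through [h T = 0] on a halfline and through [W T + c = 0] at the free end of the
    tip. *)
Lemma duboisreymond (c : R) :
  (forall h h', acf 0 T h h' -> sq J h' -> h 0 = 0 -> h T = itg J (fun x => g x - (W x + c)) ->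
    itg J (fun x => g x * h' x + w x * h x) = 0) ->
  itg J (fun x => g x - (W x + c)) * (W T + c) = 0 ->
  itg J (fun x => (g x - (W x + c)) ^+ 2) = 0.
Proof.
move=> hEL hc; have ak := acf_prim c; have sk := sq_cont (acf_cont (ltW T0) ak).
pose h' x := g x - (W x + c); pose h x := itg (sgm 0 x) h'.
have sh' : sq J h' by exact: sqB.
have ah : acf 0 T h h'.
  by split; [exact: sq_igr|move=> x _; rewrite /h int_pt add0r].
have h0 : h 0 = 0 by rewrite /h int_pt.
have e1 := hEL h h' ah sh' h0 erefl.
have am := acf_mul (ltW T0) ak ah.
have := acf_diff am (lexx 0) (ltW T0) (lexx T); rewrite h0 mulr0 subr0 [_ * h T]mulrC hc => e2.
have sh : sq J h by exact: sq_cont (acf_cont (ltW T0) ah).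
have i1 := sq_mul (msgm 0 T) sg sh'.
have i2 := sq_mul (msgm 0 T) (sq_cont cw) sh.
have i3 := sq_mul (msgm 0 T) sk sh'.
rewrite intD// in e1; rewrite intD// in e2.
transitivity (itg J (fun x => g x * h' x) - itg J (fun x => (W x + c) * h' x)).
  by rewrite -intB//; apply: int_eq => x _; rewrite /h'; ring.
by move: e1 e2; lra.
Qed.

(** Cauchy-Schwarz against the constant [1] gives equal primitives, against [g + k] equal norms. *)
Lemma zero_sq (k : R -> R) : sq J k -> itg J (fun x => (g x - k x) ^+ 2) = 0 ->
  (forall x : R, 0 <= x <= T -> itg (sgm 0 x) g = itg (sgm 0 x) k) /\
  itg J (fun x => k x ^+ 2) = itg J (fun x => g x ^+ 2).
Proof.
move=> sk z; have sd := sqB (msgm 0 T) sg sk; split.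
  move=> x /andP[x0 xT]; have sub : sgm 0 x `<=` J by exact: sgm_sub.
  have sS f : sq J f -> sq (sgm 0 x) f by exact: sqS.
  have := cauchy_schwarz (msgm 0 x) (sS _ sd) (sq_cst 0 x 1).
  have z' : itg (sgm 0 x) (fun x => (g x - k x) ^+ 2) <= 0.
    by rewrite -[leRHS]z; apply: itg_sub => //; [case: sd|move=> t _; exact: sqr_ge0].
  have {}z' : itg (sgm 0 x) (fun x => (g x - k x) ^+ 2) = 0.
    by apply/eqP; rewrite eq_le z' int_ge0// => t _; exact: sqr_ge0.
  rewrite z' mul0r (int_eq (g := fun x => g x - k x)); last by move=> t _; rewrite mulr1.
  rewrite intB//; [|exact: sq_igr (sS _ sg)|exact: sq_igr (sS _ sk)].
  by move=> /sqr_le0 /eqP; rewrite subr_eq0 => /eqP.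
have sp := sqD (msgm 0 T) sg sk.
have := cauchy_schwarz (msgm 0 T) sd sp; rewrite z mul0r => /sqr_le0 e.
have [_ ig] := sg; have [_ ik] := sk.
apply/esym/eqP; rewrite -subr_eq0 -intB// -[eqbRHS]e; apply/eqP.
by apply: int_eq => x _; ring.
Qed.

End duboisreymond.

Lemma cont_on_ray (k : R -> R) : (forall T : R, cont_on (sgm 0 T) k) -> cont_on (ray 0) k.
Proof.
move=> h x x0 e e0; have x01 : 0 <= x <= x + 1 by rewrite x0 lerDl ler01.
have [d d0 hd] := h (x + 1) x x01 e e0.
exists (Num.min d 1); first by rewrite lt_min d0 ltr01.
move=> y y0; rewrite lt_min => /andP[y1 y2]; apply: hd => //; rewrite /sgm /= (y0 : 0 <= y) /=.
by move: y2; rewrite ltr_norml => /andP[_ y2]; rewrite ltW// -ltrBlDl.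
Qed.

Lemma igr_ray_bound (f : R -> R) (C : R) : (forall x : R, 0 <= x -> 0 <= f x) ->
  (forall T : R, 0 <= T -> igr (sgm 0 T) f /\ itg (sgm 0 T) f <= C) ->
  igr (ray 0) f /\ itg (ray 0) f <= C.
Proof.
move=> f0 hf; apply: (@itg_fatou _ (ray 0) (fun n => zext n%:R f)) => //.
- by move=> n; have [i _] := hf _ (ler0n _ n); have [] := zext_ray (ler0n _ n) i.
- by move=> n x x0; rewrite /zext; case: ifP => // _; exact: f0.
- by move=> n; have [i le] := hf _ (ler0n _ n); have [_ ->] := zext_ray (ler0n _ n) i.
- move=> x x0; apply/cvgrPdist_lt => e e0; exists (Num.truncn x).+1 => //= n nx.
  rewrite /zext ifT ?subrr ?normr0//; apply: ltW.
  have /andP[_ h] := truncn_itv (x0 : 0 <= x); apply: lt_le_trans h _; by rewrite ler_nat.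
Qed.

Context (p : R) (p2 : 2 < p) (p6 : p < 6).
Let p_gt0 : 0 < p. Proof. by apply: lt_trans p2. Qed.

Definition wfun (lam t : R) : R := lam * t - fpow p t.

Lemma wfun_cont (lam : R) : continuous (wfun lam).
Proof.
move=> x; apply: (@continuousB _ _ _ (fun t => lam * t)); last exact: fpow_cont.
by apply: (@continuousM _ _ (cst lam) id); [exact: cvg_cst|exact: cvg_id].
Qed.

Section minimizer.
Variables (l mu : R) (U G : 'I_4 -> R -> R).
Hypotheses (l0 : 0 < l) (mu0 : 0 < mu) (hU : inH l U G) (Umu : sqn l U = mu).
Hypothesis hmin : forall V K, inH l V K -> sqn l V = mu -> ener p l U G <= ener p l V K.
Local Notation lam := (mult p l mu U G).
Local Notation w := (fun i x => wfun lam (U i x)).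

Let sU : sqg l U. Proof. exact: inH_sqg (ltW l0) hU. Qed.
Let sG : sqg l G. Proof. exact: inH_sqgd hU. Qed.
Let ed i : is_edge (dom l i). Proof. exact: edge_dom (ltW l0). Qed.

Lemma EL_sum N N' : inH l N N' ->
  \sum_i itg (dom l i) (fun x => G i x * N' i x + w i x * N i x) = 0.
Proof.
move=> hN; have [M M0 bM] := inH_bounded (ltW l0) hU.
have sN := inH_sqg (ltW l0) hN; have sN' := inH_sqgd hN.
rewrite -[RHS](weak_EL p2 l0 mu0 hU Umu hmin hN) /dot mulr_sumr -big_split /= -sumrB.
apply: eq_bigr => i _; have mD := mdom l i.
have i1 := sq_mul mD (sG i) (sN' i); have i2 := sq_mul mD (sU i) (sN i).
have i3 := sq_mul mD (sq_fpow p2 mD (sU i) (bM i)) (sN i).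
have i2' := igrZ lam mD i2.
rewrite -intZ// -intD// -intB//; last exact: igrD.
by apply: int_eq => x _; rewrite /wfun; ring.
Qed.

Lemma EL_edge j h h' : H1 (dom l j) h h' -> h 0 = 0 ->
  itg (dom l j) (fun x => G j x * h' x + w j x * h x) = 0.
Proof.
move=> hh h0; rewrite -[RHS](EL_sum (inH_single (ltW l0) hh h0)) (bigD1 j)//= big1 ?addr0.
  by apply: int_eq => x _; rewrite /single eqxx.
move=> i ij; rewrite -[RHS](itg0 (dom l i)); apply: int_eq => x _.
by rewrite /single (negPf ij) !mulr0 addr0.
Qed.

Let cw i : cont_on (dom l i) (w i).
Proof. exact: (cont_on_comp (G := wfun lam) (H1_cont (ed i) (hU.1 i)) (@wfun_cont lam)). Qed.

Let acU i (T : R) : dom l i T -> 0 <= T -> acf 0 T (U i) (G i).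
Proof. by move=> dT T0; exact: H1_acf (ed i) (hU.1 i) (lexx 0) T0 dT. Qed.

Lemma transfer (i : 'I_4) (T : R) k : dom l i T -> 0 < T -> cont_on (sgm 0 T) k ->
  itg (sgm 0 T) (fun x => (G i x - k x) ^+ 2) = 0 ->
  acf 0 T (U i) k /\ itg (sgm 0 T) (fun x => k x ^+ 2) = itg (sgm 0 T) (fun x => G i x ^+ 2).
Proof.
move=> dT T0' ck z; have T0 := ltW T0'.
have sub := edge_sub (ed i) dT (lexx 0).
have sg : sq (sgm 0 T) (G i) := sqS (mdom l i) (msgm 0 T) sub (sG i).
have sk := sq_cont ck; have [e1 e2] := zero_sq sg sk z; split => //.
have [_ hu] := acU dT T0; split; first exact: cont_on_igr.
by move=> x xT; rewrite hu// e1.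
Qed.

(** Test functions are free at the end of the tip, so the constant is forced to be [- W l]: this is
    the natural condition [k l = 0]. *)
Lemma regular_tip : exists k, [/\ acf 0 l k (w tip), acf 0 l (U tip) k, k l = 0 &
  itg (sgm 0 l) (fun x => k x ^+ 2) = itg (sgm 0 l) (fun x => G tip x ^+ 2)].
Proof.
pose W x := itg (sgm 0 x) (w tip).
have cwt : cont_on (sgm 0 l) (w tip) by have := @cw tip; rewrite dom_tip.
have sgt : sq (sgm 0 l) (G tip) by have := @sG tip; rewrite dom_tip.
have dl : dom l tip l by rewrite dom_tip /sgm /= lexx (ltW l0).
have ak := acf_prim cwt (- W l).
exists (fun x => W x - W l).
have z : itg (sgm 0 l) (fun x => (G tip x - (W x - W l)) ^+ 2) = 0.
  apply: (duboisreymond l0 sgt cwt); last by rewrite subrr mulr0.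
  move=> h h' ah sh' h0 _; have := @EL_edge tip h h'; rewrite dom_tip; apply => //.
  exact: H1_sgm (ltW l0) ah sh'.
have [e1 e2] := transfer dl l0 (acf_cont (ltW l0) ak) z.
by split => //; rewrite subrr.
Qed.

(** On each [[0, T]] the constant is chosen so that the test function vanishes at [T] and can be
    extended by zero. *)
Lemma regular_ray i : i != tip -> exists k, [/\ forall T : R, 0 <= T -> acf 0 T k (w i),
  H1 (ray 0) (U i) k & itg (ray 0) (fun x => k x ^+ 2) <= itg (ray 0) (fun x => G i x ^+ 2)].
Proof.
move=> it; pose W x := itg (sgm 0 x) (w i).
have dE := dom_ray l it.
have cwT T : cont_on (sgm 0 T) (w i).
  by have := @cw i; rewrite dE; apply: cont_onS => x /andP[].
have dT T : 0 <= T -> dom l i T by rewrite dE.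
have sgT T : sq (sgm 0 T) (G i).
  by have := @sG i; rewrite dE; apply: sqS => // x /andP[].
have step (T : R) : 0 < T -> exists c : R, itg (sgm 0 T) (fun x => (G i x - (W x + c)) ^+ 2) = 0.
  move=> T0; have aW := acf_prim (cwT T) 0.
  pose d := itg (sgm 0 T) (fun x => G i x - W x); exists (d / T).
  have iW : igr (sgm 0 T) W.
    by have := cont_on_igr (acf_cont (ltW T0) aW); congr igr; apply/funext => x; rewrite addr0.
  have iG := sq_igr (sgT T).
  have z0 : itg (sgm 0 T) (fun x => G i x - (W x + d / T)) = 0.
    transitivity (itg (sgm 0 T) (fun x => (G i x - W x) - d / T)).
      by apply: int_eq => x _; ring.
    rewrite intB//; [|exact: igrB|exact: igr_cst].
    by rewrite -/d int_cst ?(ltW T0)// subr0 mulfVK ?subrr// gt_eqF.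
  apply: (duboisreymond T0 (sgT T) (cwT T)); last by rewrite z0 mul0r.
  move=> h h' ah sh' h0; rewrite z0 => hT; have hz := H1_zext (ltW T0) ah sh' hT.
  have hz0 : zext T h 0 = 0 by rewrite /zext (ltW T0).
  have := @EL_edge i (zext T h) (zext T h'); rewrite dE => /(_ hz hz0) ez; rewrite -[RHS]ez.
  have sh : sq (sgm 0 T) h by exact: sq_cont (acf_cont (ltW T0) ah).
  have ii : igr (sgm 0 T) (fun x => G i x * h' x + w i x * h x).
    apply: igrD => //; first exact: (sq_mul (msgm 0 T) (sgT T) sh').
    exact: (sq_mul (msgm 0 T) (sq_cont (cwT T)) sh).
  have [_ <-] := zext_ray (ltW T0) ii; apply: int_eq => x _.
  by rewrite /zext; case: ifP => // _; rewrite !mulr0 addr0.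
have [c hc] := step 1 ltr01.
have trT (T c' : R) : 0 < T -> itg (sgm 0 T) (fun x => (G i x - (W x + c')) ^+ 2) = 0 ->
    acf 0 T (U i) (fun x => W x + c') /\
    itg (sgm 0 T) (fun x => (W x + c') ^+ 2) = itg (sgm 0 T) (fun x => G i x ^+ 2).
  move=> T0 z; apply: (transfer (dT T (ltW T0)) T0) => //.
  exact: acf_cont (ltW T0) (acf_prim (cwT T) c').
(* The constants for [1] and for [T] agree, because both make [W] plus the constant a derivative of
   the same function on [[0, min 1 T]]. *)
have all (T : R) : 0 < T -> itg (sgm 0 T) (fun x => (G i x - (W x + c)) ^+ 2) = 0.
  move=> T0; have [c' hc'] := step T T0; suff -> : c = c' by [].
  have [[_ a1] _] := trT 1 c ltr01 hc; have [[_ a2] _] := trT T c' T0 hc'.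
  pose m := Num.min 1 T; have m0 : 0 < m by rewrite lt_min ltr01.
  have m1 : 0 <= m <= 1 by rewrite (ltW m0) ge_min lexx.
  have mT : 0 <= m <= T by rewrite (ltW m0) ge_min lexx orbT.
  have iW : igr (sgm 0 m) W.
    have := cont_on_igr (acf_cont (ltW m0) (acf_prim (cwT m) 0)).
    by congr igr; apply/funext => x; rewrite addr0.
  have := a1 m m1; rewrite (a2 m mT) !intD ?int_cst ?(ltW m0) ?subr0//; try exact: igr_cst.
  by move/addrI/addrI/mulIf; rewrite gt_eqF// => /(_ isT).
have acK (T : R) : 0 <= T -> acf 0 T (fun x => W x + c) (w i).
  by move=> T0; exact: acf_prim (cwT T) c.
exists (fun x => W x + c).
have su := H1_sq (ed i) (hU.1 i); have [_ iu] := su; rewrite dE in iu.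
have ig : igr (ray 0) (fun x => G i x ^+ 2) by have [_] := sG i; rewrite dE.
have [ik le] : igr (ray 0) (fun x => (W x + c) ^+ 2) /\
    itg (ray 0) (fun x => (W x + c) ^+ 2) <= itg (ray 0) (fun x => G i x ^+ 2).
  apply: igr_ray_bound; first by move=> x _; exact: sqr_ge0.
  move=> T; rewrite le_eqVlt => /orP[/eqP <-|T0].
    split; last by rewrite int_pt int_ge0// => x _; exact: sqr_ge0.
    by have [_] := sq_cont (acf_cont (lexx 0) (acK 0 (lexx 0))).
  split; first by have [_] := sq_cont (acf_cont (ltW T0) (acK T (ltW T0))).
  have [_ ->] := trT T c T0 (all T T0); apply: itg_sub => //; first by move=> x /andP[].
  by move=> x _; exact: sqr_ge0.
split => //; split => //; split.
  apply: cont_on_meas => //; apply: cont_on_ray => T.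
  case: (leP 0 T) => T0; first exact: acf_cont T0 (acK T T0).
  by move=> x /andP[x0 xT]; have := le_lt_trans x0 (le_lt_trans xT T0); rewrite ltxx.
split => // x; rewrite /ray /= le_eqVlt => /orP[/eqP <-|x0].
  split; last by rewrite int_pt addr0.
  exact: cont_on_igr (acf_cont (lexx 0) (acK 0 (lexx 0))).
have [[i1 e1] _] := trT x c x0 (all x x0); split => //.
by apply: e1; rewrite (ltW x0) lexx.
Qed.

Lemma regularize : exists K, [/\ inH l U K, sqn l K <= sqn l G, K tip l = 0 &
  forall i (T : R), dom l i T -> acf 0 T (K i) (w i)].
Proof.
have [kt [t1 t2 t3 t4]] := regular_tip.
have /choice[kr hr] : forall i, exists k, i != tip -> [/\ forall T : R, 0 <= T -> acf 0 T k (w i),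
    H1 (ray 0) (U i) k & itg (ray 0) (fun x => k x ^+ 2) <= itg (ray 0) (fun x => G i x ^+ 2)].
  move=> i; have [->|it] := eqVneq i tip; first by exists (fun=> 0).
  by have [k hk] := regular_ray it; exists k.
pose K i := if i == tip then kt else kr i.
have Kt : K tip = kt by rewrite /K eqxx.
have Kr i : i != tip -> K i = kr i by rewrite /K => /negPf ->.
exists K; split.
- split=> i; last exact: hU.2.
  have [->|it] := eqVneq i tip.
    rewrite Kt dom_tip; apply: H1_sgm (ltW l0) t2 _.
    exact: sq_cont (acf_cont (ltW l0) t1).
  by rewrite Kr// dom_ray//; have [] := hr i it.
- rewrite /sqn; apply: ler_sum => i _; have [->|it] := eqVneq i tip.
    by rewrite Kt dom_tip t4.
  by rewrite Kr// dom_ray//; have [] := hr i it.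
- by rewrite Kt.
- move=> i T; have [->|it] := eqVneq i tip.
    by rewrite dom_tip Kt => /andP[T0 Tl]; exact: acf_sub t1 (lexx 0) T0 Tl.
  by rewrite dom_ray// Kr// => T0; have [h _ _] := hr i it; exact: h.
Qed.

End minimizer.

Section kirchhoff.
Variables (l mu lam : R) (U K : 'I_4 -> R -> R).
Hypotheses (l0 : 0 < l) (mu0 : 0 < mu) (hU : inH l U K) (Umu : sqn l U = mu).
Hypothesis hmin : forall V L, inH l V L -> sqn l V = mu -> ener p l U K <= ener p l V L.
Hypothesis lamE : lam = mult p l mu U K.
Hypothesis hK : forall i (T : R), dom l i T -> acf 0 T (K i) (fun x => wfun lam (U i x)).

(** Test with the function that falls affinely from [1] at the vertex to [0] at distance [l] on
    every edge; after integration by parts only the slopes at the vertex remain. *)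
Lemma kirchhoff : \sum_i K i 0 = 0.
Proof.
pose h (x : R) := 1 + - l^-1 * x; pose h' (_ : R) := - l^-1.
have ah : acf 0 l h h'.
  apply: acf_C1T (ltW l0) _ (@cst_continuous _ _ (- l^-1)) => t.
  have e := is_derive_fD (is_derive_cst (1 : R) t 1) (is_derive_fZ (- l^-1) (is_derive_id t 1)).
  by apply: (is_derive_eq e); rewrite add0r mulr1.
have sh' : sq (sgm 0 l) h' by exact: sq_cst.
have hl : h l = 0 by rewrite /h mulNr mulVf ?subrr// gt_eqF.
have h0 : h 0 = 1 by rewrite /h mulr0 addr0.
have hz := H1_zext (ltW l0) ah sh' hl.
have hN : inH l (fun _ => zext l h) (fun _ => zext l h').
  split => // i; apply: H1_restrict edge_ray (edge_dom i (ltW l0)) _ hz.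
  by rewrite /dom; case: ifP => _ x // /andP[].
have := EL_sum l0 mu0 hU Umu hmin hN; rewrite -lamE => e.
apply/eqP; rewrite -oppr_eq0 -[eqbRHS]e -sumrN; apply/eqP/eq_bigr => i _.
have dl : dom l i l by rewrite /dom; case: ifP => _; rewrite /sgm /ray /= (ltW l0) ?lexx.
have aK := hK dl; have am := acf_mul (ltW l0) aK ah.
have := acf_diff am (lexx 0) (ltW l0) (lexx l); rewrite hl h0 mulr0 mulr1 sub0r => ->.
have ii := acf_igr am.
have [_ ez] := zext_ray (ltW l0) ii.
rewrite /dom; case: ifP => _; last first.
  by rewrite -ez; apply: int_eq => x _; rewrite /zext; case: ifP => _; rewrite ?mulr0 ?addr0// addrC.
by apply: int_eq => x /andP[_ xl]; rewrite /zext xl addrC.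
Qed.

End kirchhoff.

Lemma regular_minimizer (l mu : R) U G : 0 < l -> 0 < mu -> inH l U G -> sqn l U = mu ->
  (forall V K, inH l V K -> sqn l V = mu -> ener p l U G <= ener p l V K) -> ener p l U G < 0 ->
  exists K lam, [/\ inH l U K /\ ener p l U K = ener p l U G, 0 < lam, K tip l = 0,
    \sum_i K i 0 = 0 & forall i (T : R), dom l i T -> acf 0 T (K i) (fun x => wfun lam (U i x))].
Proof.
move=> l0 mu0 hU Umu hmin neg.
have [K [hK sK Kl aK]] := regularize l0 mu0 hU Umu hmin.
have eE : ener p l U K = ener p l U G.
  apply/eqP; rewrite eq_le hmin// andbT /ener lerD2r ler_wpM2l// invr_ge0//.
have hmin' V L : inH l V L -> sqn l V = mu -> ener p l U K <= ener p l V L.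
  by rewrite eE; exact: hmin.
exists K, (mult p l mu U G); split => //.
(* The multiplier is positive because the energy is negative and the [L^p] term enters with the
   factor [p/2 - 1 > 0]. *)
- rewrite /mult mulr_gt0 ?divr_gt0// ltr_pwDr ?oppr_gt0// mulr_ge0//.
    by rewrite subr_ge0 ler_pdivlMr// mul1r ltW.
  by rewrite mulr_ge0 ?pn_ge0// invr_ge0 ltW.
- by apply: (kirchhoff l0 mu0 hK Umu hmin' _ aK); rewrite /mult eE.
Qed.

End regularity.

(** * The stationary equation on an edge *)

Section ode.
Context {R : realType}.
Local Notation MR := (measurableTypeR R).
Local Notation leb := (@lebesgue_measure R).

(** Multiply [D] by [exp (- C x)] to the right of [x0] and by [exp (C x)] to the left; the products
    are monotone and vanish at [x0]. *)
Lemma gronwall (T C : R) (D d : R -> R) (x0 : R) : 0 <= T -> acf 0 T D d ->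
  (forall x : R, 0 <= x <= T -> `|d x| <= C * D x) -> 0 <= x0 <= T -> D x0 = 0 ->
  forall x : R, 0 <= x <= T -> D x <= 0.
Proof.
move=> T0 ad hd /andP[x00 x0T] z x /andP[x0' xT].
have aE (s : R) : acf 0 T (fun x => expR (s * x)) (fun x => s * expR (s * x)).
  have dE (t : R) : is_derive t 1 (fun x => expR (s * x)) (s * expR (s * t)).
    have e := is_derive_fcomp (is_derive_expR (s * t)) (is_derive_fZ s (is_derive_id t 1)).
    by apply: (is_derive_eq e); rewrite mulr1 mulrC.
  exact: acf_C1T T0 dE (is_derive_continuous (fun t => is_derive_fZ s (dE t))).
have am s := acf_mul T0 ad (aE s).
have e0 (y : R) : 0 < expR y := expR_gt0 y.
case: (leP x0 x) => xx.
  have := acf_diff (am (- C)) x00 xx xT; rewrite z mul0r subr0 => e.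
  suff : D x * expR (- C * x) <= 0 by rewrite pmulr_lle0.
  rewrite e -[leRHS](mul0r (x - x0)) -int_cst//; apply: int_le => //; last first.
  - move=> t /andP[xt tx]; have tT : 0 <= t <= T by rewrite (le_trans x00 xt) (le_trans tx xT).
    have := hd t tT; rewrite ler_norml => /andP[_ h].
    have -> : d t * expR (- C * t) + D t * (- C * expR (- C * t)) = (d t - C * D t) * expR (- C * t) by ring.
    by rewrite pmulr_lle0// subr_le0.
  - exact: igr_cst.
  - by apply: igrS (acf_igr (am (- C))) => //; exact: sgm_sub.
have := acf_diff (am C) x0' (ltW xx) x0T; rewrite z mul0r sub0r => e.
suff : 0 <= - (D x * expR (C * x)) by rewrite oppr_ge0 pmulr_lle0.
rewrite e; apply: int_ge0 => t /andP[xt tx].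
have tT : 0 <= t <= T by rewrite (le_trans x0' xt) (le_trans tx x0T).
have := hd t tT; rewrite ler_norml => /andP[h _].
have -> : d t * expR (C * t) + D t * (C * expR (C * t)) = (d t + C * D t) * expR (C * t) by ring.
by rewrite mulr_ge0 ?(ltW (e0 _))//; move: h; lra.
Qed.

Lemma square_rate (a b c L : R) : 0 <= L -> `|c| <= L * `|a| ->
  `|2 * a * b + 2 * b * c| <= (1 + L) * (a ^+ 2 + b ^+ 2).
Proof.
move=> L0 h.
have -> : 2 * a * b + 2 * b * c = 2 * (b * (a + c)) by ring.
rewrite normrM ger0_norm// normrM.
have h2 : `|a + c| <= (1 + L) * `|a| by apply: le_trans (ler_normD _ _) _; lra.
rewrite -[a ^+ 2]real_normK ?num_real// -[b ^+ 2]real_normK ?num_real//.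
have := ler_wpM2l (normr_ge0 b) h2.
move: (`|a| : R) (`|b| : R) (`|a + c| : R) => x y z h3.
have : 0 <= (1 + L) * (x - y) ^+ 2 by rewrite mulr_ge0 ?sqr_ge0//; lra.
lra.
Qed.

Lemma increase_right (T : R) u k (x : R) : acf 0 T u k -> cont_on (sgm 0 T) k -> 0 <= x -> x < T ->
  0 < k x -> exists2 y : R, x < y <= T & u x < u y.
Proof.
move=> au ck x0 xT kx; have k2 : 0 < k x / 2 by rewrite divr_gt0.
have xs : sgm 0 T x by rewrite /sgm /= x0 ltW.
have [d d0 hd] := ck x xs _ k2.
pose y := Num.min T (x + d / 2).
have xy : x < y by rewrite lt_min xT ltrDl divr_gt0.
have yT : y <= T by rewrite ge_min lexx.
have yd : y - x < d.
  have : y <= x + d / 2 by rewrite ge_min lexx orbT.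
  by move: (y) => z; lra.
exists y; first by rewrite xy.
rewrite -subr_gt0 (acf_diff au x0 (ltW xy) yT).
apply: (@lt_le_trans _ _ (k x / 2 * (y - x))); first by rewrite mulr_gt0// subr_gt0.
rewrite -int_cst ?(ltW xy)//; apply: int_le => //; first exact: igr_cst.
  by apply: igrS (acf_igr au) => //; exact: sgm_sub.
move=> t /andP[xt ty]; have tT : sgm 0 T t by rewrite /sgm /= (le_trans x0 xt) (le_trans ty yT).
have := hd t tT; rewrite ger0_norm ?subr_ge0// => h.
have : t - x < d by apply: le_lt_trans yd; rewrite lerD2r.
by move=> /h; rewrite ltr_norml => /andP[h1 _]; move: h1; move: (k t) (k x) => a b; lra.
Qed.

Lemma increase_left (T : R) u k (x : R) : acf 0 T u k -> cont_on (sgm 0 T) k -> 0 < x -> x <= T ->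
  k x < 0 -> exists2 y : R, 0 <= y < x & u x < u y.
Proof.
move=> au ck x0 xT kx; have k2 : 0 < - k x / 2 by rewrite divr_gt0// oppr_gt0.
have xs : sgm 0 T x by rewrite /sgm /= xT ltW.
have [d d0 hd] := ck x xs _ k2.
pose y := Num.max 0 (x - d / 2).
have yx : y < x by rewrite gt_max x0 gtrBl divr_gt0.
have y0 : 0 <= y by rewrite le_max lexx.
have yd : x - y < d.
  have : x - d / 2 <= y by rewrite le_max lexx orbT.
  by move: (y) => z; lra.
exists y; first by rewrite y0.
rewrite -subr_lt0 (acf_diff au y0 (ltW yx) xT).
apply: (@le_lt_trans _ _ (k x / 2 * (x - y))); last first.
  by rewrite pmulr_llt0 ?subr_gt0// pmulr_llt0// invr_gt0.
rewrite -int_cst ?(ltW yx)//; apply: int_le => //; last 2 first.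
- exact: igr_cst.
- move=> t /andP[yt tx]; have tT : sgm 0 T t by rewrite /sgm /= (le_trans y0 yt) (le_trans tx xT).
  have := hd t tT; rewrite distrC ger0_norm ?subr_ge0// => h.
  have : x - t < d by apply: le_lt_trans yd; rewrite lerD2l lerN2.
  by move=> /h; rewrite ltr_norml => /andP[_ h1]; move: h1; move: (k t) (k x) => a b; lra.
- by apply: igrS (acf_igr au) => //; exact: sgm_sub.
Qed.

Context (p : R) (p2 : 2 < p) (p6 : p < 6).
Let p_gt0 : 0 < p. Proof. by apply: lt_trans p2. Qed.
Let p1 : 0 <= p - 1. Proof. by rewrite subr_ge0 (le_trans _ (ltW p2))// ler1n. Qed.
Let pm2 : 0 < p - 2. Proof. by rewrite subr_gt0. Qed.
Context (lam : R) (lam0 : 0 < lam).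

Definition solves (T : R) (u k : R -> R) : Prop :=
  acf 0 T u k /\ acf 0 T k (fun x => wfun p lam (u x)).

(** The potential of the stationary equation [u'' = lam u - |u|^(p-2) u]; this is the function [F]
    of the overview. *)
Definition Fpot (t : R) : R := lam / 2 * t ^+ 2 - p^-1 * `|t| `^ p.

Lemma is_derive_Fpot (t : R) : is_derive t 1 Fpot (wfun p lam t).
Proof.
have h := is_derive_fD (is_derive_fZ (lam / 2) (is_derive_sqr t)) (is_derive_fZ (- p^-1) (is_derive_powR_norm t p2)).
have -> : Fpot = (fun t => lam / 2 * t ^+ 2 + - p^-1 * `|t| `^ p).
  by apply/funext => x; rewrite /Fpot mulNr.
by apply: (is_derive_eq h); rewrite /wfun; field; rewrite gt_eqF.
Qed.

Lemma conserved (T : R) u k : 0 <= T -> solves T u k -> forall x : R, 0 <= x <= T ->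
  2^-1 * k x ^+ 2 - Fpot (u x) = 2^-1 * k 0 ^+ 2 - Fpot (u 0).
Proof.
move=> T0 [au ak] x /andP[x0 xT].
have a1 := acf_chain T0 au is_derive_Fpot (@wfun_cont _ _ p2 lam).
have a2 := acf_chain T0 ak is_derive_sqr continuous_dbl.
have a3 := acf_lin 2^-1 (-1) a2 a1.
have := acf_diff a3 (lexx 0) x0 xT; rewrite /comp !mulN1r.
rewrite (int_eq (g := fun _ => 0)) ?int_cst ?mul0r//.
  by move=> /eqP; rewrite subr_eq0 => /eqP.
by move=> t _; field.
Qed.

(** Gronwall for [(u1 - u2)^2 + (k1 - k2)^2]; the nonlinearity is Lipschitz on the bounded range of
    the two solutions. *)
Lemma ode_unique (T M : R) u1 k1 u2 k2 (x0 : R) : 0 <= T -> solves T u1 k1 -> solves T u2 k2 ->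
  (forall x : R, 0 <= x <= T -> `|u1 x| <= M /\ `|u2 x| <= M) ->
  0 <= x0 <= T -> u1 x0 = u2 x0 -> k1 x0 = k2 x0 ->
  forall x : R, 0 <= x <= T -> u1 x = u2 x /\ k1 x = k2 x.
Proof.
move=> T0 [a1 b1] [a2 b2] bM x0T eu ek x xT.
have M0 : 0 <= M by have [h _] := bM x0 x0T; exact: le_trans h.
have ad := acf_lin 1 (-1) a1 a2; have ae := acf_lin 1 (-1) b1 b2.
have a3 := acf_chain T0 ad is_derive_sqr continuous_dbl.
have a4 := acf_chain T0 ae is_derive_sqr continuous_dbl.
have a5 := acf_lin 1 1 a3 a4; pose L := lam + (p - 1) * M `^ (p - 2).
have L0 : 0 <= L by rewrite addr_ge0 ?(ltW lam0)// mulr_ge0 ?powR_ge0.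
have := @gronwall T (1 + L) _ _ x0 T0 a5 _ x0T _ x xT; rewrite /comp.
rewrite eu ek !mul1r !mulN1r !subrr expr0n addr0 => h.
have hz : (u1 x - u2 x) ^+ 2 + (k1 x - k2 x) ^+ 2 <= 0.
  apply: h => // t tT; rewrite !mul1r !mulN1r.
  have [m1 m2] := bM t tT; apply: square_rate L0 _.
  rewrite /wfun (_ : _ - (_ - _) = lam * (u1 t - u2 t) - (fpow p (u1 t) - fpow p (u2 t))); last by ring.
  apply: le_trans (ler_normB _ _) _; rewrite normrM (gtr0_norm lam0) mulrDl lerD2l.
  exact: fpow_lip.
have s1 := sqr_ge0 (u1 x - u2 x); have s2 := sqr_ge0 (k1 x - k2 x).
by split; apply/eqP; rewrite -subr_eq0; apply/eqP; apply: sqr_le0; lra.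
Qed.

(** The first integral is a constant and, as a combination of [k^2], [u^2] and [|u|^p], integrable
    on the halfline, so it is zero. *)
Lemma ray_conserved u k : H1 (ray 0) u k -> (forall T : R, 0 <= T -> solves T u k) ->
  forall x : R, 0 <= x -> 2^-1 * k x ^+ 2 = Fpot (u x).
Proof.
move=> hu hs x x0; have su := H1_sq edge_ray hu; have sk := H1_dsq hu.
have [M M0 uM] := H1_bounded edge_ray hu.
have ip := igr_powp p2 (mray 0) su uM; have [_ iu] := su; have [_ ik] := sk.
set c := 2^-1 * k 0 ^+ 2 - Fpot (u 0).
suff c0 : c = 0.
  by have := conserved x0 (hs x x0) (x := x); rewrite x0 lexx -/c c0 => /(_ isT) /eqP; rewrite subr_eq0 => /eqP.
pose e t := 2^-1 * k t ^+ 2 + - lam / 2 * u t ^+ 2 + p^-1 * `|u t| `^ p.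
have ie : igr (ray 0) e.
  by apply: igrD => //; [apply: igrD => //|]; exact: igrZ.
have ne := igr_norm (mray 0) ie; pose S := itg (ray 0) (fun t => `|e t|).
have S0 : 0 <= S by apply: int_ge0 => t _; exact: normr_ge0.
have key (T : R) : 0 < T -> `|c| * T <= S.
  move=> T0; have sub : sgm 0 T `<=` ray 0 by move=> t /andP[].
  have -> : `|c| * T = itg (sgm 0 T) (fun t => `|e t|).
    rewrite -[T in LHS]subr0 -int_cst ?(ltW T0)//; apply: int_eq => t tT; congr `|_|.
    by rewrite /c -(conserved (ltW T0) (hs T (ltW T0)) tT) /e /Fpot; ring.
  by apply: itg_sub => // t _; exact: normr_ge0.
apply/eqP/negPn/negP => c0; have n0 : 0 < `|c| by rewrite normr_gt0.
have := key ((S + 1) / `|c|); rewrite divr_gt0// ?ltr_wpDl// => /(_ isT).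
by rewrite mulrCA divff ?gt_eqF// mulr1 leNgt ltrDl ltr01.
Qed.

(** The positive zero of [Fpot], which is the height of the soliton with multiplier [lam]. *)
Definition height : R := (p * lam / 2) `^ (p - 2)^-1.

Lemma height_gt0 : 0 < height.
Proof. by rewrite powR_gt0// divr_gt0// mulr_gt0. Qed.

Lemma height_pow : height `^ (p - 2) = p * lam / 2.
Proof.
rewrite /height -powRrM mulVf ?gt_eqF// powRr1// divr_ge0// mulr_ge0// ltW//.
Qed.

Lemma FpotE (t : R) : Fpot t = p^-1 * t ^+ 2 * (height `^ (p - 2) - `|t| `^ (p - 2)).
Proof.
have -> : Fpot t = lam / 2 * t ^+ 2 - p^-1 * (fpow p t * t).
  rewrite /Fpot /fpow; congr (_ - _ * _); have [->|t0] := eqVneq t 0.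
    by rewrite mulr0 normr0 powR0// gt_eqF.
  rewrite -mulrA -expr2 -[t ^+ 2]real_normK ?num_real// -powR_mulrn ?normr_ge0//.
  by rewrite -powRD_pos ?normr_gt0//; congr (_ `^ _); ring.
by rewrite height_pow /fpow; field; rewrite gt_eqF.
Qed.

Lemma Fpot_ge0 (t : R) : 0 <= Fpot t -> `|t| <= height.
Proof.
rewrite FpotE; apply: contraTT; rewrite -!ltNge => th.
have t0 : 0 < `|t| by exact: lt_trans height_gt0 th.
have t2 : 0 < t ^+ 2 by rewrite -real_normK ?num_real// exprn_gt0.
have pt : 0 < p^-1 * t ^+ 2 by rewrite mulr_gt0// invr_gt0.
rewrite (pmulr_rlt0 _ pt) subr_lt0; by apply: gt0_ltr_powR; rewrite ?nnegrE ?(ltW height_gt0) ?normr_ge0.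
Qed.

Lemma Fpot_eq0 (t : R) : Fpot t = 0 -> t = 0 \/ `|t| = height.
Proof.
rewrite FpotE => /eqP; rewrite !mulf_eq0 invr_eq0 gt_eqF//= orbb subr_eq0.
move=> /orP[/eqP ->|/eqP e]; [by left|right].
have inv (x : R) : 0 <= x -> (x `^ (p - 2)) `^ (p - 2)^-1 = x.
  by move=> x0; rewrite -powRrM mulfV ?gt_eqF// powRr1.
by rewrite -(inv `|t|) ?normr_ge0// -e inv// ltW// height_gt0.
Qed.

Lemma Fpot0 : Fpot 0 = 0.
Proof. by rewrite FpotE expr0n mulr0 mul0r. Qed.

(** If [|u|] starts by increasing, it has an interior maximum before a point where it is smaller
    than at the vertex. There the slope vanishes, hence so does [Fpot], and the nonzero value must
    be the height. *)
Lemma ray_reach u k : H1 (ray 0) u k -> (forall T : R, 0 <= T -> solves T u k) ->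
  0 < u 0 * k 0 -> exists2 x : R, 0 <= x & `|u x| = height.
Proof.
wlog u0 : u k / 0 < u 0.
  move=> hw hu hs uk; case: (ltgtP (u 0) 0) => u0; last first.
  - by move: uk; rewrite u0 mul0r ltxx.
  - exact: (hw u k).
  have hN (T : R) : 0 <= T -> solves T (fun x => -1 * u x) (fun x => -1 * k x).
    move=> T0; have [a b] := hs T T0; split.
      by apply: (acf_eq (acf_lin (-1) 0 a a) T0) => x _; rewrite mul0r addr0.
    apply: (acf_eq (acf_lin (-1) 0 b b) T0) => x _; first by rewrite mul0r addr0.
    by rewrite mul0r addr0 /wfun /fpow normrM normrN1 mul1r; ring.
  have n0 : 0 < -1 * u 0 by rewrite mulN1r oppr_gt0.
  have nk : 0 < -1 * u 0 * (-1 * k 0) by rewrite !mulN1r mulrNN.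
  have [x x0 h] := hw _ _ n0 (H1_Z (-1) edge_ray hu) hN nk.
  by exists x => //; move: h; rewrite mulN1r normrN.
move=> hu hs uk; have k0 : 0 < k 0 by rewrite -(pmulr_rgt0 _ u0).
have [_ iu] := H1_sq edge_ray hu.
have [T T0' uT] := ray_small iu (exprn_gt0 2 u0).
have {}uT : `|u T| < u 0 by apply: sqr_lt_norm => //; exact: ltW.
have T0 : 0 < T.
  rewrite lt_neqAle (T0' : 0 <= T) andbT; apply/eqP => e; move: uT; rewrite -e.
  by rewrite gtr0_norm// ltxx.
have [aT bT] := hs T (ltW T0).
have cu := acf_cont (ltW T0) aT; have ck := acf_cont (ltW T0) bT.
have [x /andP[x0 xT] hx] := cont_on_max (ltW T0) cu.
have x0' : 0 < x.
  rewrite lt_neqAle x0 andbT; apply/eqP => e.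
  have [y /andP[y0 yT]] := increase_right aT ck (lexx 0) T0 k0.
  by rewrite e ltNge hx// (ltW y0).
have ux : u 0 <= u x by apply: hx; rewrite lexx ltW.
have xT' : x < T.
  rewrite lt_neqAle xT andbT; apply/eqP => e; move: ux; rewrite leNgt e.
  by move/negP; apply; apply: le_lt_trans uT; exact: ler_norm.
have kx : k x = 0.
  apply/eqP; rewrite eq_le; apply/andP; split; rewrite leNgt; apply/negP => kx.
    have [y /andP[y0 yT]] := increase_right aT ck x0 xT' kx.
    by rewrite ltNge hx// yT (le_trans x0 (ltW y0)).
  have [y /andP[y0 yx]] := increase_left aT ck x0' xT kx.
  by rewrite ltNge hx// y0 (le_trans (ltW yx) xT).
exists x => //; have := ray_conserved hu hs x0; rewrite kx expr0n mulr0 => /esym/Fpot_eq0[e|//].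
by move: ux; rewrite e leNgt u0.
Qed.

End ode.

(** * Longer tips *)

Section growing.
Context {R : realType}.
Local Notation MR := (measurableTypeR R).
Local Notation leb := (@lebesgue_measure R).

(** Slopes equal up to sign are all equal, or all zero, or of both signs; in the last case two of
    them cancel and the tip slope [t] is plus or minus [a]. *)
Lemma slopes_arith (a b c t : R) : b ^+ 2 = a ^+ 2 -> c ^+ 2 = a ^+ 2 -> t + (a + (b + c)) = 0 ->
  [/\ b = a, c = a & a != 0] \/
  (t ^+ 2 = a ^+ 2 /\ (a = 0 \/ forall m, m != 0 -> [\/ 0 < m * a, 0 < m * b | 0 < m * c])).
Proof.
move=> /eqP; rewrite eqf_sqr => hb /eqP; rewrite eqf_sqr => hc e.
have tE : t = - (a + (b + c)) by move: e; lra.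
have [a0|a0] := eqVneq a 0.
  right; split; last by left.
  by rewrite tE; move: hb hc; rewrite a0 oppr0 !orbb => /eqP -> /eqP ->; rewrite !addr0 oppr0.
have ma (m : R) : m != 0 -> 0 < m * a \/ 0 < m * - a.
  move=> m0; have : m * a != 0 by rewrite mulf_neq0.
  by rewrite mulrN oppr_gt0 neq_lt => /orP[]; [right|left].
move: hb hc => /orP[/eqP bE|/eqP bE] /orP[/eqP cE|/eqP cE].
- by left; split.
- right; split; first by rewrite tE bE cE; ring.
  by right => m /ma[]; [constructor 1|constructor 3; rewrite cE].
- right; split; first by rewrite tE bE cE; ring.
  by right => m /ma[]; [constructor 1|constructor 2; rewrite bE].
- right; split; first by rewrite tE bE cE; ring.
  by right => m /ma[]; [constructor 1|constructor 2; rewrite bE].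
Qed.

Lemma half_sqr (a t F : R) : 2^-1 * a ^+ 2 = F -> t ^+ 2 = a ^+ 2 -> 2^-1 * t ^+ 2 - F = 0.
Proof. by move=> <- ->; rewrite subrr. Qed.

Lemma sqr_half (a b F : R) : 2^-1 * a ^+ 2 = F -> 2^-1 * b ^+ 2 = F -> b ^+ 2 = a ^+ 2.
Proof. lra. Qed.

Context (p : R) (p2 : 2 < p) (p6 : p < 6).
Let p_gt0 : 0 < p. Proof. by apply: lt_trans p2. Qed.
Let pm2 : 0 < p - 2. Proof. by rewrite subr_gt0. Qed.

Lemma solves0 (lam T : R) : 0 <= T -> solves p lam T (fun=> 0) (fun=> 0).
Proof.
have a0 : acf 0 T (fun=> 0) (fun=> 0 : R).
  by split; [exact: igr_cst|move=> x _; rewrite itg0 addr0].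
move=> T0; split => //; apply: (acf_eq a0 T0) => // x _.
by rewrite /wfun /fpow !mulr0 subrr.
Qed.

Section minimizer.
Variables (l mu lam : R) (U K : 'I_4 -> R -> R).
Hypotheses (l0 : 0 < l) (mu0 : 0 < mu) (lam0 : 0 < lam).
Hypotheses (hU : inH l U K) (Umu : sqn l U = mu) (Ele : ener p l U K <= lev p 2 mu).
Hypotheses (Kl : K tip l = 0) (kir : \sum_i K i 0 = 0).
Hypothesis hK : forall i (T : R), dom l i T -> acf 0 T (K i) (fun x => wfun p lam (U i x)).
Local Notation M := (height p lam).
Let M0 : 0 < M. Proof. exact: height_gt0. Qed.

Lemma solves_dom i (T : R) : dom l i T -> solves p lam T (U i) (K i).
Proof.
move=> dT; split; last exact: hK.
have ed := edge_dom i (ltW l0); have [_ h0 _ _] := ed.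
exact: H1_acf ed (hU.1 i) (lexx 0) (h0 T dT) dT.
Qed.

Lemma solves_ray i (T : R) : i != tip -> 0 <= T -> solves p lam T (U i) (K i).
Proof. by move=> it T0; apply: solves_dom; rewrite dom_ray. Qed.

Lemma H1_rayU i : i != tip -> H1 (ray 0) (U i) (K i).
Proof. by move=> it; have := hU.1 i; rewrite dom_ray. Qed.

Lemma slope_sqr i : i != tip -> 2^-1 * K i 0 ^+ 2 = Fpot p lam (U tip 0).
Proof.
move=> it; rewrite -(hU.2 i).
exact: (ray_conserved p2 (H1_rayU it) (fun T => solves_ray it) (lexx 0)).
Qed.

Lemma tip_conserved (x : R) : 0 <= x <= l ->
  2^-1 * K tip x ^+ 2 - Fpot p lam (U tip x) = 2^-1 * K tip 0 ^+ 2 - Fpot p lam (U tip 0).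
Proof.
have dl : dom l tip l by rewrite dom_tip /sgm /= lexx (ltW l0).
exact: (conserved p2 (ltW l0) (solves_dom dl)).
Qed.

Lemma unique_dom i (T x0 : R) u k : 0 <= T -> dom l i T -> solves p lam T u k ->
  (exists M', forall x : R, 0 <= x <= T -> `|u x| <= M') -> 0 <= x0 <= T ->
  U i x0 = u x0 -> K i x0 = k x0 ->
  forall x : R, 0 <= x <= T -> U i x = u x /\ K i x = k x.
Proof.
move=> T0 dT su [M' hM'] x0T eu ek x xT.
have [M1 M10 bM1] := inH_bounded (ltW l0) hU.
apply: (ode_unique p2 lam0 T0 (solves_dom dT) su _ x0T eu ek xT (M := Num.max M1 M')).
move=> y yT; rewrite !le_max hM'// orbT; split => //; rewrite bM1//.
exact: edge_sub (edge_dom i (ltW l0)) dT (lexx 0) y yT.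
Qed.

(** The zero first integral makes the halfline slopes vanish as well, and uniqueness spreads zero
    over the whole graph, against the positive mass. *)
Lemma not_trivial : U tip 0 = 0 -> K tip 0 = 0 -> False.
Proof.
move=> u0 k0.
have bz : exists M', forall x : R, 0 <= x <= l -> `|(fun=> 0 : R) x| <= M'.
  by exists 0 => x _; rewrite normr0.
have dl : dom l tip l by rewrite dom_tip /sgm /= lexx (ltW l0).
have zl : 0 <= (0 : R) <= l by rewrite lexx (ltW l0).
have tz := unique_dom (ltW l0) dl (solves0 lam (ltW l0)) bz zl u0 k0.
suff : sqn l U = 0 by rewrite Umu => e; move: mu0; rewrite e ltxx.
rewrite /sqn big1// => i _; rewrite -[RHS](itg0 (dom l i)); apply: int_eq => x dx.
have [it|it] := eqVneq i tip.
  move: dx; rewrite it dom_tip => xl; have [-> _] := tz x xl; exact: expr0n.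
have x0 : 0 <= x by move: dx; rewrite dom_ray.
have ki : K i 0 = 0.
  have := slope_sqr it; rewrite u0 Fpot0// => /eqP; rewrite mulf_eq0 invr_eq0 pnatr_eq0 /= sqrf_eq0.
  by move/eqP.
have bz' : exists M', forall y : R, 0 <= y <= x -> `|(fun=> 0 : R) y| <= M'.
  by exists 0 => y _; rewrite normr0.
have zx : 0 <= (0 : R) <= x by rewrite lexx.
have ui : U i 0 = 0 by rewrite hU.2.
have xx : 0 <= x <= x by rewrite x0 lexx.
have [-> _] := unique_dom x0 dx (solves0 lam x0) bz' zx ui ki xx.
exact: expr0n.
Qed.


Lemma sum4 (f : 'I_4 -> R) : \sum_i f i = f tip + (f (inord 0) + (f (inord 1) + f (inord 2))).
Proof.
rewrite !big_ord_recr big_ord0 /= add0r.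
have -> : widen_ord (leqnSn 3) (widen_ord (leqnSn 2) (widen_ord (leqnSn 1) ord_max)) = inord 0 :> 'I_4.
  by apply/val_inj; rewrite /= inordK.
have -> : widen_ord (leqnSn 3) (widen_ord (leqnSn 2) ord_max) = inord 1 :> 'I_4.
  by apply/val_inj; rewrite /= inordK.
have -> : widen_ord (leqnSn 3) ord_max = inord 2 :> 'I_4.
  by apply/val_inj; rewrite /= inordK.
by rewrite /tip; ring.
Qed.

Lemma inord_ray (j : nat) : (j < 3)%N -> (inord j : 'I_4) != tip.
Proof.
move=> j3; apply/eqP => /(congr1 val); rewrite /= inordK; last exact: ltn_trans j3 _.
by move=> e; move: j3; rewrite e.
Qed.

Lemma ray_cases i : i != tip -> [\/ i = inord 0, i = inord 1 | i = inord 2].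
Proof.
have inj (j : nat) : val i = j -> i = inord j by move=> e; apply/val_inj; rewrite /= -e inord_val.
move=> it; have : (val i < 3)%N.
  rewrite ltn_neqAle -ltnS (ltn_ord i) andbT; apply: contra it => /eqP e; apply/eqP/val_inj.
  by rewrite e.
case e : (val i) => [|[|[|n]]] // _; first by constructor 1; exact: inj.
- by constructor 2; exact: inj.
- by constructor 3; exact: inj.
Qed.

Lemma Kal_height (t : R) : `|t| = M -> Kal p M t = Kal p M M.
Proof. by rewrite /Kal => ->; rewrite gtr0_norm. Qed.

Lemma three_levels : 3 * Kal p M M <= ener p l U K + p^-1 * (M `^ (p - 2) * mu) -> False.
Proof.
move=> h; have h2 := lev_le p2 p6 (ltr0n R 2) mu0 M0; rewrite /Phi in h2.
have c0 := cMM_gt0 p2 M0; rewrite Kal_max// in h.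
move: h h2 Ele c0; move: (ener p l U K) (lev p 2 mu) (M `^ (p / 2) * M) (p^-1 * _) (Hk p 1) => e L a b c.
lra.
Qed.

(** Otherwise the first integral vanishes on the tip too, so that [|U|] is at most the height [M]
    everywhere. The calibration at height [M] then counts [Kal M] three times, which the soliton
    level does not allow. *)
Lemma equal_slopes : exists2 s : R, s != 0 & forall i, i != tip -> K i 0 = s.
Proof.
have nt0 := inord_ray (isT : (0 < 3)%N); have nt1 := inord_ray (isT : (1 < 3)%N).
have nt2 := inord_ray (isT : (2 < 3)%N).
have e0 := slope_sqr nt0; have e1 := slope_sqr nt1; have e2 := slope_sqr nt2.
have := kir; rewrite sum4 => ks.
case: (slopes_arith (sqr_half e0 e1) (sqr_half e0 e2) ks) => [[b1 c1 a0]|[tE hm]].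
  exists (K (inord 0) 0) => // i it.
  by case: (ray_cases it) => ->.
exfalso; have z0 := half_sqr e0 tE.
have tF (x : R) : 0 <= x <= l -> 2^-1 * K tip x ^+ 2 = Fpot p lam (U tip x).
  by move=> xl; apply/eqP; rewrite -subr_eq0 tip_conserved// z0.
have bM : bnd l U M.
  move=> i x; have [->|it] := eqVneq i tip.
    rewrite dom_tip => xl; apply: (Fpot_ge0 p2 lam0); rewrite -tF//.
    by rewrite mulr_ge0 ?sqr_ge0 ?invr_ge0.
  rewrite dom_ray// => x0; apply: (Fpot_ge0 p2 lam0).
  rewrite -(ray_conserved p2 (H1_rayU it) (fun T => solves_ray it) x0).
  by rewrite mulr_ge0 ?sqr_ge0 ?invr_ge0.
have ll : 0 <= l <= l by rewrite lexx (ltW l0).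
(* At the free end the slope is zero, so the value is [0] or the height; [0] would make the solution
   trivial. *)
have Ul : `|U tip l| = M.
  have := tF l ll; rewrite Kl expr0n mulr0 => /esym/(Fpot_eq0 p2 lam0)[ul|//].
  have bz : exists M', forall x : R, 0 <= x <= l -> `|(fun=> 0 : R) x| <= M'.
    by exists 0 => x _; rewrite normr0.
  have dl : dom l tip l by rewrite dom_tip.
  have zl : 0 <= (0 : R) <= l by rewrite lexx (ltW l0).
  have [u0 k0] := unique_dom (ltW l0) dl (solves0 lam (ltW l0)) bz ll ul Kl zl.
  by have := not_trivial u0 k0.
(* With zero slopes the vertex itself has height [M] and [lower_tip] counts three times. With slopes
   of both signs, [|U|] increases along some halfline, reaches [M] there, and [lower_both] counts
   twice on that halfline and once at the end of the tip. *)
case: hm => [a0|hm].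
  have t0 : K tip 0 = 0 by apply: sqr_le0; rewrite tE a0 expr0n.
  move: e0; rewrite a0 expr0n mulr0 => /esym/(Fpot_eq0 p2 lam0)[m0|mM]; first exact: not_trivial m0 t0.
  have zl : 0 <= (0 : R) <= l by rewrite lexx (ltW l0).
  have := lower_tip p2 (ltW l0) hU M0 bM zl; rewrite Umu (Kal_height mM) => h.
  by apply: three_levels; apply: le_trans h; lra.
have m0 : U tip 0 != 0.
  apply/eqP => m0; apply: not_trivial => //; apply: sqr_le0; rewrite tE.
  by move: e0; rewrite m0 Fpot0//; lra.
have reach i : i != tip -> 0 < U tip 0 * K i 0 -> False.
  move=> it h; have h' : 0 < U i 0 * K i 0 by rewrite hU.2.
  have [x x0 xM] := ray_reach p2 lam0 (H1_rayU it) (fun T => solves_ray it) h'.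
  have := lower_both p2 (ltW l0) hU M0 bM it x0 ll; rewrite Umu !Kal_height// => h3.
  by apply: three_levels; apply: le_trans h3; lra.
by case: (hm _ m0); exact: reach.
Qed.

Lemma equal_rays i j (x : R) : i != tip -> j != tip -> 0 <= x -> U i x = U j x /\ K i x = K j x.
Proof.
move=> it jt x0; have [s _ hs] := equal_slopes.
have [M' _ bM'] := inH_bounded (ltW l0) hU.
have dx i' : i' != tip -> dom l i' x by move=> ?; rewrite dom_ray.
have bz : exists M', forall y : R, 0 <= y <= x -> `|U j y| <= M'.
  by exists M' => y /andP[y0 _]; apply: bM'; rewrite dom_ray.
have zx : 0 <= (0 : R) <= x by rewrite lexx.
apply: (unique_dom x0 (dx i it) (solves_ray jt x0) bz zx) => //; rewrite ?x0 ?lexx//.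
- by rewrite hU.2 [RHS]hU.2.
- by rewrite !hs.
Qed.

End minimizer.

End growing.

(** * Transferring pieces of the halflines to the tip, and the critical length *)

Section merging.
Context {R : realType}.
Local Notation MR := (measurableTypeR R).
Local Notation leb := (@lebesgue_measure R).

Lemma third_lt (A a B b q : R) : 0 < a ->
  2^-1 * (3 * A + 3 * (9^-1 * a) + B) - q * b < 2^-1 * (3 * (a + A) + B) - q * b.
Proof. lra. Qed.

Section merge.
Variables (l a : R).
Hypotheses (l0 : 0 < l) (a0 : 0 < a).
Local Notation l' := (l + 3 * a).
Let a30 : 0 < 3 * a. Proof. by rewrite mulr_gt0. Qed.
Let al : 3 * a <= l'. Proof. by rewrite lerDr ltW. Qed.

(* Length [a] is cut from each of the three halflines; the three (equal) pieces [f1] are stretched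
   by [3] and inserted between the vertex and the old tip [ft]. *)
Definition mrg (f1 f ft : R -> R) (i : 'I_4) (x : R) : R :=
  if i == tip then (if x <= 3 * a then f1 (aff (- 3^-1) a x) else ft (aff 1 (- (3 * a)) x))
  else f (aff 1 a x).

Let s0 : - (3^-1 : R) < 0. Proof. by rewrite oppr_lt0 invr_gt0. Qed.
Let e1 : aff (- 3^-1) a (3 * a) = 0. Proof. by rewrite /aff; field. Qed.
Let e2 : aff (- 3^-1) a 0 = a. Proof. by rewrite /aff mulr0 addr0. Qed.
Let e3 : aff 1 (- (3 * a)) (3 * a) = 0. Proof. by rewrite /aff mul1r addNr. Qed.
Let e4 : aff 1 (- (3 * a)) l' = l. Proof. by rewrite /aff mul1r; ring. Qed.

Lemma mrg_comp (F f1 f ft : R -> R) i :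
  (fun x => F (mrg f1 f ft i x)) = mrg (fun x => F (f1 x)) (fun x => F (f x)) (fun x => F (ft x)) i.
Proof. by apply/funext => x; rewrite /mrg; case: ifP => // _; case: ifP. Qed.

Lemma mrg_ray f1 f ft i : i != tip -> igr (ray 0) f ->
  igr (ray 0) (mrg f1 f ft i) /\ itg (ray 0) (mrg f1 f ft i) = itg (ray a) f.
Proof.
move=> it fi; have sub : ray a `<=` ray 0 by move=> x; exact: le_trans (ltW a0).
have := itg_aff a (oner_neq0 R) (mray a) (igrS (mray 0) (mray a) sub fi).
rewrite aff_ray subrr normr1 invr1 mul1r.
by have -> : mrg f1 f ft i = (fun x => f (aff 1 a x)) by apply/funext => x; rewrite /mrg (negPf it).
Qed.

Lemma mrg_tip f1 f ft : igr (sgm 0 a) f1 -> igr (sgm 0 l) ft ->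
  igr (sgm 0 l') (mrg f1 f ft tip) /\
  itg (sgm 0 l') (mrg f1 f ft tip) = 3 * itg (sgm 0 a) f1 + itg (sgm 0 l) ft.
Proof.
move=> i1 i2.
have i1' : igr (sgm (aff (- 3^-1) a (3 * a)) (aff (- 3^-1) a 0)) f1 by rewrite e1 e2.
have i2' : igr (sgm (aff 1 (- (3 * a)) (3 * a)) (aff 1 (- (3 * a)) l')) ft by rewrite e3 e4.
have [j1 k1] := aff_itgN s0 i1'; have [j2 k2] := aff_itgP ltr01 i2'.
rewrite e1 e2 in k1; rewrite e3 e4 in k2.
have h1 (x : R) : 0 <= x <= 3 * a -> f1 (aff (- 3^-1) a x) = mrg f1 f ft tip x.
  by move=> /andP[_ h]; rewrite /mrg eqxx h.
have h2 (x : R) : 3 * a < x <= l' -> ft (aff 1 (- (3 * a)) x) = mrg f1 f ft tip x.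
  by move=> /andP[h _]; rewrite /mrg eqxx leNgt h.
have g1 : igr (sgm 0 (3 * a)) (mrg f1 f ft tip) := igr_eq (msgm 0 _) h1 j1.
have g2 : igr (sgm (3 * a) l') (mrg f1 f ft tip) := igr_eq_oc al j2 h2.
have g3 := igr_join (ltW a30) al g1 g2; split => //.
rewrite (int_split (ltW a30) al g3) -(int_eq h1) k1 -(itg_eq_oc al j2 h2) k2.
by rewrite invrN opprK invrK invr1 mul1r.
Qed.

Lemma mrg_sum f1 f ft : igr (sgm 0 a) f1 -> igr (ray 0) f -> igr (sgm 0 l) ft ->
  \sum_i itg (dom l' i) (mrg f1 f ft i) =
  3 * itg (ray a) f + 3 * itg (sgm 0 a) f1 + itg (sgm 0 l) ft.
Proof.
move=> i1 i i2; rewrite (@sum_tip R) dom_tip; have [_ ->] := mrg_tip f i1 i2.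
rewrite [LHS]addrC -addrA; congr (_ + _).
rewrite -[RHS](@sum_ray_cst R); by apply: eq_bigr => j jt; rewrite dom_ray//; have [_ ->] := mrg_ray f1 ft jt i.
Qed.

Lemma inH_merge (U K : 'I_4 -> R -> R) i0 : i0 != tip -> inH l U K ->
  inH l' (mrg (U i0) (U i0) (U tip)) (mrg (fun x => - 3^-1 * K i0 x) (K i0) (K tip)).
Proof.
move=> it hU; have hr : H1 (ray 0) (U i0) (K i0) by have := hU.1 i0; rewrite dom_ray.
have ht : H1 (sgm 0 l) (U tip) (K tip) by have := hU.1 tip; rewrite dom_tip.
have [_ iu] := H1_sq edge_ray hr; have sk := H1_dsq hr; have [mk ik] := sk.
have sub : ray a `<=` ray 0 by move=> x; exact: le_trans (ltW a0).
have subs : sgm 0 a `<=` ray 0 by move=> x /andP[].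
have ska : sq (sgm 0 a) (K i0) by exact: sqS sk.
have skt := H1_dsq ht; have [mkt ikt] := skt.
split => [i|i]; last first.
  (* The inserted piece is run backwards: its start is the old point at distance [a], where the
     shortened halflines now begin, and its end is the old vertex. *)
  rewrite /mrg eqxx ltW// e2; case: ifP => // _.
  by rewrite /aff mulr0 addr0.
have [->|jt] := eqVneq i tip; last first.
  have VE : mrg (U i0) (U i0) (U tip) i = (fun x => U i0 (aff 1 a x)).
    by apply/funext => x; rewrite /mrg (negPf jt).
  have LE : mrg (fun x => - 3^-1 * K i0 x) (K i0) (K tip) i = (fun x => K i0 (aff 1 a x)).
    by apply/funext => x; rewrite /mrg (negPf jt).
  rewrite dom_ray// VE LE.
  have ac (x : R) : 0 <= x -> acf 0 x (fun t => U i0 (aff 1 a t)) (fun t => 1 * K i0 (aff 1 a t)).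
    move=> x0; apply: (acf_affP ltr01 x0); apply: (H1_acf edge_ray hr).
    - by rewrite /aff mulr0 addr0 ltW.
    - by rewrite /aff mulr0 addr0 lerDl mul1r x0.
    - by rewrite /ray /aff /= mul1r addr_ge0// ltW.
  have mE : ray 0 = aff 1 a @^-1` ray a by rewrite aff_ray subrr.
  have shift f : igr (ray 0) f -> igr (ray 0) (fun t => f (aff 1 a t)).
    move=> fi; have [i' _] := itg_aff a (oner_neq0 R) (mray a) (igrS (mray 0) (mray a) sub fi).
    by rewrite mE.
  split; first exact: (shift (fun x => U i0 x ^+ 2)).
  split.
    apply: (@measurable_comp _ _ _ _ _ _ (ray a) (K i0 : MR -> MR)) => //.
    - by rewrite mE => _ [x ? <-].
    - exact: measurable_funS mk.
    - exact: measurable_funS (aff_meas 1 a).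
  split; first exact: (shift (fun x => K i0 x ^+ 2)).
  move=> x x0; have [ii h] := ac x x0.
  have kE : (fun t => 1 * K i0 (aff 1 a t)) = (fun t => K i0 (aff 1 a t)).
    by apply/funext => t; rewrite mul1r.
  by rewrite kE in ii h; split => //; apply: h; rewrite (x0 : 0 <= x) lexx.
rewrite dom_tip.
set V := mrg _ _ _ tip; set L := mrg _ _ _ tip.
have a1 : acf 0 (3 * a) V L.
  have ac : acf 0 (3 * a) (fun t => U i0 (aff (- 3^-1) a t)) (fun t => - 3^-1 * K i0 (aff (- 3^-1) a t)).
    apply: acf_affN s0 (ltW a30) _; rewrite e1 e2.
    exact: (H1_acf edge_ray hr (lexx 0) (ltW a0) (ltW a0)).
  by apply: (acf_eq ac (ltW a30)) => x /andP[_ xa]; rewrite /V /L /mrg eqxx xa.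
have a2 : acf (3 * a) l' V L.
  have ac : acf (3 * a) l' (fun t => U tip (aff 1 (- (3 * a)) t)) (fun t => 1 * K tip (aff 1 (- (3 * a)) t)).
    apply: acf_affP ltr01 al _; rewrite e3 e4.
    apply: (H1_acf (edge_sgm (ltW l0)) ht (lexx 0) (ltW l0)).
    by rewrite /sgm /= lexx (ltW l0).
  apply: (acf_eq_oc ac al) => x /andP[xa _].
    rewrite /V /mrg eqxx; case: ifP => // xa'; have -> : x = 3 * a by apply/eqP; rewrite eq_le xa xa'.
    by rewrite e1 e3 hU.2.
  by rewrite /L /mrg eqxx leNgt xa /= mul1r.
have aV := acf_join (ltW a30) al a1 a2.
have l'0 : 0 <= l' by rewrite addr_ge0// ltW.
apply: (H1_sgm l'0 aV).
split; first by apply: igr_meas; case: aV.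
have i1 : igr (sgm 0 a) (fun x => (- 3^-1 * K i0 x) ^+ 2).
  by have [] := sqZ (- 3^-1) (msgm 0 a) ska.
have := mrg_tip (fun x => K i0 x ^+ 2) i1 ikt.
by rewrite -(mrg_comp (fun x => x ^+ 2)) => -[].
Qed.

End merge.

Context (p : R) (p2 : 2 < p) (p6 : p < 6).
Let p_gt0 : 0 < p. Proof. by apply: lt_trans p2. Qed.

Lemma min_le_soliton (l mu : R) U G : 0 < l -> 0 < mu ->
  (forall V K, inH l V K -> sqn l V = mu -> ener p l U G <= ener p l V K) ->
  ener p l U G <= lev p 2 mu.
Proof.
move=> l0 mu0 hmin; apply/ler_addgt0Pl => e e0; rewrite addrC.
have [V [K [hV Vmu hE]]] := near_soliton p2 p6 l0 mu0 e0.
exact: le_trans (hmin V K hV Vmu) (ltW hE).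
Qed.

Lemma min_longer (l l2 mu : R) : 0 < l -> l < l2 -> 0 < mu -> has_min p mu l -> below_soliton p mu l2.
Proof.
move=> l0 ll2 mu0 [U [G [hU Umu hmin]]].
have Ele := min_le_soliton l0 mu0 hmin.
have neg : ener p l U G < 0 by exact: le_lt_trans Ele (lev_lt0 p2 p6 (ltr0n _ 2) mu0).
have [K [lam [[hK eK] lam0 Kl kir odeK]]] := regular_minimizer p2 l0 mu0 hU Umu hmin neg.
rewrite -eK in Ele.
have [s sn0 hs] := equal_slopes p2 p6 l0 mu0 lam0 hK Umu Ele Kl kir odeK.
have eqr := equal_rays p2 p6 l0 mu0 lam0 hK Umu Ele Kl kir odeK.
pose a := (l2 - l) / 3; have a0 : 0 < a by rewrite divr_gt0// subr_gt0.
have l2E : l2 = l + 3 * a by rewrite /a; field.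
pose i0 : 'I_4 := inord 0; have nt : i0 != tip by exact: inord_ray.
have hM := inH_merge l0 a0 nt hK; rewrite -l2E in hM.
have hr : H1 (ray 0) (U i0) (K i0) by have := hK.1 i0; rewrite dom_ray.
have ht : H1 (sgm 0 l) (U tip) (K tip) by have := hK.1 tip; rewrite dom_tip.
have sur := H1_sq edge_ray hr; have skr := H1_dsq hr.
have sut := H1_sq (edge_sgm (ltW l0)) ht; have skt := H1_dsq ht.
have [M M0 bM] := H1_bounded edge_ray hr; have [M' M'0 bM'] := H1_bounded (edge_sgm (ltW l0)) ht.
have ipr := igr_powp p2 (mray 0) sur bM; have ipt := igr_powp p2 (msgm 0 l) sut bM'.
have sub : sgm 0 a `<=` ray 0 by move=> x /andP[].
have rest f : igr (ray 0) f -> igr (sgm 0 a) f by exact: igrS.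
have total (F : R -> R) (W : 'I_4 -> R -> R) : (forall i x, i != tip -> 0 <= x -> W i x = W i0 x) ->
    igr (ray 0) (fun x => F (W i0 x)) ->
    \sum_i itg (dom l i) (fun x => F (W i x)) =
    3 * (itg (sgm 0 a) (fun x => F (W i0 x)) + itg (ray a) (fun x => F (W i0 x))) +
    itg (sgm 0 l) (fun x => F (W tip x)).
  move=> hW iF; rewrite (@sum_tip R) dom_tip addrC -(int_split_ray (ltW a0) iF) -(@sum_ray_cst R).
  congr (_ + _); apply: eq_bigr => i it; rewrite dom_ray//; apply: int_eq => x x0.
  by rewrite hW.
have eU i x : i != tip -> 0 <= x -> U i x = U i0 x by move=> it x0; have [] := eqr i i0 x it nt x0.
have eKr i x : i != tip -> 0 <= x -> K i x = K i0 x by move=> it x0; have [] := eqr i i0 x it nt x0.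
have [_ iur] := sur; have [_ iut] := sut; have [_ ikr] := skr; have [_ ikt] := skt.
have mE : sqn l2 (mrg a (U i0) (U i0) (U tip)) = mu.
  rewrite -Umu /sqn l2E (total (fun x => x ^+ 2) U eU iur).
  under eq_bigr do rewrite (mrg_comp _ (fun x => x ^+ 2)).
  by rewrite (mrg_sum l0 a0 (rest _ iur) iur iut) -mulrDr [itg (ray a) _ + _]addrC.
have pE : pn p l2 (mrg a (U i0) (U i0) (U tip)) = pn p l U.
  rewrite /pn l2E (total (fun x => `|x| `^ p) U eU ipr).
  under eq_bigr do rewrite (mrg_comp _ (fun x => `|x| `^ p)).
  by rewrite (mrg_sum l0 a0 (rest _ ipr) ipr ipt) -mulrDr [itg (ray a) _ + _]addrC.
have i1 : igr (sgm 0 a) (fun x => (- 3^-1 * K i0 x) ^+ 2).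
  apply: (igr_eq (msgm 0 a) _ (igrZ 9^-1 (msgm 0 a) (rest _ ikr))) => x _.
  by field.
have gE : sqn l2 (mrg a (fun x => - 3^-1 * K i0 x) (K i0) (K tip)) =
   3 * itg (ray a) (fun x => K i0 x ^+ 2) + 3 * (9^-1 * itg (sgm 0 a) (fun x => K i0 x ^+ 2)) +
   itg (sgm 0 l) (fun x => K tip x ^+ 2).
  rewrite /sqn l2E; under eq_bigr do rewrite (mrg_comp _ (fun x => x ^+ 2)).
  rewrite (mrg_sum l0 a0 i1 ikr ikt) -(intZ 9^-1 (msgm 0 a) (rest _ ikr)).
  by congr (_ + 3 * _ + _); apply: int_eq => x _; field.
have sK : sqn l K = 3 * (itg (sgm 0 a) (fun x => K i0 x ^+ 2) + itg (ray a) (fun x => K i0 x ^+ 2)) +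
   itg (sgm 0 l) (fun x => K tip x ^+ 2) by exact: (total (fun x => x ^+ 2) K eKr ikr).
(* The drop of the kinetic energy is strict because the common slope at the vertex is not zero. *)
have pos : 0 < itg (sgm 0 a) (fun x => K i0 x ^+ 2).
  have da : dom l i0 a by rewrite dom_ray//; exact: ltW.
  have ck := acf_cont (ltW a0) (odeK i0 a da).
  have ck2 : cont_on (sgm 0 a) (fun x => K i0 x ^+ 2).
    by apply: (cont_on_comp (G := fun x => x ^+ 2) ck); exact: exprn_continuous.
  have aP : acf 0 a (fun x => itg (sgm 0 x) (fun x => K i0 x ^+ 2)) (fun x => K i0 x ^+ 2).
    by split; [exact: rest|move=> x _; rewrite int_pt add0r].
  have k0 : 0 < K i0 0 ^+ 2 by rewrite hs// exprn_even_gt0.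
  have [y /andP[y0 ya]] := increase_right aP ck2 (lexx 0) a0 k0.
  rewrite int_pt => h; apply: lt_le_trans h _.
  apply: (itg_sub (msgm 0 a) (msgm 0 y) _ (rest _ ikr)) => [|x _]; last exact: sqr_ge0.
  exact: sgm_sub (lexx 0) ya.
exists (mrg a (U i0) (U i0) (U tip)), (mrg a (fun x => - 3^-1 * K i0 x) (K i0) (K tip)).
split; [exact: hM|exact: mE|]; apply: lt_le_trans Ele.
by rewrite /ener pE gE sK; exact: third_lt.
Qed.

Lemma threshold (mu : R) : 0 < mu -> exists lstar : R, 0 < lstar /\
  forall l : R, 0 < l -> (has_min p mu l <-> lstar <= l).
Proof.
move=> mu0; pose T := [set l : R | 0 < l /\ below_soliton p mu l].
have [l1 l10 b1] := long_tip p2 p6 mu0.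
have [d d0 hd] := short_tip p2 p6 mu0.
have lbT : lbound T d.
  move=> l [l0 [U [G [hU Umu hE]]]]; rewrite leNgt; apply/negP => ld.
  by move: hE; rewrite ltNge (hd l U G l0 (ltW ld) hU Umu).
have hT : has_inf T by split; [exists l1 | exists d].
pose ls := inf T; have dls : d <= ls by apply: lb_le_inf => //; exists l1.
have ls0 : 0 < ls by exact: lt_le_trans d0 dls.
have above l : ls < l -> below_soliton p mu l.
  move=> lsl; have e0 : 0 < l - ls by rewrite subr_gt0.
  have [l' [l'0 bl'] h] := inf_adherent e0 hT; rewrite -/ls subrKC in h.
  exact: (min_longer l'0 h mu0 (below_min p2 p6 l'0 mu0 bl')).
exists ls; split => // l l0; split => [hl|].
  rewrite leNgt; apply/negP => lls.
  (* A ground state at [l < ls] would make the midpoint of [l] and [ls] good, below the infimum. *)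
  have m0 : 0 < (l + ls) / 2 by rewrite divr_gt0// addr_gt0.
  have lm : l < (l + ls) / 2 by rewrite midf_lt.
  have mT : T ((l + ls) / 2) by split => //; exact: (min_longer l0 lm mu0 hl).
  have : ls <= (l + ls) / 2 by apply: ge_inf => //; exists d.
  by rewrite leNgt midf_lt.
rewrite le_eqVlt => /orP[/eqP <-|lsl]; last exact: (below_min p2 p6 l0 mu0 (above l lsl)).
have [b|nb] := pselect (below_soliton p mu ls); first exact: (below_min p2 p6 ls0 mu0 b).
apply: (limit_min p2 p6 ls0 mu0 nb) => e e0; exists (ls + e / 2).
  by rewrite ltrDl ltrD2l divr_gt0//= ltr_pdivrMr// ltr_pMr// ltr1n.
by apply: above; rewrite ltrDl divr_gt0.
Qed.

End merging.

(** * Translation to the four named edges *)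

Definition edges (a b c d : RR -> RR) (i : 'I_4) : RR -> RR := nth d [:: a; b; c] i.

(** The list in [edges] has three entries, so at the tip, whose index is [3], [nth] returns its
    default [d]. *)
Lemma edgesE (a b c d : RR -> RR) : [/\ edges a b c d (inord 0) = a, edges a b c d (inord 1) = b,
  edges a b c d (inord 2) = c & edges a b c d tip = d].
Proof. by rewrite /edges !inordK. Qed.

Lemma edges_eta (U : 'I_4 -> RR -> RR) : edges (U (inord 0)) (U (inord 1)) (U (inord 2)) (U tip) = U.
Proof.
apply/funext => i; have [e0 e1 e2 e3] := edgesE (U (inord 0)) (U (inord 1)) (U (inord 2)) (U tip).
have [->//|it] := eqVneq i tip.
by case: (ray_cases it) => ->.
Qed.

Definition funs (f : graphfun) := edges (u1 f) (u2 f) (u3 f) (v f).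
Definition ders (f : graphfun) := edges (du1 f) (du2 f) (du3 f) (dv f).

Lemma funs_in_H1 (l : RR) (f : graphfun) : in_H1 l f <-> inH l (funs f) (ders f).
Proof.
have [f0 f1 f2 f3] := edgesE (u1 f) (u2 f) (u3 f) (v f).
have [g0 g1 g2 g3] := edgesE (du1 f) (du2 f) (du3 f) (dv f).
have n0 : dom l (inord 0) = ray 0 by rewrite dom_ray// inord_ray.
have n1 : dom l (inord 1) = ray 0 by rewrite dom_ray// inord_ray.
have n2 : dom l (inord 2) = ray 0 by rewrite dom_ray// inord_ray.
split => [[h0 [h1 [h2 [h3 [e0 [e1 e2]]]]]]|[h e]].
  split => i; have [->|it] := eqVneq i tip.
  - by rewrite dom_tip /funs /ders f3 g3.
  - case: (ray_cases it) => ->; rewrite ?n0 ?n1 ?n2 /funs /ders ?f0 ?f1 ?f2 ?g0 ?g1 ?g2; exact.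
  - by [].
  - by rewrite /funs f3; case: (ray_cases it) => ->; rewrite ?f0 ?f1 ?f2.
have := h (inord 0); have := h (inord 1); have := h (inord 2); have := h tip.
rewrite n0 n1 n2 dom_tip /funs /ders f0 f1 f2 f3 g0 g1 g2 g3 => h3 h2 h1 h0.
have := e (inord 0); have := e (inord 1); have := e (inord 2).
by rewrite /funs f0 f1 f2 f3 => e2 e1 e0.
Qed.

Lemma sum_funs (l : RR) (F : RR -> RR) a b c d :
  \sum_i Rintegral lebesgue_measure (dom l i) (fun x => F (edges a b c d i x)) =
  edge_int halfline (fun x => F (a x)) + edge_int halfline (fun x => F (b x)) +
  edge_int halfline (fun x => F (c x)) + edge_int (seg l) (fun x => F (d x)).
Proof.
have [f0 f1 f2 f3] := edgesE a b c d.
have n0 : dom l (inord 0) = ray 0 by rewrite dom_ray// inord_ray.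
have n1 : dom l (inord 1) = ray 0 by rewrite dom_ray// inord_ray.
have n2 : dom l (inord 2) = ray 0 by rewrite dom_ray// inord_ray.
by rewrite sum4 f0 f1 f2 f3 n0 n1 n2 dom_tip addrC !addrA.
Qed.

Lemma mass_funs (l : RR) f : mass l f = sqn l (funs f).
Proof. by rewrite /sqn (sum_funs l (fun x => x ^+ 2)). Qed.

Lemma energy_funs (p l : RR) f : energy p l f = ener p l (funs f) (ders f).
Proof.
by rewrite /ener /sqn /pn (sum_funs l (fun x => x ^+ 2)) (sum_funs l (fun x => `|x| `^ p)).
Qed.

Lemma has_ground_stateE (p l mu : RR) : has_ground_state p l mu <-> has_min p mu l.
Proof.
split.
  move=> [f [[hf mf] hmin]]; exists (funs f), (ders f).
  split; [exact/funs_in_H1|by rewrite -mass_funs|].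
  move=> V K hV mV.
  pose g := GF (V (inord 0)) (V (inord 1)) (V (inord 2)) (V tip)
     (K (inord 0)) (K (inord 1)) (K (inord 2)) (K tip).
  have gV : funs g = V by exact: edges_eta.
  have gK : ders g = K by exact: edges_eta.
  have := hmin g; rewrite /in_H1_mass funs_in_H1 mass_funs !energy_funs gV gK; apply.
  by split.
move=> [U [G [hU mU hmin]]].
pose f := GF (U (inord 0)) (U (inord 1)) (U (inord 2)) (U tip)
  (G (inord 0)) (G (inord 1)) (G (inord 2)) (G tip).
have fU : funs f = U by exact: edges_eta.
have fG : ders f = G by exact: edges_eta.
exists f; split; first by rewrite /in_H1_mass funs_in_H1 mass_funs fU fG.
move=> g [/funs_in_H1 hg mg]; rewrite !energy_funs fU fG; apply: hmin => //.
by rewrite -mass_funs.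
Qed.

Theorem theorem6p5 (p mu : RR) (hp : 2 < p < 6) (hmu : 0 < mu) :
  exists lstar : RR, 0 < lstar /\
    forall l : RR, 0 < l -> (has_ground_state p l mu <-> lstar <= l).
Proof.
have /andP[p2 p6] := hp; have [ls [ls0 h]] := threshold p2 p6 hmu.
by exists ls; split => // l l0; rewrite has_ground_stateE; exact: h.
Qed.
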